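(* Let $q$ be a radial potential as described in the context, with $0<r_0<1\le r_1\le\infty$ (annular droplet $\mathbb S$ whose inner radius is strictly inside the unit circle and whose outer radius is at least $1$). Let $Z_N^{\rm h}[q(r)]$ be the $\beta=2$ partition function with hard wall at the unit circle, and $\eta=1-q'(1)/2$. Then, as $N\to\infty$: (i) If $r_1>1$ (equivalently $0<\eta<1$), $$\begin{aligned} \log\Big(\frac{Z_N^{\rm h}[q(r)]}{(2\pi)^N}\Big)=&-N^2\big[I_{\mathbb S\cap\mathbb D}[\mu_Q]+\eta\,q(1)\big]-\frac{1+\eta}{2}N\log N\\ &-N\Big[\tfrac12E_{\mathbb S\cap\mathbb D}[\mu_Q]-(1-\eta)\tfrac{\log(\pi/2)}{2}+\eta(\log(2\eta)-1)\Big]\\ &-\sqrt N(\gamma^{\rm in}+\gamma^{\rm out})\sqrt{\Delta Q(1)}-\tfrac14\log N\\ &+F_{\mathbb S\cap\mathbb D}[Q]-(\alpha^{\rm in}+\alpha^{\rm out})+(\beta^{\rm in}+\beta^{\rm out})\frac{\partial_r\Delta Q(1)}{\Delta Q(1)}\\ &+\frac{\Delta Q(1)}{4\eta}-\tfrac12\log\eta+\tfrac14\log(2\pi\Delta Q(1))+o(1). \end{aligned}$$ (ii) If $r_1=1$ (equivalently $\eta=0$), $$\begin{aligned} \log\Big(\frac{Z_N^{\rm h}[q(r)]}{(2\pi)^N}\Big)=&-N^2I_{\mathbb S\cap\mathbb D}[\mu_Q]-\tfrac12N\log N-N\Big[\tfrac12E_{\mathbb S\cap\mathbb D}[\mu_Q]-\tfrac{\log(\pi/2)}{2}\Big]\\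 &-\sqrt N\,\gamma^{\rm in}\sqrt{\Delta Q(1)}+F_{\mathbb S\cap\mathbb D}[Q]-\alpha^{\rm in}+\beta^{\rm in}\frac{\partial_r\Delta Q(1)}{\Delta Q(1)}+\tfrac12\log2+o(1). \end{aligned}$$
   Context: Setting. $Q(z)=q(|z|)$ is a radially symmetric potential, $q$ independent of $N$ and smooth on $(0,\infty)$, strictly subharmonic: $\Delta Q(r):=\frac1r(rq'(r))'=q''(r)+\frac{q'(r)}{r}>0$. We regard $\Delta Q$ as a function of $r=|z|$, and $\partial_r\Delta Q$ is its radial derivative. $r_0$ is the smallest non-negative solution of $q'(r_0)=0$, and $r_1$ is the unique solution of $r_1q'(r_1)=2$ (with $r_1=\infty$ permitted when there is no finite solution, i.e. $rq'(r)<2$ for all $r$). The droplet is $\mathbb S=\{z\in\mathbb C: r_0\le|z|\le r_1\}$, an annulus when $r_0>0$. $\mathbb D=\{z\in\mathbb{C}:|z|\le1\}$ is the closed unit disk. The unconstrained equilibrium measure is $d\mu_Q=\frac14\Delta Q\,\mathbf 1_{\mathbb S}\,dA$, $dA(z)=d^2z/\pi$, with $d^2z$ Lebesgue measure on $\mathbb C$. Partition function: $$Z_N^{\rm h}[q(r)]=\frac1{N!}\int_{\mathbb D^N}e^{-N\sum_{j=1}^Nq(|z_j|)}\prod_{1\le j<k\le N}|z_k-z_j|^2\,d^2z_1\cdots d^2z_N .$$ Functionals (with $\mathbb S\cap\mathbb D=\{r_0\le|z|\le1\}$): $$I_{\mathbb S\cap\mathbb D}[\mu_Q]=\frac12\int_{\mathbb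 S\cap\mathbb D}Q\,d\mu_Q+\frac12q(1)(1-\eta)=\frac12\int_{r_0}^1u\,\Delta Q(u)\big[q(u)-uq'(u)\log u\big]du,$$ $$E_{\mathbb S\cap\mathbb D}[\mu_Q]=\int_{\mathbb S\cap\mathbb D}\log\big(\tfrac14\Delta Q\big)d\mu_Q=\frac12\int_{r_0}^1\log\big(\tfrac14\Delta Q(u)\big)u\,\Delta Q(u)\,du,$$ $$F_{\mathbb S\cap\mathbb D}[Q]=\frac1{12}\log\Big(\frac{r_0^2\Delta Q(r_0)}{\Delta Q(1)}\Big)-\frac1{16}\Big(\frac{\partial_r\Delta Q(1)}{\Delta Q(1)}-r_0\frac{\partial_r\Delta Q(r_0)}{\Delta Q(r_0)}\Big)+\frac1{24}\int_{r_0}^1\Big(\frac{\partial_r\Delta Q(r)}{\Delta Q(r)}\Big)^2r\,dr.$$ Universal constants: with $\Phi(x)=\log(\frac12\operatorname{erfc}(x))$, so $\Phi'(x)=-\frac{2e^{-x^2}}{\sqrt\pi\operatorname{erfc}(x)}$, $$\alpha^{\rm in}=\int_{-\infty}^0\frac{x^2-2}{3}\Phi'(x)dx,\quad\beta^{\rm in}=-\int_{-\infty}^0\frac{x^2+1}{6}\Phi'(x)dx,\quad\gamma^{\rm in}=-\frac1{\sqrt2}\int_{-\infty}^0\Phi(x)dx,$$ $$\alpha^{\rm out}=\int_0^\infty\Big(\frac13\big[x(2x^2-3)+(x^2-2)\Phi'(x)\big]-\frac1{x+1}\Big)dx,\quad\beta^{\rm out}=-\frac16\int_0^\infty\big[x(2x^2+3)+(x^2+1)\Phi'(x)\big]dx,$$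 $$\gamma^{\rm out}=-\frac1{\sqrt2}\int_0^\infty\log\big(\sqrt\pi\,x\,e^{x^2}\operatorname{erfc}(x)\big)dx.$$ *)

(* Defs.v *)
From HB Require Import structures.
From mathcomp Require Import all_boot all_order all_algebra.
From mathcomp Require Import all_classical all_reals all_analysis.
From mathcomp Require Export complex.

Set Implicit Arguments.
Unset Strict Implicit.
Unset Printing Implicit Defensive.
Import Order.TTheory GRing.Theory Num.Theory.
Import numFieldNormedType.Exports.

Local Open Scope ring_scope.
Local Open Scope classical_set_scope.

(* [m1 \x m2] with its sigma-finite structure: the library proves it
   sigma-finite, but [\x] resolves to its instance for subprobabilities. *)
Section sf_product.
Local Open Scope ereal_scope.
Context d1 d2 (T1 : measurableType d1) (T2 : measurableType d2) (R : realType).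
Variable m1 : {sigma_finite_measure set T1 -> \bar R}.
Variable m2 : {sigma_finite_measure set T2 -> \bar R}.

Definition sf_product : set (T1 * T2) -> \bar R := m1 \x m2.

HB.instance Definition _ := Measure.copy sf_product (m1 \x m2).

Let sf_product_sigma_finite : sigma_finite setT sf_product.
Proof.
have /sigma_finiteP[F [TF ndF Foo]] := sigma_finiteT m1.
have /sigma_finiteP[G [TG ndG Goo]] := sigma_finiteT m2.
exists (fun n => F n `*` G n).
  rewrite -setXTT TF TG predeqE => -[x y]; split.
    move=> [/= [n _ Fnx] [k _ Gky]]; exists (maxn n k) => //; split.
    - by move: x Fnx; exact/subsetPset/ndF/leq_maxl.
    - by move: y Gky; exact/subsetPset/ndG/leq_maxr.
  by move=> [n _ []/= ? ?]; split; exists n.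
move=> k; have [? ?] := Foo k; have [? ?] := Goo k.
split; first exact: measurableX.
by rewrite /sf_product product_measure1E// lte_mul_pinfty// ge0_fin_numE.
Qed.

HB.instance Definition _ := Measure_isSigmaFinite.Build _ _ _ sf_product
  sf_product_sigma_finite.

End sf_product.

(* The product [mu \x nu], transported from [T * n.-tuple T] to
   [n.+1.-tuple T]. *)
Section cons_measure.
Local Open Scope ereal_scope.
Context d (T : measurableType d) (R : realType) (n : nat).
Variable mu : {sigma_finite_measure set T -> \bar R}.
Variable nu : {sigma_finite_measure set (n.-tuple T) -> \bar R}.

Definition tcons (p : T * n.-tuple T) : n.+1.-tuple T := [tuple of p.1 :: p.2].
Definition tuncons (t : n.+1.-tuple T) : T * n.-tuple T :=
  (thead t, [tuple of behead t]).

Lemma tconsK : cancel tcons tuncons.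
Proof. by move=> [x t]; congr pair; apply/val_inj. Qed.

Lemma tunconsK : cancel tuncons tcons.
Proof. by move=> t; rewrite /tcons/= -tuple_eta. Qed.

Lemma measurable_tcons : measurable_fun setT tcons.
Proof. exact: measurable_cons. Qed.

Lemma measurable_tuncons : measurable_fun setT tuncons.
Proof.
apply/measurable_fun_pair; first exact: measurable_tnth.
exact: measurable_behead.
Qed.

Definition cons_measure : set (n.+1.-tuple T) -> \bar R :=
  pushforward (sf_product mu nu) tcons.

HB.instance Definition _ := Measure.copy cons_measure
  (measure_function_pushforward__canonical__measure_function_Measure
     (sf_product mu nu) measurable_tcons).

Let cons_measure_sigma_finite : sigma_finite setT cons_measure.
Proof.
have [F FT Foo] := sigma_finiteT (sf_product mu nu).
exists (fun k => tuncons @^-1` F k).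
  by rewrite -preimage_bigcup -FT preimage_setT.
move=> k; have [mF Fk] := Foo k; split.
  by rewrite -[X in measurable X]setTI; exact: measurable_tuncons.
rewrite /cons_measure /pushforward -comp_preimage.
by rewrite (_ : tuncons \o tcons = id) //; apply/funext/tconsK.
Qed.

HB.instance Definition _ := Measure_isSigmaFinite.Build _ _ _ cons_measure
  cons_measure_sigma_finite.

End cons_measure.

(* The [n]-fold product measure; see [tuple_measure_box]. *)
Fixpoint tuple_measure d (T : measurableType d) (R : realType)
    (mu : {sigma_finite_measure set T -> \bar R}) (n : nat) :
    {sigma_finite_measure set (n.-tuple T) -> \bar R} :=
  match n with
  | 0 => \d_ [tuple]
  | m.+1 => cons_measure mu (tuple_measure mu m)
  end.

Lemma measurable_box d (T : measurableType d) (n : nat) (A : 'I_n -> set T) :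
  (forall i, measurable (A i)) ->
  measurable [set t : n.-tuple T | forall i, A i (tnth t i)].
Proof.
move=> mA.
rewrite (_ : [set t | _] =
    ~` \big[setU/set0]_(i < n) ((fun t : n.-tuple T => tnth t i) @^-1` ~` A i)).
  apply/measurableC/bigsetU_measurable => i _.
  rewrite -[X in measurable X]setTI; apply: measurable_tnth => //.
  exact: measurableC.
apply/seteqP; split=> t /=.
  by move=> At; rewrite -bigcup_seq => -[i _]; apply; exact: At.
move=> At i; apply: contrapT => nAt; apply: At.
by rewrite -bigcup_seq; exists i => //=; rewrite mem_index_enum.
Qed.

Lemma tuple_measure_box d (T : measurableType d) (R : realType)
    (mu : {sigma_finite_measure set T -> \bar R}) (n : nat)
    (A : 'I_n -> set T) : (forall i, measurable (A i)) ->
  (tuple_measure mu n [set t | forall i, A i (tnth t i)] =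
   \prod_(i < n) mu (A i))%E.
Proof.
elim: n A => [|n IHn] A mA.
  by rewrite big_ord0 /= diracE mem_set// => -[].
rewrite big_ord_recl -IHn//=.
rewrite -[RHS]product_measure1E//; last first.
  by apply: (@measurable_box _ _ n (fun i => A (lift ord0 i))) => i; exact: mA.
rewrite /cons_measure /pushforward /sf_product.
congr (product_measure1 _ _ _); apply/seteqP; split=> -[x t] /=.
  move=> At; split=> [|i]; first by have := At ord0; rewrite tnth0.
  by have := At (lift ord0 i); rewrite tnthS.
move=> [Ax At] i; case: (unliftP ord0 i) => [j|] ->.
  by rewrite tnthS; exact: At.
by rewrite tnth0.
Qed.

(* Points of C as pairs (x, y).  The norm of MathComp-Analysis on [R * R] is
   the sup norm, so the modulus is taken in [R[i]]. *)
Definition plane (R : realType) := (measurableTypeR R * measurableTypeR R)%type.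

Definition lebesgue2 (R : realType) :
    {sigma_finite_measure set (plane R) -> \bar R} :=
  sf_product (@lebesgue_measure R) (@lebesgue_measure R).

Definition cplx (R : realType) (z : plane R) : R[i] := Complex z.1 z.2.

Definition modulus (R : realType) (w : R[i]) : R := ComplexField.Normc.normc w.

Definition disk (R : realType) : set (plane R) :=
  [set z | modulus (cplx z) <= 1].

Section potential.
Context (R : realType).
Implicit Type q : R -> R.

(* A radial potential is given by its profile [q], of which only the values on
   the positive half-line matter. *)
Definition smooth_pos q :=
  forall (n : nat) (r : R), 0 < r -> derivable (derive1n n q) r 1.

Definition laplQ q (r : R) : R := r^-1 * derive1 (fun s => s * derive1 q s) r.

(* [derive1 q 0] is meaningless for a function on the open half-line, hence the
   competitors are positive. *)
Definition inner_radius q (r0 : R) :=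
  [/\ 0 <= r0, derive1 q r0 = 0 & forall r, 0 < r -> derive1 q r = 0 -> r0 <= r].

Definition outer_radius q (r1 : \bar R) :=
  match r1 with
  | r%:E => [/\ 0 < r, r * derive1 q r = 2
             & forall s, 0 < s -> s * derive1 q s = 2 -> s = r]
  | +oo%E => forall r, 0 < r -> r * derive1 q r < 2
  | -oo%E => False
  end.

Definition eta q : R := 1 - derive1 q 1 / 2.

Definition droplet (r0 : R) (r1 : \bar R) : set (plane R) :=
  [set z | r0 <= modulus (cplx z) /\ ((modulus (cplx z))%:E <= r1)%E].

(* The integral of [f] over [A] against
   dmu_Q = (1/4) laplQ 1_droplet dA, where dA = d^2z / pi. *)
Definition int_muQ q (r0 : R) (r1 : \bar R) (A : set (plane R))
    (f : plane R -> R) : R :=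
  pi^-1 * \int[lebesgue2 R]_(z in A `&` droplet r0 r1)
    (f z * (4^-1 * laplQ q (modulus (cplx z)))).

Definition I_muQ q (r0 : R) (r1 : \bar R) : R :=
  2^-1 * int_muQ q r0 r1 (droplet r0 r1 `&` @disk R)
    (fun z => q (modulus (cplx z)))
  + 2^-1 * q 1 * (1 - eta q).

Definition E_muQ q (r0 : R) (r1 : \bar R) : R :=
  int_muQ q r0 r1 (droplet r0 r1 `&` @disk R)
    (fun z => ln (4^-1 * laplQ q (modulus (cplx z)))).

Definition F_Q q (r0 : R) : R :=
  12^-1 * ln (r0 ^+ 2 * laplQ q r0 / laplQ q 1)
  - 16^-1 * (derive1 (laplQ q) 1 / laplQ q 1
             - r0 * (derive1 (laplQ q) r0 / laplQ q r0))
  + 24^-1 * \int[lebesgue_measure]_(r in `[r0, 1])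
      ((derive1 (laplQ q) r / laplQ q r) ^+ 2 * r).

Definition Zh q (N : nat) : R :=
  (N`!)%:R^-1 *
  \int[tuple_measure (lebesgue2 R) N]_(z in
      [set z : N.-tuple (plane R) | forall j, @disk R (tnth z j)])
    (expR (- (N%:R * \sum_(j < N) q (modulus (cplx (tnth z j))))) *
     \prod_(k < N) \prod_(j < N | (j < k)%N)
       modulus (cplx (tnth z k) - cplx (tnth z j)) ^+ 2).

End potential.

Section constants.
Context (R : realType).

Definition erfc (x : R) : R :=
  2 / Num.sqrt pi * \int[lebesgue_measure]_(t in `[x, +oo[) expR (- t ^+ 2).

Definition Phi (x : R) : R := ln (erfc x / 2).

Definition alpha_in : R :=
  \int[lebesgue_measure]_(x in `]-oo, 0]) ((x ^+ 2 - 2) / 3 * derive1 Phi x).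

Definition beta_in : R :=
  - \int[lebesgue_measure]_(x in `]-oo, 0]) ((x ^+ 2 + 1) / 6 * derive1 Phi x).

Definition gamma_in : R :=
  - (Num.sqrt 2)^-1 * \int[lebesgue_measure]_(x in `]-oo, 0]) Phi x.

Definition alpha_out : R :=
  \int[lebesgue_measure]_(x in `[0, +oo[)
    (3^-1 * (x * (2 * x ^+ 2 - 3) + (x ^+ 2 - 2) * derive1 Phi x) - (x + 1)^-1).

Definition beta_out : R :=
  - 6^-1 * \int[lebesgue_measure]_(x in `[0, +oo[)
    (x * (2 * x ^+ 2 + 3) + (x ^+ 2 + 1) * derive1 Phi x).

Definition gamma_out : R :=
  - (Num.sqrt 2)^-1 * \int[lebesgue_measure]_(x in `[0, +oo[)
    ln (Num.sqrt pi * x * expR (x ^+ 2) * erfc x).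

End constants.

(* Main.v *)
(* Rotation invariance makes the monomials z^j orthogonal, so expanding the two
   Vandermonde determinants gives Z_N / (2 pi)^N = prod_(j < N) h_j with
   h_j = int_0^1 r^(2j+1) e^(-N q(r)) dr.  Put x = ln r and p(x) = q(e^x), a convex
   function; up to an exponentially small error ln h_j is
   G(y) = ln int_X^0 e^(-N (p(x) - y x)) dx at y = 2(j+1)/N, and the trapezoidal
   rule, whose error is controlled through the cumulants of the Gibbs measure,
   turns the sum over j into an integral of G over [0, 2].
   For y = p'(u) <= p'(0) the saddle u lies in the disk; Laplace's method gives a
   bulk contribution and, for u within N^(-1/2) of the wall x = 0, the logarithm
   of a truncated Gaussian integral: this boundary layer produces alpha^in,
   beta^in, gamma^in.  For y > p'(0) the maximum is attained at the wall and a
   Gaussian with a linear tilt, e^(x^2) erfc(x), produces the out-constants.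
   The Laplace asymptotics are done for P = 2 p / p''(0), normalised by
   P''(0) = 2, with the scale e = (N p''(0) / 2)^(-1/2). *)
Require Import Defs.
From mathcomp Require Import all_boot all_order all_algebra.
From mathcomp Require Import all_classical all_reals all_analysis.
From mathcomp Require Import measurable_realfun perm.
From mathcomp Require Import ring lra zify.
Import Order.TTheory GRing.Theory Num.Theory.
Import numFieldNormedType.Exports.
Local Open Scope ring_scope.
Local Open Scope classical_set_scope.
Set Implicit Arguments.
Unset Strict Implicit.
Unset Printing Implicit Defensive.

(** * Integration on the line *)

Section real_integration.
Context d (T : measurableType d) (R : realType) (mu : {measure set T -> \bar R}).
Implicit Types (D : set T) (f g : T -> R).

(** The obstacle is the transition at y = p'(0), where the saddle meets the wall and no single
    expansion is uniform. For saddles in the disk the window [X, B] reaches past the wall, as q is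
    smooth there, and ln J = ln W + ln (J / W). The unconstrained W has an expansion in e^2 uniform
    in the saddle u, because odd terms cancel under z -> -z. The ratio J / W differs from 1 by a
    Gaussian tail in x = u / e, so the layer contributes an integral over x <= 0. Every limit of an
    integral then follows from a pointwise limit and an integrable bound independent of N. Cutting
    at X = ln r0 - 1 keeps constants uniform, since nothing is assumed of q at the origin. There are
    N cells of width 2 e^2, with e^2 of order 1 / N; three moments of the Gibbs measure bound each
    cell error by a multiple of e^3, hence the total by a multiple of e. In the noncritical case the
    last node lies beyond the wall, where the partition integral has order e^2 instead of e at y =
    0; half the difference of logarithms is (ln e) / 2, whence - (log N) / 4. The term in 1 / eta is
    the tail, about - 1 / (2 A), of the integrand of gamma^out. *)

Lemma Rdominated D (f_ : nat -> T -> R) f g : measurable D ->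
  (forall n, measurable_fun D (f_ n)) ->
  (forall x, D x -> f_ ^~ x @ \oo --> f x) ->
  mu.-integrable D (EFin \o g) ->
  (forall n x, D x -> `|f_ n x| <= g x) ->
  mu.-integrable D (EFin \o f) /\
  (fun n => \int[mu]_(x in D) f_ n x) @ \oo --> \int[mu]_(x in D) f x.
Proof.
move=> mD mf_ f_f ig fg.
have mf : measurable_fun D f by exact: measurable_fun_cvg f_f.
have [|||||if_ _ cv] := @dominated_convergence _ _ _ mu D mD
  (fun n => EFin \o f_ n) (EFin \o f) (EFin \o g).
- by move=> n; exact/measurable_EFinP.
- exact/measurable_EFinP.
- by apply: aeW => x Dx; apply: cvg_EFin; [exact: nearW|exact: f_f].
- exact: ig.
- by apply: aeW => x n Dx; rewrite /= lee_fin; exact: fg.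
split => //; apply: fine_cvg; rewrite /Rintegral fineK//.
exact: integrable_fin_num.
Qed.

Lemma intg_le D f g : measurable D -> measurable_fun D f ->
  mu.-integrable D (EFin \o g) -> (forall x, D x -> `|f x| <= g x) ->
  mu.-integrable D (EFin \o f).
Proof.
move=> mD mf ig fg; apply: (le_integrable mD _ _ ig).
  exact/measurable_EFinP.
move=> x Dx /=; rewrite lee_fin (le_trans (fg x Dx))//; exact: ler_norm.
Qed.

Lemma intgD D f g : measurable D -> mu.-integrable D (EFin \o f) ->
  mu.-integrable D (EFin \o g) ->
  mu.-integrable D (EFin \o (fun x => f x + g x)).
Proof. by move=> mD; exact: integrableD. Qed.

Lemma intgB D f g : measurable D -> mu.-integrable D (EFin \o f) ->
  mu.-integrable D (EFin \o g) ->
  mu.-integrable D (EFin \o (fun x => f x - g x)).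
Proof. by move=> mD; exact: integrableB. Qed.

Lemma intgZ D f (k : R) : measurable D -> mu.-integrable D (EFin \o f) ->
  mu.-integrable D (EFin \o (fun x => k * f x)).
Proof. by move=> mD; exact: integrableZl. Qed.

Lemma RintegralN D f : measurable D -> mu.-integrable D (EFin \o f) ->
  \int[mu]_(x in D) (- f x) = - \int[mu]_(x in D) f x.
Proof.
move=> mD fi; under eq_Rintegral do rewrite -mulN1r.
by rewrite RintegralZl// mulN1r.
Qed.

Lemma eq_intg D f g : measurable D -> (forall x, D x -> f x = g x) ->
  mu.-integrable D (EFin \o f) -> mu.-integrable D (EFin \o g).
Proof.
by move=> mD fg; apply: (eq_integrable mD) => x /[!inE] Dx /=; rewrite fg.
Qed.

Lemma intgS D D' f : measurable D -> measurable D' -> D' `<=` D ->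
  mu.-integrable D (EFin \o f) -> mu.-integrable D' (EFin \o f).
Proof. by move=> mD mD' DD' ; exact: integrableS. Qed.

Lemma intg_mfun D f : mu.-integrable D (EFin \o f) -> measurable_fun D f.
Proof. by move/(measurable_int mu)/measurable_EFinP. Qed.

Lemma ge0_le_RintegralS D D' f : measurable D -> measurable D' -> D' `<=` D ->
  mu.-integrable D (EFin \o f) -> (forall x, D x -> 0 <= f x) ->
  \int[mu]_(x in D') f x <= \int[mu]_(x in D) f x.
Proof.
move=> mD mD' DD' fi f0.
have fi' : mu.-integrable D' (EFin \o f) by exact: intgS fi.
rewrite /Rintegral fine_le//; try exact: integrable_fin_num.
apply: ge0_subset_integral => //; first exact: (measurable_int mu).
Qed.

Lemma normr_Rintegral_le D f g : measurable D ->
  mu.-integrable D (EFin \o f) -> mu.-integrable D (EFin \o g) ->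
  (forall x, D x -> `|f x| <= g x) ->
  `|\int[mu]_(x in D) f x| <= \int[mu]_(x in D) g x.
Proof.
move=> mD fi gi fg; apply: (le_trans (le_normr_Rintegral mD fi)).
by apply: le_Rintegral => //; exact: integrable_norm.
Qed.

End real_integration.

(** * Affine changes of variables *)

Section lebesgue_line.
Context {R : realType}.
Notation mu := (@lebesgue_measure R).
Notation LT := (measurableTypeR R).
Implicit Types (f g : R -> R).

Definition affine (u e : R) : measurableTypeR R -> measurableTypeR R :=
  fun z => u + e * z.

Lemma measurable_affine (u e : R) : measurable_fun setT (affine u e).
Proof. by apply: measurable_funD => //; exact: measurable_funM. Qed.

(** Uniqueness of Lebesgue measure: [e] times the pushforward gives half-open intervals their
    length. *)
Lemma lebesgue_measure_affine (u e : R) (A : set LT) : 0 < e -> measurable A ->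
  pushforward mu (affine u e) A = ((e^-1)%:E * mu A)%E.
Proof.
move=> e0 mA.
have e0' : 0 <= e by exact: ltW.
pose pm : {measure set (measurableTypeR R) -> \bar R} :=
  measure_function_pushforward__canonical__measure_function_Measure mu (measurable_affine u e).
pose m := mscale (NngNum e0') pm.
have h : forall B : set (measurableTypeR R), measurable B -> mu B = m B.
  apply: lebesgue_measure_unique => _ [[a b]] _ <-.
  rewrite -[RHS]/(e%:E * mu (affine u e @^-1` `]a, b]))%E.
  have -> : affine u e @^-1` `]a, b] = `](a - u) / e, (b - u) / e]%classic.
    apply/seteqP; split => z /=; rewrite /affine !in_itv/= ltr_pdivrMr// ler_pdivlMr//.
      by move=> /andP[h1 h2]; apply/andP; split; lra.
    by move=> /andP[h1 h2]; apply/andP; split; lra.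
  rewrite !lebesgue_measure_itv/= !lte_fin ltr_pM2r ?invr_gt0// ltrD2r.
  case: ifPn => ab; last by rewrite mule0.
  rewrite -!EFinB -EFinM; congr EFin; field; exact: lt0r_neq0.
rewrite h// /m /mscale/= muleA -EFinM mulVf ?mul1e//; exact: lt0r_neq0.
Qed.

Lemma ge0_integral_affine (u e : R) (D : set LT) (f : measurableTypeR R -> \bar R) : 0 < e ->
  measurable D -> measurable_fun D f -> (forall x, D x -> 0 <= f x)%E ->
  (\int[mu]_(x in D) f x =
   e%:E * \int[mu]_(z in affine u e @^-1` D) f (affine u e z))%E.
Proof.
move=> e0 mD mf f0.
have := @ge0_integral_pushforward _ _ _ _ R _ (measurable_affine u e) mu D f mD mf.
move=> <-; last by move=> x /[!inE]; exact: f0.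
have ei0 : 0 <= e^-1 by rewrite invr_ge0 ltW.
rewrite [X in _ = (_ * X)%E](eq_measure_integral (mscale (NngNum ei0) mu)); last 2 first.
- exact: measurable_affine.
- move=> ? A mA _; exact: (lebesgue_measure_affine u e0 mA).
rewrite ge0_integral_mscale//= muleA -EFinM mulfV ?mul1e//; exact: lt0r_neq0.
Qed.

Lemma measurable_affine_preimage (u e : R) (D : set LT) : measurable D ->
  measurable (affine u e @^-1` D).
Proof.
by move=> mD; rewrite -[X in measurable X]setTI; exact: measurable_affine.
Qed.

Lemma intg_affine (u e : R) (D : set LT) f : 0 < e -> measurable D ->
  mu.-integrable D (EFin \o f) ->
  mu.-integrable (affine u e @^-1` D) (EFin \o (f \o affine u e)).
Proof.
move=> e0 mD fi; apply/integrableP; split.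
  apply/measurable_EFinP.
  apply: (measurable_comp mD _ (intg_mfun fi)).
    by move=> _ [z /= Dz <-].
  by apply: measurable_funTS; exact: measurable_affine.
have/integrableP[mf] := fi.
rewrite (ge0_integral_affine u e0)//; last exact: measurableT_comp.
move=> h; rewrite ltey; apply/eqP => h'; move: h.
by rewrite [X in (_ * X)%E]h' gt0_muley ?lte_fin// ltxx.
Qed.

Lemma Rintegral_affine (u e : R) (D : set LT) f : 0 < e ->
  measurable D -> mu.-integrable D (EFin \o f) ->
  \int[mu]_(x in D) f x = e * \int[mu]_(z in affine u e @^-1` D) f (affine u e z).
Proof.
move=> e0 mD fi; have mf := measurable_int mu fi.
have fi' := intg_affine u e0 mD fi.
have mD' := measurable_affine_preimage u e mD.
have E : (\int[mu]_(x in D) (f x)%:E =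
    e%:E * \int[mu]_(z in affine u e @^-1` D) (f (affine u e z))%:E)%E.
  rewrite integralE [X in (_ * X)%E]integralE muleBr//; last first.
    rewrite fin_num_adde_defl// fin_numN; exact: integrable_neg_fin_num fi'.
  have mfp : measurable_fun (D : set LT) (fun x => (EFin \o f)^\+ x)%E by exact: measurable_funepos.
  have mfn : measurable_fun (D : set LT) (fun x => (EFin \o f)^\- x)%E by exact: measurable_funeneg.
  congr (_ - _)%E.
    apply: (etrans (ge0_integral_affine u e0 mD mfp _)).
      by move=> x _; exact: funepos_ge0.
    congr (_ * _)%E; apply: eq_integral => z _.
    by rewrite !funeposE.
  apply: (etrans (ge0_integral_affine u e0 mD mfn _)).
    by move=> x _; exact: funeneg_ge0.
  congr (_ * _)%E; apply: eq_integral => z _.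
    by rewrite !funenegE.
by rewrite /Rintegral E fineM//; exact: integrable_fin_num.
Qed.

(** The change of variables by [affine] needs a positive slope, so the reflection is treated
    apart. *)
Lemma Rintegral_opp (D : set LT) f :
  measurable D -> mu.-integrable D (EFin \o f) ->
  mu.-integrable (-%R @^-1` D) (EFin \o (f \o -%R)) /\
  \int[mu]_(x in D) f x = \int[mu]_(z in (-%R : LT -> LT) @^-1` D) f (- z).
Proof.
move=> mD fi; pose op := (-%R : LT -> LT).
have mop : measurable_fun setT op by exact: oppr_measurable.
have mD' : measurable (op @^-1` D) by rewrite -[X in measurable X]setTI; exact: mop.
have S (g : LT -> \bar R) : measurable_fun D g -> (forall x, D x -> 0 <= g x)%E ->
  (\int[mu]_(x in D) g x = \int[mu]_(z in op @^-1` D) g (op z))%E.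
  move=> mg g0; rewrite -(ge0_integral_pushforward mop mu mD mg).
    apply: eq_measure_integral => A mA _; exact/esym/lebesgue_measureN.
  by move=> x /[!inE]; exact: g0.
have mf := measurable_int mu fi.
have fi' : mu.-integrable (op @^-1` D) (EFin \o (f \o op)).
  apply/integrableP; split.
    apply/measurable_EFinP; apply: (measurable_comp mD _ (intg_mfun fi)).
      by move=> _ [z /= Dz <-].
    exact: measurable_funTS.
  have/integrableP[_] := fi.
  by rewrite S//; exact: measurableT_comp.
split=> //; rewrite /Rintegral; congr fine.
rewrite integralE [RHS]integralE.
have mfp : measurable_fun (D : set LT) (fun x => (EFin \o f)^\+ x)%E by exact: measurable_funepos.
have mfn : measurable_fun (D : set LT) (fun x => (EFin \o f)^\- x)%E by exact: measurable_funeneg.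
congr (_ - _)%E.
  apply: (etrans (S _ mfp _)); first by move=> x _; exact: funepos_ge0.
  by apply: eq_integral => z _; rewrite !funeposE.
apply: (etrans (S _ mfn _)); first by move=> x _; exact: funeneg_ge0.
by apply: eq_integral => z _; rewrite !funenegE.
Qed.

End lebesgue_line.

(** * Improper integrals by primitives, and Gaussian bounds *)

Section calculus_line.
Context {R : realType}.
Notation mu := (@lebesgue_measure R).
Notation LT := (measurableTypeR R).
Implicit Types (f g F : R -> R).

Lemma is_derive_cvg f (x d : R) : is_derive x 1 f d -> {for x, continuous f}.
Proof.
move=> h; apply: differentiable_continuous.
by apply/derivable1_diffP; case: h.
Qed.

Lemma Rint_exhaust (D : set LT) (D_ : nat -> set LT) f : measurable D ->
  (forall n, measurable (D_ n)) -> (forall n, D_ n `<=` D) ->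
  (forall x, D x -> \forall n \near \oo, D_ n x) ->
  mu.-integrable D (EFin \o f) ->
  (fun n => \int[mu]_(x in D_ n) f x) @ \oo --> \int[mu]_(x in D) f x.
Proof.
move=> mD mD_ DD cD fi.
have -> : (fun n => \int[mu]_(x in D_ n) f x) =
   (fun n => \int[mu]_(x in D) (f \_ (D_ n)) x).
  by apply/funext => n; rewrite -Rintegral_mkcondr setIidr.
refine (Rdominated mD _ _ (integrable_norm fi) _).2.
- move=> n; apply/(measurable_restrict _ (mD_ n) mD).
  by apply: measurable_funS (intg_mfun fi) => //; rewrite setIC setIidr//.
- move=> x /cD [N _ hN]; apply: cvg_near_cst; near=> n.
  rewrite patchE ifT// inE; apply: hN; near: n; exact: nbhs_infty_ge.
- by move=> n x Dx /=; rewrite patchE; case: ifP => // _; rewrite normr0.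
Unshelve. all: end_near. Qed.

Lemma Rint_FTC f F (a b : R) : a <= b ->
  (forall x, a <= x <= b -> is_derive x 1 F (f x)) ->
  (forall x, a <= x <= b -> {for x, continuous f}) ->
  mu.-integrable `[a, b] (EFin \o f) /\ \int[mu]_(x in `[a, b]) f x = F b - F a.
Proof.
move=> ab dF cf.
have cf' : {within `[a, b], continuous f}.
  by apply: continuous_in_subspaceT => x; rewrite inE/= in_itv/=; exact: cf.
have fi : mu.-integrable `[a, b] (EFin \o f).
  by apply: continuous_compact_integrable => //; exact: segment_compact.
split => //; move: ab; rewrite le_eqVlt => /predU1P[->|ab].
  by rewrite set_itv1 Rintegral_set1 subrr.
rewrite /Rintegral (continuous_FTC2 ab cf' (F := F))//.
- have cF x : a <= x <= b -> {for x, continuous F}.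
    by move=> /dF; exact: is_derive_cvg.
  split.
  + by move=> x /subset_itv_oo_cc; rewrite in_itv/= => /dF [].
  + by apply: cvg_at_right_filter; apply: cF; rewrite lexx ltW.
  + by apply: cvg_at_left_filter; apply: cF; rewrite lexx ltW.
- by move=> x /subset_itv_oo_cc; rewrite in_itv/= => /dF [_ <-]; rewrite derive1E.
Qed.

(** Integrability is a hypothesis, so the improper integral may be computed along the integer
    endpoints a + n alone. *)
Lemma Rint_FTCy f F (a l : R) : mu.-integrable `[a, +oo[ (EFin \o f) ->
  (forall x, a <= x -> is_derive x 1 F (f x)) ->
  (forall x, a <= x -> {for x, continuous f}) ->
  F (a + n%:R) @[n --> \oo] --> l ->
  \int[mu]_(x in `[a, +oo[) f x = l - F a.
Proof.
move=> fi dF cf Fl.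
have h := @Rint_exhaust `[a, +oo[%classic (fun n => `[a, a + n%:R]%classic) f _ _ _ _ fi.
apply: (@cvg_unique _ _ _ _ _ _ (h _ _ _ _)) => //=.
- by move=> n x /=; rewrite !in_itv/= => /andP[->].
- move=> x /=; rewrite in_itv/= andbT => ax.
  near=> n; rewrite /= in_itv/= ax/= -lerBlDl.
  near: n; exact: nbhs_infty_ger.
under eq_fun => n.
  rewrite (@Rint_FTC f F a (a + n%:R) _ _ _).2 ?lerDl//; first over.
  - by move=> x /andP[+ _]; exact: dF.
  - by move=> x /andP[+ _]; exact: cf.
by apply: cvgB => //; exact: cvg_cst.
Unshelve. all: end_near. Qed.

Lemma Rint_FTCNy f F (a l : R) : mu.-integrable `]-oo, a] (EFin \o f) ->
  (forall x, x <= a -> is_derive x 1 F (f x)) ->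
  (forall x, x <= a -> {for x, continuous f}) ->
  F (a - n%:R) @[n --> \oo] --> l ->
  \int[mu]_(x in `]-oo, a]) f x = F a - l.
Proof.
move=> fi dF cf Fl.
have h := @Rint_exhaust `]-oo, a]%classic (fun n => `[a - n%:R, a]%classic) f _ _ _ _ fi.
apply: (@cvg_unique _ _ _ _ _ _ (h _ _ _ _)) => //=.
- by move=> n x /=; rewrite !in_itv/= => /andP[].
- move=> x /=; rewrite in_itv/= => ax.
  near=> n; rewrite /= in_itv/= ax andbT lerBlDr -lerBlDl.
  near: n; exact: nbhs_infty_ger.
under eq_fun => n.
  rewrite (@Rint_FTC f F (a - n%:R) a _ _ _).2 ?lerBlDr ?lerDl//; first over.
  - by move=> x /andP[_]; exact: dF.
  - by move=> x /andP[_]; exact: cf.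
by apply: cvgB => //; exact: cvg_cst.
Unshelve. all: end_near. Qed.

Lemma intg_gauss (c : R) : 0 < c ->
  mu.-integrable setT (EFin \o (fun z : R => expR (- (c * z ^+ 2)))).
Proof.
move=> c0.
have s0 : 0 < Num.sqrt c by rewrite sqrtr_gt0.
have := intg_affine 0 s0 measurableT (@integrableT_gauss R).
rewrite preimage_setT; apply: eq_intg => //= z _.
by rewrite /gauss_fun /affine add0r exprMn sqr_sqrtr// ltW.
Qed.

Lemma gauss_poly_bound (c : R) (k : nat) : 0 < c ->
  exists2 K : R, 0 < K & forall z : R,
    (1 + `|z|) ^+ k * expR (- (c * z ^+ 2)) <= K * expR (- (c / 2 * z ^+ 2)).
Proof.
(* Each factor 1 + |z| is at most A e^(d z^2), because 1 + |z| <= 2 + z^2 <= A (1 + d z^2). The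
   choice of d makes k such factors cost at most half of the decay. *)
move=> c0; pose d := c / 2 / k.+1%:R.
have d0 : 0 < d by rewrite !divr_gt0.
pose A := 2 + d^-1.
have A0 : 0 < A by rewrite addr_gt0// invr_gt0.
exists (A ^+ k); first exact: exprn_gt0.
move=> z.
have h1 : 1 + `|z| <= A * expR (d * z ^+ 2).
  apply: (@le_trans _ _ (A * (1 + d * z ^+ 2))); last first.
    by rewrite ler_pM2l// expR_ge1Dx.
  have -> : A * (1 + d * z ^+ 2) = 2 + d^-1 + 2 * (d * z ^+ 2) + z ^+ 2.
    by rewrite /A; field; exact: lt0r_neq0.
  have h2 : `|z| <= 1 + z ^+ 2.
    by rewrite -(real_normK (num_real z)); have := normr_ge0 z; nra.
  have h3 : 0 <= d * z ^+ 2 by rewrite mulr_ge0 ?sqr_ge0 ?ltW.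
  have h4 : 0 < d^-1 by rewrite invr_gt0.
  by lra.
have h2 : (1 + `|z|) ^+ k <= A ^+ k * expR (c / 2 * z ^+ 2).
  apply: (@le_trans _ _ ((A * expR (d * z ^+ 2)) ^+ k)).
    by rewrite lerXn2r// nnegrE ?addr_ge0// mulr_ge0 ?ltW ?expR_gt0.
  rewrite exprMn ler_pM2l ?exprn_gt0// -expRM_natl ler_expR.
  rewrite /d mulrA; apply: ler_wpM2r; first exact: sqr_ge0.
  rewrite mulrCA ler_piMr//; first by rewrite divr_ge0 ?ltW.
  by rewrite ler_pdivrMr// mul1r ler_nat.
have -> : - (c / 2 * z ^+ 2) = c / 2 * z ^+ 2 - c * z ^+ 2 by lra.
by rewrite expRD mulrA ler_pM2r ?expR_gt0.
Qed.

Lemma intg_gauss_poly (c C : R) (k : nat) f : 0 < c -> measurable_fun (setT : set LT) f ->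
  (forall z, `|f z| <= C * ((1 + `|z|) ^+ k * expR (- (c * z ^+ 2)))) ->
  mu.-integrable setT (EFin \o f).
Proof.
move=> c0 mf fC; have [K K0 hK] := gauss_poly_bound k c0.
have c20 : 0 < c / 2 by rewrite divr_gt0.
have C0 : 0 <= C.
  by have := le_trans (normr_ge0 _) (fC 0); rewrite expr0n/= mulr0 oppr0 expR0 mulr1 normr0 addr0 expr1n mulr1.
refine (intg_le measurableT mf (intgZ (C * K) measurableT (intg_gauss c20)) _).
by move=> z _ /=; rewrite (le_trans (fC z))// -mulrA ler_wpM2l.
Qed.

Lemma measurable_cont f : continuous f -> measurable_fun (setT : set LT) f.
Proof. exact: continuous_measurable_fun. Qed.

Lemma cvg_expRN_nat (c : R) : 0 < c ->
  (fun n : nat => expR (- (c * n%:R))) @ \oo --> (0 : R).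
Proof.
move=> c0; apply: (cvg_comp (fun n : nat => c * n%:R) (fun x => expR (- x)));
  last exact: cvgr_expR.
apply/cvgryPge => A; near=> n.
rewrite -ler_pdivrMl//; near: n; exact: nbhs_infty_ger.
Unshelve. all: end_near. Qed.

Lemma intg_expR (c : R) : 0 < c ->
  mu.-integrable `[0, +oo[ (EFin \o (fun z : R => expR (- (c * z)))) /\
  \int[mu]_(z in `[0, +oo[) expR (- (c * z)) = c^-1.
Proof.
move=> c0.
have i1 : mu.-integrable `[0, +oo[ (EFin \o (fun z : R => expR (- (c * z)))).
  have mI : measurable (`[0, +oo[%classic : set (measurableTypeR R)) by [].
  have h := intgZ c^-1 mI (integrableS measurableT mI (@subsetT _ _) (integrable_exponential_pdf c0)).
  apply: (eq_intg mI _ h) => z; rewrite /= in_itv/= andbT => z0.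
  by rewrite exponential_pdfE// /exponential_pdf mulrA mulVf ?mul1r ?mulNr// lt0r_neq0.
split=> //.
have -> : c^-1 = 0 - (- c^-1 * expR (- (c * 0))) by rewrite mulr0 oppr0 expR0; ring.
apply: (@Rint_FTCy _ (fun z => - c^-1 * expR (- (c * z))) 0 0 i1).
- move=> x _; apply: is_derive_eq; rewrite /GRing.scale/=.
  by field; exact: lt0r_neq0.
- move=> x _; apply: (@is_derive_cvg _ _ (- c * expR (- (c * x)))).
  by apply: is_derive_eq; rewrite /GRing.scale/=; ring.
- rewrite -[X in _ --> X](mulr0 (- c^-1)); apply: cvgM; first exact: cvg_cst.
  under eq_fun do rewrite add0r; exact: cvg_expRN_nat.
Qed.

End calculus_line.

(** * Taylor expansion of the Bregman divergence *)

Section taylor.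
Context {R : realType}.
Implicit Types (f g F : R -> R).

(** Endpoints in either order: the point x may lie on either side of the saddle u. *)
Definition between (u x c : R) := (u <= c <= x) \/ (x <= c <= u).

Lemma between_itv (X B u x c : R) : X <= u <= B -> X <= x <= B ->
  between u x c -> X <= c <= B.
Proof. by move=> /andP[? ?] /andP[? ?] [|] /andP[? ?]; apply/andP; split; lra. Qed.

Lemma between_dist (u x c : R) : between u x c -> `|c - u| <= `|x - u|.
Proof.
case=> /andP[h1 h2].
  by rewrite !ger0_norm; lra.
by rewrite !ler0_norm; lra.
Qed.

Lemma MVT_between f (df : R -> R) (u x : R) :
  (forall c, between u x c -> is_derive c 1 f (df c)) ->
  exists2 c, between u x c & f x - f u = df c * (x - u).
Proof.
move=> h; have [xu|ux] := leP u x.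
  have [||c] := @MVT_segment _ f df u x xu.
  - by move=> c; rewrite in_itv/= => /andP[? ?]; apply: h; left; rewrite !ltW.
  - apply: continuous_in_subspaceT => c; rewrite inE/= in_itv/= => hc.
    by apply: is_derive_cvg; apply: h; left.
  by rewrite in_itv/= => hc ->; exists c => //; left.
have [||c] := @MVT_segment _ f df x u (ltW ux).
- by move=> c; rewrite in_itv/= => /andP[? ?]; apply: h; right; rewrite !ltW.
- apply: continuous_in_subspaceT => c; rewrite inE/= in_itv/= => hc.
  by apply: is_derive_cvg; apply: h; right.
rewrite in_itv/= => hc e; exists c; first by right.
by rewrite -opprB e; ring.
Qed.

(** One application of the mean value theorem raises the order by one. No factorial is gained, so a
    single constant serves for all orders. *)
Lemma taylor_step f (df : R -> R) (K u x : R) (n : nat) :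
  (forall c, between u x c -> is_derive c 1 f (df c)) -> f u = 0 ->
  (forall c, between u x c -> `|df c| <= K * `|c - u| ^+ n) -> 0 <= K ->
  `|f x| <= K * `|x - u| ^+ n.+1.
Proof.
move=> df_ fu0 dfK K0; have [c bc] := MVT_between df_.
rewrite fu0 subr0 => ->; rewrite normrM exprSr mulrA ler_wpM2r//.
apply: (le_trans (dfK c bc)); rewrite ler_wpM2l//.
by rewrite lerXn2r ?nnegrE//; exact: between_dist.
Qed.

Lemma cont_bounded f (X B : R) : X <= B ->
  (forall x, X <= x <= B -> {for x, continuous f}) ->
  exists2 K : R, 0 < K & forall x, X <= x <= B -> `|f x| <= K.
Proof.
move=> XB cf.
have h : {within `[X, B], continuous (fun x => `|f x|)}.
  apply: continuous_in_subspaceT => x; rewrite inE/= in_itv/= => hx.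
  by apply: continuous_comp; [exact: cf|exact: norm_continuous].
have [c _ hc] := EVT_max XB h.
exists (1 + `|f c|); first by rewrite ltr_pwDl.
by move=> x hx; rewrite (le_trans (hc x _)) ?in_itv//= lerDr.
Qed.

Lemma cont_pos_bounded f (X B : R) : X <= B ->
  (forall x, X <= x <= B -> {for x, continuous f}) ->
  (forall x, X <= x <= B -> 0 < f x) ->
  exists2 m : R, 0 < m & forall x, X <= x <= B -> m <= f x.
Proof.
move=> XB cf f0.
have h : {within `[X, B], continuous f}.
  by apply: continuous_in_subspaceT => x; rewrite inE/= in_itv/=; exact: cf.
have [c hc1 hc] := EVT_min XB h.
exists (f c); first by apply: f0; move: hc1; rewrite in_itv.
by move=> x hx; apply: hc; rewrite in_itv.
Qed.

End taylor.

Section bregman.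
Context {R : realType} (P P1 P2 P3 P4 P5 : R -> R).
Hypothesis dP : forall x : R, is_derive x 1 P (P1 x).
Hypothesis dP1 : forall x : R, is_derive x 1 P1 (P2 x).
Hypothesis dP2 : forall x : R, is_derive x 1 P2 (P3 x).
Hypothesis dP3 : forall x : R, is_derive x 1 P3 (P4 x).
Hypothesis dP4 : forall x : R, is_derive x 1 P4 (P5 x).
Hypothesis cP5 : continuous P5.
Hypothesis P2_gt0 : forall x, 0 < P2 x.

(** The convex function P x - y x at slope y = P1 u, minus its minimum, which is attained at u. *)
Definition breg (x u : R) := P x - P u - P1 u * (x - u).

Lemma breg_ge (X B : R) : X <= B -> exists2 m : R, 0 < m &
  (forall x, X <= x <= B -> m <= P2 x) /\
  forall u x, X <= u <= B -> X <= x <= B -> m / 2 * (x - u) ^+ 2 <= breg x u.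
Proof.
move=> XB; have [||m m0 hm] := @cont_pos_bounded _ P2 X B XB.
- by move=> x _; exact: is_derive_cvg.
- by move=> x _.
exists m => //; split => // u x hu hx.
pose g y := breg y u - m / 2 * (y - u) ^+ 2.
pose dg y := P1 y - P1 u - m * (y - u).
have dgE (y : R) : is_derive y 1 g (dg y).
  rewrite /g /breg; apply: is_derive_eq; rewrite /dg /GRing.scale/=; by field.
have [c bc e] := MVT_between (u := u) (x := x) (fun y _ => dgE y).
have gu : g u = 0 by rewrite /g /breg; ring.
suff : 0 <= g x by rewrite /g; lra.
have -> : g x = dg c * (x - u) by rewrite -e gu subr0.
rewrite /dg.
have [c' bc' e'] := MVT_between (u := u) (x := c) (fun y _ => dP1 y).
rewrite e' -mulrBl -mulrA mulr_ge0//.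
  rewrite subr_ge0; apply: hm; apply: (between_itv hu _ bc').
  exact: (between_itv hu hx bc).
case: bc => /andP[h1 h2]; first by rewrite mulr_ge0; lra.
by rewrite mulr_le0; lra.
Qed.

(** The remainder of order 3 serves for domination, that of order 4 for first-order limits and
    symmetrised bounds, that of order 5 for the second-order limit. All descend by [taylor_step]
    from bounds of P3, P4 and P5 on the window. *)
Lemma breg_taylor (X B : R) : X <= B -> exists2 K : R, 0 < K &
  forall u x, X <= u <= B -> X <= x <= B ->
  let h := x - u in
  [/\ `|P2 x - P2 u| <= K * `|h|,
   `|P2 x - P2 u - P3 u * h| <= K * `|h| ^+ 2,
   `|breg x u - P2 u / 2 * h ^+ 2| <= K * `|h| ^+ 3,
   `|breg x u - P2 u / 2 * h ^+ 2 - P3 u / 6 * h ^+ 3| <= K * `|h| ^+ 4 &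
   `|breg x u - P2 u / 2 * h ^+ 2 - P3 u / 6 * h ^+ 3 - P4 u / 24 * h ^+ 4|
      <= K * `|h| ^+ 5].
Proof.
move=> XB.
have [K3 K30 b3] := @cont_bounded _ P3 X B XB (fun x _ => is_derive_cvg (dP3 x)).
have [K4 K40 b4] := @cont_bounded _ P4 X B XB (fun x _ => is_derive_cvg (dP4 x)).
have [K5 K50 b5] := @cont_bounded _ P5 X B XB (fun x _ => @cP5 x).
pose K := K3 + K4 + K5.
have [k3 k4 k5] : [/\ K3 <= K, K4 <= K & K5 <= K] by split; rewrite /K; lra.
have K0 : 0 < K by lra.
have K0' := ltW K0.
exists K => // u x hu hx h.
have bt c : between u x c -> X <= c <= B by exact: between_itv.
have btt y c : between u x y -> between u y c -> between u x c.
  by case=> /andP[? ?] [] /andP[? ?]; (try by left; lra); (try by right; lra).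
have e2 y : between u x y -> `|P2 y - P2 u| <= K * `|y - u|.
  move=> hy; rewrite -[`|y - u|]expr1.
  apply: (@taylor_step _ (fun y => P2 y - P2 u) P3 K u y 0%N) => //.
  - by move=> c _; apply: is_derive_eq; rewrite subr0.
  - by rewrite subrr.
  - by move=> c hc; rewrite expr0 mulr1 (le_trans (b3 _ _))//; exact/bt/(btt y).
have e3 y : between u x y -> `|P3 y - P3 u| <= K * `|y - u|.
  move=> hy; rewrite -[`|y - u|]expr1.
  apply: (@taylor_step _ (fun y => P3 y - P3 u) P4 K u y 0%N) => //.
  - by move=> c _; apply: is_derive_eq; rewrite subr0.
  - by rewrite subrr.
  - by move=> c hc; rewrite expr0 mulr1 (le_trans (b4 _ _))//; exact/bt/(btt y).
have e4 y : between u x y -> `|P4 y - P4 u| <= K * `|y - u|.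
  move=> hy; rewrite -[`|y - u|]expr1.
  apply: (@taylor_step _ (fun y => P4 y - P4 u) P5 K u y 0%N) => //.
  - by move=> c _; apply: is_derive_eq; rewrite subr0.
  - by rewrite subrr.
  - by move=> c hc; rewrite expr0 mulr1 (le_trans (b5 _ _))//; exact/bt/(btt y).
have e12 y : between u x y -> `|P1 y - P1 u - P2 u * (y - u)| <= K * `|y - u| ^+ 2.
  move=> hy; apply: (@taylor_step _ (fun y => P1 y - P1 u - P2 u * (y - u)) (fun y => P2 y - P2 u)) => //.
  - by move=> c _; apply: is_derive_eq; rewrite /GRing.scale/=; ring.
  - by rewrite !subrr mulr0 subrr.
  - by move=> c hc; rewrite expr1; exact/e2/(btt y).
have e23 y : between u x y -> `|P2 y - P2 u - P3 u * (y - u)| <= K * `|y - u| ^+ 2.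
  move=> hy; apply: (@taylor_step _ (fun y => P2 y - P2 u - P3 u * (y - u)) (fun y => P3 y - P3 u)) => //.
  - by move=> c _; apply: is_derive_eq; rewrite /GRing.scale/=; ring.
  - by rewrite !subrr mulr0 subrr.
  - by move=> c hc; rewrite expr1; exact/e3/(btt y).
have e34 y : between u x y -> `|P3 y - P3 u - P4 u * (y - u)| <= K * `|y - u| ^+ 2.
  move=> hy; apply: (@taylor_step _ (fun y => P3 y - P3 u - P4 u * (y - u)) (fun y => P4 y - P4 u)) => //.
  - by move=> c _; apply: is_derive_eq; rewrite /GRing.scale/=; ring.
  - by rewrite !subrr mulr0 subrr.
  - by move=> c hc; rewrite expr1; exact/e4/(btt y).
have e13 y : between u x y ->
    `|P1 y - P1 u - P2 u * (y - u) - P3 u / 2 * (y - u) ^+ 2| <= K * `|y - u| ^+ 3.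
  move=> hy; apply: (@taylor_step _ (fun y => P1 y - P1 u - P2 u * (y - u) - P3 u / 2 * (y - u) ^+ 2) (fun y => P2 y - P2 u - P3 u * (y - u))) => //.
  - by move=> c _; apply: is_derive_eq; rewrite /GRing.scale/=; field.
  - by rewrite !subrr expr0n /=; ring.
  - by move=> c hc; exact/e23/(btt y).
have e24 y : between u x y ->
    `|P2 y - P2 u - P3 u * (y - u) - P4 u / 2 * (y - u) ^+ 2| <= K * `|y - u| ^+ 3.
  move=> hy; apply: (@taylor_step _ (fun y => P2 y - P2 u - P3 u * (y - u) - P4 u / 2 * (y - u) ^+ 2) (fun y => P3 y - P3 u - P4 u * (y - u))) => //.
  - by move=> c _; apply: is_derive_eq; rewrite /GRing.scale/=; field.
  - by rewrite !subrr expr0n /=; ring.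
  - by move=> c hc; exact/e34/(btt y).
have e14 y : between u x y ->
    `|P1 y - P1 u - P2 u * (y - u) - P3 u / 2 * (y - u) ^+ 2
      - P4 u / 6 * (y - u) ^+ 3| <= K * `|y - u| ^+ 4.
  move=> hy; apply: (@taylor_step _ (fun y => P1 y - P1 u - P2 u * (y - u) - P3 u / 2 * (y - u) ^+ 2       - P4 u / 6 * (y - u) ^+ 3)
      (fun y => P2 y - P2 u - P3 u * (y - u) - P4 u / 2 * (y - u) ^+ 2)) => //.
  - by move=> c _; apply: is_derive_eq; rewrite /GRing.scale/=; field.
  - by rewrite !subrr !expr0n /=; ring.
  - by move=> c hc; exact/e24/(btt y).
have bx : between u x x by have [?|?] := leP u x; [left|right]; lra.
split.
- exact: e2.
- exact: e23.
- apply: (@taylor_step _ (fun y => breg y u - P2 u / 2 * (y - u) ^+ 2)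
    (fun y => P1 y - P1 u - P2 u * (y - u))) => //.
  + by move=> c _; rewrite /breg; apply: is_derive_eq; rewrite /GRing.scale/=; field.
  + by rewrite /breg !subrr; ring.
- apply: (@taylor_step _ (fun y => breg y u - P2 u / 2 * (y - u) ^+ 2 - P3 u / 6 * (y - u) ^+ 3)
    (fun y => P1 y - P1 u - P2 u * (y - u) - P3 u / 2 * (y - u) ^+ 2)) => //.
  + by move=> c _; rewrite /breg; apply: is_derive_eq; rewrite /GRing.scale/=; field.
  + by rewrite /breg !subrr; ring.
- apply: (@taylor_step _ (fun y => breg y u - P2 u / 2 * (y - u) ^+ 2 - P3 u / 6 * (y - u) ^+ 3
       - P4 u / 24 * (y - u) ^+ 4)
    (fun y => P1 y - P1 u - P2 u * (y - u) - P3 u / 2 * (y - u) ^+ 2 - P4 u / 6 * (y - u) ^+ 3)) => //.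
  + by move=> c _; rewrite /breg; apply: is_derive_eq; rewrite /GRing.scale/=; field.
  + by rewrite /breg !subrr; ring.
Qed.

End bregman.

(** * Gaussian integrals *)

Section gauss_moments.
Context {R : realType}.
Notation mu := (@lebesgue_measure R).
Notation LT := (measurableTypeR R).
Implicit Types (f g F : R -> R).

Lemma Rint_FTCT f F : mu.-integrable setT (EFin \o f) ->
  (forall x : R, is_derive x 1 F (f x)) -> continuous f ->
  F n%:R @[n --> \oo] --> (0 : R) -> F (- n%:R) @[n --> \oo] --> (0 : R) ->
  \int[mu]_x f x = 0.
Proof.
move=> fi dF cf F1 F2.
have h := @Rint_exhaust R setT (fun n => `[- n%:R, n%:R]%classic) f _ _ _ _ fi.
apply: (@cvg_unique _ _ _ _ _ _ (h _ _ _ _)) => //=.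
- move=> x _; near=> n; rewrite /= in_itv/= lerNl.
  apply/andP; split; near: n; exact: nbhs_infty_ger.
under eq_fun => n.
  rewrite (@Rint_FTC _ f F (- n%:R) n%:R _ _ _).2//; first over.
  by rewrite (@le_trans _ _ 0)// oppr_le0.
  by move=> x _; exact: cf.
by rewrite -(subr0 (0 : R)); apply: cvgB.
Unshelve. all: end_near. Qed.

Lemma cvg_nat_gauss_poly (c : R) (k : nat) f : 0 < c ->
  (forall z, `|f z| <= (1 + `|z|) ^+ k * expR (- (c * z ^+ 2))) ->
  f n%:R @[n --> \oo] --> (0 : R) /\ f (- n%:R) @[n --> \oo] --> (0 : R).
Proof.
move=> c0 hf; have [K K0 hK] := gauss_poly_bound k c0.
have h (n : nat) z : `|z| = n%:R -> `|f z| <= K * expR (- (c / 2 * n%:R)).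
  move=> zn; rewrite (le_trans (hf _))// (le_trans (hK _))// ler_pM2l// ler_expR lerN2.
  rewrite ler_pM2l ?divr_gt0// -(real_normK (num_real z)) zn -natrX ler_nat.
  by case: n {zn} => // n; rewrite expnS leq_pmulr// expn_gt0.
have cv : K * expR (- (c / 2 * n%:R)) @[n --> \oo] --> (0 : R).
  rewrite -(mulr0 K); apply: cvgM; first exact: cvg_cst.
  by apply: cvg_expRN_nat; rewrite divr_gt0.
have cvN : - (K * expR (- (c / 2 * n%:R))) @[n --> \oo] --> (0 : R).
  by rewrite -oppr0; exact: cvgN.
split; apply: (squeeze_cvgr _ cvN cv); apply: nearW => n.
- by rewrite -ler_norml; apply: h; rewrite normr_nat.
- by rewrite -ler_norml; apply: h; rewrite normrN normr_nat.
Qed.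

Lemma continuous_mongauss (b : R) (k : nat) :
  continuous (fun z : R => z ^+ k * expR (- (b * z ^+ 2))).
Proof.
move=> z; apply: cvgM; first exact: exprn_continuous.
apply: (@continuous_comp _ _ _ (fun z : R => - (b * z ^+ 2)) expR); last exact: continuous_expR.
by apply: cvgN; apply: cvgM; [exact: cvg_cst|exact: exprn_continuous].
Qed.

Lemma mongauss_le (b : R) (k : nat) (z : R) :
  `|z ^+ k * expR (- (b * z ^+ 2))| <= (1 + `|z|) ^+ k * expR (- (b * z ^+ 2)).
Proof.
rewrite normrM normrX (ger0_norm (expR_ge0 _)) ler_pM2r ?expR_gt0//.
by rewrite lerXn2r ?nnegrE ?addr_ge0// lerDr.
Qed.

Lemma intg_mongauss (b : R) (k : nat) : 0 < b ->
  mu.-integrable setT (EFin \o (fun z : R => z ^+ k * expR (- (b * z ^+ 2)))).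
Proof.
move=> b0; apply: (@intg_gauss_poly R b 1 k) => //.
  apply: measurable_cont; exact: continuous_mongauss.
by move=> z; rewrite mul1r; exact: mongauss_le.
Qed.

Lemma cvg_mongauss (b : R) (k : nat) : 0 < b ->
  (n%:R : R) ^+ k * expR (- (b * n%:R ^+ 2)) @[n --> \oo] --> (0 : R) /\
  (- n%:R : R) ^+ k * expR (- (b * (- n%:R) ^+ 2)) @[n --> \oo] --> (0 : R).
Proof.
move=> b0.
apply: (@cvg_nat_gauss_poly b k (fun z : R => z ^+ k * expR (- (b * z ^+ 2))) b0).
by move=> z; exact: mongauss_le.
Qed.

Lemma is_derive_mongauss (b : R) (k : nat) (z : R) :
  is_derive z 1 (fun z : R => z ^+ k.+1 * expR (- (b * z ^+ 2)))
   (k.+1%:R * (z ^+ k * expR (- (b * z ^+ 2))) - 2 * b * (z ^+ k.+2 * expR (- (b * z ^+ 2)))).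
Proof.
have h1 : is_derive z 1 (fun z : R => z ^+ k.+1) (k.+1%:R * z ^+ k).
  by apply: DeriveDef; [exact: exprn_derivable|rewrite exp_derive /GRing.scale/= mulr1].
have h2 : is_derive z 1 (fun z : R => expR (- (b * z ^+ 2))) (- (2 * b * z) * expR (- (b * z ^+ 2))).
  by apply: is_derive_eq; rewrite /GRing.scale/=; ring.
apply: is_derive_eq; rewrite /GRing.scale/= !exprS; ring.
Qed.

(** The derivative of z^(k+1) e^(-b z^2) has integral zero. *)
Lemma gauss_moment_rec (b : R) (k : nat) : 0 < b ->
  \int[mu]_z (z ^+ k.+2 * expR (- (b * z ^+ 2))) =
  k.+1%:R / (2 * b) * \int[mu]_z (z ^+ k * expR (- (b * z ^+ 2))).
Proof.
move=> b0.
have i1 := intg_mongauss k b0; have i2 := intg_mongauss k.+2 b0.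
have := @Rint_FTCT _ (fun z : R => z ^+ k.+1 * expR (- (b * z ^+ 2)))
  (intgB measurableT (intgZ k.+1%:R measurableT i1) (intgZ (2 * b) measurableT i2))
  (is_derive_mongauss b k) _ (cvg_mongauss k.+1 b0).1 (cvg_mongauss k.+1 b0).2.
rewrite RintegralB//; [|exact: intgZ|exact: intgZ].
rewrite !RintegralZl// => H.
have {}H := H _.
have/H : continuous (fun x : R => k.+1%:R * (x ^+ k * expR (- (b * x ^+ 2))) -
     2 * b * (x ^+ k.+2 * expR (- (b * x ^+ 2)))).
  move=> x; apply: cvgB; apply: cvgM; try exact: cvg_cst; exact: continuous_mongauss.
set A := \int[mu]_x _; set C := \int[mu]_x _ => e.
have b20 : 2 * b != 0 by rewrite mulf_neq0// lt0r_neq0.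
apply: (mulfI b20); rewrite mulrA mulrCA divff// mulr1.
by apply/esym/eqP; rewrite -subr_eq0 e.
Qed.

Lemma gauss_total (b : R) : 0 < b ->
  \int[mu]_z expR (- (b * z ^+ 2)) = Num.sqrt (pi / b).
Proof.
move=> b0; have s0 : 0 < Num.sqrt b by rewrite sqrtr_gt0.
have h := @Rintegral_affine R 0 (Num.sqrt b) setT _ s0 measurableT (@integrableT_gauss R).
rewrite preimage_setT in h.
have e : \int[mu]_z gauss_fun z = Num.sqrt pi by rewrite /Rintegral integralT_gauss.
rewrite sqrtrM ?pi_ge0// sqrtrV ?ltW// -e h mulrAC divff ?mul1r ?lt0r_neq0//.
apply: eq_Rintegral => z _.
by rewrite /gauss_fun /affine add0r exprMn sqr_sqrtr// ltW.
Qed.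

Lemma gauss_moment4 (b : R) : 0 < b ->
  \int[mu]_z (z ^+ 4 * expR (- (b * z ^+ 2))) = 3 / (2 * b) ^+ 2 * Num.sqrt (pi / b).
Proof.
move=> b0; rewrite !gauss_moment_rec// -gauss_total//.
under eq_Rintegral do rewrite expr0 mul1r.
by field; rewrite lt0r_neq0.
Qed.

Lemma gauss_moment6 (b : R) : 0 < b ->
  \int[mu]_z (z ^+ 6 * expR (- (b * z ^+ 2))) = 15 / (2 * b) ^+ 3 * Num.sqrt (pi / b).
Proof.
move=> b0; rewrite gauss_moment_rec// gauss_moment4//.
by field; rewrite lt0r_neq0.
Qed.

Lemma gauss_moment2 : \int[mu]_z (z ^+ 2 * expR (- z ^+ 2)) = Num.sqrt pi / 2 :> R.
Proof.
have e (k : nat) : \int[mu]_z (z ^+ k * expR (- z ^+ 2)) =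
   \int[mu]_z (z ^+ k * expR (- (1 * z ^+ 2))) :> R.
  by apply: eq_Rintegral => z _; rewrite mul1r.
rewrite e gauss_moment_rec//.
under eq_Rintegral do rewrite expr0 mul1r.
by rewrite gauss_total// divr1; field.
Qed.

Lemma gauss_moment3 : \int[mu]_z (z ^+ 3 * expR (- z ^+ 2)) = 0 :> R.
Proof.
have e (k : nat) : \int[mu]_z (z ^+ k * expR (- z ^+ 2)) =
   \int[mu]_z (z ^+ k * expR (- (1 * z ^+ 2))) :> R.
  by apply: eq_Rintegral => z _; rewrite mul1r.
rewrite e gauss_moment_rec//.
have i1 := @intg_mongauss 1 1 ltr01.
have [_ h] := Rintegral_opp measurableT i1.
rewrite preimage_setT in h.
have : \int[mu]_z (z ^+ 1 * expR (- (1 * z ^+ 2))) = - \int[mu]_z (z ^+ 1 * expR (- (1 * z ^+ 2))) :> R.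
  rewrite [LHS]h -RintegralN//; apply: eq_Rintegral => z _.
  by rewrite !expr1 sqrrN mulNr.
by move=> e0; have -> : \int[mu]_z (z ^+ 1 * expR (- (1 * z ^+ 2))) = 0 :> R; rewrite ?mulr0//; move: e0; set y := (\int[_]_z _) => e0; lra.
Qed.

End gauss_moments.

(** * Truncated Gaussian integrals *)

Section gauss_tail.
Context {R : realType}.
Notation mu := (@lebesgue_measure R).
Notation LT := (measurableTypeR R).
Implicit Types (f g F : R -> R).

(** Equal to (sqrt pi / 2) [erfc]; omitting the factor keeps the moment formulas rational. *)
Definition gtail (x : R) : R := \int[mu]_(t in `[x, +oo[) expR (- t ^+ 2).

Lemma intg_mongauss1 (k : nat) (D : set LT) : measurable D ->
  mu.-integrable D (EFin \o (fun z : R => z ^+ k * expR (- z ^+ 2))).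
Proof.
move=> mD; apply: (intgS measurableT mD (@subsetT _ _)).
apply: (eq_intg measurableT _ (intg_mongauss k ltr01)) => z _.
by rewrite mul1r.
Qed.

Lemma intg_gauss1 (D : set LT) : measurable D ->
  mu.-integrable D (EFin \o (fun z : R => expR (- z ^+ 2))).
Proof.
move=> mD; apply: (eq_intg mD _ (intg_mongauss1 0 mD)) => z _.
by rewrite expr0 mul1r.
Qed.

Lemma continuous_gauss1 : continuous (fun z : R => expR (- z ^+ 2)).
Proof.
have <- : (fun z : R => z ^+ 0 * expR (- (1 * z ^+ 2))) = (fun z : R => expR (- z ^+ 2)).
  by apply/funext => z; rewrite expr0 !mul1r.
exact: continuous_mongauss.
Qed.

Lemma gtailE (c x : R) : c <= x ->
  gtail x = gtail c - \int[mu]_(t in `[c, x]) expR (- t ^+ 2).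
Proof.
move=> cx; rewrite /gtail.
rewrite -(@Rintegral_itv_obnd_cbnd _ x); last exact: intg_gauss1.
rewrite -(@Rintegral_itvB _ _ (BLeft c) +oo%O x)//; first exact: intg_gauss1.
Qed.

Lemma is_derive_gtail (x : R) : is_derive x 1 gtail (- expR (- x ^+ 2)).
Proof.
(* The fundamental theorem concerns integrals with a fixed lower end; near x one has [gtail] =
   [gtail c] - F, by [gtailE]. *)
pose c := x - 1; have cx : c < x by rewrite /c; lra.
pose F (y : R) := \int[mu]_(t in `[c, y]) expR (- t ^+ 2).
have xx : x < x + 1 by lra.
have mI : mu.-integrable `[c, x + 1] (EFin \o (fun t => expR (- t ^+ 2))).
  exact: intg_gauss1.
have [dF F'] := @continuous_FTC1_closed R (fun t => expR (- t ^+ 2)) c x (x + 1) xx mI cx (@continuous_gauss1 x).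
have dF' : is_derive x 1 F (expR (- x ^+ 2)).
  by rewrite -F' derive1E; exact: derivableP.
have dG : is_derive x 1 (fun y => gtail c - F y) (- expR (- x ^+ 2)).
  have h1 := @is_derive_cst R R R (gtail c) x 1.
  by apply: (is_derive_eq (is_deriveB h1 dF')); rewrite sub0r.
apply: (near_eq_is_derive _ dG).
near=> y; rewrite -gtailE//; near: y.
by near do apply: ltW; apply: lt_nbhsr.
Unshelve. all: end_near. Qed.

Lemma continuous_gtail : continuous gtail.
Proof. by move=> x; apply: is_derive_cvg; exact: is_derive_gtail. Qed.

Lemma gtail_gt0 (x : R) : 0 < gtail x.
Proof.
have h : {within `[x, x + 1], continuous (fun z : R => expR (- z ^+ 2))}.
  by apply: continuous_subspaceT; exact: continuous_gauss1.
have x1 : x <= x + 1 by lra.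
have [c _ hc] := EVT_min x1 h.
apply: (@lt_le_trans _ _ (\int[mu]_(t in `[x, x + 1]) expR (- t ^+ 2))); last first.
  apply: ge0_le_RintegralS => //.
  - by move=> t /=; rewrite !in_itv/= => /andP[->].
  - exact: intg_gauss1.
apply: (@lt_le_trans _ _ (expR (- c ^+ 2))); first exact: expR_gt0.
have -> : expR (- c ^+ 2) = \int[mu]_(t in `[x, x + 1]) expR (- c ^+ 2).
  rewrite Rintegral_cst//= lebesgue_measure_itv/= lte_fin ifT; last by lra.
  by rewrite -EFinB/=; ring.
apply: le_Rintegral => //.
- apply: continuous_compact_integrable; first exact: segment_compact.
  by apply: continuous_subspaceT => z; exact: cvg_cst.
- exact: intg_gauss1.
Qed.

Lemma gtail_opp (x : R) : \int[mu]_(z in `]-oo, - x]) expR (- z ^+ 2) = gtail x.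
Proof.
have mD : measurable (`]-oo, - x]%classic : set LT) by [].
have [_ ->] := Rintegral_opp mD (intg_gauss1 mD).
have -> : -%R @^-1` `]-oo, - x] = `[x, +oo[%classic :> set LT.
  by apply/seteqP; split => z /=; rewrite !in_itv/= andbT lerN2.
rewrite /gtail.
by apply: eq_Rintegral => z _; rewrite sqrrN.
Qed.

Lemma gauss1_total : \int[mu]_z expR (- z ^+ 2) = Num.sqrt pi :> R.
Proof.
by rewrite /Rintegral integralT_gauss.
Qed.

Lemma gtail0 : gtail 0 = Num.sqrt pi / 2.
Proof. by rewrite /gtail /Rintegral integral0y_gauss. Qed.

Lemma gtail_add (x : R) : gtail x + gtail (- x) = Num.sqrt pi.
Proof.
rewrite -gauss1_total -set_itvNyy.
have mI : mu.-integrable `]-oo, +oo[ (EFin \o (fun t => expR (- t ^+ 2))) by exact: intg_gauss1.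
have := @Rintegral_itvB R (fun t => expR (- t ^+ 2)) -oo%O +oo%O x mI isT isT.
rewrite (@Rintegral_itv_obnd_cbnd _ x); last exact: intg_gauss1.
rewrite -/(gtail x) => /eqP; rewrite subr_eq => /eqP ->.
by rewrite -(gtail_opp (- x)) opprK.
Qed.

Lemma gtail_lt_total (x : R) : gtail x < Num.sqrt pi.
Proof. by rewrite -(gtail_add x) ltrDl gtail_gt0. Qed.

Lemma gtail_antitone (x y : R) : x <= y -> gtail y <= gtail x.
Proof.
move=> xy; rewrite (gtailE xy) lerBlDr lerDl.
by apply: Rintegral_ge0 => z _; exact: expR_ge0.
Qed.

Lemma gtail_ge_half (x : R) : x <= 0 -> Num.sqrt pi / 2 <= gtail x.
Proof. by move=> x0; rewrite -gtail0 gtail_antitone. Qed.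

Lemma cvg_mongauss1 (k : nat) (a : R) :
  (fun n : nat => (a + n%:R) ^+ k * expR (- (a + n%:R) ^+ 2)) @ \oo --> (0 : R).
Proof.
have [K K0 hK] := gauss_poly_bound k (@ltr01 R).
have h (n : nat) : `|(a + n%:R) ^+ k * expR (- (a + n%:R) ^+ 2)| <=
   K * expR (`|a| + 2^-1) * expR (- (1 * n%:R)).
  have -> : - (a + n%:R) ^+ 2 = - (1 * (a + n%:R) ^+ 2) by rewrite mul1r.
  rewrite (le_trans (mongauss_le _ _ _))// (le_trans (hK _))// -[leRHS]mulrA ler_pM2l// -expRD ler_expR.
  have := ler_norm (- a); rewrite normrN.
  by have := sqr_ge0 (a + n%:R - 1); nra.
have cv : K * expR (`|a| + 2^-1) * expR (- (1 * n%:R)) @[n --> \oo] --> (0 : R).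
  rewrite -(mulr0 (K * expR (`|a| + 2^-1))); apply: cvgM; first exact: cvg_cst.
  exact: cvg_expRN_nat.
have cvN : - (K * expR (`|a| + 2^-1) * expR (- (1 * n%:R))) @[n --> \oo] --> (0 : R).
  by rewrite -oppr0; exact: cvgN.
by apply: (squeeze_cvgr _ cvN cv); apply: nearW => n; rewrite -ler_norml.
Qed.

Lemma gtail_moment1 (x : R) :
  \int[mu]_(t in `[x, +oo[) (t ^+ 1 * expR (- t ^+ 2)) = expR (- x ^+ 2) / 2.
Proof.
have mI : measurable (`[x, +oo[%classic : set LT) by [].
pose F (t : R) := - 2^-1 * expR (- t ^+ 2).
have dF (t : R) : x <= t -> is_derive t 1 F (t ^+ 1 * expR (- t ^+ 2)).
  by move=> _; rewrite /F; apply: is_derive_eq; rewrite /GRing.scale/=; field.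
have cf (t : R) : x <= t -> {for t, continuous (fun t : R => t ^+ 1 * expR (- t ^+ 2))}.
  by move=> _; apply: cvgM; [exact: exprn_continuous|exact: continuous_gauss1].
have lF : F (x + n%:R) @[n --> \oo] --> (0 : R).
  rewrite -(mulr0 (- 2^-1)); apply: cvgM; first exact: cvg_cst.
  by have := cvg_mongauss1 0 x; under eq_fun do rewrite expr0 mul1r.
have -> := Rint_FTCy (intg_mongauss1 1 mI) dF cf lF.
by rewrite /F; field.
Qed.

Lemma gtail_moment2 (x : R) :
  \int[mu]_(t in `[x, +oo[) (t ^+ 2 * expR (- t ^+ 2)) =
  x * expR (- x ^+ 2) / 2 + gtail x / 2.
Proof.
have mI : measurable (`[x, +oo[%classic : set LT) by [].
have i2 := intg_mongauss1 2 mI; have i0 := intg_gauss1 mI.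
pose F (t : R) := - 2^-1 * (t ^+ 1 * expR (- t ^+ 2)).
have dF (t : R) : x <= t -> is_derive t 1 F (t ^+ 2 * expR (- t ^+ 2) - 2^-1 * expR (- t ^+ 2)).
  by move=> _; rewrite /F; apply: is_derive_eq; rewrite /GRing.scale/=; field.
have cf (t : R) : x <= t -> {for t, continuous (fun t : R => t ^+ 2 * expR (- t ^+ 2) - 2^-1 * expR (- t ^+ 2))}.
  move=> _; apply: cvgB; apply: cvgM; [exact: exprn_continuous|exact: continuous_gauss1|exact: cvg_cst|exact: continuous_gauss1].
have lF : F (x + n%:R) @[n --> \oo] --> (0 : R).
  by rewrite -(mulr0 (- 2^-1)); apply: cvgM; [exact: cvg_cst|exact: cvg_mongauss1].
have := Rint_FTCy (intgB mI i2 (intgZ 2^-1 mI i0)) dF cf lF.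
rewrite RintegralB//; last exact: intgZ.
rewrite RintegralZl// -/(gtail x) /F expr1 => /eqP; rewrite subr_eq => /eqP ->.
by field.
Qed.

Lemma gtail_moment3 (x : R) :
  \int[mu]_(t in `[x, +oo[) (t ^+ 3 * expR (- t ^+ 2)) =
  (x ^+ 2 + 1) / 2 * expR (- x ^+ 2).
Proof.
have mI : measurable (`[x, +oo[%classic : set LT) by [].
pose F (t : R) := - 2^-1 * (t ^+ 2 * expR (- t ^+ 2) + expR (- t ^+ 2)).
have dF (t : R) : x <= t -> is_derive t 1 F (t ^+ 3 * expR (- t ^+ 2)).
  by move=> _; rewrite /F; apply: is_derive_eq; rewrite /GRing.scale/=; field.
have cf (t : R) : x <= t -> {for t, continuous (fun t : R => t ^+ 3 * expR (- t ^+ 2))}.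
  by move=> _; apply: cvgM; [exact: exprn_continuous|exact: continuous_gauss1].
have lF : F (x + n%:R) @[n --> \oo] --> (0 : R).
  rewrite -(mulr0 (- 2^-1)); apply: cvgM; first exact: cvg_cst.
  rewrite -(addr0 0); apply: cvgD; first exact: cvg_mongauss1.
  by have := cvg_mongauss1 0 x; under eq_fun do rewrite expr0 mul1r.
have -> := Rint_FTCy (intg_mongauss1 3 mI) dF cf lF.
by rewrite /F; field.
Qed.

Lemma lower_moment (k : nat) (x : R) :
  \int[mu]_(z in `]-oo, - x]) (z ^+ k * expR (- z ^+ 2)) =
  (-1) ^+ k * \int[mu]_(t in `[x, +oo[) (t ^+ k * expR (- t ^+ 2)).
Proof.
have mD : measurable (`]-oo, - x]%classic : set LT) by [].
have mI : measurable (`[x, +oo[%classic : set LT) by [].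
have [_ ->] := Rintegral_opp mD (intg_mongauss1 k mD).
have -> : -%R @^-1` `]-oo, - x] = `[x, +oo[%classic :> set LT.
  by apply/seteqP; split => z /=; rewrite !in_itv/= andbT lerN2.
rewrite -RintegralZl//; last exact: intg_mongauss1.
by apply: eq_Rintegral => z _; rewrite sqrrN [(- z) ^+ k]exprNn mulrA.
Qed.

End gauss_tail.

(** * Laplace's method *)

Section quotient_limits.
Context {R : realType}.

(** The chain rule along a sequence. The difference quotient is extended by d at 0, which makes it
    continuous there and covers the indices with a_n = a. *)
Lemma chain_quot (f : R -> R) (a d s : R) (a_ e_ : nat -> R) :
  is_derive a 1 f d -> (forall n, e_ n != 0) -> e_ @ \oo --> (0 : R) ->
  (fun n => (a_ n - a) / e_ n) @ \oo --> s ->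
  (fun n => (f (a_ n) - f a) / e_ n) @ \oo --> d * s.
Proof.
move=> df e0 ecv acv.
pose g (h : R) := if h == 0 then d else h^-1 * (f (h + a) - f a).
have gc : {for 0, continuous g}.
  apply/continuous_withinNx.
  have -> : g 0 = d by rewrite /g eqxx.
  case: df => fd <-.
  have -> : 'D_1 f a = lim (h^-1 *: ((f \o shift a) (h *: 1) - f a) @[h --> 0^']) by [].
  apply: (@cvg_trans _ (h^-1 *: ((f \o shift a) (h *: 1) - f a) @[h --> 0^'])); last exact: fd.
  apply: near_eq_cvg; near=> h.
  rewrite /g ifF; last by apply/negbTE; near: h; exact: nbhs_dnbhs_neq.
  by rewrite /= /GRing.scale/= mulr1.
have acv' : (fun n => a_ n - a) @ \oo --> (0 : R).
  have -> : (fun n => a_ n - a) = (fun n => (a_ n - a) / e_ n * e_ n).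
    by apply/funext => n; rewrite mulfVK.
  by rewrite -(mulr0 s); apply: cvgM.
have gcv : (fun n => g (a_ n - a)) @ \oo --> d.
  have -> : d = g 0 by rewrite /g eqxx.
  by apply: (cvg_comp (fun n => a_ n - a) g acv'); exact: gc.
have -> : (fun n => (f (a_ n) - f a) / e_ n) = (fun n => g (a_ n - a) * ((a_ n - a) / e_ n)).
  apply/funext => n; rewrite /g mulrA; congr (_ / _).
  have [/eqP|h] := eqVneq (a_ n - a) 0.
    by rewrite subr_eq0 => /eqP ->; rewrite !subrr mulr0.
  by rewrite subrK mulrAC mulVf ?mul1r.
by apply: cvgM.
Unshelve. all: end_near. Qed.

Lemma expRN_half (t : R) : expR (- t) = expR (- (t / 2)) ^+ 2.
Proof. by rewrite expr2 -expRD; congr expR; field. Qed.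

Lemma expRN_lip (a b c : R) : c <= a -> c <= b ->
  `|expR (- a) - expR (- b)| <= `|a - b| * expR (- c).
Proof.
have W (x y : R) : c <= x -> x <= y -> expR (- x) - expR (- y) <= (y - x) * expR (- c).
  move=> cx xy.
  have h1 : expR (- x) <= expR (- c) by rewrite ler_expR lerN2.
  have h2 := expR_ge1Dx (- (y - x)).
  have h3 : expR (- y) = expR (- x) * expR (- (y - x)) by rewrite -expRD; congr expR; ring.
  have h4 := expR_ge0 (- x).
  rewrite h3; nra.
move=> ca cb; have [ab|/ltW ba] := leP a b.
  rewrite ger0_norm ?subr_ge0 ?ler_expR ?lerN2// ler0_norm ?subr_le0// opprB; exact: W.
rewrite distrC ger0_norm ?subr_ge0 ?ler_expR ?lerN2// ger0_norm ?subr_ge0//; exact: W.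
Qed.

Lemma ln_lip (a b c : R) : 0 < c -> c <= a -> c <= b ->
  `|ln a - ln b| <= `|a - b| / c.
Proof.
move=> c0.
have W (x y : R) : c <= x -> x <= y -> ln y - ln x <= (y - x) / c.
  move=> cx xy; have x0 : 0 < x by exact: lt_le_trans cx.
  have y0 : 0 < y by exact: lt_le_trans xy.
  rewrite -ln_div ?posrE//.
  have h : ln (y / x) <= y / x - 1.
    have -> : y / x = 1 + (y / x - 1) by ring.
    rewrite (le_trans (le_ln1Dx _))//; first by rewrite ltrBrDl subrr divr_gt0.
    by rewrite [1 + _]addrC addrK.
  apply: (le_trans h).
  have -> : y / x - 1 = (y - x) / x by field; exact: lt0r_neq0.
  by rewrite ler_wpM2l ?subr_ge0// lef_pV2 ?posrE.
move=> ca cb; have [ab|/ltW ba] := leP a b.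
  rewrite distrC [X in _ <= X / _]distrC ger0_norm.
    by rewrite ger0_norm ?subr_ge0//; exact: W.
  by rewrite subr_ge0 ler_ln ?posrE//; exact: lt_le_trans c0 _.
rewrite ger0_norm.
  by rewrite ger0_norm ?subr_ge0//; exact: W.
by rewrite subr_ge0 ler_ln ?posrE//; exact: lt_le_trans c0 _.
Qed.

Lemma is_derive_lnr (x : R) : 0 < x -> is_derive x 1 (@ln R) x^-1.
Proof. exact: is_derive1_ln. Qed.

Lemma cvg_shift_squeeze (u v : nat -> R) (l : R) :
  v @ \oo --> (0 : R) -> (forall n, `|u n - l| <= v n) -> u @ \oo --> l.
Proof.
move=> v0 h; apply/cvgrPdist_lt => e e0.
have /cvgrPdist_lt/(_ e e0) := v0; apply: filterS => n.
rewrite sub0r normrN distrC => hv; apply: le_lt_trans hv.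
by rewrite (le_trans (h n))// ler_norm.
Qed.

End quotient_limits.

(** * The rescaled weight: uniform bounds and pointwise expansions *)

Section lap.
Context {R : realType} (P P1 P2 P3 P4 P5 : R -> R) (X x0 B : R).
Hypothesis dP : forall x : R, is_derive x 1 P (P1 x).
Hypothesis dP1 : forall x : R, is_derive x 1 P1 (P2 x).
Hypothesis dP2 : forall x : R, is_derive x 1 P2 (P3 x).
Hypothesis dP3 : forall x : R, is_derive x 1 P3 (P4 x).
Hypothesis dP4 : forall x : R, is_derive x 1 P4 (P5 x).
Hypothesis cP5 : continuous P5.
Hypothesis P2_gt0 : forall x, 0 < P2 x.
Hypothesis Xx0 : X < x0.
Hypothesis x00 : x0 < 0.
Hypothesis B0 : 0 < B.
Notation mu := (@lebesgue_measure R).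
Notation LT := (measurableTypeR R).
Notation breg := (@breg R P P1).

(* the rescaled Boltzmann weight, cut off to the window [X, B] *)
Definition lap (e z u : R) : R :=
  if X <= u + e * z <= B then expR (- (breg (u + e * z) u / e ^+ 2)) else 0.

Definition gs (m z : R) : R := expR (- (m * z ^+ 2)).

Lemma lap_ge0 (e z u : R) : 0 <= lap e z u.
Proof. by rewrite /lap; case: ifP => // _; exact: expR_ge0. Qed.

(** Everything is uniform in the saddle u and the scale e, so these bounds supply the dominating
    functions used later. Symmetrisation improves e to e^2 because the cubic term is odd. The lower
    bound by c keeps the integrals away from 0, where ln is not Lipschitz. *)
Lemma lap_bounds : exists m K c : R, [/\ [/\ 0 < m, 0 < K, 0 < c & c <= 1],
  (forall u, x0 <= u <= 0 -> forall z, expR (- (P2 u / 2 * z ^+ 2)) <= gs m z),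
  (forall u v, x0 <= u <= 0 -> x0 <= v <= 0 ->
     [/\ m <= P2 u, `|P2 u| <= K & `|P2 u - P2 v| <= K * `|u - v|]) &
  forall u e z : R, x0 <= u <= 0 -> 0 < e <= 1 ->
  [/\ lap e z u <= gs m z,
      `|lap e z u - expR (- (P2 u / 2 * z ^+ 2))| <= K * e * `|z| ^+ 3 * gs m z,
      `|lap e z u + lap e (- z) u - 2 * expR (- (P2 u / 2 * z ^+ 2))|
         <= K * e ^+ 2 * (1 + `|z|) ^+ 6 * gs m z &
      `|z| <= c -> c <= lap e z u]].
Proof.
have far (p r s t : R) : 0 <= p <= t -> 0 <= r <= t -> 0 <= s <= t -> `|p + r - 2 * s| <= 4 * t.
  by move=> *; rewrite ler_norml; apply/andP; split; lra.
have hX := Xx0; have hx0 := x00; have hB := B0.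
have XB : X <= B by lra.
have [m m0 [mP2 mb]] := breg_ge dP dP1 dP2 P2_gt0 XB.
have [K K0 hK] := breg_taylor dP dP1 dP2 dP3 dP4 cP5 XB.
have [Q Q0 hQ] := @cont_bounded _ P2 X B XB (fun x _ => is_derive_cvg (dP2 x)).
have sub u : x0 <= u <= 0 -> X <= u <= B by move=> /andP[? ?]; apply/andP; split; lra.
(* Distance from [x0, 0] to the complement of the window, capped at 1: the cut-off does not act
   while e |z| <= c0. *)
pose c0 := Num.min 1 (Num.min (x0 - X) B).
have c00 : 0 < c0 by rewrite !lt_min ltr01 subr_gt0 Xx0 B0.
have c01 : c0 <= 1 by rewrite ge_min lexx.
have c02 : c0 <= x0 - X by rewrite !ge_min lexx !orbT.
have c03 : c0 <= B by rewrite !ge_min lexx !orbT.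
pose Qc := Q / 2 + K.
have Qc0 : 0 < Qc by rewrite /Qc; lra.
pose c := Num.min c0 (expR (- Qc)).
have cpos : 0 < c by rewrite lt_min c00 expR_gt0.
pose K' := Q + K + (c0^-1) ^+ 3 + (2 * K + K ^+ 2 + 4 * (c0^-1) ^+ 2).
have ci0 : 0 < c0^-1 by rewrite invr_gt0.
have K'0 : 0 < K'.
  rewrite /K'; have := exprn_gt0 3 ci0; have := exprn_gt0 2 ci0; have := exprn_gt0 2 K0; lra.
have [KK' K2 k4] : [/\ K <= K', K ^+ 2 + 2 * K <= K' & 4 * c0^-1 ^+ 2 <= K'].
  by rewrite /K'; have := exprn_gt0 3 ci0; have := exprn_gt0 2 ci0; have := exprn_gt0 2 K0; split; lra.
have bnd u z : x0 <= u <= 0 -> m / 2 * z ^+ 2 <= P2 u / 2 * z ^+ 2.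
  by move=> hu; rewrite ler_wpM2r ?sqr_ge0// ler_pM2r//; exact/mP2/sub.
exists (m / 2), K', c; split.
- split=> //; first exact: divr_gt0.
  by rewrite ge_min c01.
- by move=> u hu z; rewrite /gs ler_expR lerN2; exact: bnd.
- move=> u v hu hv; split.
  + by have := mP2 u (sub _ hu); lra.
  + rewrite (le_trans (hQ u (sub _ hu)))// /K'.
    have := exprn_gt0 3 ci0; have := exprn_gt0 2 ci0; have := exprn_gt0 2 K0; lra.
  + have [h _ _ _ _] := hK v u (sub _ hv) (sub _ hu).
    by rewrite (le_trans h)// ler_wpM2r.
move=> u e z hu /andP[e0 e1].
have e20 : 0 < e ^+ 2 by exact: exprn_gt0.
pose a y := breg (u + e * y) u / e ^+ 2.
pose b := P2 u / 2 * z ^+ 2.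
have hdiff y : u + e * y - u = e * y by ring.
have az (y : R) : X <= u + e * y <= B -> m / 2 * y ^+ 2 <= a y.
  move=> hw; have := mb _ _ (sub _ hu) hw.
  by rewrite /a ler_pdivlMr// hdiff exprMn; lra.
have win (y : R) : `|y| <= c0 / e -> X <= u + e * y <= B.
  rewrite ler_pdivlMr// mulrC => h.
  have : `|e * y| <= c0 by rewrite normrM gtr0_norm.
  rewrite ler_norml => /andP[h1 h2].
  by move/andP: hu => [hu1 hu2]; apply/andP; split; lra.
(* Outside the window e |z| / c0 >= 1, so any power of it may multiply the Gaussian bound; the
   cut-off then costs no more than the Taylor remainders. *)
have nwin (y : R) : ~~ (X <= u + e * y <= B) -> 1 <= c0^-1 * (e * `|y|).
  move=> h; rewrite mulrC ler_pdivlMr// mul1r.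
  rewrite leNgt; apply: contra h => /ltW h; apply: win.
  by rewrite ler_pdivlMr// mulrC.
have b3 (y : R) : X <= u + e * y <= B -> `|a y - P2 u / 2 * y ^+ 2| <= K * e * `|y| ^+ 3.
  move=> hw; have [_ _ h _ _] := hK _ _ (sub _ hu) hw.
  have -> : a y - P2 u / 2 * y ^+ 2 =
      (breg (u + e * y) u - P2 u / 2 * (u + e * y - u) ^+ 2) / e ^+ 2.
    by rewrite /a hdiff; field; exact: lt0r_neq0.
  rewrite normrM normfV (gtr0_norm e20) ler_pdivrMr//.
  rewrite (le_trans h)// hdiff normrM exprMn (gtr0_norm e0).
  by apply/eqP/eqP; rewrite le_eqVlt; apply/orP; left; apply/eqP; ring.
have gsE : gs (m / 2) z = expR (- (m / 2 * z ^+ 2)) by [].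
have g0 : 0 < gs (m / 2) z by exact: expR_gt0.
have bg : expR (- b) <= gs (m / 2) z by rewrite ler_expR lerN2; exact: bnd.
split.
- rewrite /lap; case: ifPn => hw; last exact: ltW.
  by rewrite ler_expR lerN2; exact: az.
- rewrite /lap; case: ifPn => hw.
    rewrite (le_trans (expRN_lip (az _ hw) (bnd _ _ hu)))// ler_pM2r//.
    rewrite (le_trans (b3 _ hw))// -!mulrA ler_wpM2r//.
    by rewrite mulr_ge0 ?exprn_ge0// ltW.
  rewrite sub0r normrN ger0_norm ?expR_ge0// -[leLHS]mul1r ler_pM// ?expR_ge0//.
  have h1 := nwin _ hw.
  have h3 : 1 <= (c0^-1 * (e * `|z|)) ^+ 3 by rewrite exprn_ege1.
  apply: (le_trans h3); rewrite !exprMn mulrA ler_wpM2r ?exprn_ge0//.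
  have e3 : e ^+ 3 <= e by rewrite exprS ler_piMr ?(ltW e0)// exprn_ile1// ltW.
  apply: ler_pM => //; rewrite ?exprn_ge0 ?(ltW ci0) ?(ltW e0)//.
    rewrite /K'; have := exprn_gt0 3 ci0; have := exprn_gt0 2 ci0; have := exprn_gt0 2 K0; lra.
- have z1 : `|z| ^+ 4 <= (1 + `|z|) ^+ 6.
    rewrite (@le_trans _ _ ((1 + `|z|) ^+ 4))//.
      by rewrite lerXn2r ?nnegrE ?addr_ge0// lerDr.
    by rewrite ler_weXn2l// lerDl.
  have z2 : `|z| ^+ 6 <= (1 + `|z|) ^+ 6.
    by rewrite lerXn2r ?nnegrE ?addr_ge0// lerDr.
  have z3 : `|z| ^+ 2 <= (1 + `|z|) ^+ 6.
    rewrite (@le_trans _ _ ((1 + `|z|) ^+ 2))//.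
      by rewrite lerXn2r ?nnegrE ?addr_ge0// lerDr.
    by rewrite ler_weXn2l// lerDl.
  have zp : 0 <= (1 + `|z|) ^+ 6 by rewrite exprn_ge0 ?addr_ge0.
  have [hw|] := boolP ((X <= u + e * z <= B) && (X <= u + e * - z <= B)).
    have /andP[hw1 hw2] := hw.
    rewrite /lap hw1 hw2 -/(a z) -/(a (- z)) -/b.
    have [_ _ _ d1 _] := hK _ _ (sub _ hu) hw1.
    have [_ _ _ d2 _] := hK _ _ (sub _ hu) hw2.
    have E1 : `|a z + a (- z) - 2 * b| <= 2 * K * e ^+ 2 * `|z| ^+ 4.
      have -> : a z + a (- z) - 2 * b =
       ((breg (u + e * z) u - P2 u / 2 * (u + e * z - u) ^+ 2 - P3 u / 6 * (u + e * z - u) ^+ 3) +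
       (breg (u + e * - z) u - P2 u / 2 * (u + e * - z - u) ^+ 2 - P3 u / 6 * (u + e * - z - u) ^+ 3)) / e ^+ 2.
        by rewrite /a /b !hdiff; field; exact: lt0r_neq0.
      rewrite normrM normfV (gtr0_norm e20) ler_pdivrMr//.
      rewrite (le_trans (ler_normD _ _))//.
      rewrite (le_trans (lerD d1 d2))// !hdiff !normrM normrN (gtr0_norm e0) !exprMn.
      by apply/eqP/eqP; rewrite le_eqVlt; apply/orP; left; apply/eqP; ring.
    have E2 : `|a z - a (- z)| <= 2 * K * e * `|z| ^+ 3.
      have -> : a z - a (- z) = (a z - P2 u / 2 * z ^+ 2) - (a (- z) - P2 u / 2 * (- z) ^+ 2).
        by rewrite sqrrN; ring.
      rewrite (le_trans (ler_normB _ _))// (le_trans (lerD (b3 _ hw1) (b3 _ hw2)))// normrN.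
      by suff -> : 2 * K * e * `|z| ^+ 3 = K * e * `|z| ^+ 3 + K * e * `|z| ^+ 3 by []; ring.
    (* The square of a difference of order e, plus a difference of order e^2 because the cubic terms
       cancel in the mean (a z + a (- z)) / 2. *)
    have -> : expR (- a z) + expR (- a (- z)) - 2 * expR (- b) =
      (expR (- (a z / 2)) - expR (- (a (- z) / 2))) ^+ 2 +
      2 * (expR (- ((a z + a (- z)) / 2)) - expR (- b)).
      have e1' : expR (- a z) = expR (- (a z / 2)) ^+ 2 by rewrite expr2 -expRD; congr expR; field.
      have e2' : expR (- a (- z)) = expR (- (a (- z) / 2)) ^+ 2 by rewrite expr2 -expRD; congr expR; field.
      have e3' : expR (- ((a z + a (- z)) / 2)) = expR (- (a z / 2)) * expR (- (a (- z) / 2)).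
        by rewrite -expRD; congr expR; field.
      by rewrite e1' e2' e3'; ring.
    have A1 := az _ hw1; have A2 := az _ hw2; rewrite sqrrN in A2.
    have F1 : `|(expR (- (a z / 2)) - expR (- (a (- z) / 2))) ^+ 2| <=
        K ^+ 2 * e ^+ 2 * `|z| ^+ 6 * gs (m / 2) z.
      rewrite normrX.
      have h : `|expR (- (a z / 2)) - expR (- (a (- z) / 2))| <=
         K * e * `|z| ^+ 3 * expR (- (m / 2 * z ^+ 2 / 2)).
        have h1 : m / 2 * z ^+ 2 / 2 <= a z / 2 by rewrite ler_pM2r.
        have h2 : m / 2 * z ^+ 2 / 2 <= a (- z) / 2 by rewrite ler_pM2r.
        apply: (le_trans (expRN_lip h1 h2)).
        rewrite ler_pM2r ?expR_gt0// -mulrBl normrM [`|2^-1|]gtr0_norm ?invr_gt0//.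
        rewrite ler_pdivrMr//; suff -> : K * e * `|z| ^+ 3 * 2 = 2 * K * e * `|z| ^+ 3 by [].
        by ring.
      have -> : K ^+ 2 * e ^+ 2 * `|z| ^+ 6 * gs (m / 2) z =
         (K * e * `|z| ^+ 3 * expR (- (m / 2 * z ^+ 2 / 2))) ^+ 2.
        by rewrite gsE [expR (- (m / 2 * z ^+ 2))]expRN_half; ring.
      have h0 : 0 <= K * e * `|z| ^+ 3 * expR (- (m / 2 * z ^+ 2 / 2)).
        by rewrite mulr_ge0 ?expR_ge0// mulr_ge0 ?exprn_ge0// mulr_ge0 ?ltW.
      by rewrite lerXn2r// nnegrE.
    have F2 : `|2 * (expR (- ((a z + a (- z)) / 2)) - expR (- b))| <=
        2 * K * e ^+ 2 * `|z| ^+ 4 * gs (m / 2) z.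
      rewrite normrM (ger0_norm (_ : 0 <= 2))//.
      have h := @expRN_lip _ ((a z + a (- z)) / 2) b (m / 2 * z ^+ 2) _ (bnd u z hu).
      have {}h := h ltac:(by rewrite ler_pdivlMr// mulr_natr mulr2n lerD).
      rewrite (le_trans (ler_wpM2l _ h))// mulrA ler_pM2r//.
      have -> : (a z + a (- z)) / 2 - b = (a z + a (- z) - 2 * b) / 2 by field.
      by rewrite normrM (ger0_norm (_ : 0 <= 2^-1)) ?invr_ge0// mulrC divfK.
    rewrite (le_trans (ler_normD _ _))// (le_trans (lerD F1 F2))//.
    rewrite -mulrDl ler_pM2r//.
    have k2 : 0 <= K ^+ 2 by exact: sqr_ge0.
    have h1 : K ^+ 2 * e ^+ 2 * `|z| ^+ 6 <= K ^+ 2 * e ^+ 2 * (1 + `|z|) ^+ 6.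
      by rewrite ler_wpM2l// mulr_ge0 ?sqr_ge0.
    have h2 : 2 * K * e ^+ 2 * `|z| ^+ 4 <= 2 * K * e ^+ 2 * (1 + `|z|) ^+ 6.
      by rewrite ler_wpM2l// !mulr_ge0 ?sqr_ge0 ?ltW.
    have h3 : (K ^+ 2 + 2 * K) * (e ^+ 2 * (1 + `|z|) ^+ 6) <= K' * (e ^+ 2 * (1 + `|z|) ^+ 6).
      by apply: ler_wpM2r => //; rewrite mulr_ge0 ?sqr_ge0.
    rewrite (le_trans (lerD h1 h2))// -[leRHS]mulrA (le_trans _ h3)//.
    by rewrite -(mulrA (K ^+ 2)) -(mulrA (2 * K)) -mulrDl.
  rewrite negb_and => hw.
  have h1 : 1 <= c0^-1 * (e * `|z|).
    by case/orP: hw => /nwin; rewrite ?normrN.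
  have h2 : 1 <= (c0^-1 * (e * `|z|)) ^+ 2 by rewrite exprn_ege1.
  have l1 : lap e z u <= gs (m / 2) z.
    rewrite /lap; case: ifPn => hw'; last exact: ltW.
    by rewrite ler_expR lerN2; exact: az.
  have l2 : lap e (- z) u <= gs (m / 2) z.
    rewrite /lap; case: ifPn => hw'; last exact: ltW.
    by rewrite ler_expR lerN2; have := az _ hw'; rewrite sqrrN.
  apply: (@le_trans _ _ (4 * gs (m / 2) z)).
    by apply: far; rewrite ?lap_ge0 ?expR_ge0.
  rewrite ler_pM2r//.
  apply: (@le_trans _ _ (4 * (c0^-1 * (e * `|z|)) ^+ 2)); first by rewrite ler_peMr.
  rewrite !exprMn.
  have -> : 4 * (c0^-1 ^+ 2 * (e ^+ 2 * `|z| ^+ 2)) =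
     (4 * c0^-1 ^+ 2) * (e ^+ 2 * `|z| ^+ 2) by rewrite mulrA.
  have n1 : 0 <= 4 * c0^-1 ^+ 2 by rewrite mulr_ge0// sqr_ge0.
  have n2 : 0 <= e ^+ 2 * `|z| ^+ 2 by rewrite mulr_ge0// sqr_ge0.
  have n3 : e ^+ 2 * `|z| ^+ 2 <= e ^+ 2 * (1 + `|z|) ^+ 6 by rewrite ler_wpM2l ?sqr_ge0.
  by rewrite -[leRHS]mulrA; exact: ler_pM.
move=> zc.
have zc0 : `|z| <= c0 by rewrite (le_trans zc)// ge_min lexx.
have z1 : `|z| <= 1 by exact: le_trans c01.
have hw : X <= u + e * z <= B.
  by apply: win; rewrite (le_trans zc0)// ler_pdivlMr// ler_piMr// ltW.
rewrite /lap hw -/(a z).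
apply: (@le_trans _ _ (expR (- Qc))); first by rewrite ge_min lexx orbT.
rewrite ler_expR lerN2.
have := b3 _ hw; rewrite ler_norml => /andP[_ h].
have h4 : `|z| ^+ 3 <= 1 by rewrite exprn_ile1.
have h5 : z ^+ 2 <= 1 by rewrite -(real_normK (num_real z)) exprn_ile1.
have h6 : P2 u <= Q by rewrite (le_trans (ler_norm _))//; exact/hQ/sub.
have h7 : P2 u / 2 * z ^+ 2 <= Q / 2.
  have n1 : 0 <= P2 u / 2 by rewrite divr_ge0// ltW.
  have n2 : P2 u / 2 <= Q / 2 by rewrite ler_pM2r.
  by rewrite -[leRHS]mulr1; apply: ler_pM => //; exact: sqr_ge0.
have h8 : K * e * `|z| ^+ 3 <= K.
  have n1 : e * `|z| ^+ 3 <= 1 by rewrite mulr_ile1 ?exprn_ge0 ?(ltW e0).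
  by rewrite -mulrA ler_piMr// ltW.
rewrite /Qc; lra.
Qed.

Variable e_ : nat -> R.
Hypothesis e_01 : forall n, 0 < e_ n <= 1.
Hypothesis e_cvg : e_ @ \oo --> (0 : R).

Let e_neq0 n : e_ n != 0.
Proof. by apply: lt0r_neq0; have /andP[] := e_01 n. Qed.

Let e_gt0 n : 0 < e_ n.
Proof. by have /andP[] := e_01 n. Qed.

Lemma near_window (u_ : nat -> R) (u z : R) : x0 <= u <= 0 -> u_ @ \oo --> u ->
  \forall n \near \oo, X <= u_ n + e_ n * z <= B.
Proof.
move=> hu ucv.
have cv : (fun n => u_ n + e_ n * z) @ \oo --> u.
  rewrite -[X in _ --> X]addr0 -(mul0r z); apply: cvgD => //.
  by apply: cvgM => //; exact: cvg_cst.
have hX := Xx0; have hx0 := x00; have hB := B0.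
have h1 : 0 < u - X by lra.
have h2 : 0 < B - u by lra.
have /cvgrPdist_lt/(_ _ h1) := cv; have /cvgrPdist_lt/(_ _ h2) := cv.
apply: filterS2 => n; rewrite !ltr_norml => /andP[? ?] /andP[? ?].
by apply/andP; split; lra.
Qed.

Lemma near_x0 (x : R) : x <= 0 -> \forall n \near \oo, x0 <= e_ n * x <= 0.
Proof.
move=> xle.
have cv : (fun n => e_ n * x) @ \oo --> (0 : R).
  by rewrite -(mul0r x); apply: cvgM => //; exact: cvg_cst.
have hx0 : 0 < - x0 by rewrite oppr_gt0 x00.
have /cvgrPdist_lt/(_ _ hx0) := cv.
apply: filterS => n; rewrite sub0r normrN ltr_norml opprK => /andP[h1 _].
by rewrite ltW//= mulr_ge0_le0// ltW.
Qed.

Lemma cvg_e_mul (x : R) : (fun n => e_ n * x) @ \oo --> (0 : R).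
Proof. by rewrite -(mul0r x); apply: cvgM => //; exact: cvg_cst. Qed.

(** The saddle e x stays within a multiple of e from the wall. The term in z^2 is the change of P2
    between the saddle and 0, that in z^3 the cubic Taylor term. *)
Lemma lap_cvg1 (x z : R) : x <= 0 -> P2 0 = 2 ->
  (fun n => (lap (e_ n) z (e_ n * x) - expR (- z ^+ 2)) / e_ n) @ \oo -->
  - (x * P3 0 / 2 * z ^+ 2 + P3 0 / 6 * z ^+ 3) * expR (- z ^+ 2).
Proof.
move=> xle P20.
have hX := Xx0; have hx0 := x00; have hB := B0.
have XB : X <= B by lra.
have [K K0 hK] := breg_taylor dP dP1 dP2 dP3 dP4 cP5 XB.
pose a n := breg (e_ n * x + e_ n * z) (e_ n * x) / e_ n ^+ 2.
have P2q : (fun n => (P2 (e_ n * x) - P2 0) / e_ n) @ \oo --> P3 0 * x.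
  apply: chain_quot => //.
  under eq_fun => n do rewrite subr0 mulrAC divff// mul1r.
  exact: cvg_cst.
have P3c : (fun n => P3 (e_ n * x)) @ \oo --> P3 0.
  apply: (cvg_comp _ _ (cvg_e_mul x)); exact: is_derive_cvg.
have h0 : (x0 <= 0) && ((0 : R) <= 0) by rewrite (ltW hx0) lexx.
have nw := near_window z h0 (cvg_e_mul x).
have nx := near_x0 xle.
have acv : (fun n => (a n - z ^+ 2) / e_ n) @ \oo --> x * P3 0 / 2 * z ^+ 2 + P3 0 / 6 * z ^+ 3.
  pose s n := (P2 (e_ n * x) - P2 0) / e_ n * (z ^+ 2 / 2) + P3 (e_ n * x) * (z ^+ 3 / 6).
  have scv : s @ \oo --> x * P3 0 / 2 * z ^+ 2 + P3 0 / 6 * z ^+ 3.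
    have -> : x * P3 0 / 2 * z ^+ 2 + P3 0 / 6 * z ^+ 3 = P3 0 * x * (z ^+ 2 / 2) + P3 0 * (z ^+ 3 / 6) by field.
    by apply: cvgD; apply: cvgM => //; exact: cvg_cst.
  have -> : (fun n => (a n - z ^+ 2) / e_ n) = (fun n => s n + ((a n - z ^+ 2) / e_ n - s n)).
    by apply/funext => n; ring.
  rewrite -[X in _ --> X]addr0; apply: cvgD => //.
  have bcv : (fun n => e_ n * (K * `|z| ^+ 4)) @ \oo --> (0 : R) by exact: cvg_e_mul.
  have bcvN : (fun n => - (e_ n * (K * `|z| ^+ 4))) @ \oo --> (0 : R) by rewrite -oppr0; exact: cvgN.
  apply: (squeeze_cvgr _ bcvN bcv); near=> n.
  rewrite -ler_norml.
  have w1 : X <= e_ n * x <= B.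
    have /andP[] : x0 <= e_ n * x <= 0 by near: n.
    by move=> ? ?; apply/andP; split; lra.
  have w2 : X <= e_ n * x + e_ n * z <= B by near: n.
  have [_ _ _ h _] := hK _ _ w1 w2.
  have ez : e_ n * x + e_ n * z - e_ n * x = e_ n * z by ring.
  rewrite ez in h.
  have -> : (a n - z ^+ 2) / e_ n - s n =
    (breg (e_ n * x + e_ n * z) (e_ n * x) - P2 (e_ n * x) / 2 * (e_ n * z) ^+ 2
      - P3 (e_ n * x) / 6 * (e_ n * z) ^+ 3) / e_ n ^+ 3.
    by rewrite /a /s P20; field; exact: e_neq0.
  rewrite normrM normfV [`|e_ n ^+ 3|]gtr0_norm ?exprn_gt0// ler_pdivrMr ?exprn_gt0//.
  rewrite (le_trans h)// normrM (gtr0_norm (e_gt0 n)) exprMn.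
  by rewrite le_eqVlt; apply/orP; left; apply/eqP; ring.
have ex : is_derive (z ^+ 2) 1 (fun t : R => expR (- t)) (- expR (- z ^+ 2)).
  by apply: is_derive_eq; rewrite /GRing.scale/=; ring.
have := chain_quot ex e_neq0 e_cvg acv.
rewrite mulNr -mulrN mulrC; apply: cvg_trans; apply: near_eq_cvg; near=> n.
by rewrite /lap ifT//; near: n.
Unshelve. all: end_near. Qed.

(** At order e the contributions of z and - z cancel. At order e^2 the cubic Taylor term enters
    squared, giving z^6, and the quartic one linearly. *)
Lemma lap_cvg2 (u z : R) : x0 <= u <= 0 ->
  (fun n => (lap (e_ n) z u + lap (e_ n) (- z) u - 2 * expR (- (P2 u / 2 * z ^+ 2)))
     / e_ n ^+ 2) @ \oo -->
  (P3 u ^+ 2 / 36 * z ^+ 6 - P4 u / 12 * z ^+ 4) * expR (- (P2 u / 2 * z ^+ 2)).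
Proof.
move=> hu.
have hX := Xx0; have hx0 := x00; have hB := B0.
have XB : X <= B by lra.
have [K K0 hK] := breg_taylor dP dP1 dP2 dP3 dP4 cP5 XB.
pose a y n := breg (u + e_ n * y) u / e_ n ^+ 2.
pose b := P2 u / 2 * z ^+ 2.
have w1 : X <= u <= B by case/andP: hu => ? ?; apply/andP; split; lra.
have nw y : \forall n \near \oo, X <= u + e_ n * y <= B.
  have cu : (fun _ : nat => u) @ \oo --> u by exact: cvg_cst.
  exact: near_window hu cu.
have A1 y : (fun n => (a y n - P2 u / 2 * y ^+ 2) / e_ n) @ \oo --> P3 u / 6 * y ^+ 3.
  have bcv : (fun n => P3 u / 6 * y ^+ 3 + e_ n * (K * `|y| ^+ 4)) @ \oo --> P3 u / 6 * y ^+ 3.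
    rewrite -[X in _ --> X]addr0; apply: cvgD; [exact: cvg_cst|exact: cvg_e_mul].
  have bcvN : (fun n => P3 u / 6 * y ^+ 3 - e_ n * (K * `|y| ^+ 4)) @ \oo --> P3 u / 6 * y ^+ 3.
    rewrite -[X in _ --> X]subr0; apply: cvgB; [exact: cvg_cst|exact: cvg_e_mul].
  apply: (squeeze_cvgr _ bcvN bcv); near=> n.
  rewrite -ler_distl.
  have w2 : X <= u + e_ n * y <= B by near: n; exact: nw.
  have [_ _ _ h _] := hK _ _ w1 w2.
  have ez : u + e_ n * y - u = e_ n * y by ring.
  rewrite ez in h.
  have -> : (a y n - P2 u / 2 * y ^+ 2) / e_ n - P3 u / 6 * y ^+ 3 =
    (breg (u + e_ n * y) u - P2 u / 2 * (e_ n * y) ^+ 2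
      - P3 u / 6 * (e_ n * y) ^+ 3) / e_ n ^+ 3.
    by rewrite /a; field; exact: e_neq0.
  rewrite normrM normfV [`|e_ n ^+ 3|]gtr0_norm ?exprn_gt0// ler_pdivrMr ?exprn_gt0//.
  rewrite (le_trans h)// normrM (gtr0_norm (e_gt0 n)) exprMn.
  by rewrite le_eqVlt; apply/orP; left; apply/eqP; ring.
have A2 : (fun n => ((a z n + a (- z) n) / 2 - b) / e_ n ^+ 2) @ \oo --> P4 u / 24 * z ^+ 4.
  have bcv : (fun n => P4 u / 24 * z ^+ 4 + e_ n * (K * `|z| ^+ 5)) @ \oo --> P4 u / 24 * z ^+ 4.
    rewrite -[X in _ --> X]addr0; apply: cvgD; [exact: cvg_cst|exact: cvg_e_mul].
  have bcvN : (fun n => P4 u / 24 * z ^+ 4 - e_ n * (K * `|z| ^+ 5)) @ \oo --> P4 u / 24 * z ^+ 4.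
    rewrite -[X in _ --> X]subr0; apply: cvgB; [exact: cvg_cst|exact: cvg_e_mul].
  apply: (squeeze_cvgr _ bcvN bcv); near=> n.
  rewrite -ler_distl.
  have w2 : X <= u + e_ n * z <= B by near: n; exact: nw.
  have w3 : X <= u + e_ n * (- z) <= B by near: n; exact: nw.
  have [_ _ _ _ h] := hK _ _ w1 w2.
  have [_ _ _ _ h'] := hK _ _ w1 w3.
  have ez : u + e_ n * z - u = e_ n * z by ring.
  have ez' : u + e_ n * (- z) - u = - (e_ n * z) by ring.
  rewrite ez in h; rewrite ez' in h'.
  pose D1 := (breg (u + e_ n * z) u - P2 u / 2 * (e_ n * z) ^+ 2
      - P3 u / 6 * (e_ n * z) ^+ 3 - P4 u / 24 * (e_ n * z) ^+ 4).
  pose D2 := (breg (u + e_ n * (- z)) u - P2 u / 2 * (- (e_ n * z)) ^+ 2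
      - P3 u / 6 * (- (e_ n * z)) ^+ 3 - P4 u / 24 * (- (e_ n * z)) ^+ 4).
  have -> : ((a z n + a (- z) n) / 2 - b) / e_ n ^+ 2 - P4 u / 24 * z ^+ 4 =
    (D1 + D2) / 2 / e_ n ^+ 4.
    by rewrite /D1 /D2 /a /b; field; exact: e_neq0.
  rewrite normrM normfV [`|e_ n ^+ 4|]gtr0_norm ?exprn_gt0// ler_pdivrMr ?exprn_gt0//.
  rewrite normrM [`|2^-1|]gtr0_norm ?invr_gt0// ler_pdivrMr//.
  rewrite (le_trans (ler_normD _ _))// (le_trans (lerD h h'))// normrN normrM (gtr0_norm (e_gt0 n)) exprMn.
  by rewrite le_eqVlt; apply/orP; left; apply/eqP; ring.
have ex (t : R) : is_derive t 1 (fun t : R => expR (- t)) (- expR (- t)).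
  by apply: is_derive_eq; rewrite /GRing.scale/=; ring.
have H y : (fun n => (a y n / 2 - P2 u / 2 * y ^+ 2 / 2) / e_ n) @ \oo --> P3 u / 12 * y ^+ 3.
  have -> : P3 u / 12 * y ^+ 3 = P3 u / 6 * y ^+ 3 * 2^-1 by field.
  have -> : (fun n => (a y n / 2 - P2 u / 2 * y ^+ 2 / 2) / e_ n) =
      (fun n => (a y n - P2 u / 2 * y ^+ 2) / e_ n * 2^-1).
    by apply/funext => n; field; exact: e_neq0.
  by apply: cvgM; [exact: A1|exact: cvg_cst].
have B1 := chain_quot (ex _) e_neq0 e_cvg (H z).
have B2 := chain_quot (ex _) e_neq0 e_cvg (H (- z)).
rewrite sqrrN in B2.
have e20 n : e_ n ^+ 2 != 0 by rewrite expf_neq0.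
have e2cv : (fun n => e_ n ^+ 2) @ \oo --> (0 : R).
  by under eq_fun do rewrite expr2; rewrite -(mul0r (0 : R)); apply: cvgM.
have B3 := chain_quot (ex b) e20 e2cv A2.
set s := P3 u / 12 in B1 B2 H.
pose c2 := expR (- (P2 u / 2 * z ^+ 2 / 2)).
pose q1 n := (expR (- (a z n / 2)) - c2) / e_ n.
pose q2 n := (expR (- (a (- z) n / 2)) - c2) / e_ n.
pose q3 n := (expR (- ((a z n + a (- z) n) / 2)) - expR (- b)) / e_ n ^+ 2.
have E : (P3 u ^+ 2 / 36 * z ^+ 6 - P4 u / 12 * z ^+ 4) * expR (- (P2 u / 2 * z ^+ 2)) =
   (- c2 * (s * z ^+ 3) - - c2 * (s * (- z) ^+ 3)) *
   (- c2 * (s * z ^+ 3) - - c2 * (s * (- z) ^+ 3)) +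
   2 * (- expR (- b) * (P4 u / 24 * z ^+ 4)).
  by rewrite /b [expR (- (P2 u / 2 * z ^+ 2))]expRN_half -/c2 /s; field.
have T : (fun n => (q1 n - q2 n) * (q1 n - q2 n) + 2 * q3 n) @ \oo -->
    (P3 u ^+ 2 / 36 * z ^+ 6 - P4 u / 12 * z ^+ 4) * expR (- (P2 u / 2 * z ^+ 2)).
  rewrite E; apply: cvgD; apply: cvgM.
  - by apply: cvgB; [exact: B1|exact: B2].
  - by apply: cvgB; [exact: B1|exact: B2].
  - exact: cvg_cst.
  - exact: B3.
move: T; apply: cvg_trans; apply: near_eq_cvg; near=> n.
have w2 : X <= u + e_ n * z <= B by near: n; exact: nw.
have w3 : X <= u + e_ n * (- z) <= B by near: n; exact: nw.
rewrite /lap w2 w3 -/(a z n) -/(a (- z) n) -/b.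
have e3' : expR (- ((a z n + a (- z) n) / 2)) = expR (- (a z n / 2)) * expR (- (a (- z) n / 2)).
  by rewrite -expRD; congr expR; field.
by rewrite /q1 /q2 /q3 [expR (- a z n)]expRN_half [expR (- a (- z) n)]expRN_half /= e3'; field; exact: e_neq0.
Unshelve. all: end_near. Qed.

End lap.

(** * Tilted Gaussians on the half-line *)

Section half_line.
Context {R : realType}.
Notation mu := (@lebesgue_measure R).
Notation LT := (measurableTypeR R).

Lemma intg_expR_neg (c : R) : 0 < c ->
  mu.-integrable `]-oo, 0] (EFin \o (fun z : R => expR (c * z))) /\
  \int[mu]_(z in `]-oo, 0]) expR (c * z) = c^-1.
Proof.
move=> c0; have [i1 e1] := intg_expR c0.
have mD : measurable (`[0, +oo[%classic : set LT) by [].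
have [i2 e2] := Rintegral_opp mD i1.
have E : -%R @^-1` `[0, +oo[ = `]-oo, 0]%classic :> set LT.
  by apply/seteqP; split => z /=; rewrite !in_itv/= andbT lerNr oppr0.
rewrite E in i2 e2; split.
  by apply: (eq_intg _ _ i2) => // z _ /=; rewrite mulrN opprK.
rewrite -e1 e2; apply: eq_Rintegral => z _; by rewrite mulrN opprK.
Qed.

Lemma exp_pow_bound (m : R) (k : nat) : 0 < m -> exists2 A : R, 0 < A &
  forall x z : R, 0 <= x -> z <= 0 ->
  `|z| ^+ k * (expR (2 * x * z) * gs m z) <= A / (1 + x) ^+ k * expR ((1 + x) / 2 * z).
Proof.
(* A0 is the maximum of e^(-z - m z^2). It provides the decay e^z when x = 0; half of the resulting
   decay e^((1 + x) z) is then spent on |z|^k. *)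
move=> m0; pose A0 := expR (4 * m)^-1.
have A00 : 0 < A0 by exact: expR_gt0.
have k0 : (0 : R) < (2 * k.+1%:R) by rewrite mulr_gt0.
exists (A0 * (2 * k.+1%:R) ^+ k); first by rewrite mulr_gt0 ?exprn_gt0.
move=> x z x0 z0; have s0 : 0 < 1 + x by lra.
have h1 : expR (2 * x * z) * gs m z <= A0 * expR ((1 + x) * z).
  rewrite /gs -!expRD ler_expR.
  have h : - z - m * z ^+ 2 <= (4 * m)^-1.
    have -> : - z - m * z ^+ 2 = (4 * m)^-1 - m * (z + (2 * m)^-1) ^+ 2.
      by field; exact: lt0r_neq0.
    by rewrite lerBlDr lerDl mulr_ge0 ?sqr_ge0 ?ltW.
  by nra.
have h2 : `|z| ^+ k <= (2 * k.+1%:R) ^+ k / (1 + x) ^+ k * expR (- ((1 + x) / 2 * z)).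
  rewrite -expr_div_n -[expR _](mulVKf (_ : (1 + x) ^+ k != 0)); last first.
    by rewrite expf_neq0// lt0r_neq0.
  have : ((1 + x) * `|z| / (2 * k.+1%:R)) ^+ k <= expR (- ((1 + x) / 2 * z)).
    have : (1 + x) * `|z| / (2 * k.+1%:R) <= expR ((1 + x) * `|z| / (2 * k.+1%:R)).
      by rewrite (le_trans _ (expR_ge1Dx _))// lerDr.
    move=> /(lerXn2r k) -/(_ _ _)/le_trans; apply.
    - by rewrite nnegrE divr_ge0 ?mulr_ge0 ?(ltW s0) ?(ltW k0).
    - by rewrite nnegrE expR_ge0.
    rewrite -expRM_natl ler_expR ler0_norm//.
    pose t := (1 + x) * - z.
    have t0 : 0 <= t by rewrite mulr_ge0 ?(ltW s0)// oppr_ge0.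
    have -> : - ((1 + x) / 2 * z) = t / 2 by rewrite /t; field.
    have kk0 : (0 : R) < k.+1%:R by [].
    have -> : k%:R * ((1 + x) * - z / (2 * k.+1%:R)) = (k%:R / k.+1%:R) * (t / 2).
      by rewrite /t; field; rewrite lt0r_neq0.
    by rewrite ler_piMl ?divr_ge0// ler_pdivrMr// mul1r ler_nat.
  rewrite mulVKf ?expf_neq0 ?lt0r_neq0//.
  have e1 : ((1 + x) * `|z| / (2 * k.+1%:R)) ^+ k =
     (1 + x) ^+ k * `|z| ^+ k / (2 * k.+1%:R) ^+ k by rewrite expr_div_n exprMn.
  have e2 : (2 * k.+1%:R / (1 + x)) ^+ k = (2 * k.+1%:R) ^+ k / (1 + x) ^+ k by rewrite expr_div_n.
  have s0k := exprn_gt0 k s0; have k0k := exprn_gt0 k k0.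
  rewrite e1 e2 ler_pdivrMr// => h.
  by rewrite mulrAC ler_pdivlMr// mulrC (le_trans h)// mulrC.
have g0 : 0 <= expR (2 * x * z) * gs m z by rewrite mulr_ge0 ?expR_ge0.
apply: (le_trans (ler_pM _ g0 h2 h1)); first by rewrite exprn_ge0.
have -> : expR ((1 + x) * z) = expR ((1 + x) / 2 * z) ^+ 2.
  by rewrite expr2 -expRD; congr expR; field.
rewrite expRN.
set E := expR _.
have E0 : E != 0 by rewrite lt0r_neq0// expR_gt0.
have s0k : (1 + x) ^+ k != 0 by rewrite expf_neq0// lt0r_neq0.
move: s0k; set a := (2 * _) ^+ k; set b := (1 + x) ^+ k => b0.
by rewrite le_eqVlt; apply/orP; left; apply/eqP; field; rewrite E0 b0.
Qed.

(** The tilt e^(2 x z) confines z to the scale 1 / (1 + x), so every power of z gains one such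
    factor. The Gaussian keeps the constant uniform down to x = 0. *)
Lemma exp_moment (m : R) (k : nat) : 0 < m -> exists2 C : R, 0 < C &
  forall (x : R) (f : R -> R), 0 <= x -> measurable_fun (`]-oo, 0]%classic : set LT) f ->
  (forall z, z <= 0 -> `|f z| <= `|z| ^+ k * (expR (2 * x * z) * gs m z)) ->
  mu.-integrable `]-oo, 0] (EFin \o f) /\
  `|\int[mu]_(z in `]-oo, 0]) f z| <= C / (1 + x) ^+ k.+1.
Proof.
move=> m0; have [A A0 hA] := exp_pow_bound k m0.
exists (2 * A); first by rewrite mulr_gt0.
move=> x f x0 mf hf; have s0 : 0 < (1 + x) / 2 by lra.
have [ie ee] := intg_expR_neg s0.
have mD : measurable (`]-oo, 0]%classic : set LT) by [].
have ig := intgZ (A / (1 + x) ^+ k) mD ie.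
have le z : `]-oo, (0 : R)]%classic z -> `|f z| <= A / (1 + x) ^+ k * expR ((1 + x) / 2 * z).
  by rewrite /= in_itv/= => z0; rewrite (le_trans (hf z z0))// hA.
have fi := intg_le mD mf ig le.
split=> //; apply: (le_trans (normr_Rintegral_le mD fi ig le)).
rewrite RintegralZl// ee.
rewrite le_eqVlt; apply/orP; left; apply/eqP.
have s1 : 1 + x != 0 by rewrite lt0r_neq0//; lra.
by rewrite exprS; field; rewrite expf_neq0.
Qed.

(** Completing the square and translating by x; this is how e^(x^2) erfc(x) enters the outer
    problem. *)
Lemma gtail_shift (x : R) :
  mu.-integrable `]-oo, 0] (EFin \o (fun z : R => expR (2 * x * z) * expR (- z ^+ 2))) /\
  \int[mu]_(z in `]-oo, 0]) (expR (2 * x * z) * expR (- z ^+ 2)) = expR (x ^+ 2) * gtail x.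
Proof.
have mD : measurable (`]-oo, - x]%classic : set LT) by [].
have mD0 : measurable (`]-oo, 0]%classic : set LT) by [].
have i0 := @intg_gauss1 R _ mD.
have E : affine (- x) 1 @^-1` `]-oo, - x] = `]-oo, 0]%classic :> set LT.
  by apply/seteqP; split => z /=; rewrite /affine !in_itv/= mul1r gerDl.
have i1 := intg_affine (- x) ltr01 mD i0.
have e1 := Rintegral_affine (- x) ltr01 mD i0.
rewrite E in i1 e1; rewrite mul1r gtail_opp in e1.
have pt (z : R) : expR (x ^+ 2) * expR (- (affine (- x) 1 z) ^+ 2) = expR (2 * x * z) * expR (- z ^+ 2).
  by rewrite -!expRD; congr expR; rewrite /affine; ring.
split.
  apply: (eq_intg mD0 _ (intgZ (expR (x ^+ 2)) mD0 i1)) => z _; exact: pt.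
rewrite e1 -(RintegralZl _ mD0 i1); apply: eq_Rintegral => z _; exact/esym/pt.
Qed.

Lemma intg_inv_sqr (a : R) : 0 < a ->
  mu.-integrable `[a, +oo[ (EFin \o (fun x : R => (x ^+ 2)^-1)) /\
  \int[mu]_(x in `[a, +oo[) (x ^+ 2)^-1 = a^-1.
Proof.
move=> a0.
have cf (x : R) : a <= x -> {for x, continuous (fun x : R => (x ^+ 2)^-1)}.
  move=> ax; apply: cvgV; last exact: exprn_continuous.
  by rewrite expf_neq0// lt0r_neq0// (lt_le_trans a0).
have dF (x : R) : a <= x -> is_derive x 1 (fun x : R => - x^-1) (x ^+ 2)^-1.
  move=> ax; have x0 : x != 0 by rewrite lt0r_neq0// (lt_le_trans a0).
  have h : is_derive x 1 (@GRing.inv R) (- (x ^+ 2)^-1).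
    by apply: (is_derive_eq (is_deriveV x0 (is_derive_id _ (1 : R)))); rewrite /GRing.scale/= mulr1.
  by apply: (is_derive_eq (is_deriveN h)); rewrite opprK.
have cF : (- x^-1 : R) @[x --> +oo] --> (0 : R).
  rewrite -oppr0; apply: cvgN; apply/gtr0_cvgV0; first by near=> x; near: x; exact: nbhs_pinfty_gt.
  exact: cvg_id.
have [i e] : mu.-integrable `[a, +oo[ (EFin \o (fun x : R => (x ^+ 2)^-1)) /\
   (\int[mu]_(x in `[a, +oo[) ((x ^+ 2)^-1)%:E = (0 - - a^-1)%:E)%E.
  have e : (\int[mu]_(x in `[a, +oo[) ((x ^+ 2)^-1)%:E = 0%:E - (- a^-1)%:E)%E.
    apply: (@ge0_continuous_FTC2y R (fun x : R => (x ^+ 2)^-1) (fun x : R => - x^-1) a 0) => //.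
    - by move=> x _; rewrite invr_ge0 sqr_ge0.
    - by apply: continuous_in_subspaceT => x; rewrite inE/= in_itv/= andbT; exact: cf.
    - by move=> x /ltW /dF [].
    - by apply: cvg_at_right_filter; apply: (is_derive_cvg (dF a _)).
    - by move=> x; rewrite in_itv/= andbT => /ltW /dF [_ <-]; rewrite derive1E.
  split => //; apply/integrableP; split.
    apply/measurable_EFinP; apply: subspace_continuous_measurable_fun => //.
    by apply: continuous_in_subspaceT => x; rewrite inE/= in_itv/= andbT; exact: cf.
  under eq_integral => x _ do rewrite /= ger0_norm ?invr_ge0 ?sqr_ge0//.
  by rewrite e -EFinB ltry.
by split=> //; rewrite /Rintegral e/= sub0r opprK.
Unshelve. all: end_near. Qed.

End half_line.

Section partition_integral.
Context {R : realType} (P : R -> R).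
Hypothesis cP : continuous P.
Notation mu := (@lebesgue_measure R).
Notation LT := (measurableTypeR R).

Definition gibbs (l y x : R) : R := expR (- (l * (P x - y * x))).

Lemma continuous_gibbs (l y : R) : continuous (gibbs l y).
Proof.
move=> x; apply: (@continuous_comp _ _ _ (fun x : R => - (l * (P x - y * x))) expR);
  last exact: continuous_expR.
apply: cvgN; apply: cvgM; first exact: cvg_cst.
by apply: cvgB; [exact: cP|apply: cvgM; [exact: cvg_cst|exact: cvg_id]].
Qed.

Lemma intg_gibbs (l y a b : R) : mu.-integrable `[a, b] (EFin \o gibbs l y).
Proof.
apply: continuous_compact_integrable; first exact: segment_compact.
by apply: continuous_subspaceT; exact: continuous_gibbs.
Qed.

(* log-partition function; its argument [l] plays the role of N *)
Definition lnZ (a b l y : R) : R := ln (\int[mu]_(x in `[a, b]) gibbs l y x).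

Lemma Rintegral_gt0_cont (f : R -> R) (a b : R) : a < b -> continuous f ->
  (forall x, 0 < f x) -> 0 < \int[mu]_(x in `[a, b]) f x.
Proof.
move=> ab cf f0.
have [m m0 hm] := @cont_pos_bounded R f a b (ltW ab) (fun x _ => @cf x) (fun x _ => f0 x).
have cc : mu.-integrable `[a, b] (EFin \o (fun _ : R => m)).
  apply: continuous_compact_integrable; first exact: segment_compact.
  by apply: continuous_subspaceT => z; exact: cvg_cst.
have ci : mu.-integrable `[a, b] (EFin \o f).
  apply: continuous_compact_integrable; first exact: segment_compact.
  exact: continuous_subspaceT.
apply: (@lt_le_trans _ _ (\int[mu]_(x in `[a, b]) m)).
  rewrite Rintegral_cst//= lebesgue_measure_itv/= lte_fin ab -EFinB/=.
  by rewrite mulr_gt0// subr_gt0.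
by apply: le_Rintegral => // x; rewrite /= in_itv/=; exact: hm.
Qed.

Lemma gibbs_int_gt0 (a b l y : R) : a < b -> 0 < \int[mu]_(x in `[a, b]) gibbs l y x.
Proof.
move=> ab; apply: Rintegral_gt0_cont => //; first exact: continuous_gibbs.
by move=> x; exact: expR_gt0.
Qed.

(** A change of slope multiplies the integrand by e^(l (y - y') x) with x bounded. The constant
    grows with l: the bound serves only for continuity in y. *)
Lemma lnZ_lip (a b l y y' : R) : a < b -> 0 <= l ->
  lnZ a b l y - lnZ a b l y' <= l * (`|a| + `|b|) * `|y - y'|.
Proof.
move=> ab l0; set L := `|a| + `|b|.
have h1 := gibbs_int_gt0 l y ab; have h2 := gibbs_int_gt0 l y' ab.
rewrite /lnZ -ln_div ?posrE// -[leRHS]expRK ler_ln ?posrE ?expR_gt0 ?divr_gt0//.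
rewrite ler_pdivrMr// -RintegralZl//; last exact: intg_gibbs.
apply: le_Rintegral => //; first exact: intg_gibbs.
  by apply: intgZ => //; exact: intg_gibbs.
move=> x; rewrite /= in_itv/= => /andP[ax xb].
rewrite /gibbs -expRD ler_expR.
have xL : `|x| <= L.
  rewrite /L; have := ler_norm b; have := ler_norm (- a); rewrite normrN => *.
  have := normr_ge0 a; have := normr_ge0 b => *.
  by rewrite ler_norml; apply/andP; split; lra.
have : (y - y') * x <= L * `|y - y'|.
  by rewrite (le_trans (ler_norm _))// normrM mulrC ler_wpM2r.
move=> /(ler_wpM2l l0); lra.
Qed.

Lemma continuous_lnZ (a b l : R) : a < b -> 0 <= l -> continuous (lnZ a b l).
Proof.
move=> ab l0 y; set L := l * (`|a| + `|b|).
have L0 : 0 <= L by rewrite mulr_ge0// addr_ge0.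
apply/cvgrPdist_le => e e0; near=> t.
have h : `|lnZ a b l y - lnZ a b l t| <= L * `|y - t|.
  have b1 := lnZ_lip y t ab l0; have b2 := lnZ_lip t y ab l0.
  by rewrite ler_norml; apply/andP; split; [rewrite lerNl opprB distrC; exact: b2|exact: b1].
apply: (le_trans h).
have : `|y - t| <= e / (L + 1).
  by near: t; apply: cvgr_dist_le => //; rewrite divr_gt0// ltr_wpDl.
rewrite ler_pdivlMr ?ltr_wpDl// => h'.
rewrite (le_trans _ h')// mulrC ler_wpM2l// lerDl//.
Unshelve. all: end_near. Qed.

End partition_integral.

(** * Partition integrals as integrals of the rescaled weight *)

Section lapint.
Context {R : realType} (P P1 P2 P3 P4 P5 : R -> R) (X x0 B : R).
Hypothesis dP : forall x : R, is_derive x 1 P (P1 x).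
Hypothesis dP1 : forall x : R, is_derive x 1 P1 (P2 x).
Hypothesis dP2 : forall x : R, is_derive x 1 P2 (P3 x).
Hypothesis dP3 : forall x : R, is_derive x 1 P3 (P4 x).
Hypothesis dP4 : forall x : R, is_derive x 1 P4 (P5 x).
Hypothesis cP5 : continuous P5.
Hypothesis P2_gt0 : forall x, 0 < P2 x.
Hypothesis Xx0 : X < x0.
Hypothesis x00 : x0 < 0.
Hypothesis B0 : 0 < B.
Notation mu := (@lebesgue_measure R).
Notation LT := (measurableTypeR R).

Notation breg := (breg P P1).
Notation lap := (lap P P1 X B).

Let cP : continuous P.
Proof. by move=> x; exact: is_derive_cvg. Qed.

Lemma measurable_lap (e u : R) : measurable_fun (setT : set LT) (fun z => lap e z u).
Proof.
have ma : measurable_fun (setT : set LT) (fun z : R => u + e * z).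
  by apply: measurable_funD => //; exact: measurable_funM.
apply: measurable_fun_ifT => //.
  by apply: measurable_and; exact: measurable_fun_ler.
apply: measurable_cont => z.
apply: (@continuous_comp _ _ _ (fun z : R => - (breg (u + e * z) u / e ^+ 2)) expR);
  last exact: continuous_expR.
apply: cvgN; apply: cvgM; last exact: cvg_cst.
have ca : {for z, continuous (fun z : R => u + e * z)}.
  by apply: cvgD; [exact: cvg_cst|apply: cvgM; [exact: cvg_cst|exact: cvg_id]].
rewrite /breg ; apply: cvgB.
  apply: cvgB; last exact: cvg_cst.
  by apply: (continuous_comp ca); exact: cP.
apply: cvgM; first exact: cvg_cst.
by apply: cvgB => //; exact: cvg_cst.
Qed.

Lemma lap_affine (e u d : R) (w : R -> R) : 0 < e -> d <= B -> continuous w ->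
  \int[mu]_(z in [set z | u + e * z <= d]) (w z * lap e z u) =
  e^-1 * \int[mu]_(x in `[X, d]) (w ((x - u) / e) * expR (- (breg x u / e ^+ 2))).
Proof.
move=> e0 dB cw.
have mD : measurable (`[X, d]%classic : set LT) by [].
have cf : continuous (fun x : R => w ((x - u) / e) * expR (- (breg x u / e ^+ 2))).
  move=> x; apply: cvgM.
    apply: (@continuous_comp _ _ _ (fun x : R => (x - u) / e) w); last exact: cw.
    by apply: cvgM; [apply: cvgB; [exact: cvg_id|exact: cvg_cst]|exact: cvg_cst].
  apply: (@continuous_comp _ _ _ (fun x : R => - (breg x u / e ^+ 2)) expR);
    last exact: continuous_expR.
  apply: cvgN; apply: cvgM; last exact: cvg_cst.
  apply: cvgB; first by apply: cvgB; [exact: cP|exact: cvg_cst].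
  by apply: cvgM; [exact: cvg_cst|apply: cvgB; [exact: cvg_id|exact: cvg_cst]].
have fi : mu.-integrable `[X, d] (EFin \o (fun x : R => w ((x - u) / e) * expR (- (breg x u / e ^+ 2)))).
  by apply: continuous_compact_integrable; [exact: segment_compact|exact: continuous_subspaceT].
rewrite (Rintegral_affine u e0 mD fi) mulrA mulVf ?mul1r ?lt0r_neq0//.
rewrite Rintegral_mkcond [RHS]Rintegral_mkcond; apply: eq_Rintegral => z _.
rewrite !patchE.
have m1 : (z \in [set z0 | u + e * z0 <= d]) = (u + e * z <= d) by apply/idP/idP; rewrite inE.
have m2 : (z \in affine u e @^-1` `[X, d]) = (X <= u + e * z <= d).
  by apply/idP/idP; rewrite inE/= in_itv.
rewrite m1 m2 /lap /affine; have [zd|zd] := boolP (u + e * z <= d); last by rewrite andbF.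
rewrite (le_trans zd dB) !andbT; case: ifPn => _; last by rewrite mulr0.
by congr (w _ * _); field; exact: lt0r_neq0.
Qed.

(* For N = e^-2 and slope y = P1 u, the Gibbs integral over [X, B] is Wl up to an
   explicit factor; Jl is its restriction to the half-line left of the wall x = 0,
   and Ml replaces Jl when y exceeds P1 0 by 2 e x. *)
Definition Wl (e u : R) : R := \int[mu]_z lap e z u.
Definition Jl (e u : R) : R := \int[mu]_(z in [set z | u + e * z <= 0]) lap e z u.
Definition Ml (e x : R) : R :=
  \int[mu]_(z in `]-oo, 0]) (expR (2 * x * z) * lap e z 0).

Lemma gibbs_breg (e u x : R) : e != 0 ->
  expR (- (breg x u / e ^+ 2)) =
  expR ((P u - u * P1 u) / e ^+ 2) * gibbs P (e ^+ 2)^-1 (P1 u) x.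
Proof. by move=> e0; rewrite /gibbs -expRD; congr expR; rewrite /breg; field. Qed.

Lemma lnW (e u : R) : 0 < e ->
  ln (Wl e u) = lnZ P X B (e ^+ 2)^-1 (P1 u) + (P u - u * P1 u) / e ^+ 2 - ln e.
Proof.
move=> e0; have e0' := lt0r_neq0 e0.
have hX : X < B by have h1 := Xx0; have h2 := x00; have h3 := B0; lra.
have -> : Wl e u = e^-1 * (expR ((P u - u * P1 u) / e ^+ 2) *
    \int[mu]_(x in `[X, B]) gibbs P (e ^+ 2)^-1 (P1 u) x).
  rewrite -RintegralZl//; last exact: intg_gibbs.
  have c1 : continuous (fun _ : R => 1 : R) by move=> t; exact: cvg_cst.
  have := @lap_affine e u B (fun=> 1) e0 (lexx _) c1.
  under [in X in _ = X -> _]eq_Rintegral do rewrite mul1r gibbs_breg//.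
  move=> <-; rewrite [RHS]Rintegral_mkcond; apply: eq_Rintegral => z _.
  rewrite patchE mul1r; case: ifPn => // /negP; rewrite inE/= => h.
  by rewrite /lap ifF//; apply/negbTE; apply/negP => /andP[].
have i0 := @gibbs_int_gt0 R P cP X B (e ^+ 2)^-1 (P1 u) hX.
rewrite lnM ?posrE ?invr_gt0 ?mulr_gt0 ?expR_gt0// lnV ?posrE// lnM ?posrE ?expR_gt0//.
by rewrite expRK /lnZ; ring.
Qed.

Lemma lnJ (e u : R) : 0 < e ->
  ln (Jl e u) = lnZ P X 0 (e ^+ 2)^-1 (P1 u) + (P u - u * P1 u) / e ^+ 2 - ln e.
Proof.
move=> e0; have e0' := lt0r_neq0 e0.
have hX : X < 0 by have h1 := Xx0; have h2 := x00; lra.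
have -> : Jl e u = e^-1 * (expR ((P u - u * P1 u) / e ^+ 2) *
    \int[mu]_(x in `[X, 0]) gibbs P (e ^+ 2)^-1 (P1 u) x).
  rewrite -RintegralZl//; last exact: intg_gibbs.
  have c1 : continuous (fun _ : R => 1 : R) by move=> t; exact: cvg_cst.
  have := @lap_affine e u 0 (fun=> 1) e0 (ltW B0) c1.
  under [in X in _ = X -> _]eq_Rintegral do rewrite mul1r gibbs_breg//.
  by move=> <-; apply: eq_Rintegral => z _; rewrite mul1r.
have i0 := @gibbs_int_gt0 R P cP X 0 (e ^+ 2)^-1 (P1 u) hX.
rewrite lnM ?posrE ?invr_gt0 ?mulr_gt0 ?expR_gt0// lnV ?posrE// lnM ?posrE ?expR_gt0//.
by rewrite expRK /lnZ; ring.
Qed.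

(** When the slope exceeds P1 0 the exponent is expanded at the wall instead of at the saddle. With
    s = e z the excess 2 e x contributes 2 e x s / e^2 = 2 x z, a tilt independent of e. *)
Lemma lnM_lap (e x : R) : 0 < e ->
  ln (Ml e x) = lnZ P X 0 (e ^+ 2)^-1 (P1 0 + 2 * e * x) + P 0 / e ^+ 2 - ln e.
Proof.
move=> e0; have e0' := lt0r_neq0 e0.
have hX : X < 0 by have h1 := Xx0; have h2 := x00; lra.
have -> : Ml e x = e^-1 * (expR (P 0 / e ^+ 2) *
    \int[mu]_(s in `[X, 0]) gibbs P (e ^+ 2)^-1 (P1 0 + 2 * e * x) s).
  rewrite -RintegralZl//; last exact: intg_gibbs.
  have cw : continuous (fun z : R => expR (2 * x * z)).
    move=> z; apply: (@continuous_comp _ _ _ (fun z : R => 2 * x * z) expR);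
      last exact: continuous_expR.
    by apply: cvgM; [exact: cvg_cst|exact: cvg_id].
  have := @lap_affine e 0 0 _ e0 (ltW B0) cw.
  have -> : [set z : R | 0 + e * z <= 0] = `]-oo, 0]%classic.
    by apply/seteqP; split => z /=; rewrite in_itv/= add0r pmulr_rle0.
  rewrite /Ml => ->; congr (_ * _); apply: eq_Rintegral => s _.
  rewrite gibbs_breg// /gibbs -!expRD; congr expR; field; exact: e0'.
have i0 := @gibbs_int_gt0 R P cP X 0 (e ^+ 2)^-1 (P1 0 + 2 * e * x) hX.
rewrite lnM ?posrE ?invr_gt0 ?mulr_gt0 ?expR_gt0// lnV ?posrE// lnM ?posrE ?expR_gt0//.
by rewrite expRK /lnZ; ring.
Qed.

End lapint.

(** * Saddle points inside the disk *)

Section bulk.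
Context {R : realType} (P P1 P2 P3 P4 P5 : R -> R) (X x0 B : R).
Hypothesis dP : forall x : R, is_derive x 1 P (P1 x).
Hypothesis dP1 : forall x : R, is_derive x 1 P1 (P2 x).
Hypothesis dP2 : forall x : R, is_derive x 1 P2 (P3 x).
Hypothesis dP3 : forall x : R, is_derive x 1 P3 (P4 x).
Hypothesis dP4 : forall x : R, is_derive x 1 P4 (P5 x).
Hypothesis cP5 : continuous P5.
Hypothesis P2_gt0 : forall x, 0 < P2 x.
Hypothesis Xx0 : X < x0.
Hypothesis x00 : x0 < 0.
Hypothesis B0 : 0 < B.
Notation mu := (@lebesgue_measure R).
Notation LT := (measurableTypeR R).
Notation lap := (lap P P1 X B).
Notation Wl := (Wl P P1 X B).
Notation Jl := (Jl P P1 X B).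
Notation Ml := (Ml P P1 X B).

Lemma continuous_gs (m : R) : continuous (gs m).
Proof.
have -> : gs m = (fun z : R => z ^+ 0 * expR (- (m * z ^+ 2))).
  by apply/funext => z; rewrite expr0 mul1r.
exact: continuous_mongauss.
Qed.

Lemma intg_gs_poly (m : R) (k : nat) : 0 < m ->
  mu.-integrable setT (EFin \o (fun z : R => (1 + `|z|) ^+ k * gs m z)).
Proof.
move=> m0; apply: (@intg_gauss_poly R m 1 k) => //.
  apply: measurable_cont => z; apply: cvgM; last exact: continuous_gs.
  apply: (@continuous_comp _ _ _ (fun z : R => 1 + `|z|) (fun z => z ^+ k)); last exact: exprn_continuous.
  by apply: cvgD; [exact: cvg_cst|exact: norm_continuous].
by move=> z; rewrite mul1r normrM normrX (ger0_norm (expR_ge0 _)) ger0_norm// addr_ge0.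
Qed.

Lemma lap_le_gs_poly (m : R) (k : nat) (z : R) : gs m z <= (1 + `|z|) ^+ k * gs m z.
Proof. by rewrite ler_peMl ?expR_ge0// exprn_ege1// lerDl. Qed.

(** The error e^2 comes from averaging over z and - z. The lower bounds come from [- c, 0], which
    lies left of the wall whenever u <= 0, hence serves for [Wl] and [Jl] alike. *)
Lemma W_bounds : exists2 C : R, 0 < C & forall u e : R, x0 <= u <= 0 -> 0 < e <= 1 ->
  [/\ mu.-integrable setT (EFin \o (fun z : R => lap e z u)),
      C^-1 <= Wl e u, C^-1 <= Jl e u, C^-1 <= Num.sqrt (2 * pi / P2 u) &
      `|Wl e u - Num.sqrt (2 * pi / P2 u)| <= C * e ^+ 2].
Proof.
have [m [K [c [[m0 K0 c0 c1] hg hP2 hl]]]] := lap_bounds dP dP1 dP2 dP3 dP4 cP5 P2_gt0 Xx0 x00 B0.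
pose G := \int[mu]_z ((1 + `|z|) ^+ 6 * gs m z).
have iG := intg_gs_poly 6 m0.
have G0 : 0 <= G by apply: Rintegral_ge0 => z _; rewrite mulr_ge0 ?expR_ge0// exprn_ge0// addr_ge0.
have KG0 : 0 <= K * G by rewrite mulr_ge0// ltW.
have p0 : 0 < Num.sqrt (2 * pi / K) :> R by rewrite sqrtr_gt0 divr_gt0// mulr_gt0// pi_gt0.
pose C := K * G + (c ^+ 2)^-1 + (Num.sqrt (2 * pi / K))^-1.
have ci : 0 < (c ^+ 2)^-1 by rewrite invr_gt0 exprn_gt0.
have pi0 : 0 < (Num.sqrt (2 * pi / K))^-1 by rewrite invr_gt0.
have C0 : 0 < C by rewrite /C; lra.
have Cc : C^-1 <= c ^+ 2.
  by rewrite -[leRHS]invrK lef_pV2 ?posrE//; rewrite /C; lra.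
have Cs : C^-1 <= Num.sqrt (2 * pi / K).
  by rewrite -[leRHS]invrK lef_pV2 ?posrE//; rewrite /C; lra.
exists C => // u e hu he.
have [e0 e1] := andP he.
have il : mu.-integrable setT (EFin \o (fun z : R => lap e z u)).
  have mf := measurable_lap X B dP e u.
  refine (intg_le measurableT mf iG _) => z _.
  rewrite ger0_norm ?lap_ge0//; have [h _ _ _] := hl u e z hu he.
  exact: le_trans h (lap_le_gs_poly _ _ _).
have lowD (D : set LT) : measurable D -> `[- c, 0]%classic `<=` D ->
    c ^+ 2 <= \int[mu]_(z in D) lap e z u.
  move=> mD hD.
  have mc : measurable (`[- c, 0]%classic : set LT) by [].
  have iD := intgS measurableT mD (@subsetT _ _) il.
  apply: (@le_trans _ _ (\int[mu]_(z in `[- c, 0]) lap e z u)); last first.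
    by apply: ge0_le_RintegralS => // z _; exact: lap_ge0.
  have -> : c ^+ 2 = \int[mu]_(z in `[- c, 0]) c.
    rewrite Rintegral_cst//= lebesgue_measure_itv/= lte_fin ifT ?oppr_lt0//.
    by rewrite -EFinB/=; ring.
  apply: le_Rintegral => //.
  - apply: continuous_compact_integrable; first exact: segment_compact.
    by apply: continuous_subspaceT => z; exact: cvg_cst.
  - exact: intgS mD mc hD iD.
  - move=> z; rewrite /= in_itv/= => /andP[z1 z2]; have [_ _ _] := hl u e z hu he.
    by apply; rewrite ler0_norm//; lra.
have mJ : measurable ([set z | u + e * z <= 0] : set LT).
  have -> : [set z : R | u + e * z <= 0] = `]-oo, - u / e]%classic.
    by apply/seteqP; split => z /=; rewrite in_itv/= ler_pdivlMr// mulrC; lra.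
  by [].
have P2u := P2_gt0 u.
have [mu1 mu2 _] := hP2 u u hu hu.
split => //.
- by apply: (le_trans Cc); apply: lowD.
- apply: (le_trans Cc); apply: lowD => // z /=; rewrite in_itv/= => /andP[_ z0].
  by case/andP: hu => _ u0; have := mulr_ge0_le0 (ltW e0) z0; lra.
- apply: (le_trans Cs); apply: ler_wsqrtr.
  rewrite ler_wpM2l ?mulr_ge0 ?pi_ge0// lef_pV2 ?posrE//.
  exact: le_trans (ler_norm _) mu2.
have P2u2 : 0 < P2 u / 2 by rewrite divr_gt0.
pose g z := expR (- (P2 u / 2 * z ^+ 2)).
have ig : mu.-integrable setT (EFin \o g) by exact: intg_gauss.
have eg : \int[mu]_z g z = Num.sqrt (2 * pi / P2 u).
  by rewrite gauss_total//; congr Num.sqrt; field; exact: lt0r_neq0.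
have [il' el] := Rintegral_opp measurableT il.
rewrite preimage_setT in il' el.
have E : 2 * (Wl e u - Num.sqrt (2 * pi / P2 u)) =
    \int[mu]_z (lap e z u + lap e (- z) u - 2 * g z).
  have mT := @measurableT _ LT; have i2 := intgZ 2 mT ig.
  rewrite (RintegralB mT (intgD mT il il') i2) (RintegralD mT il il') (RintegralZl 2 mT ig) eg -el -/(Wl e u).
  ring.
have iS : mu.-integrable setT (EFin \o (fun z => lap e z u + lap e (- z) u - 2 * g z)).
  by apply: intgB => //; [exact: intgD|exact: intgZ].
have bd : `|\int[mu]_z (lap e z u + lap e (- z) u - 2 * g z)| <= K * e ^+ 2 * G.
  rewrite -RintegralZl//; apply: normr_Rintegral_le => //; first exact: intgZ.
  by move=> z _; have [_ _ h _] := hl u e z hu he; rewrite mulrA.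
have : `|2 * (Wl e u - Num.sqrt (2 * pi / P2 u))| <= K * e ^+ 2 * G by rewrite E.
rewrite normrM (ger0_norm (_ : 0 <= 2))// => h.
have h1 : 0 <= K * G * e ^+ 2 by rewrite mulr_ge0 ?sqr_ge0.
have h2 : K * G * e ^+ 2 <= C * e ^+ 2 by rewrite ler_wpM2r ?sqr_ge0// /C -addrA lerDl addr_ge0 ?invr_ge0 ?sqrtr_ge0 ?sqr_ge0.
have h3 : K * e ^+ 2 * G = K * G * e ^+ 2 by rewrite mulrAC.
by rewrite (le_trans _ h2)// -h3 (le_trans _ h)// ler_peMl// ler1n.
Qed.

Variable e_ : nat -> R.
Hypothesis e_01 : forall n, 0 < e_ n <= 1.
Hypothesis e_cvg : e_ @ \oo --> (0 : R).

Let e_neq0 n : e_ n != 0.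
Proof. by apply: lt0r_neq0; have /andP[] := e_01 n. Qed.

Let e_gt0 n : 0 < e_ n.
Proof. by have /andP[] := e_01 n. Qed.

(** The second coefficient of Laplace's method, from the Gaussian moments of orders 4 and 6. *)
Lemma W_cvg2 (u : R) : x0 <= u <= 0 ->
  (fun n => (Wl (e_ n) u - Num.sqrt (2 * pi / P2 u)) / e_ n ^+ 2) @ \oo -->
  Num.sqrt (2 * pi / P2 u) * (5 * P3 u ^+ 2 / (24 * P2 u ^+ 3) - P4 u / (8 * P2 u ^+ 2)).
Proof.
move=> hu.
have [m [K [c [[m0 K0 c0 c1] hg hP2 hl]]]] := lap_bounds dP dP1 dP2 dP3 dP4 cP5 P2_gt0 Xx0 x00 B0.
have [C C0 hW] := W_bounds.
have iG := intg_gs_poly 6 m0.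
have P2u := P2_gt0 u.
have P2u2 : 0 < P2 u / 2 by rewrite divr_gt0.
pose g z := expR (- (P2 u / 2 * z ^+ 2)).
have ig : mu.-integrable setT (EFin \o g) by exact: intg_gauss.
have eg : \int[mu]_z g z = Num.sqrt (2 * pi / P2 u).
  by rewrite gauss_total//; congr Num.sqrt; field; exact: lt0r_neq0.
pose f_ n z := (lap (e_ n) z u + lap (e_ n) (- z) u - 2 * g z) / e_ n ^+ 2.
pose f z := (P3 u ^+ 2 / 36 * z ^+ 6 - P4 u / 12 * z ^+ 4) * g z.
have il n : mu.-integrable setT (EFin \o (fun z : R => lap (e_ n) z u)).
  by have [] := hW u (e_ n) hu (e_01 n).
have il' n := Rintegral_opp measurableT (il n).
rewrite preimage_setT in il'.
have iS n : mu.-integrable setT (EFin \o (fun z => lap (e_ n) z u + lap (e_ n) (- z) u - 2 * g z)).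
  by apply: intgB => //; [apply: intgD => //; exact: (il' n).1|exact: intgZ].
have mf n : measurable_fun (setT : set LT) (f_ n).
  have := intg_mfun (intgZ (e_ n ^+ 2)^-1 measurableT (iS n)).
  by rewrite /f_; under eq_fun do rewrite mulrC.
have cf z : setT z -> f_ ^~ z @ \oo --> f z.
  by move=> _; exact: (@lap_cvg2 _ _ _ _ _ _ _ _ _ _ dP dP1 dP2 dP3 dP4 cP5 Xx0 x00 B0 _ e_01 e_cvg u z hu).
have bf n z : setT z -> `|f_ n z| <= K * ((1 + `|z|) ^+ 6 * gs m z).
  move=> _; have [_ _ h _] := hl u (e_ n) z hu (e_01 n).
  have e20 : 0 < e_ n ^+ 2 by rewrite exprn_gt0.
  rewrite /f_ normrM normfV (gtr0_norm e20) ler_pdivrMr//.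
  by rewrite (le_trans h)// le_eqVlt; apply/orP; left; apply/eqP; ring.
have [fi fcv] := Rdominated measurableT mf cf (intgZ K measurableT iG) bf.
have ef : \int[mu]_z f z = 2 * (Num.sqrt (2 * pi / P2 u) * (5 * P3 u ^+ 2 / (24 * P2 u ^+ 3) - P4 u / (8 * P2 u ^+ 2))).
  have i6 := intg_mongauss 6 P2u2; have i4 := intg_mongauss 4 P2u2.
  have -> : f = fun z => P3 u ^+ 2 / 36 * (z ^+ 6 * g z) - P4 u / 12 * (z ^+ 4 * g z).
    by apply/funext => z; rewrite /f; ring.
  rewrite RintegralB//; [|exact: intgZ|exact: intgZ].
  rewrite !RintegralZl//.
  rewrite gauss_moment6// gauss_moment4//.
  have -> : pi / (P2 u / 2) = 2 * pi / P2 u by field; exact: lt0r_neq0.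
  field; exact: lt0r_neq0.
have En n : \int[mu]_z f_ n z = 2 * ((Wl (e_ n) u - Num.sqrt (2 * pi / P2 u)) / e_ n ^+ 2).
  rewrite /f_ RintegralZr//.
  rewrite RintegralB//; [|by apply: intgD => //; exact: (il' n).1|exact: intgZ].
  rewrite RintegralD//; last exact: (il' n).1.
  rewrite RintegralZl// eg -(il' n).2 -/(Wl (e_ n) u).
  by field.
have -> : Num.sqrt (2 * pi / P2 u) * (5 * P3 u ^+ 2 / (24 * P2 u ^+ 3) - P4 u / (8 * P2 u ^+ 2)) =
  2^-1 * \int[mu]_z f z by rewrite ef mulKf// pnatr_eq0.
have -> : (fun n => (Wl (e_ n) u - Num.sqrt (2 * pi / P2 u)) / e_ n ^+ 2) = (fun n => 2^-1 * \int[mu]_z f_ n z).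
  by apply/funext => n; rewrite En mulKf// pnatr_eq0.
by apply: cvgM => //; exact: cvg_cst.
Qed.

Lemma continuous_lnZ_comp (f g : R -> R) (l b c : R) : X < b -> continuous f -> continuous g ->
  continuous (fun u => lnZ P X b (l ^+ 2)^-1 (f u) + g u - c).
Proof.
move=> Xb cf cg u; have cP : continuous P by move=> x; exact: is_derive_cvg.
apply: cvgB; last exact: cvg_cst.
apply: cvgD; last exact: cg.
apply: (@continuous_comp _ _ _ f _); first exact: cf.
by apply: continuous_lnZ => //; rewrite invr_ge0 sqr_ge0.
Qed.

Let cg (e : R) : continuous (fun u => (P u - u * P1 u) / e ^+ 2).
Proof.
move=> u; apply: cvgM; last exact: cvg_cst.
apply: cvgB; first exact: is_derive_cvg.
by apply: cvgM; [exact: cvg_id|exact: is_derive_cvg].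
Qed.

Lemma continuous_lnW (e : R) : 0 < e -> continuous (fun u => ln (Wl e u)).
Proof.
move=> e0; have hX : X < B by have h1 := Xx0; have h2 := x00; have h3 := B0; lra.
have -> : (fun u => ln (Wl e u)) = (fun u => lnZ P X B (e ^+ 2)^-1 (P1 u) + (P u - u * P1 u) / e ^+ 2 - ln e).
  by apply/funext => u; exact: (lnW dP Xx0 x00 B0).
by apply: continuous_lnZ_comp => // u; exact: is_derive_cvg.
Qed.

Lemma continuous_lnJ (e : R) : 0 < e -> continuous (fun u => ln (Jl e u)).
Proof.
move=> e0; have hX : X < 0 by have h1 := Xx0; have h2 := x00; lra.
have -> : (fun u => ln (Jl e u)) = (fun u => lnZ P X 0 (e ^+ 2)^-1 (P1 u) + (P u - u * P1 u) / e ^+ 2 - ln e).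
  by apply/funext => u; exact: (lnJ dP Xx0 x00 B0).
by apply: continuous_lnZ_comp => // u; exact: is_derive_cvg.
Qed.

Lemma continuous_lnM (e : R) : 0 < e -> continuous (fun x => ln (Ml e x)).
Proof.
move=> e0; have hX : X < 0 by have h1 := Xx0; have h2 := x00; lra.
have -> : (fun u => ln (Ml e u)) = (fun u => lnZ P X 0 (e ^+ 2)^-1 (P1 0 + 2 * e * u) + P 0 / e ^+ 2 - ln e).
  by apply/funext => u; exact: (lnM_lap dP Xx0 x00 B0).
apply: continuous_lnZ_comp => // u; last exact: cvg_cst.
by apply: cvgD; [exact: cvg_cst|apply: cvgM; [exact: cvg_cst|exact: cvg_id]].
Qed.

(** The weight P2 is the Jacobian of y = P1 u. On the compact interval a constant dominates, since
    numerator and denominator are both of order e^2 uniformly in u. *)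
Theorem bulk_limit :
  (fun n => \int[mu]_(u in `[x0, 0])
     (P2 u * ((ln (Wl (e_ n) u) - ln (Num.sqrt (2 * pi / P2 u))) / e_ n ^+ 2))) @ \oo -->
  \int[mu]_(u in `[x0, 0]) (5 * P3 u ^+ 2 / (24 * P2 u ^+ 2) - P4 u / (8 * P2 u)).
Proof.
have [C C0 hW] := W_bounds.
have [m [K [c [[m0 K0 c0 c1] hg hP2 hl]]]] := lap_bounds dP dP1 dP2 dP3 dP4 cP5 P2_gt0 Xx0 x00 B0.
have mD : measurable (`[x0, 0]%classic : set LT) by [].
have cP2 : continuous P2 by move=> x; exact: is_derive_cvg.
have hX : X < B by have h1 := Xx0; have h2 := x00; have h3 := B0; lra.
apply: (@Rdominated _ LT _ mu _ _ _ (fun=> K * C ^+ 2) mD _ _ _ _).2.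
- move=> n; apply: measurable_funTS; apply: measurable_cont => u.
  apply: cvgM; first exact: cP2.
  apply: cvgM; last exact: cvg_cst.
  apply: cvgB; first exact: continuous_lnW.
  have p0 : 0 < 2 * pi / P2 u by rewrite divr_gt0// mulr_gt0// pi_gt0.
  apply: (@continuous_comp _ _ _ (fun u => Num.sqrt (2 * pi / P2 u)) (@ln R)).
    apply: (@continuous_comp _ _ _ (fun u => 2 * pi / P2 u) (@Num.sqrt R)); last exact: sqrt_continuous.
    apply: cvgM; first exact: cvg_cst.
    by apply: cvgV; [exact: lt0r_neq0|exact: cP2].
  by apply: continuous_ln; rewrite sqrtr_gt0.
- move=> u; rewrite /= in_itv/= => hu.
  have p0 : 0 < Num.sqrt (2 * pi / P2 u) by rewrite sqrtr_gt0 divr_gt0// mulr_gt0// pi_gt0.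
  have e20 n : e_ n ^+ 2 != 0 by rewrite expf_neq0.
  have e2cv : (fun n => e_ n ^+ 2) @ \oo --> (0 : R).
    by under eq_fun do rewrite expr2; rewrite -(mul0r (0 : R)); apply: cvgM.
  have := chain_quot (is_derive_lnr p0) e20 e2cv (W_cvg2 hu).
  rewrite mulrA mulVf ?lt0r_neq0// mul1r => h.
  have -> : 5 * P3 u ^+ 2 / (24 * P2 u ^+ 2) - P4 u / (8 * P2 u) =
    P2 u * (5 * P3 u ^+ 2 / (24 * P2 u ^+ 3) - P4 u / (8 * P2 u ^+ 2)).
    by field; exact: lt0r_neq0.
  by apply: cvgM => //; exact: cvg_cst.
- apply: continuous_compact_integrable; first exact: segment_compact.
  by apply: continuous_subspaceT => z; exact: cvg_cst.
- move=> n u; rewrite /= in_itv/= => hu.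
  have [_ w1 _ w2 w3] := hW u (e_ n) hu (e_01 n).
  have [_ k1 _] := hP2 u u hu hu.
  have Ci : 0 < C^-1 by rewrite invr_gt0.
  have e20 : 0 < e_ n ^+ 2 by rewrite exprn_gt0.
  have h := ln_lip Ci w1 w2.
  rewrite normrM; apply: ler_pM => //.
  rewrite normrM normfV (gtr0_norm e20) ler_pdivrMr//.
  rewrite (le_trans h)// invrK.
  by rewrite (le_trans (ler_wpM2r (ltW C0) w3))// le_eqVlt; apply/orP; left; apply/eqP; ring.
Qed.

End bulk.

(** * The boundary layer left of the wall *)

Section inside.
Context {R : realType} (P P1 P2 P3 P4 P5 : R -> R) (X x0 B : R).
Hypothesis dP : forall x : R, is_derive x 1 P (P1 x).
Hypothesis dP1 : forall x : R, is_derive x 1 P1 (P2 x).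
Hypothesis dP2 : forall x : R, is_derive x 1 P2 (P3 x).
Hypothesis dP3 : forall x : R, is_derive x 1 P3 (P4 x).
Hypothesis dP4 : forall x : R, is_derive x 1 P4 (P5 x).
Hypothesis cP5 : continuous P5.
Hypothesis P2_gt0 : forall x, 0 < P2 x.
Hypothesis P20 : P2 0 = 2.
Hypothesis Xx0 : X < x0.
Hypothesis x00 : x0 < 0.
Hypothesis B0 : 0 < B.
Notation mu := (@lebesgue_measure R).
Notation LT := (measurableTypeR R).
Notation lap := (lap P P1 X B).
Notation Wl := (Wl P P1 X B).
Notation Jl := (Jl P P1 X B).

Lemma intg_split (f : R -> R) (a : R) : mu.-integrable setT (EFin \o f) ->
  \int[mu]_z f z = \int[mu]_(z in `]-oo, a]) f z + \int[mu]_(z in `]a, +oo[) f z.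
Proof.
rewrite -set_itvNyy => fi.
have := @Rintegral_itvB R f -oo%O +oo%O a fi isT isT.
by move=> /eqP; rewrite subr_eq addrC => /eqP.
Qed.

Lemma ln_ratio (c j w j0 w0 : R) : 0 < c -> c <= j -> c <= w -> c <= j0 -> c <= w0 ->
  `|ln j - ln w - (ln j0 - ln w0)| <=
  (`|w0 - j0| * `|w - w0| + w0 * `|w - j - (w0 - j0)|) / c ^+ 2.
Proof.
move=> c0 hj hw hj0 hw0.
have [pj pw pj0 pw0] : [/\ 0 < j, 0 < w, 0 < j0 & 0 < w0] by split; apply: lt_le_trans; eauto.
have -> : ln j - ln w - (ln j0 - ln w0) = ln (j * w0) - ln (j0 * w).
  by rewrite !lnM ?posrE//; ring.
have c20 : 0 < c ^+ 2 by rewrite exprn_gt0.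
have h1 : c ^+ 2 <= j * w0 by rewrite expr2 ler_pM// ltW.
have h2 : c ^+ 2 <= j0 * w by rewrite expr2 ler_pM// ltW.
rewrite (le_trans (ln_lip c20 h1 h2))// ler_pM2r ?invr_gt0//.
have -> : j * w0 - j0 * w = (w0 - j0) * (w - w0) - w0 * (w - j - (w0 - j0)) by ring.
by rewrite (le_trans (ler_normB _ _))// !normrM (gtr0_norm pw0).
Qed.

(** The Gaussian is frozen at the wall, where P2 0 / 2 = 1; replacing P2 (e x) by P2 0 costs the
    factor |x|. *)
Lemma lap_gauss : exists m K : R, [/\ 0 < m, 0 < K,
  (forall z, expR (- z ^+ 2) <= gs m z) &
  forall x e : R, x <= 0 -> x0 <= e * x -> 0 < e <= 1 ->
  `|P2 (e * x) - 2| <= K * e * `|x| /\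
  forall z : R, lap e z (e * x) <= gs m z /\
   `|lap e z (e * x) - expR (- z ^+ 2)| <= e * (K * (1 + `|x|)) * ((1 + `|z|) ^+ 3 * gs m z)].
Proof.
have [m [K [c [[m0 K0 c0 c1] hg hP2 hl]]]] := lap_bounds dP dP1 dP2 dP3 dP4 cP5 P2_gt0 Xx0 x00 B0.
have h00 : x0 <= 0 <= (0 : R) by rewrite lexx (ltW x00).
have hg0 (z : R) : expR (- z ^+ 2) <= gs m z.
  have -> : z ^+ 2 = P2 0 / 2 * z ^+ 2 by rewrite P20; field.
  exact: hg.
exists m, K; split => // x e x_le ex he.
have [e0 e1] := andP he.
have hu : x0 <= e * x <= 0 by rewrite ex/= mulr_ge0_le0// ltW.
have [_ _ h2] := hP2 _ _ hu h00.
rewrite P20 subr0 normrM (gtr0_norm e0) mulrA in h2.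
split => // z.
have [l1 l2 _ _] := hl _ _ z hu he; split => //.
have g0 : 0 <= gs m z by exact: expR_ge0.
have e2 : `|expR (- (P2 (e * x) / 2 * z ^+ 2)) - expR (- z ^+ 2)| <= `|P2 (e * x) / 2 * z ^+ 2 - z ^+ 2| * gs m z.
  apply: expRN_lip.
    by have := hg _ hu z; rewrite /gs ler_expR lerN2.
  by have := hg0 z; rewrite /gs ler_expR lerN2.
have e3 : `|P2 (e * x) / 2 * z ^+ 2 - z ^+ 2| <= K * e * `|x| * `|z| ^+ 2 / 2.
  have -> : P2 (e * x) / 2 * z ^+ 2 - z ^+ 2 = (P2 (e * x) - 2) * z ^+ 2 / 2 by field.
  by rewrite normrM normfV normrM normrX (ger0_norm (_ : 0 <= 2))// ler_pM2r ?invr_gt0// ler_wpM2r// exprn_ge0.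
rewrite -[X in `|X|](subrKA (expR (- (P2 (e * x) / 2 * z ^+ 2)))).
rewrite (le_trans (ler_normD _ _))// (le_trans (lerD l2 (le_trans e2 (ler_wpM2r g0 e3))))//.
have -> : K * e * `|z| ^+ 3 * gs m z + K * e * `|x| * `|z| ^+ 2 / 2 * gs m z =
   (e * K) * ((`|z| ^+ 3 + `|x| * (`|z| ^+ 2 / 2)) * gs m z) by field.
have -> : e * (K * (1 + `|x|)) * ((1 + `|z|) ^+ 3 * gs m z) =
   (e * K) * (((1 + `|z|) ^+ 3 + `|x| * (1 + `|z|) ^+ 3) * gs m z) by ring.
have eK0 : 0 <= e * K by rewrite mulr_ge0// ltW.
rewrite (ler_wpM2l eK0)// (ler_wpM2r g0)//.
have z0 := normr_ge0 z; have z2 : 0 <= `|z| ^+ 2 by rewrite exprn_ge0.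
have z3 : 0 <= `|z| ^+ 3 by rewrite exprn_ge0.
have E3 : (1 + `|z|) ^+ 3 = 1 + 3 * `|z| + 3 * `|z| ^+ 2 + `|z| ^+ 3 by ring.
by apply: lerD; [|apply: ler_wpM2l => //]; rewrite E3; lra.
Qed.

Definition gpoly (m : R) (D : set LT) : R := \int[mu]_(z in D) ((1 + `|z|) ^+ 3 * gs m z).

Lemma gs_le_gpoly (m : R) (D : set LT) : 0 < m -> measurable D -> \int[mu]_(z in D) gs m z <= gpoly m D.
Proof.
move=> m0 mD; have mT := @measurableT _ LT.
apply: le_Rintegral => //.
- exact: (intgS mT mD (@subsetT _ _) (intg_gauss m0)).
- exact: (intgS mT mD (@subsetT _ _) (intg_gs_poly 3 m0)).
- by move=> z _; exact: lap_le_gs_poly.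
Qed.

(** On the domain |z| >= |x|, so half of the exponent can be exchanged for a Gaussian in x. *)
Lemma gpoly_tail (m : R) : 0 < m -> exists2 C : R, 0 < C &
  gpoly m setT <= C /\ forall x, x <= 0 -> gpoly m `]- x, +oo[%classic <= C * gs (m / 2) x.
Proof.
move=> m0; have m20 : 0 < m / 2 by rewrite divr_gt0.
have mT := @measurableT _ LT.
have h0 (k : R) (D : set LT) : 0 < k -> measurable D -> 0 <= gpoly k D.
  by move=> k0 mD; apply: Rintegral_ge0 => z _; rewrite mulr_ge0 ?expR_ge0// exprn_ge0// addr_ge0.
have i1 := intg_gs_poly 3 m0; have i2 := intg_gs_poly 3 m20.
exists (gpoly m setT + gpoly (m / 2) setT + 1).
  by rewrite ltr_wpDl// addr_ge0// h0.
split; first by rewrite -addrA lerDl addr_ge0// h0.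
move=> x x_le.
have mD : measurable (`]- x, +oo[%classic : set LT) by [].
apply: (@le_trans _ _ (gpoly (m / 2) setT * gs (m / 2) x)); last first.
  rewrite ler_wpM2r ?expR_ge0//.
  by have := h0 m setT m0 mT; lra.
rewrite /gpoly mulrC -RintegralZl//.
apply: (@le_trans _ _ (\int[mu]_(z in `]- x, +oo[) (gs (m / 2) x * ((1 + `|z|) ^+ 3 * gs (m / 2) z)))); last first.
  apply: ge0_le_RintegralS => //; first exact: intgZ.
  by move=> z _; rewrite !mulr_ge0 ?expR_ge0// exprn_ge0// addr_ge0.
apply: le_Rintegral => //.
- exact: (intgS mT mD (@subsetT _ _) i1).
- by apply: (intgS mT mD (@subsetT _ _)); exact: intgZ.
- move=> z; rewrite /= in_itv/= andbT => xz.
  rewrite mulrCA ler_wpM2l ?exprn_ge0 ?addr_ge0// /gs -expRD ler_expR.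
  have : x ^+ 2 <= z ^+ 2 by rewrite -sqrrN lerXn2r ?nnegrE; lra.
  by move=> h; have := ler_wpM2l (ltW m20) h; lra.
Qed.

Lemma Jl_itv (e x : R) : 0 < e -> Jl e (e * x) = \int[mu]_(z in `]-oo, - x]) lap e z (e * x).
Proof.
move=> e0; rewrite /Jl; congr (Rintegral _ _ _); apply/seteqP; split => z /=;
  rewrite in_itv/= -mulrDr pmulr_rle0//; lra.
Qed.

(** Logarithm of the fraction of the Gaussian mass that lies left of the wall; it equals [Phi], by
    [PhiE]. *)
Definition lnPhi (x : R) : R := ln (gtail x) - ln (Num.sqrt pi).

Lemma continuous_lnPhi : continuous lnPhi.
Proof.
move=> x; apply: cvgB; last exact: cvg_cst.
apply: (@continuous_comp _ _ _ gtail (@ln R)); first exact: continuous_gtail.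
by apply: continuous_ln; exact: gtail_gt0.
Qed.

(** The layer integrand in the variable x = u / e, less its limit 2 [lnPhi] (P2 0 = 2), divided by
    e. The conditional replaces the part below x0 by zero, so that all scales share the domain x <=
    0. *)
Definition inner (e x : R) : R :=
  ((if x0 <= e * x then P2 (e * x) * (ln (Jl e (e * x)) - ln (Wl e (e * x))) else 0)
   - 2 * lnPhi x) / e.

Lemma lap_intD (m : R) (e u : R) (D : set LT) : 0 < m -> measurable D ->
  (forall z, lap e z u <= gs m z) ->
  mu.-integrable D (EFin \o (fun z : R => lap e z u)) /\
  0 <= \int[mu]_(z in D) lap e z u <= gpoly m D.
Proof.
move=> m0 mD h; have mT := @measurableT _ LT.
have ig := intgS mT mD (@subsetT _ _) (intg_gauss m0).
have il : mu.-integrable D (EFin \o (fun z : R => lap e z u)).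
  have mf : measurable_fun D (fun z : R => lap e z u) := measurable_funTS (measurable_lap X B dP e u).
  refine (intg_le mD mf ig _) => z _.
  by rewrite ger0_norm ?lap_ge0//; exact: h.
split => //; apply/andP; split; first by apply: Rintegral_ge0 => z _; exact: lap_ge0.
apply: le_trans (gs_le_gpoly m0 mD); apply: le_Rintegral => // z _; exact: h.
Qed.

Lemma lap_diffD (m K e x : R) (D : set LT) : 0 < m -> measurable D ->
  (forall z, expR (- z ^+ 2) <= gs m z) ->
  (forall z : R, lap e z (e * x) <= gs m z /\
   `|lap e z (e * x) - expR (- z ^+ 2)| <= K * ((1 + `|z|) ^+ 3 * gs m z)) ->
  `|\int[mu]_(z in D) lap e z (e * x) - \int[mu]_(z in D) expR (- z ^+ 2)| <= K * gpoly m D.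
Proof.
move=> m0 mD hg h; have mT := @measurableT _ LT.
have [il _] := lap_intD m0 mD (fun z => (h z).1).
have ip := intgS mT mD (@subsetT _ _) (intg_gs_poly 3 m0).
rewrite -RintegralB//; last exact: intg_gauss1.
rewrite /gpoly -RintegralZl//; apply: normr_Rintegral_le => //.
- by apply: intgB => //; exact: intg_gauss1.
- exact: intgZ.
- by move=> z _; have [] := h z.
Qed.

(** This Gaussian bound permits dominated convergence in the layer variable, over an unbounded
    domain. *)
Lemma inner_bound : exists m C : R, [/\ 0 < m, 0 < C,
  (forall x, x <= 0 -> `|lnPhi x| <= C * gs m x) &
  forall e x : R, 0 < e <= 1 -> x <= 0 -> `|inner e x| <= C * ((1 + `|x|) ^+ 1 * gs m x)].
Proof.
have [m [K [m0 K0 hg hl]]] := lap_gauss.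
have [Cg Cg0 [CgT Cgx]] := gpoly_tail m0.
have [C1 C10 hW] := W_bounds dP dP1 dP2 dP3 dP4 cP5 P2_gt0 Xx0 x00 B0.
set s := Num.sqrt pi : R.
have s0 : 0 < s by rewrite sqrtr_gt0 pi_gt0.
pose c := Num.min (C1^-1) (s / 2).
have c0 : 0 < c by rewrite lt_min invr_gt0 C10 divr_gt0.
have cC : c <= C1^-1 by rewrite ge_min lexx.
have cs : c <= s / 2 by rewrite ge_min lexx orbT.
have cs1 : c <= s by apply: (le_trans cs); lra.
have c20 : 0 < c ^+ 2 by rewrite exprn_gt0.
have nx0 : 0 < - x0 by rewrite oppr_gt0.
pose A1 := K * Cg / c; pose A2 := 2 * K * Cg * (Cg + s) / c ^+ 2; pose A3 := 2 * Cg / c / - x0.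
pose A4 := Cg / c.
have [A10 A20 A30 A40] : [/\ 0 < A1, 0 < A2, 0 < A3 & 0 < A4].
  by rewrite /A1 /A2 /A3 /A4; split; rewrite ?divr_gt0 ?mulr_gt0 ?addr_gt0.
have m20 : 0 < m / 2 by rewrite divr_gt0.
have jx x : x <= 0 -> c <= gtail x by move=> xle; rewrite (le_trans cs)// gtail_ge_half.
have mD x : measurable (`]- x, +oo[%classic : set LT) by [].
have mJ x : measurable (`]-oo, - x]%classic : set LT) by [].
have mT := @measurableT _ LT.
have T0 x : \int[mu]_(z in `]- x, +oo[) expR (- z ^+ 2) = s - gtail x.
  have := intg_split (- x) (intg_gauss1 mT).
  by rewrite gauss1_total gtail_opp -/s => ->; ring.
have T0b x : x <= 0 -> 0 <= s - gtail x <= Cg * gs (m / 2) x.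
  move=> xle; rewrite subr_ge0 ltW/= ?gtail_lt_total// -T0.
  rewrite (le_trans _ (Cgx x xle))// (le_trans _ (gs_le_gpoly m0 (mD x)))//.
  apply: le_Rintegral => //; first exact: intg_gauss1.
  exact: (intgS mT (mD x) (@subsetT _ _) (intg_gauss m0)).
have Phb x : x <= 0 -> `|lnPhi x| <= A4 * gs (m / 2) x.
  move=> xle; have /andP[t1 t2] := T0b x xle.
  rewrite (le_trans (ln_lip c0 (jx x xle) cs1))// distrC ger0_norm//.
  by rewrite /A4 mulrAC ler_pM2r ?invr_gt0.
exists (m / 2), (A1 + A2 + A3 + A4); split => //; first lra.
  by move=> x xle; rewrite (le_trans (Phb x xle))// ler_wpM2r ?expR_ge0//; lra.
move=> e x he xle; have [e0 e1] := andP he; rewrite expr1.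
have g0 : 0 <= gs (m / 2) x by exact: expR_ge0.
set t := gs (m / 2) x in g0 *.
have y0 := normr_ge0 x; set y := `|x| in y0 *.
rewrite /inner; case: ifPn => hx; last first.
  (* Below x0 only - 2 [lnPhi] / e remains; there e |x| > - x0, so 1 / e is absorbed by |x| / (-
     x0). *)
  rewrite -ltNge in hx.
  rewrite sub0r mulNr normrN normrM normfV (gtr0_norm e0) ler_pdivrMr// normrM ger0_norm//.
  have yx : - x0 <= e * y by rewrite /y ler0_norm//; lra.
  apply: (@le_trans _ _ (A3 * (e * y) * t)).
    apply: (@le_trans _ _ (2 * (A4 * t))); first by rewrite ler_wpM2l//; exact: Phb.
    rewrite mulrA ler_wpM2r//.
    have -> : 2 * A4 = A3 * - x0 by rewrite /A3 /A4; field; rewrite (lt0r_neq0 c0) (ltr0_neq0 x00).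
    by rewrite ler_wpM2l// ltW.
  rewrite [leRHS](_ : _ = (A1 + A2 + A3 + A4) * (e * (1 + y)) * t); last by ring.
  rewrite (ler_wpM2r g0)//; apply: ler_pM.
  - exact: ltW.
  - by rewrite mulr_ge0// ltW.
  - lra.
  - by rewrite ler_pM2l//; lra.
have [hp hl2] := hl x e xle hx he.
have hu : x0 <= e * x <= 0 by rewrite hx/= mulr_ge0_le0// ltW.
have [iT w1 j1 _ _] := hW _ _ hu he.
set j := Jl e (e * x) in j1 *; set w := Wl e (e * x) in w1 *.
have [_ /andP[t1 t2]] := lap_intD m0 (mD x) (fun z => (hl2 z).1).
have ET : w - j = \int[mu]_(z in `]- x, +oo[) lap e z (e * x).
  by rewrite /w /Wl (intg_split (- x) iT) /j Jl_itv//; ring.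
rewrite -ET in t1 t2.
have d1 := lap_diffD m0 (mD x) hg hl2.
have d2 := lap_diffD m0 mT hg hl2.
rewrite -ET T0 in d1; rewrite -/(Wl e (e * x)) -/w gauss1_total -/s in d2.
have cj := le_trans cC j1; have cw := le_trans cC w1.
have t3 := le_trans t2 (Cgx x xle); rewrite -/t in t3.
have K1 : 0 <= e * (K * (1 + y)) by rewrite !mulr_ge0 ?(ltW e0) ?(ltW K0)// addr_ge0.
have d1' := le_trans d1 (ler_wpM2l K1 (Cgx x xle)); rewrite -/t in d1'.
have d2' := le_trans d2 (ler_wpM2l K1 CgT).
have /andP[t01 t02] := T0b x xle; rewrite -/t in t02.
have b1 : `|ln j - ln w| <= Cg * t / c.
  rewrite (le_trans (ln_lip c0 cj cw))// distrC ger0_norm// ler_pM2r ?invr_gt0//.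
have b2 : `|ln j - ln w - lnPhi x| <= e * (1 + y) * t * (K * Cg * (Cg + s) / c ^+ 2).
  rewrite (le_trans (ln_ratio c0 cj cw (jx x xle) cs1))//.
  rewrite mulrA ler_pM2r ?invr_gt0//.
  have -> : e * (1 + y) * t * (K * Cg * (Cg + s)) =
     Cg * t * (e * (K * (1 + y)) * Cg) + s * (e * (K * (1 + y)) * (Cg * t)) by ring.
  apply: lerD; last by rewrite ler_wpM2l// ltW.
  by rewrite (ger0_norm t01) ler_pM.
(* The variation of P2 multiplies ln (j / w), already a Gaussian tail; [ln_ratio] handles the
   rest. *)
have -> : (P2 (e * x) * (ln j - ln w) - 2 * lnPhi x) / e =
   ((P2 (e * x) - 2) * (ln j - ln w) + 2 * (ln j - ln w - lnPhi x)) / e by congr (_ / _); ring.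
rewrite normrM normfV (gtr0_norm e0) ler_pdivrMr//.
rewrite (le_trans (ler_normD _ _))// !normrM (ger0_norm (_ : 0 <= 2))//.
have b3 : `|P2 (e * x) - 2| * `|ln j - ln w| <= K * e * y * (Cg * t / c) by apply: ler_pM.
rewrite (le_trans (lerD b3 (ler_wpM2l (ler0n R 2) b2)))//.
have -> : K * e * y * (Cg * t / c) + 2 * (e * (1 + y) * t * (K * Cg * (Cg + s) / c ^+ 2)) =
   (A1 * y + A2 * (1 + y)) * (e * t) by rewrite /A1 /A2; field; exact: lt0r_neq0.
rewrite [leRHS](_ : _ = ((A1 + A2 + A3 + A4) * (1 + y)) * (e * t)); last by ring.
rewrite ler_wpM2r ?mulr_ge0 ?(ltW e0)//.
have q1 := mulr_ge0 (ltW A10) y0; have q3 := mulr_ge0 (ltW A30) y0; have q4 := mulr_ge0 (ltW A40) y0.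
lra.
Qed.

Variable e_ : nat -> R.
Hypothesis e_01 : forall n, 0 < e_ n <= 1.
Hypothesis e_cvg : e_ @ \oo --> (0 : R).

Let e_gt0 n : 0 < e_ n.
Proof. by have /andP[] := e_01 n. Qed.

Let e_neq0 n : e_ n != 0.
Proof. exact: lt0r_neq0. Qed.

Lemma quot_cvg (D : set LT) (x : R) : measurable D -> x <= 0 ->
  (fun n => (\int[mu]_(z in D) lap (e_ n) z (e_ n * x) - \int[mu]_(z in D) expR (- z ^+ 2)) / e_ n) @ \oo -->
  \int[mu]_(z in D) (- (x * P3 0 / 2 * z ^+ 2 + P3 0 / 6 * z ^+ 3) * expR (- z ^+ 2)).
Proof.
move=> mD xle; have mT := @measurableT _ LT.
have [m [K [m0 K0 hg hl]]] := lap_gauss.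
pose f_ n z := if x0 <= e_ n * x then (lap (e_ n) z (e_ n * x) - expR (- z ^+ 2)) / e_ n else 0.
have nx := near_x0 x00 e_01 e_cvg xle.
have ip := intgS mT mD (@subsetT _ _) (intg_gs_poly 3 m0).
have mf n : measurable_fun D (f_ n).
  rewrite /f_; case: (x0 <= e_ n * x) => //; apply: measurable_funTS; apply: measurable_funM => //.
  apply: measurable_funB; first exact: (measurable_lap X B dP).
  by apply: measurable_cont; exact: continuous_gauss1.
have cf z : D z -> f_ ^~ z @ \oo --> - (x * P3 0 / 2 * z ^+ 2 + P3 0 / 6 * z ^+ 3) * expR (- z ^+ 2).
  move=> _; have := @lap_cvg1 _ _ _ _ _ _ _ _ _ _ dP dP1 dP2 dP3 dP4 cP5 Xx0 x00 B0 _ e_01 e_cvg x z xle P20.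
  apply: cvg_trans; apply: near_eq_cvg; near=> n.
  rewrite /f_ ifT//; have /andP[] // : x0 <= e_ n * x <= 0 by near: n.
have bf n z : D z -> `|f_ n z| <= K * (1 + `|x|) * ((1 + `|z|) ^+ 3 * gs m z).
  move=> _; rewrite /f_; case: ifPn => hx; last first.
    by rewrite normr0 !mulr_ge0 ?expR_ge0 ?exprn_ge0 ?addr_ge0// ltW.
  have [_ hl2] := hl x _ xle hx (e_01 n); have [_ h] := hl2 z.
  rewrite normrM normfV (gtr0_norm (e_gt0 n)) ler_pdivrMr// (le_trans h)//.
  by rewrite le_eqVlt; apply/orP; left; apply/eqP; ring.
have [_] := Rdominated mD mf cf (intgZ (K * (1 + `|x|)) mD ip) bf.
apply: cvg_trans; apply: near_eq_cvg; near=> n.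
have /andP[hx _] : x0 <= e_ n * x <= 0 by near: n.
have [_ hl2] := hl x _ xle hx (e_01 n).
have [il _] := lap_intD m0 mD (fun z => (hl2 z).1).
rewrite /f_ hx RintegralZr//; last by apply: intgB => //; exact: intg_gauss1.
by rewrite RintegralB//; exact: intg_gauss1.
Unshelve. all: end_near. Qed.

Lemma cubic_moment (D : set LT) (x : R) : measurable D ->
  \int[mu]_(z in D) (- (x * P3 0 / 2 * z ^+ 2 + P3 0 / 6 * z ^+ 3) * expR (- z ^+ 2)) =
  - (x * P3 0 / 2 * \int[mu]_(z in D) (z ^+ 2 * expR (- z ^+ 2))
     + P3 0 / 6 * \int[mu]_(z in D) (z ^+ 3 * expR (- z ^+ 2))).
Proof.
move=> mD; have i2 := intg_mongauss1 2 mD; have i3 := intg_mongauss1 3 mD.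
rewrite -!RintegralZl// -RintegralD//; [|exact: intgZ|exact: intgZ].
rewrite -mulN1r -RintegralZl//; last by apply: intgD => //; exact: intgZ.
by apply: eq_Rintegral => z _; ring.
Qed.

(** The first-order coefficient in e of P2 (e x) ln (J / W), with P3 0 factored out: the first
    summand comes from the weight, x [lnPhi] from the variation of P2. *)
Definition inner_lim (x : R) : R :=
  expR (- x ^+ 2) / gtail x * (1 - 2 * x ^+ 2) / 6 + x * lnPhi x.

Lemma inner_cvg (x : R) : x <= 0 ->
  (fun n => inner (e_ n) x) @ \oo --> P3 0 * inner_lim x.
Proof.
move=> xle; have mT := @measurableT _ LT.
have mJ : measurable (`]-oo, - x]%classic : set LT) by [].
have s0 : 0 < Num.sqrt pi :> R by rewrite sqrtr_gt0 pi_gt0.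
have g0 := gtail_gt0 x.
have nx := near_x0 x00 e_01 e_cvg xle.
have qJ := quot_cvg mJ xle; have qW := quot_cvg mT xle.
rewrite cubic_moment// !lower_moment gtail_moment2 gtail_moment3 gtail_opp in qJ.
rewrite cubic_moment// gauss_moment2 gauss_moment3 gauss1_total in qW.
have qJ' : (fun n => (Jl (e_ n) (e_ n * x) - gtail x) / e_ n) @ \oo -->
   P3 0 * (expR (- x ^+ 2) * (1 - 2 * x ^+ 2) / 12 - x * gtail x / 4).
  have -> : (fun n => (Jl (e_ n) (e_ n * x) - gtail x) / e_ n) = (fun n =>
     (\int[mu]_(z in `]-oo, - x]) lap (e_ n) z (e_ n * x) - gtail x) / e_ n).
    by apply/funext => n; rewrite Jl_itv.
  by move: qJ; congr (_ --> _); field.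
have qW' : (fun n => (Wl (e_ n) (e_ n * x) - Num.sqrt pi) / e_ n) @ \oo -->
   P3 0 * (- x * Num.sqrt pi / 4).
  by move: qW; congr (_ --> _); field.
have lJ := chain_quot (is_derive_lnr g0) e_neq0 e_cvg qJ'.
have lW := chain_quot (is_derive_lnr s0) e_neq0 e_cvg qW'.
have dJW : (fun n => (ln (Jl (e_ n) (e_ n * x)) - ln (gtail x)) / e_ n -
      (ln (Wl (e_ n) (e_ n * x)) - ln (Num.sqrt pi)) / e_ n) @ \oo -->
   (gtail x)^-1 * (P3 0 * (expR (- x ^+ 2) * (1 - 2 * x ^+ 2) / 12 - x * gtail x / 4)) -
      (Num.sqrt pi)^-1 * (P3 0 * (- x * Num.sqrt pi / 4)) by apply: cvgB.
have limJW : (fun n => ln (Jl (e_ n) (e_ n * x)) - ln (Wl (e_ n) (e_ n * x))) @ \oo --> lnPhi x.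
  have h : (fun n => lnPhi x + e_ n * (((ln (Jl (e_ n) (e_ n * x)) - ln (gtail x)) / e_ n) -
      ((ln (Wl (e_ n) (e_ n * x)) - ln (Num.sqrt pi)) / e_ n))) @ \oo --> lnPhi x.
    rewrite -[X in _ --> X]addr0; apply: cvgD; first exact: cvg_cst.
    rewrite -(mul0r ((gtail x)^-1 * (P3 0 * (expR (- x ^+ 2) * (1 - 2 * x ^+ 2) / 12 - x * gtail x / 4)) -
      (Num.sqrt pi)^-1 * (P3 0 * (- x * Num.sqrt pi / 4)))).
    exact: cvgM e_cvg dJW.
  have -> : (fun n => ln (Jl (e_ n) (e_ n * x)) - ln (Wl (e_ n) (e_ n * x))) =
    (fun n => lnPhi x + e_ n * (((ln (Jl (e_ n) (e_ n * x)) - ln (gtail x)) / e_ n) -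
      ((ln (Wl (e_ n) (e_ n * x)) - ln (Num.sqrt pi)) / e_ n))).
    by apply/funext => n; rewrite /lnPhi; field; exact: e_neq0.
  exact: h.
have P2q : (fun n => (P2 (e_ n * x) - P2 0) / e_ n) @ \oo --> P3 0 * x.
  apply: chain_quot => //.
  under eq_fun => n do rewrite subr0 mulrAC divff// mul1r.
  exact: cvg_cst.
have T : (fun n => (P2 (e_ n * x) - P2 0) / e_ n * (ln (Jl (e_ n) (e_ n * x)) - ln (Wl (e_ n) (e_ n * x)))
   + 2 * ((ln (Jl (e_ n) (e_ n * x)) - ln (gtail x)) / e_ n - (ln (Wl (e_ n) (e_ n * x)) - ln (Num.sqrt pi)) / e_ n)) @ \oo -->
   P3 0 * x * lnPhi x + 2 * ((gtail x)^-1 * (P3 0 * (expR (- x ^+ 2) * (1 - 2 * x ^+ 2) / 12 - x * gtail x / 4)) -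
      (Num.sqrt pi)^-1 * (P3 0 * (- x * Num.sqrt pi / 4))).
  apply: cvgD; first by apply: cvgM; [exact: P2q|exact: limJW].
  by apply: cvgM; [exact: cvg_cst|exact: dJW].
have -> : P3 0 * inner_lim x = P3 0 * x * lnPhi x + 2 * ((gtail x)^-1 * (P3 0 * (expR (- x ^+ 2) * (1 - 2 * x ^+ 2) / 12 - x * gtail x / 4)) -
      (Num.sqrt pi)^-1 * (P3 0 * (- x * Num.sqrt pi / 4))).
  by rewrite /inner_lim; field; rewrite !lt0r_neq0.
move: T; apply: cvg_trans; apply: near_eq_cvg; near=> n.
have /andP[hx _] : x0 <= e_ n * x <= 0 by near: n.
by rewrite /inner hx P20 /lnPhi; field; exact: e_neq0.
Unshelve. all: end_near. Qed.

(** With u = e x the integral over u divided by e^2 is 1 / e times one over x; its leading part 2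
    [lnPhi] yields the term of order sqrt N, its first correction the term in beta^in. *)
Theorem inner_limit : mu.-integrable `]-oo, 0] (EFin \o lnPhi) /\
  (fun n => \int[mu]_(u in `[x0, 0]) (P2 u * (ln (Jl (e_ n) u) - ln (Wl (e_ n) u))) / e_ n ^+ 2
     - 2 / e_ n * \int[mu]_(x in `]-oo, 0]) lnPhi x) @ \oo -->
  P3 0 * \int[mu]_(x in `]-oo, 0]) inner_lim x.
Proof.
have mT := @measurableT _ LT.
have mD : measurable (`]-oo, 0]%classic : set LT) by [].
have [m [C [m0 C0 hPh hI]]] := inner_bound.
have cP2 : continuous P2 by move=> x; exact: is_derive_cvg.
have iPh : mu.-integrable `]-oo, 0] (EFin \o lnPhi).
  have mf := measurable_funTS (measurable_cont continuous_lnPhi) : measurable_fun (`]-oo, 0]%classic : set LT) lnPhi.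
  refine (intg_le mD mf (intgZ C mD (intgS mT mD (@subsetT _ _) (intg_gauss m0))) _) => z.
  by rewrite /= in_itv/=; exact: hPh.
split => //.
have cJ e u : 0 < e -> {for u, continuous (fun u => P2 u * (ln (Jl e u) - ln (Wl e u)))}.
  move=> e0; apply: cvgM; first exact: cP2.
  by apply: cvgB; [exact: (continuous_lnJ dP dP1 Xx0 x00 B0)|exact: (continuous_lnW dP dP1 Xx0 x00 B0)].
pose h_ n (x : R) := if x0 <= e_ n * x then P2 (e_ n * x) * (ln (Jl (e_ n) (e_ n * x)) - ln (Wl (e_ n) (e_ n * x))) else 0.
have cm n : continuous (fun x : R => e_ n * x).
  by move=> x; apply: cvgM; [exact: cvg_cst|exact: cvg_id].
have mh n : measurable_fun (setT : set LT) (h_ n).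
  apply: measurable_fun_ifT => //.
    by apply: measurable_fun_ler => //; apply: measurable_cont; exact: cm.
  apply: measurable_cont => x.
  apply: (@continuous_comp _ _ _ (fun x : R => e_ n * x) (fun u => P2 u * (ln (Jl (e_ n) u) - ln (Wl (e_ n) u)))).
    exact: cm.
  exact: cJ.
have mi n : measurable_fun (`]-oo, 0]%classic : set LT) (inner (e_ n)).
  apply: measurable_funTS; apply: measurable_funM => //; apply: measurable_funB; first exact: mh.
  apply: measurable_funM => //; exact: measurable_cont continuous_lnPhi.
have iG := intgZ C mD (intgS mT mD (@subsetT _ _) (intg_gs_poly 1 m0)).
have ci x : (`]-oo, 0]%classic : set LT) x -> (fun n => inner (e_ n) x) @ \oo --> P3 0 * inner_lim x.
  by rewrite /= in_itv/=; exact: inner_cvg.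
have bi n x : (`]-oo, 0]%classic : set LT) x -> `|inner (e_ n) x| <= C * ((1 + `|x|) ^+ 1 * gs m x).
  by rewrite /= in_itv/= => xle; exact: hI.
have [il] := Rdominated mD mi ci iG bi.
have -> : \int[mu]_(x in `]-oo, 0]) (P3 0 * inner_lim x) = P3 0 * \int[mu]_(x in `]-oo, 0]) inner_lim x.
  (* Dominated convergence gives integrability of the product P3 0 * [inner_lim] only; when P3 0 = 0
     both sides vanish. *)
  have [P30|P30] := eqVneq (P3 0) 0.
    by rewrite P30 mul0r; under eq_Rintegral do rewrite mul0r; rewrite Rintegral_cst//= mul0r.
  rewrite RintegralZl//; apply: (eq_intg mD _ (intgZ (P3 0)^-1 mD il)) => x _.
  by rewrite mulKf.
apply: cvg_trans; apply: near_eq_cvg; near=> n.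
have e0 := e_gt0 n.
have ii : mu.-integrable `]-oo, 0] (EFin \o inner (e_ n)) by refine (intg_le mD (mi n) iG (bi n)).
have ih : mu.-integrable `]-oo, 0] (EFin \o h_ n).
  apply: (eq_intg mD _ (intgD mD (intgZ (e_ n) mD ii) (intgZ 2 mD iPh))) => x _.
  by rewrite /inner -/(h_ n x); field; exact: e_neq0.
have -> : \int[mu]_(x in `]-oo, 0]) inner (e_ n) x =
   (\int[mu]_(x in `]-oo, 0]) h_ n x) / e_ n - 2 / e_ n * \int[mu]_(x in `]-oo, 0]) lnPhi x.
  have -> : \int[mu]_(x in `]-oo, 0]) inner (e_ n) x =
     \int[mu]_(x in `]-oo, 0]) ((e_ n)^-1 * h_ n x - 2 / e_ n * lnPhi x).
    by apply: eq_Rintegral => x _; rewrite /inner -/(h_ n x); field; exact: e_neq0.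
  rewrite RintegralB//; [|exact: intgZ|exact: intgZ].
  by rewrite !RintegralZl// [_^-1 * _]mulrC.
have mI : measurable (`[x0, 0]%classic : set LT) by [].
have iJ : mu.-integrable `[x0, 0] (EFin \o (fun u => P2 u * (ln (Jl (e_ n) u) - ln (Wl (e_ n) u)))).
  by apply: continuous_compact_integrable; [exact: segment_compact|apply: continuous_subspaceT => u; exact: cJ].
rewrite (Rintegral_affine 0 e0 mI iJ).
have -> : \int[mu]_(z in affine 0 (e_ n) @^-1` `[x0, 0])
     (P2 (affine 0 (e_ n) z) * (ln (Jl (e_ n) (affine 0 (e_ n) z)) - ln (Wl (e_ n) (affine 0 (e_ n) z)))) =
   \int[mu]_(x in `]-oo, 0]) h_ n x.
  rewrite Rintegral_mkcond [RHS]Rintegral_mkcond; apply: eq_Rintegral => z _.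
  rewrite !patchE.
  have m1 : (z \in affine 0 (e_ n) @^-1` `[x0, 0]) = (x0 <= e_ n * z) && (z <= 0).
    by apply/idP/idP; rewrite inE/= in_itv/= /affine add0r pmulr_rle0.
  have m2 : (z \in (`]-oo, 0]%classic : set LT)) = (z <= 0) by apply/idP/idP; rewrite inE/= in_itv/=.
  rewrite m1 m2 /h_ /affine add0r; case: (z <= 0); last by rewrite andbF.
  by rewrite andbT; case: ifP.
by field; exact: e_neq0.
Unshelve. all: end_near. Qed.

End inside.

(** * Saddle points beyond the wall *)

Section outside.
Context {R : realType} (P P1 P2 P3 P4 P5 : R -> R) (X x0 B : R).
Hypothesis dP : forall x : R, is_derive x 1 P (P1 x).
Hypothesis dP1 : forall x : R, is_derive x 1 P1 (P2 x).
Hypothesis dP2 : forall x : R, is_derive x 1 P2 (P3 x).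
Hypothesis dP3 : forall x : R, is_derive x 1 P3 (P4 x).
Hypothesis dP4 : forall x : R, is_derive x 1 P4 (P5 x).
Hypothesis cP5 : continuous P5.
Hypothesis P2_gt0 : forall x, 0 < P2 x.
Hypothesis P20 : P2 0 = 2.
Hypothesis Xx0 : X < x0.
Hypothesis x00 : x0 < 0.
Hypothesis B0 : 0 < B.
Notation mu := (@lebesgue_measure R).
Notation LT := (measurableTypeR R).
Notation lap := (lap P P1 X B).
Notation Ml := (Ml P P1 X B).

Let mN : measurable (`]-oo, 0]%classic : set LT). Proof. by []. Qed.

Lemma intg_inv1_sqr :
  mu.-integrable `[0, +oo[ (EFin \o (fun x : R => ((1 + x) ^+ 2)^-1)).
Proof.
have [i1 _] := @intg_inv_sqr R 1 ltr01.
have mD : measurable (`[1, +oo[%classic : set LT) by [].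
have := intg_affine 1 ltr01 mD i1.
have -> : affine 1 1 @^-1` `[1, +oo[ = `[0, +oo[%classic :> set LT.
  by apply/seteqP; split => z /=; rewrite /affine !in_itv/= !andbT mul1r lerDl.
move=> h; apply: (eq_intg _ _ h) => // z _.
by rewrite /affine /= mul1r.
Qed.

(** The Mills ratio of the density e^(-t^2), and by [gtail_shift] the limit of [Ml] as e tends to
    0. *)
Definition mills (x : R) : R := expR (x ^+ 2) * gtail x.

Lemma mills_gt0 (x : R) : 0 < mills x.
Proof. by rewrite mulr_gt0 ?expR_gt0// gtail_gt0. Qed.

Lemma continuous_mills : continuous mills.
Proof.
move=> x; apply: cvgM; last exact: continuous_gtail.
by apply: (@continuous_comp _ _ _ (fun x : R => x ^+ 2) expR);
  [exact: exprn_continuous|exact: continuous_expR].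
Qed.

(** On - c / (1 + x) <= z <= 0 the tilt stays above e^(-2), and the length of this interval gives
    the order 1 / (1 + x). *)
Lemma expM_lower (c x : R) (f : R -> R) : 0 < c -> c <= 1 -> 0 <= x ->
  mu.-integrable `]-oo, 0] (EFin \o (fun z : R => expR (2 * x * z) * f z)) ->
  (forall z, 0 <= f z) -> (forall z, `|z| <= c -> c <= f z) ->
  c ^+ 2 * expR (- 2) / (1 + x) <= \int[mu]_(z in `]-oo, 0]) (expR (2 * x * z) * f z).
Proof.
move=> c0 c1 x_ge fi f0 fc.
have s0 : 0 < 1 + x by lra.
have cs0 : 0 < c / (1 + x) by rewrite divr_gt0.
have mI : measurable (`[- (c / (1 + x)), 0]%classic : set LT) by [].
have sub : `[- (c / (1 + x)), 0]%classic `<=` (`]-oo, 0]%classic : set LT).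
  by move=> z; rewrite /= !in_itv/= => /andP[].
apply: (@le_trans _ _ (\int[mu]_(z in `[- (c / (1 + x)), 0]) (expR (2 * x * z) * f z))); last first.
  by apply: ge0_le_RintegralS => // z _; rewrite mulr_ge0 ?expR_ge0.
have -> : c ^+ 2 * expR (- 2) / (1 + x) = \int[mu]_(z in `[- (c / (1 + x)), 0]) (expR (- 2) * c).
  rewrite Rintegral_cst//= lebesgue_measure_itv/= lte_fin oppr_lt0 cs0.
  by rewrite -EFinB/= opprK add0r; field; exact: lt0r_neq0.
apply: le_Rintegral => //.
- apply: continuous_compact_integrable; first exact: segment_compact.
  by apply: continuous_subspaceT => z; exact: cvg_cst.
- exact: (intgS mN mI sub fi).
- move=> z; rewrite /= in_itv/= => /andP[z1 z2].
  have zc : - z <= c by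
    rewrite lerNl (le_trans _ z1)// lerN2 ler_pdivrMr// ler_peMr ?(ltW c0)// lerDl.
  apply: ler_pM; rewrite ?expR_ge0 ?(ltW c0)//; last by apply: fc; rewrite ler0_norm.
  rewrite ler_expR.
  have : - z * (1 + x) <= c by rewrite -ler_pdivlMr// lerNl.
  have : 0 <= - z by rewrite oppr_ge0.
  lra.
Qed.

Lemma lap_zero : exists m K c : R, [/\ 0 < m, 0 < K, 0 < c & c <= 1] /\
  [/\ (forall z, expR (- z ^+ 2) <= gs m z),
   (forall z, `|z| <= c -> c <= expR (- z ^+ 2)) &
   forall e z : R, 0 < e <= 1 ->
   [/\ lap e z 0 <= gs m z, `|lap e z 0 - expR (- z ^+ 2)| <= K * e * `|z| ^+ 3 * gs m z &
     `|z| <= c -> c <= lap e z 0]].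
Proof.
have [m [K [c [[m0 K0 c0 c1] hg hP2 hl]]]] := lap_bounds dP dP1 dP2 dP3 dP4 cP5 P2_gt0 Xx0 x00 B0.
have h00 : x0 <= 0 <= (0 : R) by rewrite lexx (ltW x00).
have E z : P2 0 / 2 * z ^+ 2 = z ^+ 2 by rewrite P20; field.
pose d := Num.min c (expR (- 1)).
have dc : d <= c by rewrite ge_min lexx.
have d1 : d <= expR (- 1) by rewrite ge_min lexx orbT.
exists m, K, d; split; first by split => //; [rewrite lt_min c0 expR_gt0|exact: le_trans dc c1].
split.
- by move=> z; have := hg 0 h00 z; rewrite E.
- move=> z zd; rewrite (le_trans d1)// ler_expR lerN2 -real_normK ?num_real//.
  by rewrite expr_le1// (le_trans zd)// (le_trans dc).
- move=> e z he; have [l1 l2 _ l3] := hl 0 e z h00 he; rewrite E in l2; split => // zd.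
  by apply: (le_trans dc); apply: l3; exact: le_trans zd dc.
Qed.

(** [Ml] itself decays like 1 / (1 + x). The cubic moment makes the absolute error (1 + x)^(-4), so
    the relative error (1 + x)^(-3) is integrable in x. *)
Lemma M_bounds : exists2 C : R, 0 < C & forall e x : R, 0 < e <= 1 -> 0 <= x ->
  [/\ mu.-integrable `]-oo, 0] (EFin \o (fun z : R => expR (2 * x * z) * lap e z 0)),
     (C * (1 + x))^-1 <= Ml e x, (C * (1 + x))^-1 <= mills x &
     `|Ml e x - mills x| <= C * e / (1 + x) ^+ 4].
Proof.
have [m [K [c [[m0 K0 c0 c1] [hg hc hl]]]]] := lap_zero.
have [C0 C00 h0] := exp_moment 0 m0.
have [C3 C30 h3] := exp_moment 3 m0.
pose L := (c ^+ 2 * expR (- 2))^-1.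
have cc0 : 0 < c ^+ 2 * expR (- 2) by rewrite mulr_gt0 ?exprn_gt0 ?expR_gt0.
have L0 : 0 < L by rewrite invr_gt0.
exists (L + K * C3); first by rewrite addr_gt0 ?mulr_gt0.
move=> e x he xge; have [e0 e1] := andP he.
have s0 : 0 < 1 + x by lra.
have mE : measurable_fun (`]-oo, 0]%classic : set LT) (fun z : R => expR (2 * x * z)).
  apply: measurable_funTS; apply: measurable_cont => z.
  apply: (@continuous_comp _ _ _ (fun z : R => 2 * x * z) expR); last exact: continuous_expR.
  by apply: cvgM; [exact: cvg_cst|exact: cvg_id].
have ml : measurable_fun (`]-oo, 0]%classic : set LT) (fun z : R => lap e z 0).
  exact: measurable_funTS (measurable_lap X B dP e 0).
have [|iM _] := h0 x _ xge (measurable_funM mE ml).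
  move=> z _; rewrite expr0 mul1r normrM !ger0_norm ?expR_ge0 ?lap_ge0//.
  by rewrite ler_wpM2l ?expR_ge0//; have [] := hl e z he.
have [i0 e0'] := gtail_shift x.
have low (v : R) : c ^+ 2 * expR (- 2) / (1 + x) <= v -> ((L + K * C3) * (1 + x))^-1 <= v.
  apply: le_trans; have -> : c ^+ 2 * expR (- 2) / (1 + x) = (L * (1 + x))^-1 by rewrite /L invfM invrK.
  have KC : 0 < K * C3 by rewrite mulr_gt0.
  rewrite lef_pV2 ?posrE ?mulr_gt0 ?(addr_gt0 L0 KC)//.
  by rewrite (ler_wpM2r (ltW s0))// lerDl ltW.
split => //.
- apply: low; apply: (@expM_lower c x (fun z => lap e z 0) c0 c1 xge iM) => z; first exact: lap_ge0.
  by have [_ _ h] := hl e z he; exact: h.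
- by apply: low; rewrite /mills -e0'; apply: expM_lower => // z; exact: expR_ge0.
have Ed : Ml e x - mills x = \int[mu]_(z in `]-oo, 0])
     (expR (2 * x * z) * (lap e z 0 - expR (- z ^+ 2))).
  rewrite /Ml /mills -e0' -RintegralB//; apply: eq_Rintegral => z _; by rewrite mulrBr.
have mf : measurable_fun (`]-oo, 0]%classic : set LT)
   (fun z : R => (K * e)^-1 * (expR (2 * x * z) * (lap e z 0 - expR (- z ^+ 2)))).
  apply: measurable_funM => //; apply: measurable_funM => //; apply: measurable_funB => //.
  by apply: measurable_funTS; apply: measurable_cont; exact: continuous_gauss1.
have Ke0 : 0 < K * e by rewrite mulr_gt0.
have [|iD hD] := h3 x _ xge mf.
  move=> z _; have [_ l2 _] := hl e z he.
  rewrite !normrM normfV (gtr0_norm Ke0) (ger0_norm (expR_ge0 _)).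
  rewrite ler_pdivrMl// mulrCA [leRHS]mulrCA [leRHS](_ : _ = expR (2 * x * z) * (K * e * `|z| ^+ 3 * gs m z)); last by ring.
  by rewrite ler_wpM2l ?expR_ge0.
rewrite -[Ml e x - mills x](mulVKf (lt0r_neq0 Ke0)) Ed.
rewrite -RintegralZl//; last first.
  apply: (eq_intg mN _ (intgZ (K * e) mN iD)) => z _; by rewrite mulVKf ?lt0r_neq0.
rewrite normrM (gtr0_norm Ke0) (le_trans (ler_wpM2l (ltW Ke0) hD))//.
rewrite mulrA ler_wpM2r ?invr_ge0 ?exprn_ge0 ?(ltW s0)//.
have := mulr_ge0 (ltW L0) (ltW e0); lra.
Qed.

Lemma out_bound : exists2 C : R, 0 < C & forall e x : R, 0 < e <= 1 -> 0 <= x ->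
  `|(ln (Ml e x) - ln (mills x)) / e| <= C * ((1 + x) ^+ 2)^-1.
Proof.
have [C C0 hM] := M_bounds.
exists (C ^+ 2); first by rewrite exprn_gt0.
move=> e x he xge; have [_ l1 l2 l3] := hM e x he xge; have [e0 e1] := andP he.
have s0 : 0 < 1 + x by lra.
have cs : 0 < (C * (1 + x))^-1 by rewrite invr_gt0 mulr_gt0.
rewrite normrM normfV (gtr0_norm e0) ler_pdivrMr// (le_trans (ln_lip cs l1 l2))// invrK.
rewrite (le_trans (ler_wpM2r (mulr_ge0 (ltW C0) (ltW s0)) l3))//.
have -> : C * e / (1 + x) ^+ 4 * (C * (1 + x)) = C ^+ 2 * (e * ((1 + x) ^+ 3)^-1).
  by field; exact: lt0r_neq0.
rewrite -[leRHS]mulrA (ler_wpM2l (exprn_ge0 2 (ltW C0)))// [leRHS]mulrC (ler_wpM2l (ltW e0))//.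
rewrite lef_pV2 ?posrE ?exprn_gt0// [leRHS]exprS ler_peMl ?exprn_ge0 ?(ltW s0)//; lra.
Qed.

(** The substitution w = z - x reduces this to the moments of orders 0 to 3 of e^(-w^2) on w <= -
    x. *)
Lemma cubic_shift (x : R) :
  mu.-integrable `]-oo, 0] (EFin \o (fun z : R => z ^+ 3 * (expR (2 * x * z) * expR (- z ^+ 2)))) /\
  \int[mu]_(z in `]-oo, 0]) (z ^+ 3 * (expR (2 * x * z) * expR (- z ^+ 2))) =
  mills x * (3 * x / 2 + x ^+ 3) - (x ^+ 2 + 1) / 2.
Proof.
have mD : measurable (`]-oo, - x]%classic : set LT) by [].
pose mm k (w : R) := w ^+ k * expR (- w ^+ 2).
have im k : mu.-integrable `]-oo, - x] (EFin \o mm k) by exact: intg_mongauss1.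
pose F w := mm 3 w + 3 * x * mm 2 w + 3 * x ^+ 2 * mm 1 w + x ^+ 3 * mm 0 w.
have iF1 := intgD mD (im 3) (intgZ (3 * x) mD (im 2)).
have iF2 := intgD mD iF1 (intgZ (3 * x ^+ 2) mD (im 1)).
have iF : mu.-integrable `]-oo, - x] (EFin \o F) := intgD mD iF2 (intgZ (x ^+ 3) mD (im 0)).
have E : affine (- x) 1 @^-1` `]-oo, - x] = `]-oo, 0]%classic :> set LT.
  by apply/seteqP; split => z /=; rewrite /affine !in_itv/= mul1r gerDl.
have i1 := intg_affine (- x) ltr01 mD iF.
have e1 := Rintegral_affine (- x) ltr01 mD iF.
rewrite E in i1 e1; rewrite mul1r in e1.
have pt (z : R) : expR (x ^+ 2) * F (affine (- x) 1 z) = z ^+ 3 * (expR (2 * x * z) * expR (- z ^+ 2)).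
  have -> : F (affine (- x) 1 z) = z ^+ 3 * expR (- (affine (- x) 1 z) ^+ 2).
    by rewrite /F /mm /affine; ring.
  by rewrite mulrCA -!expRD; congr (_ * expR _); rewrite /affine; ring.
split.
  apply: (eq_intg mN _ (intgZ (expR (x ^+ 2)) mN i1)) => z _; exact: pt.
transitivity (expR (x ^+ 2) * \int[mu]_(w in `]-oo, - x]) F w).
  rewrite e1 -(RintegralZl _ mN i1); apply: eq_Rintegral => z _; exact/esym/pt.
rewrite (RintegralD mD iF2 (intgZ (x ^+ 3) mD (im 0))) (RintegralD mD iF1 (intgZ (3 * x ^+ 2) mD (im 1))).
rewrite (RintegralD mD (im 3) (intgZ (3 * x) mD (im 2))).
have eZ k c : \int[mu]_(w in `]-oo, - x]) (c * mm k w) = c * \int[mu]_(w in `]-oo, - x]) mm k w.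
  by rewrite RintegralZl.
have em k : \int[mu]_(w in `]-oo, - x]) mm k w = (-1) ^+ k * \int[mu]_(t in `[x, +oo[) (t ^+ k * expR (- t ^+ 2)).
  exact: lower_moment.
rewrite (eZ 2) (eZ 1) (eZ 0) !em gtail_moment3 gtail_moment2 gtail_moment1.
have -> : \int[mu]_(t in `[x, +oo[) (t ^+ 0 * expR (- t ^+ 2)) = gtail x.
  by apply: eq_Rintegral => z _; rewrite expr0 mul1r.
by rewrite /mills expRN; field; rewrite lt0r_neq0// expR_gt0.
Qed.

(** Minus the mean of z^3 under the tilted weight e^(2 x z - z^2) on z <= 0. *)
Definition outer_lim (x : R) : R :=
  expR (- x ^+ 2) / gtail x * (x ^+ 2 + 1) / 2 - 3 * x / 2 - x ^+ 3.

Lemma mills_low : exists2 c : R, 0 < c & forall x, 0 <= x -> c / (1 + x) <= mills x.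
Proof.
have c0 := expR_gt0 (- 1 : R).
have c1 : expR (- 1) <= 1 :> R by rewrite -[leRHS]expR0 ler_expR; lra.
exists (expR (- 1) ^+ 2 * expR (- 2)); first by rewrite mulr_gt0 ?exprn_gt0 ?expR_gt0.
move=> x xge; have [i0 e0] := gtail_shift x.
rewrite /mills -e0; apply: (expM_lower c0 c1 xge i0); first by move=> z; exact: expR_ge0.
move=> z zd; rewrite ler_expR lerN2 -real_normK ?num_real//.
by rewrite expr_le1// (le_trans zd).
Qed.

(** The closed form hides a cancellation of growing terms. The decay is read off the third moment
    divided by [mills]. *)
Lemma intg_outer_lim : mu.-integrable `[0, +oo[ (EFin \o outer_lim).
Proof.
have [C C0 h3] := exp_moment 3 (@ltr01 R).
have [c c0 hc] := mills_low.
have mD : measurable (`[0, +oo[%classic : set LT) by [].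
have cg : continuous outer_lim.
  move=> x; apply: cvgB; last exact: exprn_continuous.
  apply: cvgB; last first.
    by apply: cvgM; [apply: cvgM; [exact: cvg_cst|exact: cvg_id]|exact: cvg_cst].
  apply: cvgM; last exact: cvg_cst.
  apply: cvgM; last by apply: cvgD; [exact: exprn_continuous|exact: cvg_cst].
  apply: cvgM; first exact: continuous_gauss1.
  by apply: cvgV; [rewrite lt0r_neq0// gtail_gt0|exact: continuous_gtail].
have mg : measurable_fun (`[0, +oo[%classic : set LT) outer_lim := measurable_funTS (measurable_cont cg).
refine (intg_le mD mg (intgZ (C / c) mD intg_inv1_sqr) _) => x.
rewrite /= in_itv/= andbT => xge.
have s0 : 0 < 1 + x by lra.
have [ic ec] := cubic_shift x.
have [|_ h] := h3 x _ xge (intg_mfun ic).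
  by move=> z _; rewrite /gs mul1r normrM normrX (ger0_norm (mulr_ge0 (expR_ge0 _) (expR_ge0 _))).
have m0 := mills_gt0 x; have g0 := gtail_gt0 x.
have -> : outer_lim x = - (\int[mu]_(z in `]-oo, 0]) (z ^+ 3 * (expR (2 * x * z) * expR (- z ^+ 2)))) / mills x.
  rewrite ec /outer_lim /mills expRN; field.
  by rewrite (lt0r_neq0 g0) lt0r_neq0// expR_gt0.
rewrite normrM normrN normfV (gtr0_norm m0) ler_pdivrMr//.
apply: (le_trans h).
apply: (@le_trans _ _ (C / c / (1 + x) ^+ 2 * (c / (1 + x)))); last first.
  by rewrite ler_wpM2l ?hc// divr_ge0 ?exprn_ge0 ?(ltW s0)// divr_ge0 ?ltW.
have -> : C / c / (1 + x) ^+ 2 * (c / (1 + x)) = C * ((1 + x) ^+ 3)^-1.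
  by field; rewrite (lt0r_neq0 s0) (lt0r_neq0 c0).
rewrite (ler_wpM2l (ltW C0))// lef_pV2 ?posrE ?exprn_gt0//.
by rewrite [leRHS]exprS ler_peMl ?exprn_ge0 ?(ltW s0)//; lra.
Qed.

Variable e_ : nat -> R.
Hypothesis e_01 : forall n, 0 < e_ n <= 1.
Hypothesis e_cvg : e_ @ \oo --> (0 : R).

Let e_gt0 n : 0 < e_ n.
Proof. by have /andP[] := e_01 n. Qed.

Let e_neq0 n : e_ n != 0.
Proof. exact: lt0r_neq0. Qed.

Lemma quotM_cvg (x : R) : 0 <= x ->
  (fun n => (Ml (e_ n) x - mills x) / e_ n) @ \oo -->
  - P3 0 / 6 * (mills x * (3 * x / 2 + x ^+ 3) - (x ^+ 2 + 1) / 2).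
Proof.
move=> xge.
have [m [K [c [[m0 K0 c0 c1] [hg hc hl]]]]] := lap_zero.
have [C C0 hM] := M_bounds.
have [ic ec] := cubic_shift x.
have [i0 e0] := gtail_shift x.
pose f_ n z := expR (2 * x * z) * ((lap (e_ n) z 0 - expR (- z ^+ 2)) / e_ n).
have ii n : mu.-integrable `]-oo, 0] (EFin \o (fun z => expR (2 * x * z) * lap (e_ n) z 0 - expR (2 * x * z) * expR (- z ^+ 2))).
  by apply: intgB => //; have [] := hM _ x (e_01 n) xge.
have mf n : measurable_fun (`]-oo, 0]%classic : set LT) (f_ n).
  have := intg_mfun (intgZ (e_ n)^-1 mN (ii n)).
  by apply: eq_measurable_fun => z _; rewrite /f_; ring.
have cf (z : R) : (`]-oo, 0]%classic : set LT) z -> f_ ^~ z @ \oo -->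
   - P3 0 / 6 * (z ^+ 3 * (expR (2 * x * z) * expR (- z ^+ 2))).
  move=> _; have := @lap_cvg1 _ _ _ _ _ _ _ _ _ _ dP dP1 dP2 dP3 dP4 cP5 Xx0 x00 B0 _ e_01 e_cvg 0 z (lexx _) P20.
  under eq_fun do rewrite mulr0.
  move=> h; have -> : - P3 0 / 6 * (z ^+ 3 * (expR (2 * x * z) * expR (- z ^+ 2))) =
    expR (2 * x * z) * (- (0 * P3 0 / 2 * z ^+ 2 + P3 0 / 6 * z ^+ 3) * expR (- z ^+ 2)) by field.
  by apply: cvgM => //; exact: cvg_cst.
have mE : measurable_fun (`]-oo, 0]%classic : set LT) (fun z : R => `|z| ^+ 3 * (expR (2 * x * z) * gs m z)).
  apply: measurable_funTS; apply: measurable_cont => z; apply: cvgM.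
    apply: (@continuous_comp _ _ _ (fun z : R => `|z|) (fun z => z ^+ 3)); last exact: exprn_continuous.
    exact: norm_continuous.
  apply: cvgM; last exact: continuous_gs.
  apply: (@continuous_comp _ _ _ (fun z : R => 2 * x * z) expR); last exact: continuous_expR.
  by apply: cvgM; [exact: cvg_cst|exact: cvg_id].
have [C3 C30 h3] := exp_moment 3 m0.
have [ig _] := h3 x _ xge mE (fun z _ => ltac:(by rewrite ger0_norm// !mulr_ge0 ?exprn_ge0 ?expR_ge0)).
have bf n (z : R) : (`]-oo, 0]%classic : set LT) z -> `|f_ n z| <= K * (`|z| ^+ 3 * (expR (2 * x * z) * gs m z)).
  move=> _; have [_ l2 _] := hl _ z (e_01 n).
  rewrite /f_ normrM (ger0_norm (expR_ge0 _)) normrM normfV (gtr0_norm (e_gt0 n)).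
  rewrite [leRHS](_ : _ = expR (2 * x * z) * (K * `|z| ^+ 3 * gs m z)); last by ring.
  rewrite ler_wpM2l ?expR_ge0// ler_pdivrMr// (le_trans l2)//.
  by rewrite le_eqVlt; apply/orP; left; apply/eqP; ring.
have [_] := Rdominated mN mf cf (intgZ K mN ig) bf.
rewrite RintegralZl// ec.
rewrite (_ : (fun n => _) = (fun n => (Ml (e_ n) x - mills x) / e_ n)) //.
apply/funext => n; rewrite /f_ /Ml /mills -e0.
have [iM _ _ _] := hM _ x (e_01 n) xge.
rewrite -RintegralB// -RintegralZr//; apply: eq_Rintegral => z _; ring.
Qed.

Lemma out_cvg (x : R) : 0 <= x ->
  (fun n => (ln (Ml (e_ n) x) - ln (mills x)) / e_ n) @ \oo --> P3 0 / 6 * outer_lim x.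
Proof.
move=> xge; have m0 := mills_gt0 x; have g0 := gtail_gt0 x.
have := chain_quot (is_derive_lnr m0) e_neq0 e_cvg (quotM_cvg xge).
have -> : (mills x)^-1 * (- P3 0 / 6 * (mills x * (3 * x / 2 + x ^+ 3) - (x ^+ 2 + 1) / 2)) =
  P3 0 / 6 * outer_lim x.
  rewrite /outer_lim /mills expRN; field.
  by rewrite (lt0r_neq0 g0) lt0r_neq0// expR_gt0.
exact.
Qed.

(** The endpoint moves with n; the integrand is extended by zero to the half-line, where [out_bound]
    dominates it. *)
Theorem outer_limit (A_ : nat -> R) : (A_ n) @[n --> \oo] --> +oo ->
  (fun n => (\int[mu]_(x in `[0, A_ n]) (ln (Ml (e_ n) x) - ln (mills x))) / e_ n) @ \oo -->
  P3 0 / 6 * \int[mu]_(x in `[0, +oo[) outer_lim x.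
Proof.
move=> Ay.
have [C C0 hb] := out_bound.
have mD : measurable (`[0, +oo[%classic : set LT) by [].
pose f_ n x := if x <= A_ n then (ln (Ml (e_ n) x) - ln (mills x)) / e_ n else 0.
have cf n : continuous (fun x => (ln (Ml (e_ n) x) - ln (mills x)) / e_ n).
  move=> x; apply: cvgM; last exact: cvg_cst.
  apply: cvgB; first exact: (continuous_lnM dP Xx0 x00 B0).
  apply: (@continuous_comp _ _ _ mills (@ln R)); first exact: continuous_mills.
  by apply: continuous_ln; exact: mills_gt0.
have mf n : measurable_fun (`[0, +oo[%classic : set LT) (f_ n).
  apply: measurable_funTS; apply: measurable_fun_ifT => //.
    exact: measurable_fun_ler.
  by apply: measurable_cont; exact: cf.
have cvf x : (`[0, +oo[%classic : set LT) x -> f_ ^~ x @ \oo --> P3 0 / 6 * outer_lim x.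
  rewrite /= in_itv/= andbT => xge; have := out_cvg xge.
  apply: cvg_trans; apply: near_eq_cvg; near=> n.
  rewrite /f_ ifT//; near: n.
  by move/cvgryPge : Ay => /(_ x).
have bf n x : (`[0, +oo[%classic : set LT) x -> `|f_ n x| <= C * ((1 + x) ^+ 2)^-1.
  rewrite /= in_itv/= andbT => xge; rewrite /f_; case: ifPn => _; first exact: hb.
  by rewrite normr0 mulr_ge0 ?(ltW C0)// invr_ge0 sqr_ge0.
have [_] := Rdominated mD mf cvf (intgZ C mD intg_inv1_sqr) bf.
rewrite RintegralZl//; last exact: intg_outer_lim.
rewrite (_ : (fun n => _) = (fun n => (\int[mu]_(x in `[0, A_ n]) (ln (Ml (e_ n) x) - ln (mills x))) / e_ n)) //.
apply/funext => n.
have mI : measurable (`[0, A_ n]%classic : set LT) by [].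
have ci : mu.-integrable `[0, A_ n] (EFin \o (fun x => ln (Ml (e_ n) x) - ln (mills x))).
  have i : mu.-integrable `[0, A_ n] (EFin \o (fun x => (ln (Ml (e_ n) x) - ln (mills x)) / e_ n)).
    by apply: continuous_compact_integrable; [exact: segment_compact|exact: continuous_subspaceT].
  apply: (eq_intg mI _ (intgZ (e_ n) mI i)) => x _.
  by field; exact: e_neq0.
rewrite -RintegralZr// Rintegral_mkcond [RHS]Rintegral_mkcond; apply: eq_Rintegral => x _.
rewrite !patchE.
have m1 : (x \in (`[0, +oo[%classic : set LT)) = (0 <= x).
  by apply/idP/idP; rewrite inE/= in_itv/= andbT.
have m2 : (x \in (`[0, A_ n]%classic : set LT)) = (0 <= x <= A_ n).
  by apply/idP/idP; rewrite inE/= in_itv/=.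
by rewrite m1 m2 /f_; case: (0 <= x).
Unshelve. all: end_near. Qed.

End outside.

(** * The universal constants *)

Section constants.
Context {R : realType}.
Notation mu := (@lebesgue_measure R).
Notation LT := (measurableTypeR R).

Let mN : measurable (`]-oo, 0]%classic : set LT). Proof. by []. Qed.
Let mP : measurable (`[0, +oo[%classic : set LT). Proof. by []. Qed.

Let sqpi_gt0 : 0 < Num.sqrt pi :> R.
Proof. by rewrite sqrtr_gt0 pi_gt0. Qed.

Lemma PhiE : @Phi R = lnPhi.
Proof.
apply/funext => x; rewrite /lnPhi /Phi -ln_div ?posrE ?gtail_gt0//; congr ln.
by rewrite /erfc -/(gtail x); field; exact: lt0r_neq0.
Qed.

Lemma lnPhi0 : lnPhi 0 = - ln 2 :> R.
Proof.
rewrite /lnPhi gtail0 -ln_div ?posrE ?divr_gt0//.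
by rewrite mulrAC divff ?lt0r_neq0// mul1r lnV ?posrE.
Qed.

Lemma lnPhi_mills (x : R) : lnPhi x = ln (mills x) - x ^+ 2 - ln (Num.sqrt pi).
Proof.
rewrite /lnPhi; congr (_ - _).
by rewrite /mills lnM ?posrE ?expR_gt0 ?gtail_gt0// expRK; ring.
Qed.

Lemma is_derive_lnPhi (x : R) : is_derive x 1 lnPhi (- (mills x)^-1).
Proof.
have g0 := gtail_gt0 x.
have h1 := is_derive_gtail x.
have h2 := is_derive_lnr g0.
have h : is_derive x 1 (@ln R \o gtail) ((gtail x)^-1 * - expR (- x ^+ 2)).
  exact: is_derive1_comp.
have hc := is_derive_cst (ln (Num.sqrt pi) : R) x (1 : R).
have := is_deriveB h hc => h3; apply: (is_derive_eq h3).
by rewrite subr0 /mills expRN; field; rewrite (lt0r_neq0 g0) lt0r_neq0// expR_gt0.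
Qed.

Lemma derive1_Phi (x : R) : derive1 (@Phi R) x = - (mills x)^-1.
Proof. by rewrite PhiE derive1E; case: (is_derive_lnPhi x). Qed.

Lemma continuous_millsV : continuous (fun x : R => (mills x)^-1).
Proof.
by move=> x; apply: cvgV; [rewrite lt0r_neq0// mills_gt0|exact: continuous_mills].
Qed.

Lemma millsV_le (x : R) : x <= 0 -> (mills x)^-1 <= 2 / Num.sqrt pi * expR (- x ^+ 2).
Proof.
move=> x0; have := gtail_ge_half x0 => h.
rewrite /mills invfM -expRN mulrC ler_wpM2r ?expR_ge0//.
by rewrite -invf_div lef_pV2 ?posrE ?gtail_gt0// divr_gt0.
Qed.

Lemma gtail_le (x : R) : 0 <= x -> gtail x <= Num.sqrt pi * expR (- x ^+ 2).
Proof.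
move=> x0; have [i e] := gtail_shift x.
have : expR (x ^+ 2) * gtail x <= Num.sqrt pi.
  rewrite -e; apply: (@le_trans _ _ (\int[mu]_(z in `]-oo, 0]) expR (- z ^+ 2))).
    apply: le_Rintegral => //; first exact: intg_gauss1.
    move=> z; rewrite /= in_itv/= => z0; rewrite ler_piMl ?expR_ge0//.
    by rewrite -[leRHS]expR0 ler_expR mulr_ge0_le0// mulr_ge0.
  by have := @gtail_opp R 0; rewrite oppr0 => ->; rewrite ltW// gtail_lt_total.
by rewrite mulrC -ler_pdivlMr ?expR_gt0// expRN.
Qed.

Lemma lnPhi_le (x : R) : x <= 0 -> `|lnPhi x| <= 2 * expR (- x ^+ 2).
Proof.
move=> x0; have h := gtail_ge_half x0.
have c0 : 0 < Num.sqrt pi / 2 :> R by rewrite divr_gt0.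
have h1 : Num.sqrt pi / 2 <= Num.sqrt pi :> R by move: sqpi_gt0 => h1; lra.
apply: (le_trans (ln_lip c0 h h1)).
have -> : gtail x - Num.sqrt pi = - gtail (- x) by rewrite -(gtail_add x); ring.
rewrite normrN gtr0_norm ?gtail_gt0// ler_pdivrMr//.
have : gtail (- x) <= Num.sqrt pi * expR (- (- x) ^+ 2) by apply: gtail_le; rewrite oppr_ge0.
by rewrite sqrrN; lra.
Qed.

Lemma intg_half (k : nat) (C : R) (f : R -> R) : continuous f ->
  (forall x, x <= 0 -> `|f x| <= C * (`|x| ^+ k * expR (- x ^+ 2))) ->
  mu.-integrable `]-oo, 0] (EFin \o f).
Proof.
move=> cf hf.
have mf : measurable_fun (`]-oo, 0]%classic : set LT) f := measurable_funTS (measurable_cont cf).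
have ig := intgZ (C * (-1) ^+ k) mN (intg_mongauss1 k mN).
refine (intg_le mN mf ig _) => x.
rewrite /= in_itv/= => x0; apply: (le_trans (hf x x0)).
by rewrite -!mulrA ler0_norm// [(- x) ^+ k]exprNn -mulrA.
Qed.

Lemma intg_pow_millsV (k : nat) :
  mu.-integrable `]-oo, 0] (EFin \o (fun x : R => x ^+ k * (mills x)^-1)).
Proof.
apply: (@intg_half k (2 / Num.sqrt pi)).
  by move=> x; apply: cvgM; [exact: exprn_continuous|exact: continuous_millsV].
move=> x x0; rewrite normrM normrX [`|_^-1|]gtr0_norm ?invr_gt0 ?mills_gt0//.
by rewrite mulrCA ler_wpM2l ?exprn_ge0// millsV_le.
Qed.

Lemma intg_pow_lnPhi (k : nat) :
  mu.-integrable `]-oo, 0] (EFin \o (fun x : R => x ^+ k * lnPhi x)).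
Proof.
apply: (@intg_half k 2).
  by move=> x; apply: cvgM; [exact: exprn_continuous|exact: continuous_lnPhi].
move=> x x0; rewrite normrM normrX.
by rewrite mulrCA ler_wpM2l ?exprn_ge0// lnPhi_le.
Qed.

Lemma cvg_gauss_neg (k : nat) (C : R) (f : R -> R) :
  (forall x, x <= 0 -> `|f x| <= C * (`|x| ^+ k * expR (- x ^+ 2))) ->
  f (0 - n%:R) @[n --> \oo] --> (0 : R).
Proof.
move=> hf.
apply: (@cvg_shift_squeeze _ _ (fun n => C * ((0 + n%:R) ^+ k * expR (- (0 + n%:R) ^+ 2)))).
  rewrite -(mulr0 C); apply: cvgM; [exact: cvg_cst|exact: cvg_mongauss1].
move=> n; rewrite subr0 sub0r add0r.
have n0 : - n%:R <= 0 :> R by rewrite oppr_le0.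
by rewrite (le_trans (hf _ n0))// normrN normr_nat sqrrN.
Qed.

Lemma int_millsV_neg : \int[mu]_(x in `]-oo, 0]) (mills x)^-1 = ln 2.
Proof.
rewrite -[RHS]opprK -lnPhi0.
have i := intg_pow_millsV 0.
have i' : mu.-integrable `]-oo, 0] (EFin \o (fun x : R => (mills x)^-1)).
  by apply: (eq_intg mN _ i) => x _; rewrite expr0 mul1r.
have dF (x : R) : x <= 0 -> is_derive x 1 (fun x => - lnPhi x) (mills x)^-1.
  by move=> _; have h := is_derive_lnPhi x; apply: is_derive_eq; rewrite opprK.
have cF (x : R) : x <= 0 -> {for x, continuous (fun x : R => (mills x)^-1)}.
  by move=> _; exact: continuous_millsV.
rewrite (Rint_FTCNy (l := 0) i' dF cF) ?subr0//.
apply: (@cvg_gauss_neg 0 2 (fun x => - lnPhi x)) => x x0.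
by rewrite expr0 mul1r normrN lnPhi_le.
Qed.

Lemma int_x_lnPhi : \int[mu]_(x in `]-oo, 0]) (x * lnPhi x) =
  2^-1 * \int[mu]_(x in `]-oo, 0]) (x ^+ 2 * (mills x)^-1).
Proof.
have i1 := intg_pow_lnPhi 1; have i2 := intg_pow_millsV 2.
have i1' : mu.-integrable `]-oo, 0] (EFin \o (fun x : R => x * lnPhi x)).
  by apply: (eq_intg mN _ i1) => x _; rewrite expr1.
have i3 := intgB mN i1' (intgZ 2^-1 mN i2).
pose F (x : R) := 2^-1 * x ^+ 2 * lnPhi x.
have dF (x : R) : x <= 0 -> is_derive x 1 F (x * lnPhi x - 2^-1 * (x ^+ 2 * (mills x)^-1)).
  move=> _; have h := is_derive_lnPhi x.
  have h2 : is_derive x 1 (fun x : R => 2^-1 * x ^+ 2) x.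
    by apply: is_derive_eq; rewrite /GRing.scale/=; field.
  have h3 := is_deriveM h2 h; apply: (is_derive_eq h3).
  by rewrite /GRing.scale/=; ring.
have cF (x : R) : x <= 0 -> {for x, continuous (fun x : R => x * lnPhi x - 2^-1 * (x ^+ 2 * (mills x)^-1))}.
  move=> _; apply: cvgB.
    by apply: cvgM; [exact: cvg_id|exact: continuous_lnPhi].
  apply: cvgM; first exact: cvg_cst.
  by apply: cvgM; [exact: exprn_continuous|exact: continuous_millsV].
have lF : F (0 - n%:R) @[n --> \oo] --> (0 : R).
  apply: (@cvg_gauss_neg 2 1) => x x0.
  rewrite /F !normrM normfV -normrM -expr2 (ger0_norm (_ : 0 <= 2))// mul1r.
  have := lnPhi_le x0; have := sqr_ge0 `|x|.
  rewrite normrX => h1 h2; have := ler_wpM2l h1 h2; lra.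
have := Rint_FTCNy i3 dF cF lF.
rewrite RintegralB//; last exact: intgZ.
rewrite RintegralZl// [F 0](_ : _ = 0) ?subr0; last by rewrite /F expr2 !mulr0 mul0r.
by move=> /eqP; rewrite subr_eq0 => /eqP ->.
Qed.

Let R2 (f g : R -> R) (D : set LT) (a b : R) : measurable D ->
  mu.-integrable D (EFin \o f) -> mu.-integrable D (EFin \o g) ->
  \int[mu]_(x in D) (a * f x + b * g x) = a * \int[mu]_(x in D) f x + b * \int[mu]_(x in D) g x.
Proof.
by move=> mD fi gi; rewrite RintegralD//; [rewrite !RintegralZl//|exact: intgZ|exact: intgZ].
Qed.

Let i0 : mu.-integrable `]-oo, 0] (EFin \o (fun x : R => (mills x)^-1)).
Proof. by apply: (eq_intg mN _ (intg_pow_millsV 0)) => x _; rewrite expr0 mul1r. Qed.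

(** Integration by parts turns x [lnPhi] into (x^2 / 2) / [mills], and 1/6 - x^2/3 + x^2/2 = (x^2 +
    1) / 6. *)
Lemma beta_inE : @beta_in R = \int[mu]_(x in `]-oo, 0]) inner_lim x.
Proof.
have i2 := intg_pow_millsV 2.
have il : mu.-integrable `]-oo, 0] (EFin \o (fun x : R => x * lnPhi x)).
  by apply: (eq_intg mN _ (intg_pow_lnPhi 1)) => x _; rewrite expr1.
have -> : \int[mu]_(x in `]-oo, 0]) inner_lim x =
   \int[mu]_(x in `]-oo, 0]) (6^-1 * (mills x)^-1 + - 3^-1 * (x ^+ 2 * (mills x)^-1) + x * lnPhi x).
  apply: eq_Rintegral => x _; rewrite /inner_lim /mills expRN; field.
  by rewrite (lt0r_neq0 (gtail_gt0 _)) lt0r_neq0// expR_gt0.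
rewrite RintegralD//; last by apply: intgD => //; exact: intgZ.
rewrite R2// int_x_lnPhi.
have -> : @beta_in R = - \int[mu]_(x in `]-oo, 0]) (- 6^-1 * (mills x)^-1 + - 6^-1 * (x ^+ 2 * (mills x)^-1)).
  rewrite /beta_in; congr (- _); apply: eq_Rintegral => x _.
  by rewrite derive1_Phi; field; rewrite lt0r_neq0// mills_gt0.
by rewrite R2//; field.
Qed.

(** Since (2 - x^2) / 3 = 1 - 2 (x^2 + 1) / 6, what remains is the integral of 1 / [mills] = - Phi'.
    The term 2 beta^in matches the constant 2 in p3 / p2 = 2 + r (derivative of the Laplacian) /
    (Laplacian). *)
Lemma alpha_inE : @alpha_in R = ln 2 - 2 * @beta_in R.
Proof.
have i2 := intg_pow_millsV 2.
have -> : @alpha_in R = \int[mu]_(x in `]-oo, 0]) (2 / 3 * (mills x)^-1 + - 3^-1 * (x ^+ 2 * (mills x)^-1)).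
  apply: eq_Rintegral => x _.
  by rewrite derive1_Phi; field; rewrite lt0r_neq0// mills_gt0.
have -> : @beta_in R = - \int[mu]_(x in `]-oo, 0]) (- 6^-1 * (mills x)^-1 + - 6^-1 * (x ^+ 2 * (mills x)^-1)).
  rewrite /beta_in; congr (- _); apply: eq_Rintegral => x _.
  by rewrite derive1_Phi; field; rewrite lt0r_neq0// mills_gt0.
by rewrite !R2// int_millsV_neg; field.
Qed.

Lemma gamma_inE : \int[mu]_(x in `]-oo, 0]) lnPhi x = - (Num.sqrt 2 * @gamma_in R).
Proof.
by rewrite /gamma_in PhiE mulNr mulrN opprK mulVKf// lt0r_neq0// sqrtr_gt0.
Qed.

(** The third moment of the tilted weight on z <= 0 is nonpositive; its closed form is this
    bound. *)
Lemma mills_le (x : R) : 0 < x -> 2 * x * mills x <= 1 - (2 * x ^+ 2 + 3)^-1.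
Proof.
move=> x0; have [i e] := cubic_shift x.
have : \int[mu]_(z in `]-oo, 0]) (z ^+ 3 * (expR (2 * x * z) * expR (- z ^+ 2))) <= 0.
  rewrite -oppr_ge0 -RintegralN//; apply: Rintegral_ge0 => z.
  rewrite /= in_itv/= => z0; rewrite -mulNr mulr_ge0 ?mulr_ge0 ?expR_ge0//.
  have -> : - z ^+ 3 = (- z) ^+ 3 by ring.
  by rewrite exprn_ge0// oppr_ge0.
rewrite e => h; have q0 : 0 < 2 * x ^+ 2 + 3 by rewrite addr_gt0// mulr_gt0// exprn_gt0.
have -> : 1 - (2 * x ^+ 2 + 3)^-1 = (2 * x ^+ 2 + 2) / (2 * x ^+ 2 + 3) by field; exact: lt0r_neq0.
rewrite ler_pdivlMr//; lra.
Qed.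

(** The right-hand side is the integral of (t - x)^2 e^(-t^2) over t >= x. *)
Lemma square_moment (x : R) :
  0 <= gtail x * (2^-1 + x ^+ 2) - x * expR (- x ^+ 2) / 2.
Proof.
have mD : measurable (`[x, +oo[%classic : set LT) by [].
pose mm k (w : R) := w ^+ k * expR (- w ^+ 2).
have im k : mu.-integrable `[x, +oo[ (EFin \o mm k) by exact: intg_mongauss1.
have : 0 <= \int[mu]_(t in `[x, +oo[) (mm 2 t + (- (2 * x) * mm 1 t + x ^+ 2 * mm 0 t)).
  apply: Rintegral_ge0 => t _.
  have -> : mm 2 t + (- (2 * x) * mm 1 t + x ^+ 2 * mm 0 t) = (t - x) ^+ 2 * expR (- t ^+ 2).
    by rewrite /mm; ring.
  by rewrite mulr_ge0 ?expR_ge0 ?sqr_ge0.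
rewrite RintegralD//; last by apply: intgD => //; exact: intgZ.
rewrite (@R2 (mm 1) (mm 0))// gtail_moment2 gtail_moment1.
have -> : \int[mu]_(t in `[x, +oo[) mm 0 t = gtail x.
  by apply: eq_Rintegral => z _; rewrite /mm expr0 mul1r.
lra.
Qed.

Lemma mills_ge (x : R) : 0 < x -> 1 - (2 * x ^+ 2 + 1)^-1 <= 2 * x * mills x.
Proof.
move=> x0; have q0 : 0 < 2 * x ^+ 2 + 1 by rewrite addr_gt0// mulr_gt0// exprn_gt0.
have -> : 1 - (2 * x ^+ 2 + 1)^-1 = (2 * x ^+ 2) / (2 * x ^+ 2 + 1) by field; exact: lt0r_neq0.
rewrite ler_pdivrMr//.
have := mulr_ge0 (expR_ge0 (x ^+ 2)) (square_moment x).
have -> : expR (x ^+ 2) * (gtail x * (2^-1 + x ^+ 2) - x * expR (- x ^+ 2) / 2) =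
   mills x * (2^-1 + x ^+ 2) - x / 2.
  by rewrite /mills expRN; field; rewrite lt0r_neq0// expR_gt0.
move=> h; have := mulr_ge0 (ltW x0) h; lra.
Qed.

(* the integrand of gamma_out; it is integrable because 2 x mills x tends to 1 *)
Definition lmills (x : R) : R := ln (2 * x * mills x).

Lemma lmills_bounds (x : R) : 0 < x -> - (2 * x ^+ 2)^-1 <= lmills x <= - (2 * x ^+ 2 + 3)^-1.
Proof.
move=> x0; have x20 : 0 < 2 * x ^+ 2 by rewrite mulr_gt0// exprn_gt0.
have m0 : 0 < 2 * x * mills x by exact: mulr_gt0 (mulr_gt0 (ltr0Sn _ _) x0) (mills_gt0 x).
apply/andP; split.
  rewrite lerNl /lmills -lnV ?posrE//.
  have h : (2 * x * mills x)^-1 <= 1 + (2 * x ^+ 2)^-1.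
    have -> : 1 + (2 * x ^+ 2)^-1 = (1 - (2 * x ^+ 2 + 1)^-1)^-1.
      by field; rewrite !lt0r_neq0//; lra.
    rewrite lef_pV2 ?posrE ?mills_ge// subr_gt0 invf_lt1; lra.
  rewrite (le_trans _ (le_ln1Dx _))//; last by rewrite (lt_trans _ (_ : 0 < _))// invr_gt0.
  by rewrite ler_ln ?posrE ?invr_gt0// addr_gt0// invr_gt0.
have h := mills_le x0.
have q0 : 0 < 2 * x ^+ 2 + 3 by lra.
rewrite (le_trans _ (le_ln1Dx _))//; last first.
  by rewrite ltrN2 invf_lt1//; lra.
rewrite ler_ln ?posrE//.
by apply: lt_le_trans h.
Qed.

(** The bounds of [lmills_bounds] differ by O(x^(-4)), which identifies the leading tail - 1 / (2
    x^2). *)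
Lemma lmills_asym (x : R) : 0 < x -> `|lmills x + (2 * x ^+ 2)^-1| <= (x ^+ 2 * x ^+ 2)^-1.
Proof.
move=> x0; have /andP[h1 h2] := lmills_bounds x0.
have x20 : 0 < x ^+ 2 by rewrite exprn_gt0.
have q0 : 0 < 2 * x ^+ 2 + 3 by lra.
rewrite ger0_norm; last by lra.
apply: (@le_trans _ _ ((2 * x ^+ 2)^-1 - (2 * x ^+ 2 + 3)^-1)); first lra.
have -> : (2 * x ^+ 2)^-1 - (2 * x ^+ 2 + 3)^-1 = 3 / (2 * x ^+ 2 * (2 * x ^+ 2 + 3)).
  by field; rewrite !lt0r_neq0.
rewrite ler_pdivrMr ?mulr_gt0//.
have -> : (x ^+ 2 * x ^+ 2)^-1 * (2 * x ^+ 2 * (2 * x ^+ 2 + 3)) = 4 + 6 / x ^+ 2.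
  by field; rewrite lt0r_neq0.
have : 0 < 6 / x ^+ 2 by rewrite divr_gt0.
lra.
Qed.

Lemma intg_setU (D1 D2 : set LT) (f : R -> R) : measurable D1 -> measurable D2 ->
  mu.-integrable D1 (EFin \o f) -> mu.-integrable D2 (EFin \o f) ->
  mu.-integrable (D1 `|` D2) (EFin \o f).
Proof.
move=> m1 m2 i1 i2.
have mD : measurable (D2 `\` D1) by exact: measurableD.
have i3 := intgS m2 mD (@subDsetl _ _ _) i2.
have mf : measurable_fun (D1 `|` D2) (EFin \o f).
  by apply/measurable_funU => //; split; [exact: measurable_int i1|exact: measurable_int i2].
have E : D1 `|` D2 = D1 `|` (D2 `\` D1).
  apply/seteqP; split => x; last by case=> [|[]]; [left|right].
  by have [?|?] := pselect (D1 x); [left|case=> ?; [left|right]].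
rewrite E in mf *.
apply/integrableP; split => //.
rewrite ge0_integral_setU//; last 2 first.
- exact: measurableT_comp.
- by apply/disj_set2P; rewrite setDE setICA setICr setI0.
by move: i1 i3 => /integrableP[_ h1] /integrableP[_ h3]; rewrite lte_add_pinfty.
Qed.

Lemma intg_on_01 (f : R -> R) : continuous f -> mu.-integrable `[0, 1] (EFin \o f).
Proof.
move=> cf; apply: continuous_compact_integrable; first exact: segment_compact.
exact: continuous_subspaceT.
Qed.

Let cover01 : `[0, +oo[%classic = `[0, 1]%classic `|` `[1, +oo[%classic :> set LT.
Proof.
apply/seteqP; split => x /=; rewrite !in_itv/= !andbT.
  by have [x1|x1] := leP x 1; [left; apply/andP|right; exact: ltW].
by move=> [/andP[]//|x1]; lra.
Qed.

Lemma intg_half_line (f : R -> R) (C : R) : measurable_fun (`[0, +oo[%classic : set LT) f ->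
  mu.-integrable `[0, 1] (EFin \o f) ->
  (forall x, 1 <= x -> `|f x| <= C * (x ^+ 2)^-1) ->
  mu.-integrable `[0, +oo[ (EFin \o f).
Proof.
move=> mf f01 fC.
have m1 : measurable (`[0, 1]%classic : set LT) by [].
have m2 : measurable (`[1, +oo[%classic : set LT) by [].
rewrite cover01; apply: (intg_setU m1 m2) => //.
have [i1 _] := @intg_inv_sqr R 1 ltr01.
have mf' : measurable_fun (`[1, +oo[%classic : set LT) f.
  by apply: (measurable_funS mP _ mf) => x; rewrite /= !in_itv/= !andbT; lra.
refine (intg_le m2 mf' (intgZ C m2 i1) _) => x.
by rewrite /= in_itv/= andbT; exact: fC.
Qed.

(** Monotone convergence over [1 / (n + 1), 1], where the primitive x - x ln x bounds the integrals
    of - ln by 1. *)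
Lemma intg_ln01 : mu.-integrable `]0, 1] (EFin \o @ln R).
Proof.
pose F (n : nat) : set LT := `[n.+1%:R^-1, 1]%classic.
have mF n : measurable (F n) by exact: measurable_itv.
have n0 (n : nat) : 0 < n.+1%:R^-1 :> R by rewrite invr_gt0.
have n1 (n : nat) : n.+1%:R^-1 <= 1 :> R by rewrite invf_le1// ler1n.
have mD : measurable (`]0, 1]%classic : set LT) by [].
have UF : \bigcup_n F n = `]0, 1]%classic.
  apply/seteqP; split => x /=.
    move=> [n _]; rewrite /F /= !in_itv/= => /andP[h1 h2].
    by rewrite (lt_le_trans (n0 n) h1).
  rewrite in_itv/= => /andP[x0 x1].
  have h := truncnS_gt x^-1.
  exists (Num.truncn x^-1) => //; rewrite /F /= in_itv/= x1 andbT.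
  by rewrite -[leRHS]invrK lef_pV2 ?posrE ?invr_gt0// ltW.
have iF n : mu.-integrable (F n) (EFin \o (fun x : R => - ln x)) /\
    \int[mu]_(x in F n) - ln x <= 1.
  have dF (x : R) : n.+1%:R^-1 <= x <= 1 -> is_derive x 1 (fun x : R => x - x * ln x) (- ln x).
    move=> /andP[x1 _]; have x0 : 0 < x by exact: lt_le_trans (n0 n) x1.
    have h := is_derive_lnr x0; have h2 := is_deriveM (is_derive_id x (1 : R)) h.
    apply: (is_derive_eq (is_deriveB (is_derive_id x (1 : R)) h2)).
    by rewrite /GRing.scale/=; field; exact: lt0r_neq0.
  have cF (x : R) : n.+1%:R^-1 <= x <= 1 -> {for x, continuous (fun x : R => - ln x)}.
    move=> /andP[x1 _]; have x0 : 0 < x by exact: lt_le_trans (n0 n) x1.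
    by apply: cvgN; exact: continuous_ln.
  have [i ->] := Rint_FTC (n1 n) dF cF; split => //.
  rewrite ln1 mulr0 subr0 lerBlDr lerDl subr_ge0.
  apply: (@le_trans _ _ 0); last exact: ltW.
  by rewrite mulr_ge0_le0 ?(ltW (n0 n))// ln_le0.
have f0 n (x : R) : F n x -> (0 <= (- ln x)%:E)%E.
  by rewrite /F /= in_itv/= lee_fin => /andP[_ x1]; rewrite oppr_ge0 ln_le0.
have ndF : nondecreasing_seq F.
  move=> m n mn; apply/subsetPset => x; rewrite /F /= !in_itv/= => /andP[h ->].
  by rewrite andbT (le_trans _ h)// lef_pV2 ?posrE// ler_nat ltnS.
have h := @ge0_nondecreasing_set_cvg_integral _ _ R F (fun x => (- ln x)%:E) mu ndF mF
   (fun n => measurable_int _ (iF n).1) f0.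
rewrite UF in h.
have b n : (\int[mu]_(x in F n) (- ln x)%:E <= 1)%E.
  have [i hb] := iF n; rewrite /Rintegral in hb.
  by rewrite -(fineK (integrable_fin_num _ i))// lee_fin.
have hl : (\int[mu]_(x in `]0%R, 1%R]) (- ln x)%:E <= 1)%E.
  rewrite -(cvg_lim _ h)//; apply: lime_le; last by near=> n; exact: b.
  by apply/cvg_ex; eexists; exact: h.
have ml : measurable_fun (`]0, 1]%classic : set LT) (@ln R) := measurable_funTS (@measurable_ln R).
apply/integrableP; split; first exact/measurable_EFinP.
apply: (@le_lt_trans _ _ 1%E); last exact: ltry.
apply: le_trans hl; rewrite le_eqVlt; apply/orP; left; apply/eqP.
apply: eq_integral => x; rewrite inE/= in_itv/= => /andP[_ x1].
by rewrite ler0_norm// ln_le0.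
Unshelve. all: end_near. Qed.

Lemma intg_ln (A : R) : 0 < A -> mu.-integrable `]0, A] (EFin \o @ln R) /\
  \int[mu]_(x in `]0, A]) ln x = A * ln A - A.
Proof.
move=> A0.
have mD : measurable (`]0, A]%classic : set LT) by [].
have m1 : measurable (`]0, 1]%classic : set LT) by [].
have mC : measurable (`[1, A]%classic : set LT) by [].
have mU : measurable (`]0, 1]%classic `|` `[1, A]%classic : set LT) by exact: measurableU.
have i : mu.-integrable `]0, A] (EFin \o @ln R).
  apply: (@intgS _ _ _ _ (`]0, 1]%classic `|` `[1, A]%classic : set LT) _ _ mU mD).
    move=> x /=; rewrite !in_itv/= => /andP[x0 xA].
    have [x1|x1] := leP x 1; [left|right; rewrite (ltW x1)//].
    by rewrite x0.
  apply: (intg_setU m1 mC) => //; first exact: intg_ln01.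
  apply: continuous_compact_integrable; first exact: segment_compact.
  apply: continuous_in_subspaceT => x; rewrite inE/= in_itv/= => /andP[x1 _].
  by apply: continuous_ln; lra.
split => //.
pose a (n : nat) : R := A / n.+1%:R.
have a0 n : 0 < a n by rewrite divr_gt0.
have aA n : a n <= A by rewrite ler_pdivrMr// ler_peMr ?(ltW A0)// ler1n.
pose F (n : nat) : set LT := `[a n, A]%classic.
have ex : (fun n => \int[mu]_(x in F n) ln x) @ \oo --> \int[mu]_(x in `]0, A]) ln x.
  apply: Rint_exhaust => //; first by move=> n; exact: measurable_itv.
    by move=> n x; rewrite /F /= !in_itv/= => /andP[h ->]; rewrite (lt_le_trans (a0 n) h).
  move=> x; rewrite /= in_itv/= => /andP[x0 xA]; near=> n.
  rewrite /F /= in_itv/= xA andbT /a ler_pdivrMr// mulrC -ler_pdivrMr//.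
  rewrite (@le_trans _ _ n%:R) ?ler_nat//.
  by near: n; exact: nbhs_infty_ger.
have eF n : \int[mu]_(x in F n) ln x = A * ln A - A - (a n * ln (a n) - a n).
  have dF (x : R) : a n <= x <= A -> is_derive x 1 (fun x : R => x * ln x - x) (ln x).
    move=> /andP[x1 _]; have x0 : 0 < x by exact: lt_le_trans (a0 n) x1.
    have h := is_derive_lnr x0; have h2 := is_deriveM (is_derive_id x (1 : R)) h.
    apply: (is_derive_eq (is_deriveB h2 (is_derive_id x (1 : R)))).
    by rewrite /GRing.scale/=; field; exact: lt0r_neq0.
  have cF (x : R) : a n <= x <= A -> {for x, continuous (@ln R)}.
    move=> /andP[x1 _]; have x0 : 0 < x by exact: lt_le_trans (a0 n) x1.
    exact: continuous_ln.
  by have [_ ->] := Rint_FTC (aA n) dF cF.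
have acv : a @ \oo --> (0 : R).
  rewrite -(mulr0 A); apply: cvgM; first exact: cvg_cst.
  exact: cvg_harmonic.
(* From ln y < y, applied to x when x >= 1 and to 1 / sqrt x when x < 1; it gives a_n ln a_n ->
   0. *)
have xlnx (x : R) : 0 < x -> `|x * ln x| <= x ^+ 2 + 2 * Num.sqrt x.
  move=> x0; have s0 : 0 < Num.sqrt x by rewrite sqrtr_gt0.
  have sx : Num.sqrt x ^+ 2 = x by rewrite sqr_sqrtr// ltW.
  have x20 := sqr_ge0 x.
  have [x1|x1] := leP 1 x.
    rewrite ger0_norm ?mulr_ge0 ?(ltW x0) ?ln_ge0//.
    have := ler_wpM2l (ltW x0) (ltW (ln_sublinear x0)); rewrite -expr2; lra.
  rewrite ler0_norm; last by rewrite mulr_ge0_le0 ?(ltW x0)// ln_le0// ltW.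
  have h := ln_sublinear (_ : 0 < (Num.sqrt x)^-1).
  rewrite invr_gt0 lnV ?posrE// in h; have h' := h s0.
  have e1 : ln x = 2 * ln (Num.sqrt x) by rewrite -{1}sx lnXn// mulr_natl.
  have : x * - ln (Num.sqrt x) <= x * (Num.sqrt x)^-1 by rewrite ler_wpM2l// ltW.
  have -> : x * (Num.sqrt x)^-1 = Num.sqrt x by rewrite -{1}sx; field; exact: lt0r_neq0.
  rewrite e1; lra.
have alcv : (fun n => a n * ln (a n)) @ \oo --> (0 : R).
  apply: (@cvg_shift_squeeze _ _ (fun n => a n ^+ 2 + 2 * Num.sqrt (a n))); last first.
    by move=> n; rewrite subr0 xlnx.
  have -> : 0 = 0 * 0 + 2 * Num.sqrt 0 :> R by rewrite sqrtr0; ring.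
  apply: cvgD; first by under eq_fun do rewrite expr2; exact: cvgM.
  apply: cvgM; first exact: cvg_cst.
  by apply: (cvg_comp _ _ acv); exact: sqrt_continuous.
have T : (fun n => \int[mu]_(x in F n) ln x) @ \oo --> A * ln A - A.
  have -> : (fun n => \int[mu]_(x in F n) ln x) = (fun n => A * ln A - A - (a n * ln (a n) - a n)).
    by apply/funext.
  rewrite -[X in _ --> X]subr0; apply: cvgB; first exact: cvg_cst.
  by rewrite -(subr0 0); apply: cvgB.
exact: (cvg_unique _ ex T).
Unshelve. all: end_near. Qed.

Lemma lmillsE (x : R) : 0 < x -> lmills x = ln 2 + ln x + ln (mills x).
Proof.
by move=> x0; rewrite /lmills lnM ?posrE ?mills_gt0 ?mulr_gt0// lnM ?posrE.
Qed.

Lemma intg_lmills : mu.-integrable `[0, +oo[ (EFin \o lmills).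
Proof.
have ml : measurable_fun (`[0, +oo[%classic : set LT) lmills.
  apply: measurable_funTS; apply: (measurableT_comp (@measurable_ln R)).
  apply: measurable_cont => x; apply: cvgM; last exact: continuous_mills.
  by apply: cvgM; [exact: cvg_cst|exact: cvg_id].
apply: (@intg_half_line _ 2^-1 ml); last first.
  move=> x x1; have x0 : 0 < x by exact: lt_le_trans x1.
  have /andP[h1 h2] := lmills_bounds x0.
  have h3 : 0 < (2 * x ^+ 2 + 3)^-1 by rewrite invr_gt0 addr_gt0// mulr_gt0// exprn_gt0.
  by rewrite ler0_norm -?invfM; lra.
have m1 : measurable (`]0, 1]%classic : set LT) by [].
have m0 : measurable (`[0, 0]%classic : set LT) by [].
have -> : `[0, 1]%classic = `[0, 0]%classic `|` `]0, 1]%classic :> set LT.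
  apply/seteqP; split => x /=; rewrite !in_itv/=.
    move=> /andP[x0 x1]; have [x2|x2] := leP x 0; [left|right; exact/andP].
    by rewrite x0.
  by move=> [/andP[? ?]|/andP[? ?]]; apply/andP; split; lra.
apply: intg_setU => //.
  have i : mu.-integrable `[0, 0] (EFin \o (fun=> lmills 0)).
    apply: continuous_compact_integrable; first exact: segment_compact.
    by apply: continuous_subspaceT => z; exact: cvg_cst.
  apply: (eq_intg m0 _ i) => x; rewrite /= in_itv/= => /andP[? ?].
  by congr lmills; lra.
have m01 : measurable (`[0, 1]%classic : set LT) by [].
have sub : `]0, 1]%classic `<=` (`[0, 1]%classic : set LT).
  by move=> x; rewrite /= !in_itv/= => /andP[/ltW -> ->].
have ci : continuous (fun x : R => ln 2 + ln (mills x)).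
  move=> x; apply: cvgD; first exact: cvg_cst.
  apply: (@continuous_comp _ _ _ mills (@ln R)); first exact: continuous_mills.
  by apply: continuous_ln; exact: mills_gt0.
have i1 := intgS m01 m1 sub (intg_on_01 ci).
apply: (eq_intg m1 _ (intgD m1 i1 intg_ln01)) => x.
rewrite /= in_itv/= => /andP[x0 _].
by rewrite lmillsE//; ring.
Qed.

Lemma gamma_outE : \int[mu]_(x in `[0, +oo[) lmills x = - (Num.sqrt 2 * @gamma_out R).
Proof.
rewrite /gamma_out mulNr mulrN opprK mulVKf ?lt0r_neq0 ?sqrtr_gt0//.
apply: eq_Rintegral => x _; rewrite /lmills; congr ln.
rewrite /erfc -/(gtail x) /mills; field; exact: lt0r_neq0.
Qed.

(** Here ln [mills] = [lmills] - ln (2 x), and the tail of [lmills] beyond A is - 1 / (2 A) up to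
    A^(-3). As A has order 1 / e, division by e turns 1 / (2 A) into the term in Laplacian / (4
    eta), and the remainder vanishes. *)
Lemma int_ln_mills (A : R) : 1 <= A ->
  `|\int[mu]_(x in `[0, A]) ln (mills x) -
    (\int[mu]_(x in `[0, +oo[) lmills x - (A * ln (2 * A) - A) + (2 * A)^-1)| <= (A ^+ 3)^-1.
Proof.
move=> A1; have A0 : 0 < A by exact: lt_le_trans A1.
have mA : measurable (`]0, A]%classic : set LT) by [].
have mT : measurable (`[A, +oo[%classic : set LT) by [].
have il := intg_lmills.
have subA : `]0, A]%classic `<=` (`[0, +oo[%classic : set LT).
  by move=> x; rewrite /= !in_itv/= andbT => /andP[/ltW].
have subT : `[A, +oo[%classic `<=` (`[0, +oo[%classic : set LT).
  by move=> x; rewrite /= !in_itv/= !andbT; lra.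
have iA := intgS mP mA subA il.
have iT := intgS mP mT subT il.
have [iln eln] := intg_ln A0.
have ic : mu.-integrable `]0, A] (EFin \o (fun=> - ln 2)).
  have mI : measurable (`[0, A]%classic : set LT) by [].
  apply: (intgS mI mA); first by move=> x; rewrite /= !in_itv/= => /andP[/ltW -> ->].
  apply: continuous_compact_integrable; first exact: segment_compact.
  by apply: continuous_subspaceT => z; exact: cvg_cst.
have pt (x : R) : 0 < x -> ln (mills x) = lmills x + (- ln 2 - ln x).
  by move=> x0; rewrite lmillsE//; ring.
have i2 := intgB mA ic iln.
have im : mu.-integrable `]0, A] (EFin \o (fun x => ln (mills x))).
  apply: (eq_intg mA _ (intgD mA iA i2)) => x.
  by rewrite /= in_itv/= => /andP[x0 _]; rewrite -pt.
have e1 : \int[mu]_(x in `[0, A]) ln (mills x) =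
   \int[mu]_(x in `]0, A]) lmills x - (A * ln (2 * A) - A).
  rewrite -(Rintegral_itv_obnd_cbnd im).
  have -> : \int[mu]_(x in `]0, A]) ln (mills x) = \int[mu]_(x in `]0, A]) (lmills x + (- ln 2 - ln x)).
    by apply: eq_Rintegral => x; rewrite inE/= in_itv/= => /andP[x0 _]; exact: pt.
  rewrite RintegralD// RintegralB// eln Rintegral_cst//= lebesgue_measure_itv/= lte_fin A0.
  by rewrite -EFinB/= lnM ?posrE//; ring.
have e2 : \int[mu]_(x in `]0, A]) lmills x =
   \int[mu]_(x in `[0, +oo[) lmills x - \int[mu]_(x in `[A, +oo[) lmills x.
  rewrite (Rintegral_itv_obnd_cbnd iA).
  have := @Rintegral_itvB R lmills (BLeft 0) +oo%O A il.
  rewrite !bnd_simp => /(_ (ltW A0) isT) h.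
  rewrite -(@Rintegral_itv_obnd_cbnd _ A) -?h ?subKr//.
  by apply: (intgS mT _ _ iT) => // x; rewrite /= !in_itv/= !andbT => /ltW.
have [isq esq] := intg_inv_sqr A0.
have e3 : - (\int[mu]_(x in `[A, +oo[) lmills x) - (2 * A)^-1 =
   - (\int[mu]_(x in `[A, +oo[) (lmills x + 2^-1 * (x ^+ 2)^-1)).
  rewrite RintegralD//; last exact: intgZ.
  by rewrite RintegralZl// esq invfM; ring.
rewrite e1 e2.
set a := \int[mu]_(x in `[0, +oo[) lmills x; set b := \int[mu]_(x in `[A, +oo[) lmills x in e3 *.
have -> : a - b - (A * ln (2 * A) - A) - (a - (A * ln (2 * A) - A) + (2 * A)^-1) = - b - (2 * A)^-1 by ring.
rewrite e3 normrN.
have iS := intgD mT iT (intgZ 2^-1 mT isq).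
apply: (le_trans (normr_Rintegral_le mT iS (intgZ (A ^+ 2)^-1 mT isq) _)).
  move=> x; rewrite /= in_itv/= andbT => Ax; have x0 : 0 < x by lra.
  rewrite -invfM (le_trans (lmills_asym x0))// invfM ler_wpM2r ?invr_ge0 ?sqr_ge0//.
  by rewrite lef_pV2 ?posrE ?exprn_gt0// lerXn2r ?nnegrE ?(ltW A0) ?(ltW x0).
rewrite RintegralZl// esq le_eqVlt; apply/orP; left; apply/eqP.
by field; exact: lt0r_neq0.
Qed.

(** What is left of the integrand of [alpha_out] after removing - (2/3) [outer_lim]; it has an
    elementary primitive in terms of [lnPhi]. *)
Definition wmills (x : R) : R := (mills x)^-1 - 2 * x - (x + 1)^-1.

Let cxV (x : R) : 0 <= x -> {for x, continuous (fun x : R => (x + 1)^-1)}.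
Proof.
move=> x0; apply: cvgV; first by rewrite lt0r_neq0//; lra.
by apply: cvgD; [exact: cvg_id|exact: cvg_cst].
Qed.

Let cw (x : R) : 0 <= x -> {for x, continuous wmills}.
Proof.
move=> x0; apply: cvgB; last exact: cxV.
apply: cvgB; first exact: continuous_millsV.
by apply: cvgM; [exact: cvg_cst|exact: cvg_id].
Qed.

Lemma wmills_bound (x : R) : 1 <= x -> `|wmills x| <= (x ^+ 2)^-1.
Proof.
move=> x1; have x0 : 0 < x by exact: lt_le_trans x1.
have m0 := mills_gt0 x.
have x20 : 0 < x ^+ 2 by rewrite exprn_gt0.
have mx : 0 < 2 * x * mills x by exact: mulr_gt0 (mulr_gt0 (ltr0Sn _ _) x0) m0.
have E : (mills x)^-1 = 2 * x * (2 * x * mills x)^-1.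
  by field; rewrite (lt0r_neq0 m0) (lt0r_neq0 x0).
have h1 : (mills x)^-1 <= 2 * x + x^-1.
  have -> : 2 * x + x^-1 = 2 * x * (1 - (2 * x ^+ 2 + 1)^-1)^-1.
    by field; rewrite !lt0r_neq0//; lra.
  rewrite E ler_wpM2l ?mulr_ge0 ?(ltW x0)// lef_pV2 ?posrE ?mills_ge//.
  by rewrite subr_gt0 invf_lt1; lra.
have h2 : 2 * x + x / (x ^+ 2 + 1) <= (mills x)^-1.
  have -> : 2 * x + x / (x ^+ 2 + 1) = 2 * x * (1 - (2 * x ^+ 2 + 3)^-1)^-1.
    by field; rewrite !lt0r_neq0//; lra.
  rewrite E ler_wpM2l ?mulr_ge0 ?(ltW x0)// lef_pV2 ?posrE ?mills_le//.
  by rewrite subr_gt0 invf_lt1; lra.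
have h3 : (x + 1)^-1 <= x / (x ^+ 2 + 1).
  rewrite ler_pdivlMr; last lra.
  rewrite mulrC ler_pdivrMr; last lra.
  by rewrite mulrDr mulr1 -expr2; lra.
have h4 : x^-1 - (x + 1)^-1 <= (x ^+ 2)^-1.
  have -> : x^-1 - (x + 1)^-1 = (x * (x + 1))^-1 by field; rewrite !lt0r_neq0//; lra.
  by rewrite lef_pV2 ?posrE ?mulr_gt0//; [rewrite mulrDr -expr2 mulr1|]; lra.
by rewrite /wmills ger0_norm; lra.
Qed.

Lemma intg_wmills : mu.-integrable `[0, +oo[ (EFin \o wmills).
Proof.
have i1 : mu.-integrable `[0, 1] (EFin \o wmills).
  apply: continuous_compact_integrable; first exact: segment_compact.
  by apply: continuous_in_subspaceT => x; rewrite inE/= in_itv/= => /andP[x0 _]; exact: cw.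
apply: (@intg_half_line _ 1) => //; last by move=> x x1; rewrite mul1r wmills_bound.
apply: subspace_continuous_measurable_fun => //.
by apply: continuous_in_subspaceT => x; rewrite inE/= in_itv/= andbT; exact: cw.
Qed.

Lemma int_wmills : \int[mu]_(x in `[0, +oo[) wmills x = ln (Num.sqrt pi).
Proof.
pose F (x : R) := - lnPhi x - x ^+ 2 - ln (x + 1).
have dF (x : R) : 0 <= x -> is_derive x 1 F (wmills x).
  move=> x0; have h := is_derive_lnPhi x.
  have x1 : 0 < x + 1 by lra.
  have h0 : is_derive x 1 (fun x : R => x + 1) 1.
    by apply: is_derive_eq; rewrite addr0.
  have h1 : is_derive x 1 (@ln R \o (fun x : R => x + 1)) ((x + 1)^-1 * 1).
    by have h1 := is_derive_lnr x1; exact: is_derive1_comp.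
  have h2 : is_derive x 1 (fun x : R => x ^+ 2) (2 * x).
    by apply: is_derive_eq; rewrite /GRing.scale/=; ring.
  have h3 := is_deriveB (is_deriveB (is_deriveN h) h2) h1.
  by apply: (is_derive_eq h3); rewrite /wmills opprK mulr1.
have lF : F (0 + n%:R) @[n --> \oo] --> ln (Num.sqrt pi) + ln 2.
  rewrite -cvg_shiftS.
  apply: (@cvg_shift_squeeze _ _ (fun n => 2 * n.+1%:R^-1)).
    by rewrite -(mulr0 2); apply: cvgM; [exact: cvg_cst|exact: cvg_harmonic].
  move=> n /=; rewrite add0r; set x : R := n.+1%:R.
  have x0 : 0 < x by rewrite /x.
  have x1 : 1 <= x by rewrite /x ler1n.
  clearbody x.
  have xx : 0 < 1 + x^-1 by rewrite addr_gt0// invr_gt0.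
  have e1 : ln (x + 1) = ln x + ln (1 + x^-1).
    by rewrite -lnM ?posrE//; congr ln; field; exact: lt0r_neq0.
  (* The divergent terms of F cancel: [lmills] and ln (1 + 1 / x) both vanish at infinity. *)
  have -> : F x - (ln (Num.sqrt pi) + ln 2) = - lmills x - ln (1 + x^-1).
    by rewrite /F lnPhi_mills e1 lmillsE//; ring.
  have /andP[h1 h2] := lmills_bounds x0.
  have h3 : 0 < (2 * x ^+ 2 + 3)^-1 by rewrite invr_gt0 addr_gt0// mulr_gt0// exprn_gt0.
  have h4 : (2 * x ^+ 2)^-1 <= x^-1.
    by rewrite lef_pV2 ?posrE ?mulr_gt0 ?exprn_gt0// expr2 mulrA ler_peMl//; lra.
  have h5 : ln (1 + x^-1) <= x^-1.
    by apply: le_ln1Dx; apply: lt_trans (_ : 0 < _); rewrite ?invr_gt0.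
  have h6 : 0 <= ln (1 + x^-1) by rewrite ln_ge0// lerDl invr_ge0 ltW.
  have h7 : 0 < x^-1 by rewrite invr_gt0.
  rewrite ler_norml; apply/andP; split; lra.
rewrite (Rint_FTCy intg_wmills dF cw lF).
by rewrite /F lnPhi0 expr2 mulr0 add0r ln1 !subr0 opprK addrK.
Qed.

(** The integrand of [beta_out] is - 2 [outer_lim], because Phi' = - 1 / [mills]. *)
Lemma beta_outE : @beta_out R = 3^-1 * \int[mu]_(x in `[0, +oo[) outer_lim x.
Proof.
have i := intg_outer_lim (R := R).
have -> : @beta_out R = - 6^-1 * \int[mu]_(x in `[0, +oo[) (- 2 * outer_lim x).
  rewrite /beta_out; congr (_ * _); apply: eq_Rintegral => x _.
  rewrite derive1_Phi /outer_lim /mills expRN; field.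
  by rewrite (lt0r_neq0 (gtail_gt0 _)) lt0r_neq0// expR_gt0.
by rewrite RintegralZl//; field.
Qed.

Lemma alpha_outE : @alpha_out R = ln (Num.sqrt pi) - 2 * @beta_out R.
Proof.
have i := intg_outer_lim (R := R).
have -> : @alpha_out R = \int[mu]_(x in `[0, +oo[) (1 * wmills x + - (2 / 3) * outer_lim x).
  rewrite /alpha_out; apply: eq_Rintegral => x.
  rewrite inE/= in_itv/= andbT => x0.
  rewrite derive1_Phi /outer_lim /wmills /mills expRN; field.
  by rewrite (lt0r_neq0 (gtail_gt0 _)) !lt0r_neq0// ?expR_gt0//; lra.
rewrite R2//; last exact: intg_wmills.
by rewrite int_wmills beta_outE; field.
Qed.

End constants.

(** * From sums to integrals *)

Section cumulants.
Context {R : realType}.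

Lemma ln1_taylor (c t : R) : 0 < c -> c <= 1 -> c <= 1 + t ->
  `|ln (1 + t) - t + t ^+ 2 / 2| <= c^-1 * `|t| ^+ 3.
Proof.
move=> c0 c1 ct.
pose f (t : R) := ln (1 + t) - t + t ^+ 2 / 2.
have btw (s : R) : between 0 t s -> c <= 1 + s by case=> /andP[? ?]; lra.
have df (s : R) : between 0 t s -> is_derive s 1 f (s ^+ 2 / (1 + s)).
  move=> /btw h; have s0 : 0 < 1 + s by lra.
  have h0 : is_derive s 1 (fun t : R => 1 + t) 1.
    by apply: (is_derive_eq (is_deriveD (is_derive_cst (1 : R) s (1 : R)) (is_derive_id s (1 : R)))); rewrite add0r.
  have h1 : is_derive s 1 (@ln R \o (fun t : R => 1 + t)) ((1 + s)^-1 * 1).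
    by have h1 := is_derive_lnr s0; exact: is_derive1_comp.
  have h2 : is_derive s 1 (fun t : R => t ^+ 2 / 2) s.
    by apply: is_derive_eq; rewrite /GRing.scale/=; field.
  have h3 := is_deriveD (is_deriveB h1 (is_derive_id s (1 : R))) h2.
  by apply: (is_derive_eq h3); field; exact: lt0r_neq0.
have b (s : R) : between 0 t s -> `|s ^+ 2 / (1 + s)| <= c^-1 * `|s - 0| ^+ 2.
  move=> /btw h; have s0 : 0 < 1 + s by lra.
  rewrite subr0 normrM normrX normfV (gtr0_norm s0) mulrC ler_wpM2r ?exprn_ge0//.
  by rewrite lef_pV2 ?posrE.
have f0 : f 0 = 0 by rewrite /f addr0 ln1; ring.
have ci : 0 <= c^-1 by rewrite invr_ge0 ltW.
by have := taylor_step df f0 b ci; rewrite subr0.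
Qed.

Lemma expR_taylor3 (L t : R) : `|t| <= L ->
  `|expR t - 1 - t - t ^+ 2 / 2| <= expR L * `|t| ^+ 3.
Proof.
move=> tL.
have LE : 0 <= expR L by exact: expR_ge0.
have btw (s r : R) : between 0 s r -> `|s| <= L -> `|r| <= L.
  by move=> /between_dist; rewrite !subr0 => h1 h2; exact: le_trans h1 h2.
have s1 (s : R) : `|s| <= L -> `|expR s - 1| <= expR L * `|s| ^+ 1.
  move=> sL; have := @taylor_step R (fun s => expR s - 1) expR (expR L) 0 s 0.
  rewrite (subr0 s); apply => //.
  - by move=> c _; apply: is_derive_eq; rewrite subr0.
  - by rewrite expR0 subrr.
  - move=> c hc; rewrite expr0 mulr1 ger0_norm ?expR_ge0// ler_expR.
    exact: le_trans (ler_norm _) (btw _ _ hc sL).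
have s2 (s : R) : `|s| <= L -> `|expR s - 1 - s| <= expR L * `|s| ^+ 2.
  move=> sL; have := @taylor_step R (fun s => expR s - 1 - s) (fun s => expR s - 1) (expR L) 0 s 1.
  rewrite (subr0 s); apply => //.
  - by move=> c _; apply: is_derive_eq; rewrite subr0.
  - by rewrite expR0; ring.
  - by move=> c hc; rewrite subr0; apply: s1; exact: btw hc sL.
have := @taylor_step R (fun s => expR s - 1 - s - s ^+ 2 / 2) (fun s => expR s - 1 - s) (expR L) 0 t 2.
rewrite (subr0 t); apply => //.
- by move=> c _; apply: is_derive_eq; rewrite /GRing.scale/= subr0; field.
- by rewrite expR0; ring.
- by move=> c hc; rewrite subr0; apply: s2; exact: btw hc tL.
Qed.

(** T stands for the mean of e^(th X) under a law whose moments m1 and m2 have sizes e and e^2; its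
    logarithm is expanded up to the second cumulant. *)
Lemma cumulant3 (C c : R) : 0 < C -> 0 < c -> c <= 1 -> exists2 D : R, 0 < D &
  forall e th m1 m2 T : R, 0 < e <= 1 -> `|th| <= 2 -> `|m1| <= C * e -> `|m2| <= C * e ^+ 2 ->
  `|T - 1 - th * m1 - th ^+ 2 * m2 / 2| <= C * e ^+ 3 -> c <= T ->
  `|ln T - th * m1 - th ^+ 2 * ((m2 - m1 ^+ 2) / 2)| <= D * e ^+ 3.
Proof.
(* 125 C^3 is the cube in |t| <= 5 C e, C the error on T, and 21/2 C^2 half of 3 C times 7 C, from
   t^2 - (th m1)^2. *)
move=> C0 c0 c1; exists (125 * C ^+ 3 / c + C + 21 / 2 * C ^+ 2).
  by rewrite !addr_gt0 ?divr_gt0 ?mulr_gt0 ?exprn_gt0 ?invr_gt0.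
move=> e th m1 m2 T /andP[e0 e1] th2 hm1 hm2 hT cT.
pose t := T - 1; have ET : T = 1 + t by rewrite /t; ring.
have e20 : 0 < e ^+ 2 by rewrite exprn_gt0.
have e32 : e ^+ 3 <= e ^+ 2 by rewrite exprS ler_piMl// ltW.
have e21 : e ^+ 2 <= e by rewrite expr2 ler_piMl// ltW.
have b1 : `|th * m1| <= 2 * C * e by rewrite normrM -mulrA ler_pM.
have b2 : `|th ^+ 2 * m2 / 2| <= 2 * C * e ^+ 2.
  have -> : th ^+ 2 * m2 / 2 = (th * th / 2) * m2 by field.
  have -> : 2 * C * e ^+ 2 = 2 * (C * e ^+ 2) by ring.
  rewrite normrM ler_pM// normrM normrM normfV (ger0_norm (_ : 0 <= 2))//.
  by have := ler_pM (normr_ge0 th) (normr_ge0 th) th2 th2; lra.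
have C1 : C * e ^+ 3 <= C * e ^+ 2 by rewrite ler_wpM2l// ltW.
have C2 : C * e ^+ 2 <= C * e by rewrite ler_wpM2l// ltW.
have b3 : `|t - th * m1| <= 3 * C * e ^+ 2.
  have -> : t - th * m1 = (T - 1 - th * m1 - th ^+ 2 * m2 / 2) + th ^+ 2 * m2 / 2 by rewrite /t; ring.
  by rewrite (le_trans (ler_normD _ _))// (le_trans (lerD hT b2))//; lra.
have b4 : `|t| <= 5 * C * e.
  rewrite -[t](subrK (th * m1)) (le_trans (ler_normD _ _))// (le_trans (lerD b3 b1))//; lra.
have b5 : `|t + th * m1| <= 7 * C * e.
  by rewrite (le_trans (ler_normD _ _))// (le_trans (lerD b4 b1))//; lra.
have b6 : `|t ^+ 2 - (th * m1) ^+ 2| <= 21 * C ^+ 2 * e ^+ 3.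
  rewrite subr_sqr normrM (le_trans (ler_pM _ _ b3 b5))//.
  by rewrite le_eqVlt; apply/orP; left; apply/eqP; ring.
have b7 : `|t| ^+ 3 <= 125 * C ^+ 3 * e ^+ 3.
  have -> : 125 * C ^+ 3 * e ^+ 3 = (5 * C * e) ^+ 3 by ring.
  by rewrite lerXn2r ?nnegrE// !mulr_ge0// ltW.
have := ln1_taylor c0 c1 (_ : c <= 1 + t); rewrite -ET => /(_ cT) h1.
have h2 : c^-1 * `|t| ^+ 3 <= c^-1 * (125 * C ^+ 3 * e ^+ 3) by rewrite ler_wpM2l// invr_ge0 ltW.
have -> : ln T - th * m1 - th ^+ 2 * ((m2 - m1 ^+ 2) / 2) =
   (ln T - t + t ^+ 2 / 2) + (T - 1 - th * m1 - th ^+ 2 * m2 / 2) - (t ^+ 2 - (th * m1) ^+ 2) / 2.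
  by rewrite /t; field.
rewrite (le_trans (ler_normB _ _))//.
have h3 := le_trans (ler_normD (ln T - t + t ^+ 2 / 2) _) (lerD (le_trans h1 h2) hT).
have h4 : `|(t ^+ 2 - (th * m1) ^+ 2) / 2| <= 21 * C ^+ 2 * e ^+ 3 / 2.
  by rewrite normrM normfV (ger0_norm (_ : 0 <= 2))// ler_wpM2r.
rewrite (le_trans (lerD h3 h4))// le_eqVlt; apply/orP; left; apply/eqP; field; exact: lt0r_neq0.
Qed.

End cumulants.

(** * The trapezoidal rule for log-partition functions *)

Section trapezoid.
Context {R : realType} (P : R -> R) (X : R).
Hypothesis cP : continuous P.
Hypothesis X0 : X < 0.
Notation mu := (@lebesgue_measure R).
Notation LT := (measurableTypeR R).
Notation gb e y := (gibbs P (e ^+ 2)^-1 y).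
Notation G e := (lnZ P X 0 (e ^+ 2)^-1).

(* The Gibbs measure with slope y concentrates around a at scale e: this is all
   that the trapezoidal rule needs, and it avoids differentiating lnZ in y. *)
Definition conc (C e y a : R) := X <= a <= 0 /\ forall k, (0 < k <= 3)%N ->
  \int[mu]_(x in `[X, 0]) (`|x - a| ^+ k * gb e y x) <= C * e ^+ k * \int[mu]_(x in `[X, 0]) gb e y x.

Lemma intg_Xgibbs (e y : R) (w : R -> R) : continuous w ->
  mu.-integrable `[X, 0] (EFin \o (fun x => w x * gb e y x)).
Proof.
move=> cw; apply: continuous_compact_integrable; first exact: segment_compact.
by apply: continuous_subspaceT => x; apply: cvgM; [exact: cw|exact: continuous_gibbs].
Qed.

(** As N = e^(-2), a slope increment th e^2 multiplies the weight by e^(th x). The increment of lnZ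
    is therefore a logarithmic moment generating function, to which [cumulant3] applies. *)
Lemma lnZ_step (C : R) : 0 < C -> exists2 D : R, 0 < D &
  forall e y a : R, 0 < e <= 1 -> conc C e y a ->
  exists m v : R, [/\ `|m - a| <= C * e, `|v| <= D * e ^+ 2 &
    forall th : R, `|th| <= 2 ->
    `|G e (y + th * e ^+ 2) - G e y - th * m - th ^+ 2 * v| <= D * e ^+ 3].
Proof.
move=> C0; pose L := 2 * - X; have L0 : 0 < L by rewrite mulr_gt0// oppr_gt0.
have EL : 1 <= expR L by rewrite -[leLHS]expR0 ler_expR ltW.
(* The cubic remainder of the exponential is at most e^L |th (x - a)|^3 with |th| <= 2, and 8 =
   2^3. *)
pose C' := 8 * expR L * C.
have C'0 : 0 < C' by rewrite !mulr_gt0 ?expR_gt0.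
have CC' : C <= C' by rewrite ler_peMl ?(ltW C0)//; lra.
have c1 : expR (- L) <= 1 by rewrite -[leRHS]expR0 ler_expR; lra.
have [D D0 hD] := cumulant3 C'0 (expR_gt0 (- L)) c1.
exists (D + C' + C' ^+ 2); first by rewrite !addr_gt0 ?exprn_gt0.
move=> e y a he [ha hc]; have [e0 e1] := andP he.
set w := gb e y; set Z := \int[mu]_(x in `[X, 0]) w x.
have Z0 : 0 < Z by exact: gibbs_int_gt0.
have Zn : Z != 0 by exact: lt0r_neq0.
have cd : continuous (fun x : R => x - a) by move=> x; apply: cvgB; [exact: cvg_id|exact: cvg_cst].
have cdk k : continuous (fun x : R => (x - a) ^+ k).
  by move=> x; apply: (@continuous_comp _ _ _ (fun x : R => x - a) (fun z => z ^+ k)); [exact: cd|exact: exprn_continuous].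
have cak k : continuous (fun x : R => `|x - a| ^+ k).
  move=> x; apply: (@continuous_comp _ _ _ (fun x : R => `|x - a|) (fun z => z ^+ k)); last exact: exprn_continuous.
  by apply: (@continuous_comp _ _ _ (fun x : R => x - a) (fun z : R => `|z|)); [exact: cd|exact: norm_continuous].
have ik k : mu.-integrable `[X, 0] (EFin \o (fun x => (x - a) ^+ k * w x)) by exact: intg_Xgibbs.
have ia k : mu.-integrable `[X, 0] (EFin \o (fun x => `|x - a| ^+ k * w x)) by exact: intg_Xgibbs.
have iw : mu.-integrable `[X, 0] (EFin \o w) by exact: intg_gibbs.
have mI : measurable (`[X, 0]%classic : set LT) by [].
pose m k := (\int[mu]_(x in `[X, 0]) ((x - a) ^+ k * w x)) / Z.
have hm k : (0 < k <= 3)%N -> `|m k| <= C * e ^+ k.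
  move=> hk; rewrite /m normrM normfV (gtr0_norm Z0) ler_pdivrMr//.
  apply: le_trans (hc k hk).
  apply: normr_Rintegral_le => // x _.
  by rewrite normrM normrX (ger0_norm (expR_ge0 _)).
have h1 : `|m 1%N| <= C * e by have := hm 1%N isT; rewrite expr1.
have h2 := hm 2%N isT.
exists (a + m 1%N), ((m 2%N - m 1%N ^+ 2) / 2); split.
- by rewrite addrAC subrr add0r.
- have h1' : `|m 1%N| ^+ 2 <= (C * e) ^+ 2 by rewrite lerXn2r ?nnegrE ?mulr_ge0 ?(ltW C0) ?(ltW e0).
  rewrite normrM normfV (ger0_norm (_ : 0 <= 2))// ler_pdivrMr//.
  rewrite (le_trans (ler_normB _ _))// normrX.
  have e20 : 0 < e ^+ 2 by rewrite exprn_gt0.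
  have q1 : C ^+ 2 <= C' ^+ 2 by rewrite lerXn2r ?nnegrE ?(ltW C0) ?(ltW C'0).
  have q2 := ler_wpM2r (ltW e20) q1; have q3 := ler_wpM2r (ltW e20) CC'.
  have q4 := mulr_ge0 (ltW D0) (ltW e20).
  have q5 := mulr_gt0 C'0 e20; have q6 : 0 <= C' ^+ 2 * e ^+ 2 by rewrite mulr_ge0 ?sqr_ge0.
  by rewrite exprMn in h1'; lra.
move=> th hth.
pose T := (\int[mu]_(x in `[X, 0]) (expR (th * (x - a)) * w x)) / Z.
have cE : continuous (fun x : R => expR (th * (x - a))).
  move=> x; apply: (@continuous_comp _ _ _ (fun x : R => th * (x - a)) expR); last exact: continuous_expR.
  by apply: cvgM; [exact: cvg_cst|exact: cd].
have iE : mu.-integrable `[X, 0] (EFin \o (fun x => expR (th * (x - a)) * w x)) by exact: intg_Xgibbs.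
have thL (x : R) : X <= x <= 0 -> `|th * (x - a)| <= L.
  move=> /andP[x1 x2]; have /andP[a1 a2] := ha; rewrite normrM /L ler_pM//.
  by rewrite ler_norml; apply/andP; split; lra.
have TL : expR (- L) <= T.
  rewrite /T ler_pdivlMr// -RintegralZl//; apply: le_Rintegral => //; first exact: intgZ.
  move=> x; rewrite /= in_itv/= => /thL; rewrite ler_norml => /andP[h _].
  by rewrite ler_wpM2r ?expR_ge0// ler_expR.
have T0 : 0 < T by exact: lt_le_trans (expR_gt0 _) TL.
have ET : G e (y + th * e ^+ 2) - G e y = th * a + ln T.
  have -> : G e (y + th * e ^+ 2) = ln (expR (th * a) * (T * Z)).
    rewrite /lnZ; congr ln; rewrite /T divfK// -RintegralZl//.
    apply: eq_Rintegral => x _; rewrite /w /gibbs -!expRD; congr expR.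
    by field; rewrite lt0r_neq0.
  have -> : G e y = ln Z by [].
  have p1 : expR (th * a) \is Num.pos by rewrite posrE expR_gt0.
  have p2 : T \is Num.pos by rewrite posrE.
  have p3 : Z \is Num.pos by rewrite posrE.
  have p4 : T * Z \is Num.pos by rewrite posrE mulr_gt0.
  by rewrite (lnM p1 p4) (lnM p2 p3) expRK; ring.
have hT : `|T - 1 - th * m 1%N - th ^+ 2 * m 2%N / 2| <= C' * e ^+ 3.
  have -> : T - 1 - th * m 1%N - th ^+ 2 * m 2%N / 2 =
     (\int[mu]_(x in `[X, 0]) ((expR (th * (x - a)) - 1 - th * (x - a) - (th * (x - a)) ^+ 2 / 2) * w x)) / Z.
    have -> : \int[mu]_(x in `[X, 0]) ((expR (th * (x - a)) - 1 - th * (x - a) - (th * (x - a)) ^+ 2 / 2) * w x) =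
      \int[mu]_(x in `[X, 0]) (expR (th * (x - a)) * w x - w x - th * ((x - a) ^+ 1 * w x) - th ^+ 2 / 2 * ((x - a) ^+ 2 * w x)).
      by apply: eq_Rintegral => x _; field.
    have j1 := intgB mI iE iw; have j2 := intgB mI j1 (intgZ th mI (ik 1%N)).
    rewrite RintegralB//; last exact: intgZ.
    rewrite RintegralB//; last exact: intgZ.
    rewrite RintegralB// (RintegralZl _ _ (ik 1%N))// (RintegralZl _ _ (ik 2%N))//.
    by rewrite /T /m -/Z; field.
  rewrite normrM normfV (gtr0_norm Z0) ler_pdivrMr//.
  have h3 : 0 < 8 * expR L by rewrite mulr_gt0 ?expR_gt0.
  have -> : C' * e ^+ 3 * Z = 8 * expR L * (C * e ^+ 3 * Z) by rewrite /C'; ring.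
  apply: le_trans (ler_wpM2l (ltW h3) (hc 3%N isT)).
  rewrite -RintegralZl//; apply: normr_Rintegral_le => //.
  - apply: intg_Xgibbs => x; apply: cvgB.
      apply: cvgB; first by apply: cvgB; [exact: cE|exact: cvg_cst].
      by apply: cvgM; [exact: cvg_cst|exact: cd].
    apply: cvgM; last exact: cvg_cst.
    apply: (@continuous_comp _ _ _ (fun x : R => th * (x - a)) (fun z => z ^+ 2)); last exact: exprn_continuous.
    by apply: cvgM; [exact: cvg_cst|exact: cd].
  - exact: intgZ.
  - move=> x; rewrite /= in_itv/= => /thL h.
    rewrite normrM (ger0_norm (expR_ge0 _)) mulrA ler_wpM2r ?expR_ge0//.
    rewrite (le_trans (expR_taylor3 h))// normrM exprMn mulrCA mulrA ler_wpM2r ?exprn_ge0//.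
    rewrite ler_wpM2r ?expR_ge0//.
    have -> : 8 = 2 ^+ 3 :> R by ring.
    by rewrite lerXn2r ?nnegrE.
have e20 : 0 < e ^+ 2 by rewrite exprn_gt0.
have h1' : `|m 1%N| <= C' * e by rewrite (le_trans h1)// ler_wpM2r// ltW.
have h2' : `|m 2%N| <= C' * e ^+ 2 by rewrite (le_trans h2)// ler_wpM2r// ltW.
have := hD e th _ _ T he hth h1' h2' hT TL.
rewrite ET.
have -> : th * a + ln T - th * (a + m 1%N) - th ^+ 2 * ((m 2%N - m 1%N ^+ 2) / 2) =
  ln T - th * m 1%N - th ^+ 2 * ((m 2%N - m 1%N ^+ 2) / 2) by ring.
move=> h; apply: (le_trans h); rewrite ler_wpM2r ?exprn_ge0 ?(ltW e0)// -addrA lerDl.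
by rewrite addr_ge0 ?sqr_ge0// ltW.
Qed.

Lemma Rint_cat (f : R -> R) (a b c : R) : continuous f -> a <= b -> b <= c ->
  \int[mu]_(x in `[a, c]) f x = \int[mu]_(x in `[a, b]) f x + \int[mu]_(x in `[b, c]) f x.
Proof.
move=> cf ab bc.
have i (s t : R) : mu.-integrable `[s, t] (EFin \o f).
  by apply: continuous_compact_integrable; [exact: segment_compact|exact: continuous_subspaceT].
have := @Rintegral_itvB R f (BLeft a) (BRight c) b (i a c).
rewrite !bnd_simp => /(_ ab bc) h.
have mbc : measurable (`[b, c]%classic : set LT) by [].
rewrite -(@Rintegral_itv_obnd_cbnd _ b) -?h; first by rewrite addrC subrK.
by apply: (intgS mbc _ _ (i b c)) => // x; rewrite /= !in_itv/= => /andP[/ltW -> ->].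
Qed.

Local Opaque lnZ.

(** The rule with its second-difference correction is exact on the quadratic model in th, so only
    the deviation D e^3 from that model contributes. One expansion, at the right node y, covers the
    cell and both neighbouring nodes. *)
Lemma trapezoid_cell (D e y m v : R) : 0 < e ->
  (forall th : R, `|th| <= 2 ->
    `|G e (y + th * e ^+ 2) - G e y - th * m - th ^+ 2 * v| <= D * e ^+ 3) ->
  `|G e y - (2 * e ^+ 2)^-1 * \int[mu]_(t in `[y - 2 * e ^+ 2, y]) G e t
    - 2^-1 * (G e y - G e (y - 2 * e ^+ 2))
    - 12^-1 * ((G e (y + 2 * e ^+ 2) - G e y) - (G e y - G e (y - 2 * e ^+ 2)))|
  <= 2 * (D * e ^+ 3).
Proof.
move=> e0 hst.
have e20 : 0 < e ^+ 2 by rewrite exprn_gt0.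
have cG : continuous (G e) by apply: continuous_lnZ => //; rewrite invr_ge0 ltW.
have n2 : `|- 2 : R| <= 2 by rewrite normrN ger0_norm.
have p2 : `|2 : R| <= 2 by rewrite ger0_norm.
have g1 := hst _ n2; have g2 := hst _ p2.
rewrite mulNr in g1.
have mI : measurable (`[y - 2 * e ^+ 2, y]%classic : set LT) by [].
have iI : mu.-integrable `[y - 2 * e ^+ 2, y] (EFin \o G e).
  by apply: continuous_compact_integrable; [exact: segment_compact|exact: continuous_subspaceT].
have E : affine y (e ^+ 2) @^-1` `[y - 2 * e ^+ 2, y] = `[- 2, 0]%classic :> set LT.
  have key (z : R) : (y - 2 * e ^+ 2 <= y + e ^+ 2 * z <= y) = (- 2 <= z <= 0).
    by rewrite lerD2l gerDl pmulr_rle0// -mulNr mulrC ler_pM2l.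
  by apply/seteqP; split => z; rewrite /affine /= !in_itv/= key.
have cI := Rintegral_affine y e20 mI iI.
rewrite E in cI.
have cq : continuous (fun th : R => G e y + th * m + th ^+ 2 * v).
  move=> th; apply: cvgD; last by apply: cvgM; [exact: exprn_continuous|exact: cvg_cst].
  by apply: cvgD; [exact: cvg_cst|apply: cvgM; [exact: cvg_id|exact: cvg_cst]].
have ca : continuous (fun th : R => G e (affine y (e ^+ 2) th)).
  move=> th; apply: (@continuous_comp _ _ _ (fun th : R => y + e ^+ 2 * th) (G e)); last exact: cG.
  by apply: cvgD; [exact: cvg_cst|apply: cvgM; [exact: cvg_cst|exact: cvg_id]].
have icont (f : R -> R) : continuous f -> mu.-integrable `[- 2, 0] (EFin \o f).
  by move=> cf; apply: continuous_compact_integrable; [exact: segment_compact|exact: continuous_subspaceT].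
have n20 : (- 2 : R) <= 0 by rewrite oppr_le0.
have eq1 : \int[mu]_(th in `[- 2, 0]) (G e y + th * m + th ^+ 2 * v) = 2 * G e y - 2 * m + 8 / 3 * v.
  have dF (x : R) : - 2 <= x <= 0 -> is_derive x 1 (fun x : R => G e y * x + x ^+ 2 * (m / 2) + x ^+ 3 * (v / 3))
      (G e y + x * m + x ^+ 2 * v).
    by move=> _; apply: is_derive_eq; rewrite /GRing.scale/=; field.
  have [_ ->] := Rint_FTC n20 dF (fun x _ => @cq x).
  by field.
have m20 : measurable (`[- 2, 0]%classic : set LT) by [].
have eq2 : `|\int[mu]_(th in `[- 2, 0]) G e (affine y (e ^+ 2) th) - (2 * G e y - 2 * m + 8 / 3 * v)| <= 2 * (D * e ^+ 3).
  rewrite -eq1 -(RintegralB m20 (icont _ ca) (icont _ cq)).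
  have -> : 2 * (D * e ^+ 3) = \int[mu]_(x in `[- 2, 0]) (D * e ^+ 3).
    rewrite Rintegral_cst//= lebesgue_measure_itv/= lte_fin oppr_lt0 ltr0n/=.
    by rewrite sub0r opprK mulrC.
  apply: normr_Rintegral_le => //.
  - by apply: icont => x; apply: cvgB; [exact: ca|exact: cq].
  - by apply: icont => x; exact: cvg_cst.
  - move=> th; rewrite /= in_itv/= => /andP[t1 t2].
    have ht : `|th| <= 2 by rewrite ler_norml t1 (le_trans t2).
    by have := hst th ht; rewrite /affine [e ^+ 2 * th]mulrC !opprD !addrA.
move: eq2 g1 g2; rewrite cI.
move: (\int[mu]_(th in `[- 2, 0]) G e (affine y (e ^+ 2) th)) => J.
move: (G e (y - 2 * e ^+ 2)) (G e (y + 2 * e ^+ 2)) (G e y) => gm gp b1.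
have -> : (2 * e ^+ 2)^-1 * (e ^+ 2 * J) = 2^-1 * J by field; exact: lt0r_neq0.
move: (D * e ^+ 3) => d; clear.
rewrite !ler_norml => /andP[? ?] /andP[? ?] /andP[? ?].
by apply/andP; split; lra.
Qed.

(** Second differences telescope to the first differences at the two ends; the right one involves a
    node beyond the last. With n of order e^(-2) the error is of order e. *)
Lemma trapezoid (C : R) : 0 < C -> exists2 D : R, 0 < D &
  forall (e : R) (n : nat), 0 < e <= 1 ->
  (forall j, (j < n)%N -> exists a, conc C e (2 * j.+1%:R * e ^+ 2) a) ->
  `|\sum_(j < n) G e (2 * j.+1%:R * e ^+ 2)
    - (2 * e ^+ 2)^-1 * \int[mu]_(y in `[0, 2 * n%:R * e ^+ 2]) G e y
    - 2^-1 * (G e (2 * n%:R * e ^+ 2) - G e 0)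
    - 12^-1 * ((G e (2 * n.+1%:R * e ^+ 2) - G e (2 * n%:R * e ^+ 2)) - (G e (2 * e ^+ 2) - G e 0))|
  <= n%:R * (D * e ^+ 3).
Proof.
move=> C0; have [D D0 hD] := lnZ_step C0.
exists (2 * D); first by rewrite mulr_gt0.
have aux (S b1 I0 I1 b2 g0 gp gm c h w : R) : S + b1 - c * (I0 + I1) - h * (b1 - g0) - w * (gp - b1 - (b2 - g0)) =
  S - c * I0 - h * (gm - g0) - w * (b1 - gm - (b2 - g0)) +
  (b1 - c * I1 - h * (b1 - gm) - w * (gp - b1 - (b1 - gm))) by ring.
move=> e + he; have [e0 e1] := andP he.
have e20 : 0 < e ^+ 2 by rewrite exprn_gt0.
have cG : continuous (G e) by apply: continuous_lnZ => //; rewrite invr_ge0 ltW.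
elim=> [_|n IHn hn].
  have -> : 2 * 0%:R * e ^+ 2 = 0 by rewrite mulr0 mul0r.
  rewrite mulr1 set_itv1 Rintegral_set1 big_ord0 mul0r (subrr (G e 0)).
  by rewrite (subrr (G e (2 * e ^+ 2) - G e 0)) !mulr0 !subr0 normr0.
have {IHn} h := IHn (fun j jn => hn j (ltnW jn)).
have [a ha] := hn n (ltnSn n).
have [m [v [_ _ hst]]] := hD e _ a he ha.
have hc := trapezoid_cell e0 hst.
have yE : 2 * n.+1%:R * e ^+ 2 - 2 * e ^+ 2 = 2 * n%:R * e ^+ 2 by rewrite -[n.+1%:R]natr1; ring.
have yE' : 2 * n.+1%:R * e ^+ 2 + 2 * e ^+ 2 = 2 * n.+2%:R * e ^+ 2 by rewrite -[n.+2%:R]natr1; ring.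
rewrite yE yE' in hc.
have y0 : 0 <= 2 * n%:R * e ^+ 2 by rewrite !mulr_ge0 ?ler0n// ltW.
have y1 : 2 * n%:R * e ^+ 2 <= 2 * n.+1%:R * e ^+ 2 by rewrite !ler_wpM2r ?ler_wpM2l ?ler_nat// ltW.
rewrite (Rint_cat cG y0 y1) big_ord_recr/= -[n.+1%:R in leRHS]natr1.
have -> : (n%:R + 1) * (2 * D * e ^+ 3) = n%:R * (2 * D * e ^+ 3) + 2 * (D * e ^+ 3) by ring.
apply: le_trans (lerD h hc); apply: le_trans (ler_normD _ _).
rewrite le_eqVlt; apply/orP; left; apply/eqP; congr `|_|.
exact: aux.
Qed.

End trapezoid.

Section real_limits.
Context {R : realType}.
Implicit Types (u v : nat -> R) (a b k : R).

Lemma rcvgD u v a b : u @ \oo --> a -> v @ \oo --> b -> (fun n => u n + v n) @ \oo --> (a + b : R).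
Proof. by move=> ua vb; apply: cvgD. Qed.

Lemma rcvgN u a : u @ \oo --> a -> (fun n => - u n) @ \oo --> (- a : R).
Proof. by move=> ua; apply: cvgN. Qed.

Lemma rcvgB u v a b : u @ \oo --> a -> v @ \oo --> b -> (fun n => u n - v n) @ \oo --> (a - b : R).
Proof. by move=> ua vb; apply: cvgB. Qed.

Lemma rcvgZ k u a : u @ \oo --> a -> (fun n => k * u n) @ \oo --> (k * a : R).
Proof. by move=> ua; apply: cvgM => //; exact: cvg_cst. Qed.

Lemma rcvgC a : (fun _ : nat => a) @ \oo --> a.
Proof. exact: cvg_cst. Qed.

Lemma rcvg_eq u v a b : u @ \oo --> a -> (forall n, u n = v n) -> a = b -> v @ \oo --> b.
Proof. by move=> ua /funext <- <-. Qed.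

End real_limits.
Arguments rcvgZ {R} k {u a}.
Arguments rcvgC {R} a.

(** * Asymptotics of the sum of log-partition functions *)

Section assembly.
Context {R : realType} (P P1 P2 P3 P4 P5 : R -> R) (X x0 B : R).
Hypothesis dP : forall x : R, is_derive x 1 P (P1 x).
Hypothesis dP1 : forall x : R, is_derive x 1 P1 (P2 x).
Hypothesis dP2 : forall x : R, is_derive x 1 P2 (P3 x).
Hypothesis dP3 : forall x : R, is_derive x 1 P3 (P4 x).
Hypothesis dP4 : forall x : R, is_derive x 1 P4 (P5 x).
Hypothesis cP5 : continuous P5.
Hypothesis P2_gt0 : forall x, 0 < P2 x.
Hypothesis P20 : P2 0 = 2.
Hypothesis Xx0 : X < x0.
Hypothesis x00 : x0 < 0.
Hypothesis B0 : 0 < B.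
Hypothesis P1x0 : P1 x0 = 0.
Notation mu := (@lebesgue_measure R).
Notation LT := (measurableTypeR R).
Notation lap := (lap P P1 X B).
Notation Wl := (Wl P P1 X B).
Notation Jl := (Jl P P1 X B).
Notation Ml := (Ml P P1 X B).
Notation gb e y := (gibbs P (e ^+ 2)^-1 y).
Notation G e := (lnZ P X 0 (e ^+ 2)^-1).
Notation conc := (conc P X).

Let X0 : X < 0.
Proof. by have h1 := Xx0; have h2 := x00; lra. Qed.

Let cP : continuous P. Proof. by move=> x; exact: is_derive_cvg. Qed.
Let cP1 : continuous P1. Proof. by move=> x; exact: is_derive_cvg. Qed.
Let cP2 : continuous P2. Proof. by move=> x; exact: is_derive_cvg. Qed.
Let mT := @measurableT _ LT.

Let cabs (k : nat) : continuous (fun z : R => `|z| ^+ k).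
Proof.
move=> x; apply: (@continuous_comp _ _ _ (fun x : R => `|x|) (fun z => z ^+ k)); last exact: exprn_continuous.
exact: norm_continuous.
Qed.

(** The substitution x = u + e z transfers a moment bound for the rescaled weight to the Gibbs
    measure; the normalising factor b cancels. *)
Lemma conc_lap (e u y b K : R) (w : R -> R) (k : nat) : 0 < e -> 0 < b -> continuous w ->
  (forall z, 0 <= w z) ->
  (forall x, w ((x - u) / e) * expR (- (breg P P1 x u / e ^+ 2)) = b * gb e y x) ->
  \int[mu]_(z in [set z | u + e * z <= 0]) ((`|z| ^+ k * w z) * lap e z u) <=
    K * \int[mu]_(z in [set z | u + e * z <= 0]) (w z * lap e z u) ->
  \int[mu]_(x in `[X, 0]) (`|x - u| ^+ k * gb e y x) <= K * e ^+ k * \int[mu]_(x in `[X, 0]) gb e y x.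
Proof.
move=> e0 b0 cw w0 hw.
have cwk : continuous (fun z : R => `|z| ^+ k * w z) by move=> z; apply: cvgM; [exact: cabs|exact: cw].
rewrite (lap_affine X dP u e0 (ltW B0) cwk) (lap_affine X dP u e0 (ltW B0) cw).
have -> : \int[mu]_(x in `[X, 0]) (w ((x - u) / e) * expR (- (breg P P1 x u / e ^+ 2))) =
    b * \int[mu]_(x in `[X, 0]) gb e y x.
  have ig : mu.-integrable `[X, 0] (EFin \o gb e y) by exact: intg_gibbs.
  have mX : measurable (`[X, 0]%classic : set LT) by [].
  by rewrite -(RintegralZl b mX ig); apply: eq_Rintegral => x _; exact: hw.
have ik : mu.-integrable `[X, 0] (EFin \o (fun x => `|x - u| ^+ k * gb e y x)).
  apply: intg_Xgibbs => // x.
  apply: (@continuous_comp _ _ _ (fun x : R => x - u) (fun z => `|z| ^+ k)); last exact: cabs.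
  by apply: cvgB; [exact: cvg_id|exact: cvg_cst].
have -> : \int[mu]_(x in `[X, 0]) (`|(x - u) / e| ^+ k * w ((x - u) / e) * expR (- (breg P P1 x u / e ^+ 2))) =
    (b / e ^+ k) * \int[mu]_(x in `[X, 0]) (`|x - u| ^+ k * gb e y x).
  rewrite -RintegralZl//; apply: eq_Rintegral => x _.
  rewrite -mulrA hw normrM normfV (gtr0_norm e0) expr_div_n.
  by field; rewrite expf_neq0// lt0r_neq0.
move: (\int[mu]_(x in `[X, 0]) (`|x - u| ^+ k * gb e y x)) (\int[mu]_(x in `[X, 0]) gb e y x) => Ik I0.
have ek0 : 0 < e ^+ k by rewrite exprn_gt0.
have p0 : 0 <= e * e ^+ k / b by rewrite divr_ge0 ?mulr_ge0 ?(ltW e0) ?(ltW ek0) ?(ltW b0).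
move=> /(ler_wpM2l p0).
have -> : e * e ^+ k / b * (e^-1 * (b / e ^+ k * Ik)) = Ik.
  by field; rewrite !lt0r_neq0.
have -> : e * e ^+ k / b * (K * (e^-1 * (b * I0))) = K * e ^+ k * I0 by field; rewrite !lt0r_neq0.
by [].
Qed.

Lemma conc_in : exists2 C : R, 0 < C & forall e u : R, 0 < e <= 1 -> x0 <= u <= 0 ->
  conc C e (P1 u) u.
Proof.
have [m [K [c [[m0 K0 c0 c1] hg hP2 hl]]]] := lap_bounds dP dP1 dP2 dP3 dP4 cP5 P2_gt0 Xx0 x00 B0.
have [C1 C10 hW] := W_bounds dP dP1 dP2 dP3 dP4 cP5 P2_gt0 Xx0 x00 B0.
have g0 : 0 <= gpoly m setT.
  by apply: Rintegral_ge0 => z _; rewrite mulr_ge0 ?expR_ge0// exprn_ge0// addr_ge0.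
exists ((gpoly m setT + 1) * C1); first by rewrite mulr_gt0//; lra.
move=> e u he hu; have [e0 e1] := andP he; split.
  by have h := Xx0; case/andP: hu => *; apply/andP; split => //; lra.
move=> k /andP[_ k3].
have c1' : continuous (fun _ : R => 1 : R) by move=> t; exact: cvg_cst.
apply: (@conc_lap e u (P1 u) (expR ((P u - u * P1 u) / e ^+ 2)) _ (fun=> 1)) => //.
- exact: expR_gt0.
- by move=> x; rewrite mul1r (gibbs_breg _ _ _ _ (lt0r_neq0 e0)).
have mD : measurable ([set z | u + e * z <= 0] : set LT).
  have -> : [set z : R | u + e * z <= 0] = `]-oo, - u / e]%classic.
    by apply/seteqP; split => z /=; rewrite in_itv/= ler_pdivlMr// mulrC; lra.
  by [].
have [_ _ j1 _ _] := hW u e hu he.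
have -> : \int[mu]_(z in [set z | u + e * z <= 0]) (1 * lap e z u) = Jl e u.
  by apply: eq_Rintegral => z _; rewrite mul1r.
have ip := intgS mT mD (@subsetT _ _) (intg_gs_poly 3 m0).
have bd (z : R) : `|z| ^+ k * 1 * lap e z u <= (1 + `|z|) ^+ 3 * gs m z.
  have [l1 _ _ _] := hl u e z hu he; rewrite mulr1; apply: ler_pM => //; rewrite ?exprn_ge0 ?lap_ge0//.
  apply: (@le_trans _ _ ((1 + `|z|) ^+ k)); first by rewrite lerXn2r ?nnegrE ?addr_ge0// lerDr.
  by rewrite ler_weXn2l// lerDl.
apply: (@le_trans _ _ (gpoly m setT)).
  apply: (@le_trans _ _ (\int[mu]_(z in [set z | u + e * z <= 0]) ((1 + `|z|) ^+ 3 * gs m z))).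
    apply: le_Rintegral => //.
    have mf : measurable_fun ([set z | u + e * z <= 0] : set LT) (fun z : R => `|z| ^+ k * 1 * lap e z u).
      apply: measurable_funM; last exact: measurable_funTS (measurable_lap X B dP e u).
      apply: measurable_funTS; apply: measurable_cont => z.
      by apply: cvgM; [exact: cabs|exact: cvg_cst].
    refine (intg_le mD mf ip _) => z _.
    by rewrite ger0_norm// !mulr_ge0 ?exprn_ge0 ?lap_ge0.
  apply: ge0_le_RintegralS => //; first exact: intg_gs_poly.
  by move=> z _; rewrite mulr_ge0 ?expR_ge0// exprn_ge0// addr_ge0.
rewrite -mulrA; apply: (@le_trans _ _ ((gpoly m setT + 1) * 1)); first by rewrite mulr1 lerDl.
rewrite ler_wpM2l ?addr_ge0//.
by rewrite -(divff (lt0r_neq0 C10)) ler_pM2l.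
Qed.

(** Beyond the wall the measure concentrates at 0: the k-th moment has order (1 + x)^(-k-1) and the
    mass order 1 / (1 + x), so the bound is uniform in x. *)
Lemma conc_out : exists2 C : R, 0 < C & forall e x : R, 0 < e <= 1 -> 0 <= x ->
  conc C e (P1 0 + 2 * e * x) 0.
Proof.
have [m [K [c [[m0 K0 c0 c1] [hg hc hl]]]]] := lap_zero dP dP1 dP2 dP3 dP4 cP5 P2_gt0 P20 Xx0 x00 B0.
have [C1 C10 hM] := M_bounds dP dP1 dP2 dP3 dP4 cP5 P2_gt0 P20 Xx0 x00 B0.
have [D1 D10 h1] := exp_moment 1 m0.
have [D2 D20 h2] := exp_moment 2 m0.
have [D3 D30 h3] := exp_moment 3 m0.
exists ((D1 + D2 + D3) * C1); first by rewrite mulr_gt0 ?addr_gt0.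
move=> e x he xge; have [e0 e1] := andP he; split.
  by rewrite lexx (ltW X0).
have s0 : 0 < 1 + x by lra.
have s1 : 1 <= 1 + x by lra.
move=> k hk.
pose w (z : R) := expR (2 * x * z).
have cw : continuous w.
  move=> z; apply: (@continuous_comp _ _ _ (fun z : R => 2 * x * z) expR); last exact: continuous_expR.
  by apply: cvgM; [exact: cvg_cst|exact: cvg_id].
apply: (@conc_lap e 0 _ (expR (P 0 / e ^+ 2)) _ w) => //.
- exact: expR_gt0.
- by move=> z; exact: expR_ge0.
- move=> z; rewrite (gibbs_breg _ _ _ _ (lt0r_neq0 e0)) /w /gibbs -!expRD; congr expR.
  by field; rewrite lt0r_neq0.
have -> : [set z : R | 0 + e * z <= 0] = `]-oo, 0]%classic.
  by apply/seteqP; split => z /=; rewrite in_itv/= add0r pmulr_rle0.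
have [iM l1 _ _] := hM e x he xge.
rewrite -/(Ml e x).
have mf j : measurable_fun (`]-oo, 0]%classic : set LT) (fun z : R => `|z| ^+ j * w z * lap e z 0).
  apply: measurable_funM; last exact: measurable_funTS (measurable_lap X B dP e 0).
  apply: measurable_funTS; apply: measurable_cont => z.
  by apply: cvgM; [exact: cabs|exact: cw].
have bf j (z : R) : z <= 0 -> `| `|z| ^+ j * w z * lap e z 0 | <= `|z| ^+ j * (expR (2 * x * z) * gs m z).
  move=> _; rewrite !normrM normrX normr_id (ger0_norm (expR_ge0 _)) (ger0_norm (lap_ge0 _ _ _ _ _ _ _)).
  rewrite -mulrA ler_wpM2l ?exprn_ge0// ler_wpM2l ?expR_ge0//.
  by have [] := hl e z he.
apply: (@le_trans _ _ ((D1 + D2 + D3) / (1 + x))); last first.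
  rewrite -mulrA; apply: ler_wpM2l; first by rewrite !addr_ge0// ltW.
  apply: le_trans (ler_wpM2l (ltW C10) l1); rewrite invfM mulVKf//; exact: lt0r_neq0.
have fin j D : 0 < D -> (0 < j)%N -> D <= D1 + D2 + D3 ->
    D / (1 + x) ^+ j.+1 <= (D1 + D2 + D3) / (1 + x).
  move=> D0' j0 DD; apply: ler_pM => //; rewrite ?invr_ge0 ?exprn_ge0 ?(ltW D0') ?(ltW s0)//.
  rewrite lef_pV2 ?posrE ?exprn_gt0// exprS ler_peMr ?(ltW s0)//.
  exact: exprn_ege1.
case: k hk => [//|[_|[_|[_|//]]]]; apply: (le_trans (ler_norm _)).
- by have [_ h] := h1 x _ xge (mf 1%N) (bf 1%N); apply: (le_trans h); apply: fin => //; lra.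
- by have [_ h] := h2 x _ xge (mf 2%N) (bf 2%N); apply: (le_trans h); apply: fin => //; lra.
- by have [_ h] := h3 x _ xge (mf 3%N) (bf 3%N); apply: (le_trans h); apply: fin => //; lra.
Qed.

Lemma conc_mono (C D e y a : R) : C <= D -> 0 < e -> conc C e y a -> conc D e y a.
Proof.
move=> CD e0 [ha h]; split => // k hk; apply: (le_trans (h k hk)).
rewrite ler_wpM2r ?ler_wpM2r ?exprn_ge0 ?(ltW e0)//.
by apply: Rintegral_ge0 => z _; exact: expR_ge0.
Qed.

Lemma conc_all : exists2 C : R, 0 < C & forall e : R, 0 < e <= 1 ->
  [/\ conc C e 0 x0, forall y, P1 0 <= y -> conc C e y 0 &
      forall y, 0 <= y -> exists a, conc C e y a].
Proof.
have [C1 C10 h1] := conc_in; have [C2 C20 h2] := conc_out.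
exists (C1 + C2); first by rewrite addr_gt0.
move=> e he; have [e0 _] := andP he.
have le1 : C1 <= C1 + C2 by rewrite lerDl ltW.
have le2 : C2 <= C1 + C2 by rewrite lerDr ltW.
have hout y : P1 0 <= y -> conc (C1 + C2) e y 0.
  move=> hy; have xge : 0 <= (y - P1 0) / (2 * e) by rewrite divr_ge0 ?subr_ge0 ?mulr_ge0 ?(ltW e0).
  have := h2 e _ he xge; have -> : P1 0 + 2 * e * ((y - P1 0) / (2 * e)) = y.
    by field; exact: lt0r_neq0.
  exact: conc_mono.
have hin u : x0 <= u <= 0 -> conc (C1 + C2) e (P1 u) u.
  by move=> hu; apply: (conc_mono le1 e0); exact: h1.
split => //.
  by rewrite -P1x0; apply: hin; rewrite lexx ltW.
move=> y y0; have [hy|hy] := leP (P1 0) y; first by exists 0; exact: hout.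
have cw : {within `[x0, 0], continuous P1} by exact: continuous_subspaceT.
have hv : Num.min (P1 x0) (P1 0) <= y <= Num.max (P1 x0) (P1 0).
  by rewrite P1x0 ge_min y0 le_max (ltW hy) orbT.
have [u] := IVT (ltW x00) cw hv.
rewrite in_itv/= => hu <-; exists u; exact: hin.
Qed.

Variables (e_ : nat -> R) (N_ : nat -> nat) (Y : R).
Hypothesis e_01 : forall n, 0 < e_ n <= 1.
Hypothesis e_cvg : e_ @ \oo --> (0 : R).
Hypothesis Ne : forall n, 2 * (N_ n)%:R * e_ n ^+ 2 = Y.
Hypothesis PY : P1 0 <= Y.

Let e_gt0 n : 0 < e_ n. Proof. by have /andP[] := e_01 n. Qed.
Let e_neq0 n : e_ n != 0. Proof. exact: lt0r_neq0. Qed.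

Let Gsum n := \sum_(j < N_ n) G (e_ n) (2 * j.+1%:R * e_ n ^+ 2).

Let cG e : continuous (G e).
Proof. by apply: continuous_lnZ => //; rewrite invr_ge0 sqr_ge0. Qed.

Lemma cvg_e_scale (D : R) : (fun n => D * e_ n) @ \oo --> (0 : R).
Proof. by rewrite -(mulr0 D); apply: cvgM => //; exact: cvg_cst. Qed.

(** To leading order the increment over a cell is twice the mean of the Gibbs measure, which is
    within O(e) of a. *)
Lemma lnZ_incr (y a : R) : (exists2 C : R, 0 < C & forall n, conc C (e_ n) y a) ->
  (fun n => G (e_ n) (y + 2 * e_ n ^+ 2) - G (e_ n) y) @ \oo --> 2 * a.
Proof.
have aux (m v g s t : R) : `|g - 2 * m - 2 ^+ 2 * v| <= s -> `|v| <= s -> `|m - a| <= t ->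
    `|g - 2 * a| <= 5 * s + 2 * t.
  rewrite !ler_norml => /andP[? ?] /andP[? ?] /andP[? ?].
  by apply/andP; split; lra.
move=> [C C0 hc]; have [D D0 hD] := lnZ_step cP X0 C0.
apply: (@cvg_shift_squeeze _ _ (fun n => (5 * D + 2 * C) * e_ n)); first exact: cvg_e_scale.
move=> n; have [e0 e1] := andP (e_01 n).
have [m [v [hm hv h]]] := hD _ _ _ (e_01 n) (hc n).
have p2 : `|2 : R| <= 2 by rewrite ger0_norm.
have {h} h := h 2 p2.
have e2 : e_ n ^+ 2 <= e_ n by rewrite expr2 ler_piMl// ltW.
have e3 : e_ n ^+ 3 <= e_ n by rewrite exprS (le_trans (ler_wpM2l (ltW e0) e2))// -expr2.
have h2 := le_trans hv (ler_wpM2l (ltW D0) e2).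
have h3 := le_trans h (ler_wpM2l (ltW D0) e3).
have -> : (5 * D + 2 * C) * e_ n = 5 * (D * e_ n) + 2 * (C * e_ n) by ring.
exact: aux h3 h2 hm.
Qed.

(** The end correction is (2 * 0 - 2 x0) / 12: the Gibbs measure concentrates at the wall for y = Y
    and at x0 for y = 0. *)
Lemma sum_euler : (fun n => Gsum n - (2 * e_ n ^+ 2)^-1 * \int[mu]_(y in `[0, Y]) G (e_ n) y
    - 2^-1 * (G (e_ n) Y - G (e_ n) 0)) @ \oo --> - x0 / 6.
Proof.
have [C C0 hC] := conc_all.
have [D D0 hD] := trapezoid cP X0 C0.
have i1 : (fun n => G (e_ n) (Y + 2 * e_ n ^+ 2) - G (e_ n) Y) @ \oo --> (2 * 0 : R).
  by apply: lnZ_incr; exists C => // n; have [_ h _] := hC _ (e_01 n); exact: h.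
have i2 : (fun n => G (e_ n) (0 + 2 * e_ n ^+ 2) - G (e_ n) 0) @ \oo --> (2 * x0 : R).
  by apply: lnZ_incr; exists C => // n; have [h _ _] := hC _ (e_01 n).
have T : (fun n => Gsum n - (2 * e_ n ^+ 2)^-1 * \int[mu]_(y in `[0, Y]) G (e_ n) y
    - 2^-1 * (G (e_ n) Y - G (e_ n) 0)
    - 12^-1 * ((G (e_ n) (Y + 2 * e_ n ^+ 2) - G (e_ n) Y) - (G (e_ n) (0 + 2 * e_ n ^+ 2) - G (e_ n) 0)))
    @ \oo --> (0 : R).
  apply: (@cvg_shift_squeeze _ _ (fun n => (Y * D / 2) * e_ n)); first exact: cvg_e_scale.
  move=> n; rewrite subr0.
  have hc j : (j < N_ n)%N -> exists a, conc C (e_ n) (2 * j.+1%:R * e_ n ^+ 2) a.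
    move=> _; have [_ _ h] := hC _ (e_01 n); apply: h.
    by rewrite !mulr_ge0 ?exprn_ge0 ?ler0n// ltW.
  have := hD _ (N_ n) (e_01 n) hc.
  have -> : 2 * (N_ n).+1%:R * e_ n ^+ 2 = Y + 2 * e_ n ^+ 2 by rewrite -natr1 -(Ne n); ring.
  rewrite Ne add0r => h; apply: (le_trans h).
  by rewrite le_eqVlt; apply/orP; left; apply/eqP; rewrite -(Ne n); field.
refine (rcvg_eq (rcvgD T (rcvgZ 12^-1 (rcvgB i1 i2))) _ _) => [n|]; last by field.
by rewrite subrK.
Qed.

Lemma is_derive_primitive (f : R -> R) (c x : R) : continuous f -> c < x ->
  is_derive x 1 (fun y => \int[mu]_(t in `[c, y]) f t) (f x).
Proof.
move=> cf cx; have xx : x < x + 1 by lra.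
have mI : mu.-integrable `[c, x + 1] (EFin \o f).
  by apply: continuous_compact_integrable; [exact: segment_compact|exact: continuous_subspaceT].
have [dF F'] := @continuous_FTC1_closed R f c x (x + 1) xx mI cx (@cf x).
by rewrite -F' derive1E; exact: derivableP.
Qed.

Lemma lnZ_subst (e : R) :
  \int[mu]_(y in `[0, P1 0]) G e y = \int[mu]_(u in `[x0, 0]) (G e (P1 u) * P2 u).
Proof.
have P1ge (u : R) : x0 <= u -> 0 <= P1 u.
  move=> hu; have [c _] := @MVT_between R P1 P2 x0 u (fun c _ => dP1 c).
  rewrite P1x0 subr0 => ->; by rewrite mulr_ge0 ?subr_ge0// ltW.
(* Starting the primitive at - 1 keeps it differentiable at y = P1 x0 = 0, the left end of the
   integral. *)
pose F y := \int[mu]_(t in `[- 1, y]) G e t.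
have dF (u : R) : x0 <= u <= 0 -> is_derive u 1 (F \o P1) (G e (P1 u) * P2 u).
  move=> /andP[hu _]; have := P1ge u hu => h.
  have h1 : is_derive (P1 u) 1 F (G e (P1 u)) by apply: is_derive_primitive => //; lra.
  have h2 := dP1 u; exact: is_derive1_comp.
have cf (u : R) : x0 <= u <= 0 -> {for u, continuous (fun u => G e (P1 u) * P2 u)}.
  move=> _; apply: cvgM; last exact: cP2.
  by apply: (@continuous_comp _ _ _ P1 (G e)); [exact: cP1|exact: cG].
have [_ ->] := Rint_FTC (ltW x00) dF cf.
have m10 : - 1 <= 0 :> R by rewrite oppr_le0.
rewrite /= P1x0 /F (@Rint_cat R (G e) _ _ _ (@cG e) m10 (P1ge 0 (ltW x00))).
by rewrite addrC addKr.
Qed.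

(** [Lam], [Ent] and [Blk] are the coefficients of orders N^2, N and 1: minimum value of the
    exponent, logarithm of the Gaussian width, and second Laplace correction. *)
Let Lam := \int[mu]_(u in `[x0, 0]) (P2 u * (P u - u * P1 u)).
Let Ent := \int[mu]_(u in `[x0, 0]) (P2 u * ln (2 * pi / P2 u)).
Let Blk := \int[mu]_(u in `[x0, 0]) (5 * P3 u ^+ 2 / (24 * P2 u ^+ 2) - P4 u / (8 * P2 u)).

Let icont (f : R -> R) : continuous f -> mu.-integrable `[x0, 0] (EFin \o f).
Proof.
by move=> cf; apply: continuous_compact_integrable; [exact: segment_compact|exact: continuous_subspaceT].
Qed.

Let IZ (f : R -> R) (k : R) : continuous f ->
  \int[mu]_(u in `[x0, 0]) (k * f u) = k * \int[mu]_(u in `[x0, 0]) f u.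
Proof. by move=> cf; rewrite RintegralZl//; exact: icont. Qed.

Let cg : continuous (fun u => P u - u * P1 u).
Proof. by move=> u; apply: cvgB; [exact: cP|apply: cvgM; [exact: cvg_id|exact: cP1]]. Qed.

Let sP2 u : 0 < 2 * pi / P2 u.
Proof. by rewrite divr_gt0// mulr_gt0// pi_gt0. Qed.

Let cs : continuous (fun u => ln (2 * pi / P2 u)).
Proof.
move=> u; apply: (@continuous_comp _ _ _ (fun u => 2 * pi / P2 u) (@ln R)).
  by apply: cvgM; [exact: cvg_cst|apply: cvgV; [exact: lt0r_neq0|exact: cP2]].
exact: continuous_ln.
Qed.

Lemma int_in : (fun n => (2 * e_ n ^+ 2)^-1 * \int[mu]_(y in `[0, P1 0]) G (e_ n) y -
   (- (2 * e_ n ^+ 4)^-1 * Lam + ln (e_ n) / (2 * e_ n ^+ 2) * P1 0 + (4 * e_ n ^+ 2)^-1 * Ent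
     - (e_ n)^-1 * (Num.sqrt 2 * gamma_in R))) @ \oo --> 2^-1 * Blk + 2^-1 * P3 0 * beta_in R.
Proof.
have hB := bulk_limit dP dP1 dP2 dP3 dP4 cP5 P2_gt0 Xx0 x00 B0 e_01 e_cvg.
have [iPh hI] := inner_limit dP dP1 dP2 dP3 dP4 cP5 P2_gt0 P20 Xx0 x00 B0 e_01 e_cvg.
rewrite -beta_inE in hI.
refine (rcvg_eq (rcvgD (rcvgZ 2^-1 hB) (rcvgZ 2^-1 hI)) _ _) => [n|]; last by rewrite mulrA.
have e0 := e_gt0 n.
have cJ := continuous_lnJ dP dP1 Xx0 x00 B0 e0.
have cW := continuous_lnW dP dP1 Xx0 x00 B0 e0.
have lsq u : ln (Num.sqrt (2 * pi / P2 u)) = 2^-1 * ln (2 * pi / P2 u).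
  rewrite -[in RHS](@sqr_sqrtr _ (2 * pi / P2 u)) ?ltW// lnXn ?sqrtr_gt0// mulr2n; by field.
have cLW : continuous (fun u => P2 u * ln (Wl (e_ n) u)) by move=> u; apply: cvgM; [exact: cP2|exact: cW].
have cLJ : continuous (fun u => P2 u * ln (Jl (e_ n) u)) by move=> u; apply: cvgM; [exact: cP2|exact: cJ].
have cLs : continuous (fun u => P2 u * ln (2 * pi / P2 u)) by move=> u; apply: cvgM; [exact: cP2|exact: cs].
have cLg : continuous (fun u => P2 u * (P u - u * P1 u)) by move=> u; apply: cvgM; [exact: cP2|exact: cg].
have mI : measurable (`[x0, 0]%classic : set LT) by [].
have e1 : \int[mu]_(u in `[x0, 0]) (P2 u * ((ln (Wl (e_ n) u) - ln (Num.sqrt (2 * pi / P2 u))) / e_ n ^+ 2)) =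
   (\int[mu]_(u in `[x0, 0]) (P2 u * ln (Wl (e_ n) u)) - 2^-1 * Ent) / e_ n ^+ 2.
  rewrite /Ent -(IZ _ cLs) -(RintegralB mI (icont cLW) (intgZ 2^-1 mI (icont cLs))).
  rewrite -RintegralZr//; last exact: (intgB mI (icont cLW) (intgZ 2^-1 mI (icont cLs))).
  by apply: eq_Rintegral => u _; rewrite lsq; ring.
have e2 : \int[mu]_(u in `[x0, 0]) (P2 u * (ln (Jl (e_ n) u) - ln (Wl (e_ n) u))) =
   \int[mu]_(u in `[x0, 0]) (P2 u * ln (Jl (e_ n) u)) - \int[mu]_(u in `[x0, 0]) (P2 u * ln (Wl (e_ n) u)).
  by rewrite -(RintegralB mI (icont cLJ) (icont cLW)); apply: eq_Rintegral => u _; ring.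
have e3 : \int[mu]_(u in `[x0, 0]) P2 u = P1 0.
  by have [_ ->] := Rint_FTC (ltW x00) (fun x _ => dP1 x) (fun x _ => @cP2 x); rewrite P1x0 subr0.
have e4 : \int[mu]_(y in `[0, P1 0]) G (e_ n) y =
   \int[mu]_(u in `[x0, 0]) (P2 u * ln (Jl (e_ n) u)) - (e_ n ^+ 2)^-1 * Lam + ln (e_ n) * P1 0.
  rewrite lnZ_subst -e3 /Lam -(IZ _ cLg) -(IZ _ cP2).
  have i1 := icont cLJ; have i2 := intgZ (e_ n ^+ 2)^-1 mI (icont cLg).
  rewrite -(RintegralB mI i1 i2) -(RintegralD mI (intgB mI i1 i2) (intgZ (ln (e_ n)) mI (icont cP2))).
  apply: eq_Rintegral => u _; rewrite (lnJ dP Xx0 x00 B0 u e0); ring.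
rewrite e1 e2 e4 gamma_inE.
move: (\int[mu]_(u in `[x0, 0]) (P2 u * ln (Wl (e_ n) u))) (\int[mu]_(u in `[x0, 0]) (P2 u * ln (Jl (e_ n) u)))
  Lam Ent (P1 0) (gamma_in R) (ln (e_ n)) (e_neq0 n).
by move: (e_ n) => e w j la en p g le ne; field.
Qed.

(** The saddle x0 is |x0| / e away from the wall in units of z, so the truncation removes only a
    Gaussian tail and the full Gaussian integral survives. *)
Lemma lnJ_x0 : (fun n => ln (Jl (e_ n) x0)) @ \oo --> 2^-1 * ln (2 * pi / P2 x0).
Proof.
have hx0 : x0 <= x0 <= 0 by rewrite lexx ltW.
have [m [K [c [[m0 K0 c0 c1] hg hP2 hl]]]] := lap_bounds dP dP1 dP2 dP3 dP4 cP5 P2_gt0 Xx0 x00 B0.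
have [C1 C10 hW] := W_bounds dP dP1 dP2 dP3 dP4 cP5 P2_gt0 Xx0 x00 B0.
have [Cg Cg0 [_ Cgx]] := gpoly_tail m0.
have s0 : 0 < Num.sqrt (2 * pi / P2 x0) by rewrite sqrtr_gt0.
have -> : 2^-1 * ln (2 * pi / P2 x0) = ln (Num.sqrt (2 * pi / P2 x0)).
  rewrite -[in LHS](@sqr_sqrtr _ (2 * pi / P2 x0)) ?ltW// lnXn// mulr2n; by field.
suff J : (fun n => Jl (e_ n) x0) @ \oo --> Num.sqrt (2 * pi / P2 x0).
  by apply: (cvg_comp _ _ J); exact: continuous_ln.
pose xn n := x0 / e_ n.
have xn0 n : xn n <= 0 by rewrite /xn ler_pdivrMr// mul0r ltW.
pose c' := (m / 2 * x0 ^+ 2)^-1.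
have x02 : 0 < x0 ^+ 2 by rewrite exprn_even_gt0//= lt_eqF.
have c'0 : 0 < c' by rewrite invr_gt0 mulr_gt0 ?divr_gt0.
apply: (@cvg_shift_squeeze _ _ (fun n => (C1 + Cg * c') * e_ n)); first exact: cvg_e_scale.
move=> n; have [e0 e1] := andP (e_01 n).
have [iT _ _ _ hw] := hW _ _ hx0 (e_01 n).
have ex : x0 = e_ n * xn n by rewrite /xn; field; exact: e_neq0.
have mD : measurable (`]- xn n, +oo[%classic : set LT) by [].
have e2 : e_ n ^+ 2 <= e_ n by rewrite expr2 ler_piMl// ltW.
have [_ /andP[t1 t2]] := lap_intD dP m0 mD (fun z => let: And4 h _ _ _ := hl x0 _ z hx0 (e_01 n) in h).
have ET : Wl (e_ n) x0 - Jl (e_ n) x0 = \int[mu]_(z in `]- xn n, +oo[) lap (e_ n) z x0.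
  rewrite /Wl (intg_split (- xn n) iT) [in Jl _ _]ex Jl_itv// -ex; ring.
have t3 := le_trans t2 (Cgx _ (xn0 n)).
have b : gs (m / 2) (xn n) <= c' * e_ n.
  rewrite /gs; have p0 : 0 < m / 2 * xn n ^+ 2.
    by apply: mulr_gt0; [rewrite divr_gt0|rewrite /xn expr_div_n divr_gt0// exprn_gt0].
  rewrite expRN; apply: (@le_trans _ _ (m / 2 * xn n ^+ 2)^-1).
    rewrite lef_pV2 ?posrE ?expR_gt0// (le_trans _ (expR_ge1Dx _))// lerDr//.
  have -> : (m / 2 * xn n ^+ 2)^-1 = c' * e_ n ^+ 2.
    by rewrite /c' /xn; field; rewrite e_neq0 (lt0r_neq0 m0) lt_eqF.
  by rewrite ler_wpM2l// ltW.
have t4 := le_trans t3 (ler_wpM2l (ltW Cg0) b).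
have hw' := le_trans hw (ler_wpM2l (ltW C10) e2).
rewrite -ET in t1 t4.
have -> : Jl (e_ n) x0 - Num.sqrt (2 * pi / P2 x0) =
  (Wl (e_ n) x0 - Num.sqrt (2 * pi / P2 x0)) - (Wl (e_ n) x0 - Jl (e_ n) x0) by ring.
apply: (le_trans (ler_normB _ _)); rewrite (ger0_norm t1).
have -> : (C1 + Cg * c') * e_ n = C1 * e_ n + Cg * (c' * e_ n) by ring.
exact: lerD.
Qed.

(** With the saddle on the wall exactly half of the Gaussian is left. *)
Lemma lnJ_0 : (fun n => ln (Jl (e_ n) 0)) @ \oo --> ln (Num.sqrt pi / 2).
Proof.
have [m [K [m0 K0 hg hl]]] := lap_gauss dP dP1 dP2 dP3 dP4 cP5 P2_gt0 P20 Xx0 x00 B0.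
have s0 : 0 < Num.sqrt pi / 2 :> R by rewrite divr_gt0// sqrtr_gt0 pi_gt0.
have mD : measurable (`]-oo, - 0]%classic : set LT) by [].
suff J : (fun n => Jl (e_ n) 0) @ \oo --> Num.sqrt pi / 2.
  by apply: (cvg_comp _ _ J); exact: continuous_ln.
apply: (@cvg_shift_squeeze _ _ (fun n => (K * gpoly m `]-oo, - 0]%classic) * e_ n)); first exact: cvg_e_scale.
move=> n; have x0e : x0 <= e_ n * 0 by rewrite mulr0 ltW.
have [_ h] := hl 0 _ (lexx _) x0e (e_01 n).
have := lap_diffD dP m0 mD hg h.
rewrite -(Jl_itv _ _ _ _ _ (e_gt0 n)) gtail_opp mulr0 gtail0 normr0 addr0 mulr1.
by move=> h'; rewrite (le_trans h')// le_eqVlt; apply/orP; left; apply/eqP; ring.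
Qed.

Lemma lnZ_at0 n : G (e_ n) 0 = ln (Jl (e_ n) x0) - P x0 / e_ n ^+ 2 + ln (e_ n).
Proof. by rewrite (lnJ dP Xx0 x00 B0 x0 (e_gt0 n)) P1x0; field; exact: e_neq0. Qed.

(** The constant shared by both cases: end correction, bulk, layer, and half of - ln [Jl] at the
    node y = 0. *)
Let K0 := - x0 / 6 + 2^-1 * Blk + 2^-1 * P3 0 * beta_in R - 4^-1 * ln (2 * pi / P2 x0).

Theorem sum_asym_crit : Y = P1 0 ->
  (fun n => Gsum n - (- (2 * e_ n ^+ 4)^-1 * Lam + ln (e_ n) / (2 * e_ n ^+ 2) * Y + (4 * e_ n ^+ 2)^-1 * Ent
     - (e_ n)^-1 * (Num.sqrt 2 * gamma_in R) - (2 * e_ n ^+ 2)^-1 * (P 0 - P x0))) @ \oo -->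
   K0 + 2^-1 * ln (Num.sqrt pi / 2).
Proof.
move=> EY.
refine (rcvg_eq (rcvgD (rcvgD sum_euler int_in) (rcvgZ 2^-1 (rcvgB lnJ_0 lnJ_x0))) _ _) => [n|];
  last by rewrite /K0; field.
rewrite lnZ_at0 EY.
have -> : G (e_ n) (P1 0) = ln (Jl (e_ n) 0) - P 0 / e_ n ^+ 2 + ln (e_ n).
  by rewrite (lnJ dP Xx0 x00 B0 0 (e_gt0 n)); field; exact: e_neq0.
move: (Gsum n) (\int[mu]_(y in `[0, P1 0]) G (e_ n) y) Lam Ent (P1 0) (gamma_in R) (ln (e_ n))
  (ln (Jl (e_ n) 0)) (ln (Jl (e_ n) x0)) (e_neq0 n).
by move: (e_ n) => e *; field.
Qed.

(** The image of Y under y = P1 0 + 2 e x, the parametrisation of slopes beyond the wall. *)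
Let A n := (Y - P1 0) / (2 * e_ n).

Let AyE : P1 0 < Y -> A n @[n --> \oo] --> +oo.
Proof.
move=> YP; apply/cvgryPge => M.
have d0 : 0 < Y - P1 0 by rewrite subr_gt0.
have M0 : 0 < `|M| + 1 by rewrite ltr_wpDl.
have p0 : 0 < (Y - P1 0) / (2 * (`|M| + 1)) by rewrite divr_gt0// mulr_gt0.
have /cvgrPdist_lt/(_ _ p0) := e_cvg; apply: filterS => n.
rewrite sub0r normrN gtr0_norm// ltr_pdivlMr ?mulr_gt0// => h.
rewrite /A ler_pdivlMr ?mulr_gt0//.
have : M * e_ n <= `|M| * e_ n by rewrite ler_wpM2r ?ler_norm// ltW.
by have := e_gt0 n; lra.
Qed.

(** The limit term 1 / (Y - P1 0) is 1 / (2 A) of [int_ln_mills] divided by e. *)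
Lemma int_out : P1 0 < Y ->
  (fun n => (2 * e_ n ^+ 2)^-1 * \int[mu]_(y in `[P1 0, Y]) G (e_ n) y -
    (- (Y - P1 0) * P 0 / (2 * e_ n ^+ 4) + (Y - P1 0) / (2 * e_ n ^+ 2) * ln (e_ n)
      - (e_ n)^-1 * (Num.sqrt 2 * gamma_out R)
      - (Y - P1 0) / (2 * e_ n ^+ 2) * (ln (Y - P1 0) - ln (e_ n) - 1))) @ \oo -->
  (Y - P1 0)^-1 + 2^-1 * P3 0 * beta_out R.
Proof.
move=> YP; have d0 : 0 < Y - P1 0 by rewrite subr_gt0.
have hO := outer_limit dP dP1 dP2 dP3 dP4 cP5 P2_gt0 P20 Xx0 x00 B0 e_01 e_cvg (AyE YP).
have eb : P3 0 / 6 * \int[mu]_(x in `[0, +oo[) outer_lim x = 2^-1 * P3 0 * beta_out R.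
  by rewrite beta_outE; field.
rewrite eb in hO.
pose r n := \int[mu]_(x in `[0, A n]) ln (mills x) -
    (\int[mu]_(x in `[0, +oo[) lmills x - (A n * ln (2 * A n) - A n) + (2 * A n)^-1).
have rcv : (fun n => r n / e_ n) @ \oo --> (0 : R).
  have bcv : (fun n => (2 / (Y - P1 0)) ^+ 3 * e_ n) @ \oo --> (0 : R) by exact: cvg_e_scale.
  have bcvN := rcvgN bcv; rewrite oppr0 in bcvN.
  apply: (squeeze_cvgr _ bcvN bcv).
  have /cvgryPge/(_ 1) := AyE YP; apply: filterS => n A1.
  have [e0 e1] := andP (e_01 n).
  rewrite -ler_norml normrM normfV (gtr0_norm e0) ler_pdivrMr//.
  apply: (le_trans (int_ln_mills A1)).
  have -> : (A n ^+ 3)^-1 = (2 / (Y - P1 0)) ^+ 3 * e_ n ^+ 3.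
    by rewrite /A; field; rewrite e_neq0 lt0r_neq0.
  have q0 : 0 <= (2 / (Y - P1 0)) ^+ 3 by rewrite exprn_ge0// divr_ge0// ltW.
  rewrite -[leRHS]mulrA (ler_wpM2l q0)// -expr2.
  by rewrite exprS ler_piMl ?sqr_ge0.
refine (rcvg_eq (rcvgD (rcvgD rcv (rcvgC (Y - P1 0)^-1)) hO) _ _) => [n|]; last by rewrite add0r.
have e0 := e_gt0 n.
have A0 : 0 < A n by rewrite divr_gt0// mulr_gt0.
have e20 : 0 < 2 * e_ n by rewrite mulr_gt0.
have mI : measurable (`[P1 0, Y]%classic : set LT) by [].
have iI : mu.-integrable `[P1 0, Y] (EFin \o G (e_ n)).
  by apply: continuous_compact_integrable; [exact: segment_compact|exact: continuous_subspaceT].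
have E : affine (P1 0) (2 * e_ n) @^-1` `[P1 0, Y] = `[0, A n]%classic :> set LT.
  apply/seteqP; split => z; rewrite /affine /= !in_itv/= lerDl pmulr_rge0// /A ler_pdivlMr//;
   by rewrite mulrC lerBrDl.
have mA : measurable (`[0, A n]%classic : set LT) by [].
have cM := continuous_lnM dP Xx0 x00 B0 e0.
have cml : continuous (fun x : R => ln (mills x)).
  move=> x; apply: (@continuous_comp _ _ _ mills (@ln R)); first exact: continuous_mills.
  by apply: continuous_ln; exact: mills_gt0.
have iA (f : R -> R) : continuous f -> mu.-integrable `[0, A n] (EFin \o f).
  by move=> cf; apply: continuous_compact_integrable; [exact: segment_compact|exact: continuous_subspaceT].
have cc (c : R) : continuous (fun _ : R => c) by move=> x; exact: cvg_cst.
have e1 : \int[mu]_(y in `[P1 0, Y]) G (e_ n) y = 2 * e_ n *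
   (\int[mu]_(x in `[0, A n]) ln (Ml (e_ n) x) + A n * (ln (e_ n) - P 0 / e_ n ^+ 2)).
  rewrite (Rintegral_affine (P1 0) e20 mI iI) E; congr (_ * _).
  have -> : A n * (ln (e_ n) - P 0 / e_ n ^+ 2) = \int[mu]_(x in `[0, A n]) (ln (e_ n) - P 0 / e_ n ^+ 2).
    by rewrite Rintegral_cst//= lebesgue_measure_itv/= lte_fin A0 -EFinB/= subr0 mulrC.
  rewrite -(RintegralD mA (iA _ cM) (iA _ (cc _))); apply: eq_Rintegral => x _.
  by rewrite /affine (lnM_lap dP Xx0 x00 B0 x e0); ring.
have e2 : \int[mu]_(x in `[0, A n]) (ln (Ml (e_ n) x) - ln (mills x)) =
   \int[mu]_(x in `[0, A n]) ln (Ml (e_ n) x) - \int[mu]_(x in `[0, A n]) ln (mills x).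
  by rewrite (RintegralB mA (iA _ cM) (iA _ cml)).
have e3 : ln (2 * A n) = ln (Y - P1 0) - ln (e_ n).
  rewrite -ln_div ?posrE//; congr ln; rewrite /A; field; exact: e_neq0.
rewrite e1 e2 /r gamma_outE e3 /A; field.
by rewrite e_neq0 lt0r_neq0.
Qed.

(** At the last node [Ml] behaves as [mills] (A), hence as 1 / (2 A); the added logarithms are ln (2
    A). *)
Lemma lnM_A : P1 0 < Y -> (fun n => ln (Ml (e_ n) (A n)) + (ln (Y - P1 0) - ln (e_ n))) @ \oo --> (0 : R).
Proof.
move=> YP; have d0 : 0 < Y - P1 0 by rewrite subr_gt0.
have [C C0 hb] := out_bound dP dP1 dP2 dP3 dP4 cP5 P2_gt0 P20 Xx0 x00 B0.
have A0 n : 0 < A n by rewrite divr_gt0// mulr_gt0.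
apply: (@cvg_shift_squeeze _ _ (fun n => (C + (Y - P1 0)^-1 ^+ 2 * 2) * e_ n)); first exact: cvg_e_scale.
move=> n; rewrite subr0; have [e0 e1] := andP (e_01 n).
have e3 : ln (2 * A n) = ln (Y - P1 0) - ln (e_ n).
  rewrite -ln_div ?posrE//; congr ln; rewrite /A; field; exact: e_neq0.
have h1 := hb _ _ (e_01 n) (ltW (A0 n)).
rewrite normrM normfV (gtr0_norm e0) ler_pdivrMr// in h1.
have h2 : `|ln (Ml (e_ n) (A n)) - ln (mills (A n))| <= C * e_ n.
  apply: (le_trans h1); rewrite ler_wpM2r ?(ltW e0)// ler_piMr ?(ltW C0)//.
  by rewrite invf_le1 ?exprn_gt0 ?addr_gt0// exprn_ege1// lerDl ltW.
have /andP[l1 l2] := lmills_bounds (A0 n).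
have l3 : 0 < (2 * A n ^+ 2 + 3)^-1 by rewrite invr_gt0 addr_gt0// mulr_gt0// exprn_gt0.
have l4 : (2 * A n ^+ 2)^-1 <= (Y - P1 0)^-1 ^+ 2 * 2 * e_ n.
  have -> : (2 * A n ^+ 2)^-1 = (Y - P1 0)^-1 ^+ 2 * 2 * e_ n ^+ 2.
    by rewrite /A; field; rewrite e_neq0 lt0r_neq0.
  have q0 : 0 <= (Y - P1 0)^-1 ^+ 2 * 2 by rewrite mulr_ge0 ?sqr_ge0.
  by rewrite (ler_wpM2l q0)// expr2 ler_piMl// ltW.
have -> : ln (Ml (e_ n) (A n)) + (ln (Y - P1 0) - ln (e_ n)) =
  (ln (Ml (e_ n) (A n)) - ln (mills (A n))) + lmills (A n).
  by rewrite -e3 lmillsE// lnM ?posrE//; ring.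
rewrite (le_trans (ler_normD _ _))// mulrDl lerD// ler0_norm; lra.
Qed.

Theorem sum_asym_out : P1 0 < Y ->
  (fun n => Gsum n - (- (2 * e_ n ^+ 4)^-1 * Lam + ln (e_ n) / (2 * e_ n ^+ 2) * Y + (4 * e_ n ^+ 2)^-1 * Ent
     - (e_ n)^-1 * (Num.sqrt 2 * gamma_in R) - (2 * e_ n ^+ 2)^-1 * (P 0 - P x0)
     - (Y - P1 0) * P 0 / (2 * e_ n ^+ 4)
     - (e_ n)^-1 * (Num.sqrt 2 * gamma_out R)
     - (Y - P1 0) / (2 * e_ n ^+ 2) * (ln (Y - P1 0) - ln (e_ n) - 1)
     + 2^-1 * ln (e_ n))) @ \oo -->
   K0 + (Y - P1 0)^-1 + 2^-1 * P3 0 * beta_out R - 2^-1 * ln (Y - P1 0).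
Proof.
move=> YP.
have T := rcvgD (rcvgD (rcvgD sum_euler int_in) (int_out YP)) (rcvgZ 2^-1 (rcvgB (lnM_A YP) lnJ_x0)).
refine (rcvg_eq (rcvgB T (rcvgC (2^-1 * ln (Y - P1 0)))) _ _) => [n|];
  last by rewrite /K0; field; rewrite lt0r_neq0// subr_gt0.
have P10 : 0 <= P1 0.
  have [c _] := @MVT_between R P1 P2 x0 0 (fun c _ => dP1 c).
  by rewrite P1x0 subr0 => ->; rewrite mulr_ge0 ?sub0r ?oppr_ge0 ?ltW.
rewrite lnZ_at0 (Rint_cat (@cG _) P10 PY).
have -> : G (e_ n) Y = ln (Ml (e_ n) (A n)) - P 0 / e_ n ^+ 2 + ln (e_ n).
  rewrite (lnM_lap dP Xx0 x00 B0 (A n) (e_gt0 n)).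
  have -> : P1 0 + 2 * e_ n * A n = Y by rewrite /A; field; exact: e_neq0.
  by ring.
move: (Gsum n) (\int[mu]_(y in `[0, P1 0]) G (e_ n) y) (\int[mu]_(y in `[P1 0, Y]) G (e_ n) y) Lam Ent
  (gamma_in R) (gamma_out R) (ln (Y - P1 0)) (ln (e_ n))
  (ln (Ml (e_ n) (A n))) (ln (Jl (e_ n) x0)) (e_neq0 n).
by move: (e_ n) (P1 0) => e p *; field.
Qed.

End assembly.

(** * The radial potential in logarithmic coordinates *)

Section exponential_coordinates.
Context {R : realType}.
Notation mu := (@lebesgue_measure R).
Notation LT := (measurableTypeR R).

(** The substitution s = e^(k x): k = 2 for the squared modulus, k = 1 for the modulus. *)
Lemma Rint_exp (k : R) (g : R -> R) (a b : R) : 0 < k -> a <= b -> continuous g ->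
  mu.-integrable `[expR (k * a), expR (k * b)] (EFin \o (fun s : R => g (ln s / k) / (k * s))) /\
  \int[mu]_(s in `[expR (k * a), expR (k * b)]) (g (ln s / k) / (k * s)) = \int[mu]_(x in `[a, b]) g x.
Proof.
move=> k0 ab cg.
have s_gt0 (s : R) : expR (k * a) <= s <= expR (k * b) -> 0 < s.
  by move=> /andP[h _]; exact: lt_le_trans (expR_gt0 _) h.
pose F (y : R) := \int[mu]_(t in `[a - 1, y]) g t.
have dF (s : R) : expR (k * a) <= s <= expR (k * b) ->
    is_derive s 1 (F \o (fun s => ln s / k)) (g (ln s / k) / (k * s)).
  move=> hs; have s0 := s_gt0 s hs.
  have h1 := is_derive_lnr s0.
  have h2 : is_derive s 1 (fun s : R => ln s / k) (s^-1 / k).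
    by apply: is_derive_eq; rewrite /GRing.scale/=; ring.
  have al : a <= ln s / k.
    rewrite ler_pdivlMr// mulrC -[k * a]expRK ler_ln ?posrE ?expR_gt0//.
    by case/andP: hs.
  have h3 : is_derive (ln s / k) 1 F (g (ln s / k)) by apply: is_derive_primitive => //; lra.
  have h4 : is_derive s 1 (F \o (fun s => ln s / k)) (g (ln s / k) * (s^-1 / k)).
    exact: is_derive1_comp.
  by apply: (is_derive_eq h4); field; rewrite !lt0r_neq0.
have cf (s : R) : expR (k * a) <= s <= expR (k * b) ->
    {for s, continuous (fun s : R => g (ln s / k) / (k * s))}.
  move=> hs; have s0 := s_gt0 s hs.
  apply: cvgM.
    apply: (@continuous_comp _ _ _ (fun s : R => ln s / k) g); last exact: cg.
    by apply: cvgM; [exact: continuous_ln|exact: cvg_cst].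
  apply: cvgV; first by rewrite lt0r_neq0// mulr_gt0.
  by apply: cvgM; [exact: cvg_cst|exact: cvg_id].
have ekab : expR (k * a) <= expR (k * b) by rewrite ler_expR ler_pM2l.
have [i ->] := Rint_FTC ekab dF cf; split => //.
rewrite /= !expRK; have kk (x : R) : k * x / k = x by rewrite mulrAC divff ?mul1r// lt0r_neq0.
have a1 : a - 1 <= a by lra.
by rewrite !kk /F (Rint_cat cg a1 ab) addrC addKr.
Qed.

End exponential_coordinates.

Section profile.
Context {R : realType} (q : R -> R) (r0 : R).
Hypothesis q_smooth : smooth_pos q.
Hypothesis q_subharmonic : forall r, 0 < r -> 0 < laplQ q r.
Hypothesis r0_gt0 : 0 < r0.
Hypothesis r0_lt1 : r0 < 1.
Hypothesis q1r0 : derive1 q r0 = 0.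
Notation mu := (@lebesgue_measure R).
Notation LT := (measurableTypeR R).

(* (r d/dr)^k q = sum_j S(k, j) r^j q^(j), S the Stirling numbers *)
Definition aq (k : nat) (x : R) : R := expR x ^+ k * derive1n k q (expR x).
Definition p0 := aq 0.
Definition p1 := aq 1.
Definition p2 (x : R) : R := aq 1 x + aq 2 x.
Definition p3 (x : R) : R := aq 1 x + 3 * aq 2 x + aq 3 x.
Definition p4 (x : R) : R := aq 1 x + 7 * aq 2 x + 6 * aq 3 x + aq 4 x.
Definition p5 (x : R) : R := aq 1 x + 15 * aq 2 x + 25 * aq 3 x + 10 * aq 4 x + aq 5 x.

Lemma is_derive_q (k : nat) (r : R) : 0 < r -> is_derive r 1 (derive1n k q) (derive1n k.+1 q r).
Proof.
move=> r_gt0; apply: DeriveDef; first exact: q_smooth.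
by rewrite derive1nS derive1E.
Qed.

Lemma is_derive_aq (k : nat) (x : R) : is_derive x 1 (aq k) (k%:R * aq k x + aq k.+1 x).
Proof.
have e0 := expR_gt0 x.
have h1 := is_derive_q k e0.
have h2 : is_derive x 1 (derive1n k q \o expR) (derive1n k.+1 q (expR x) * expR x).
  exact: is_derive1_comp.
have h3 : is_derive (expR x) 1 (fun r : R => r ^+ k) (k%:R * expR x ^+ k.-1).
  by apply: DeriveDef; [exact: exprn_derivable|rewrite exp_derive /GRing.scale/= mulr1].
have h4 : is_derive x 1 ((fun r : R => r ^+ k) \o expR) (k%:R * expR x ^+ k.-1 * expR x).
  exact: is_derive1_comp.
have h5 := is_deriveM h4 h2.
apply: (is_derive_eq h5); rewrite /GRing.scale/= /aq exprS.
by case: k {h1 h2 h3 h4 h5} => [|k]; [rewrite /=; ring|rewrite exprS /=; ring].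
Qed.

Lemma aqE k x : aq k x = expR x ^+ k * derive1n k q (expR x).
Proof. by []. Qed.

Local Opaque aq.

Lemma dp0 (x : R) : is_derive x 1 p0 (p1 x).
Proof. by apply: (is_derive_eq (is_derive_aq 0 x)); rewrite mul0r add0r. Qed.

Lemma dp1 (x : R) : is_derive x 1 p1 (p2 x).
Proof. by apply: (is_derive_eq (is_derive_aq 1 x)); rewrite mul1r. Qed.

Lemma dp2 (x : R) : is_derive x 1 p2 (p3 x).
Proof.
by apply: (is_derive_eq (is_deriveD (is_derive_aq 1 x) (is_derive_aq 2 x))); rewrite /p3; move: (aq 1 x) (aq 2 x) (aq 3 x) => *; ring.
Qed.

Let h k x := is_derive_aq k x.
Let hZ (c : R) k (x : R) : is_derive x 1 (fun x => c * aq k x) (c * (k%:R * aq k x + aq k.+1 x)).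
Proof. exact: is_deriveZ. Qed.

Lemma dp3 (x : R) : is_derive x 1 p3 (p4 x).
Proof.
apply: (is_derive_eq (is_deriveD (is_deriveD (h 1 x) (hZ 3 2 x)) (h 3 x))).
by rewrite /p4; move: (aq 1 x) (aq 2 x) (aq 3 x) (aq 4 x) => *; ring.
Qed.

Lemma dp4 (x : R) : is_derive x 1 p4 (p5 x).
Proof.
apply: (is_derive_eq (is_deriveD (is_deriveD (is_deriveD (h 1 x) (hZ 7 2 x)) (hZ 6 3 x)) (h 4 x))).
by rewrite /p5; move: (aq 1 x) (aq 2 x) (aq 3 x) (aq 4 x) (aq 5 x) => *; ring.
Qed.

Lemma continuous_aq k : continuous (aq k).
Proof. by move=> x; exact: is_derive_cvg (is_derive_aq k x). Qed.

Lemma continuous_p5 : continuous p5.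
Proof.
have cZ (c : R) k : continuous (fun x => c * aq k x).
  by move=> x; apply: cvgM; [exact: cvg_cst|exact: continuous_aq].
move=> x; apply: cvgD; last exact: continuous_aq.
apply: cvgD; last exact: cZ.
apply: cvgD; last exact: cZ.
by apply: cvgD; [exact: continuous_aq|exact: cZ].
Qed.

Lemma p0E (x : R) : p0 x = q (expR x).
Proof. by rewrite /p0 aqE expr0 mul1r. Qed.

Lemma p1E (x : R) : p1 x = expR x * derive1 q (expR x).
Proof. by rewrite /p1 aqE expr1 derive1n1. Qed.

Lemma laplQE (r : R) : 0 < r -> laplQ q r = derive1n 2 q r + derive1n 1 q r / r.
Proof.
move=> r_gt0; rewrite /laplQ derive1E -derive1n1.
have h1 := is_derive_q 1 r_gt0.
have h2 := is_deriveM (is_derive_id r (1 : R)) h1.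
have -> : 'D_1 (fun s : R => s * derive1n 1 q s) r = r * derive1n 2 q r + derive1n 1 q r.
  by case: h2 => _ e2; apply: etrans e2 _; rewrite /GRing.scale/=; ring.
by field; exact: lt0r_neq0.
Qed.

Lemma p2E (x : R) : p2 x = expR x ^+ 2 * laplQ q (expR x).
Proof.
rewrite laplQE ?expR_gt0// /p2 !aqE; have := lt0r_neq0 (expR_gt0 x).
by move: (expR x) => r rn; move: (derive1n 1 q r) (derive1n 2 q r) => *; field.
Qed.

Lemma is_derive_laplQ (r : R) : 0 < r ->
  is_derive r 1 (laplQ q) (derive1n 3 q r + derive1n 2 q r / r - derive1n 1 q r / r ^+ 2).
Proof.
move=> r_gt0.
have h1 : is_derive r 1 (derive1n 1 q) (derive1n 2 q r) := is_derive_q 1 r_gt0.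
have h2 : is_derive r 1 (derive1n 2 q) (derive1n 3 q r) := is_derive_q 2 r_gt0.
have rn : r != 0 by exact: lt0r_neq0.
have h3 : is_derive r 1 (@GRing.inv R) (- (r ^+ 2)^-1).
  by apply: (is_derive_eq (is_deriveV rn (is_derive_id _ (1 : R)))); rewrite /GRing.scale/= mulr1.
have h4 := is_deriveD h2 (is_deriveM h1 h3).
have h5 : is_derive r 1 (fun r => derive1n 2 q r + derive1n 1 q r / r)
   (derive1n 3 q r + derive1n 2 q r / r - derive1n 1 q r / r ^+ 2).
  move: h4; move: (derive1n 1 q r) (derive1n 2 q r) (derive1n 3 q r) => a b c h4.
  by apply: (is_derive_eq h4); rewrite /GRing.scale/=; ring.
apply: (near_eq_is_derive _ h5).
near=> y; rewrite laplQE//; near: y.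
exact: lt_nbhsr.
Unshelve. all: end_near. Qed.

Lemma p3E (x : R) : p3 x = expR x ^+ 2 * (2 * laplQ q (expR x) + expR x * derive1 (laplQ q) (expR x)).
Proof.
have e0 := expR_gt0 x.
have [_ e1] := is_derive_laplQ e0.
rewrite derive1E e1 laplQE// /p3 !aqE; have := lt0r_neq0 e0.
by move: (expR x) => r rn; move: (derive1n 1 q r) (derive1n 2 q r) (derive1n 3 q r) => *; field.
Qed.

Lemma p2_gt0 (x : R) : 0 < p2 x.
Proof. by rewrite p2E mulr_gt0 ?exprn_gt0 ?expR_gt0// q_subharmonic// expR_gt0. Qed.

Definition x0 : R := ln r0.

Lemma x00 : x0 < 0.
Proof. by rewrite /x0 -ln1 ltr_ln ?posrE. Qed.

Lemma p1x0 : p1 x0 = 0.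
Proof. by rewrite p1E /x0 lnK ?posrE// q1r0 mulr0. Qed.

Lemma p1_incr (x y : R) : x < y -> p1 x < p1 y.
Proof.
move=> xy; have [c _ e] := @MVT_between R p1 p2 x y (fun c _ => dp1 c).
by rewrite -subr_gt0 e mulr_gt0 ?p2_gt0 ?subr_gt0.
Qed.

Lemma p0_decr (x y : R) : x <= y -> y <= x0 -> p0 y <= p0 x.
Proof.
move=> xy yx0; have [c [/andP[c1 c2]|/andP[c1 c2]] e] := @MVT_between R p0 p1 x y (fun c _ => dp0 c).
  have p1c : p1 c <= 0.
    rewrite -p1x0; have := le_trans c2 yx0; rewrite le_eqVlt => /predU1P[->//|h'].
    exact: ltW (p1_incr h').
  by rewrite -subr_le0 e mulr_le0_ge0// subr_ge0.
have exy : x = y by apply/eqP; rewrite eq_le xy (le_trans c1 c2).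
by rewrite exy.
Qed.

Lemma p0_decr_lt : p0 (x0 - 2^-1) < p0 (x0 - 1).
Proof.
have [c [/andP[c1 c2]|/andP[c1 c2]] e] := @MVT_between R p0 p1 (x0 - 1) (x0 - 2^-1) (fun c _ => dp0 c);
  last by lra.
have cx : c < x0 by lra.
have := p1_incr cx; rewrite p1x0 => p1c.
by rewrite -subr_lt0 e nmulr_rlt0//; lra.
Qed.

(** Written in s = r^2, in which planar Lebesgue measure becomes pi ds. The factor 1/2 in
    [radial_norm] then gives the h_j of the overview. *)
Definition radial (N : R) (j : nat) (s : R) : R := s ^+ j * expR (- (N * q (Num.sqrt s))).

Definition radial_norm (N : R) (j : nat) : R := 2^-1 * \int[mu]_(s in `]0, 1]) radial N j s.

Notation X := (x0 - 1).

Let sqrtE (s : R) : 0 < s -> Num.sqrt s = expR (ln s / 2).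
Proof.
move=> s0; have -> : s = expR (ln s / 2) ^+ 2.
  by rewrite -expRM_natl mulrCA divff// mulr1 lnK ?posrE.
by rewrite sqrtr_sqr gtr0_norm ?expR_gt0// -expRM_natl expRK mulrAC divff// mul1r.
Qed.

Let radialE (N : R) (j : nat) (s : R) : 0 < s ->
  radial N j s = s ^+ j * expR (- (N * p0 (ln s / 2))).
Proof. by move=> s0; rewrite /radial p0E sqrtE. Qed.

Let cp0 : continuous p0. Proof. exact: continuous_aq. Qed.

Lemma continuous_radial (N : R) (j : nat) (s : R) : 0 < s -> {for s, continuous (radial N j)}.
Proof.
move=> s0.
have c : {for s, continuous (fun s : R => s ^+ j * expR (- (N * p0 (ln s / 2))))}.
  apply: cvgM; first exact: exprn_continuous.
  apply: (@continuous_comp _ _ _ (fun s : R => - (N * p0 (ln s / 2))) expR); last exact: continuous_expR.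
  apply: cvgN; apply: cvgM; first exact: cvg_cst.
  apply: (@continuous_comp _ _ _ (fun s : R => ln s / 2) p0); last exact: cp0.
  by apply: cvgM; [exact: continuous_ln|exact: cvg_cst].
rewrite /continuous_at /prop_for /= radialE//.
move: c; apply: cvg_trans; apply: near_eq_cvg; near=> y.
rewrite radialE//; near: y; exact: lt_nbhsr.
Unshelve. all: end_near. Qed.

(** A lower bound of q down to the origin, where no regularity is assumed; it makes the radial
    weights integrable. *)
Lemma q_min (r : R) : 0 < r -> r <= 1 -> q r0 <= q r.
Proof.
move=> rp r1; have E (t : R) : 0 < t -> q t = p0 (ln t) by move=> t0; rewrite p0E lnK ?posrE.
rewrite !E// -/x0.
have [h'|h'] := leP (ln r) x0; first exact: p0_decr.
have [c [/andP[c1 c2]|/andP[c1 c2]] e] := @MVT_between R p0 p1 x0 (ln r) (fun c _ => dp0 c); last by lra.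
have p1c : 0 <= p1 c.
  rewrite -p1x0; move: c1; rewrite le_eqVlt => /predU1P[->//|c1]; exact: ltW (p1_incr c1).
by rewrite -subr_ge0 e mulr_ge0// subr_ge0 ltW.
Qed.

Lemma intg_radial (N : R) (j : nat) : 0 <= N -> mu.-integrable `]0, 1] (EFin \o radial N j).
Proof.
move=> N0; have mD : measurable (`]0, 1]%classic : set LT) by [].
have mI : measurable (`[0, 1]%classic : set LT) by [].
have mf : measurable_fun (`]0, 1]%classic : set LT) (radial N j).
  apply: subspace_continuous_measurable_fun => //.
  by apply: continuous_in_subspaceT => x; rewrite inE/= in_itv/= => /andP[xp _]; exact: continuous_radial.
have ic : mu.-integrable `]0, 1] (EFin \o (fun=> expR (- (N * q r0)))).
  apply: (intgS mI mD); first by move=> x; rewrite /= !in_itv/= => /andP[/ltW -> ->].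
  apply: continuous_compact_integrable; first exact: segment_compact.
  by apply: continuous_subspaceT => z; exact: cvg_cst.
refine (intg_le mD mf ic _) => s; rewrite /= in_itv/= => /andP[s0 s1].
rewrite ger0_norm ?mulr_ge0 ?exprn_ge0 ?expR_ge0 ?(ltW s0)//.
apply: (@le_trans _ _ (1 * expR (- (N * q (Num.sqrt s))))).
  by rewrite ler_wpM2r ?expR_ge0// exprn_ile1// ltW.
rewrite mul1r ler_expR lerN2 ler_wpM2l// q_min ?sqrtr_gt0//.
by rewrite -[leRHS]sqrtr1 ler_wsqrtr.
Qed.

Lemma radial_split (N : R) (j : nat) : 0 < N -> exists t : R,
  [/\ radial_norm N j = expR (lnZ p0 X 0 N (2 * j.+1%:R / N)) + t, 0 <= t &
      t <= 2 * expR (- (p0 X - p0 (x0 - 2^-1)) * N) * expR (lnZ p0 X 0 N (2 * j.+1%:R / N))].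
Proof.
move=> N0; have hx0 := x00.
have X0 : X < 0 by lra.
set c := expR (2 * X).
have c0 : 0 < c by exact: expR_gt0.
have c1 : c < 1 by rewrite -[ltRHS]expR0 ltr_expR; lra.
have e20 : expR (2 * 0) = 1 :> R by rewrite mulr0 expR0.
have cg : continuous (gibbs p0 N (2 * j.+1%:R / N)) by exact: continuous_gibbs.
have [i2 e2] := @Rint_exp R 2 _ X 0 (ltr0Sn _ 1) (ltW X0) cg.
rewrite e20 -/c in i2 e2.
have pt (s : R) : 0 < s -> gibbs p0 N (2 * j.+1%:R / N) (ln s / 2) / (2 * s) = 2^-1 * radial N j s.
  move=> s0; rewrite radialE// /gibbs.
  have -> : - (N * (p0 (ln s / 2) - 2 * j.+1%:R / N * (ln s / 2))) = j.+1%:R * ln s + - (N * p0 (ln s / 2)).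
    by field; exact: lt0r_neq0.
  by rewrite expRD expRM_natl lnK ?posrE// exprS; field; exact: lt0r_neq0.
have mD : measurable (`]0, 1]%classic : set LT) by [].
have mC : measurable (`]0, c]%classic : set LT) by [].
have ir := intg_radial j (ltW N0).
have subC : `]0, c]%classic `<=` (`]0, 1]%classic : set LT).
  by move=> x; rewrite /= !in_itv/= => /andP[-> h']; rewrite (le_trans h' (ltW c1)).
have iC := intgS mD mC subC ir.
have Z0 : 0 < \int[mu]_(x in `[X, 0]) gibbs p0 N (2 * j.+1%:R / N) x by exact: gibbs_int_gt0.
have EZ : expR (lnZ p0 X 0 N (2 * j.+1%:R / N)) = \int[mu]_(x in `[X, 0]) gibbs p0 N (2 * j.+1%:R / N) x.
  by rewrite lnK ?posrE.
exists (2^-1 * \int[mu]_(s in `]0, c]) radial N j s); split.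
- rewrite EZ -e2.
  have -> : \int[mu]_(s in `[c, 1]) (gibbs p0 N (2 * j.+1%:R / N) (ln s / 2) / (2 * s)) =
     2^-1 * \int[mu]_(s in `[c, 1]) radial N j s.
    rewrite -RintegralZl//; last first.
      have mc : measurable (`[c, 1]%classic : set LT) by [].
      apply: (eq_intg mc _ (intgZ 2 mc i2)) => s; rewrite /= in_itv/= => /andP[cs _].
      by rewrite pt ?(lt_le_trans c0 cs)//; field.
    apply: eq_Rintegral => s; rewrite inE/= in_itv/= => /andP[cs _].
    by rewrite pt// (lt_le_trans c0 cs).
  rewrite -mulrDr /radial_norm; congr (_ * _).
  have := @Rintegral_itvB R (radial N j) (BRight 0) (BRight 1) c ir.
  rewrite !bnd_simp => /(_ (ltW c0) (ltW c1)) e3.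
  rewrite -(@Rintegral_itv_obnd_cbnd _ c) -?e3 ?subrK//.
  apply: (intgS mD _ _ ir) => // x; rewrite /= !in_itv/= => /andP[h1 ->].
  by rewrite (lt_trans c0 h1).
- rewrite mulr_ge0//; apply: Rintegral_ge0 => s; rewrite /= in_itv/= => /andP[s0 _].
  by rewrite mulr_ge0 ?expR_ge0// exprn_ge0// ltW.
rewrite EZ.
have b1 : \int[mu]_(s in `]0, c]) radial N j s <= c ^+ j.+1 * expR (- (N * p0 X)).
  have ic : mu.-integrable `]0, c] (EFin \o (fun=> c ^+ j * expR (- (N * p0 X)))).
    have mI : measurable (`[0, c]%classic : set LT) by [].
    apply: (intgS mI mC); first by move=> x; rewrite /= !in_itv/= => /andP[/ltW -> ->].
    apply: continuous_compact_integrable; first exact: segment_compact.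
    by apply: continuous_subspaceT => z; exact: cvg_cst.
  apply: (@le_trans _ _ (\int[mu]_(s in `]0, c]) (c ^+ j * expR (- (N * p0 X))))).
    apply: le_Rintegral => // s; rewrite /= in_itv/= => /andP[s0 sc].
    rewrite radialE//; apply: ler_pM; rewrite ?exprn_ge0 ?expR_ge0 ?(ltW s0)//.
      by rewrite lerXn2r ?nnegrE ?(ltW s0) ?(ltW c0).
    rewrite ler_expR lerN2 (ler_wpM2l (ltW N0))//; apply: p0_decr; last by lra.
    have : ln s <= 2 * X by rewrite -[leRHS]expRK ler_ln ?posrE.
    by lra.
  rewrite Rintegral_cst//= lebesgue_measure_itv/= lte_fin c0 -EFinB/= subr0.
  by rewrite mulrAC -exprSr.
(* Only [x0 - 1/2, x0] is kept: [p0] decreases there, and the slope term is smallest at the left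
   end. *)
have b2 : 2^-1 * (expR (2 * j.+1%:R * (x0 - 2^-1)) * expR (- (N * p0 (x0 - 2^-1)))) <=
    \int[mu]_(x in `[X, 0]) gibbs p0 N (2 * j.+1%:R / N) x.
  have mI : measurable (`[x0 - 2^-1, x0]%classic : set LT) by [].
  have mX : measurable (`[X, 0]%classic : set LT) by [].
  have sub : `[x0 - 2^-1, x0]%classic `<=` (`[X, 0]%classic : set LT).
    by move=> x; rewrite /= !in_itv/= => /andP[? ?]; apply/andP; split; lra.
  have ig : mu.-integrable `[X, 0] (EFin \o gibbs p0 N (2 * j.+1%:R / N)) by exact: intg_gibbs.
  apply: (@le_trans _ _ (\int[mu]_(x in `[x0 - 2^-1, x0]) gibbs p0 N (2 * j.+1%:R / N) x)); last first.
    by apply: ge0_le_RintegralS => // x _; exact: expR_ge0.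
  set K := expR _ * expR _.
  have -> : 2^-1 * K = \int[mu]_(x in `[x0 - 2^-1, x0]) K.
    rewrite Rintegral_cst//= lebesgue_measure_itv/= lte_fin ifT; last by lra.
    by rewrite -EFinB/=; field.
  apply: le_Rintegral => //.
  - apply: continuous_compact_integrable; first exact: segment_compact.
    by apply: continuous_subspaceT => z; exact: cvg_cst.
  - exact: (intgS mX mI sub ig).
  - move=> x; rewrite /= in_itv/= => /andP[x1 x2].
    rewrite /K /gibbs -expRD ler_expR.
    have -> : - (N * (p0 x - 2 * j.+1%:R / N * x)) = 2 * j.+1%:R * x - N * p0 x by field; exact: lt0r_neq0.
    rewrite lerB//; first by rewrite ler_wpM2l// mulr_ge0.
    by rewrite (ler_wpM2l (ltW N0))// p0_decr.
have pE := expR_ge0 (- (p0 X - p0 (x0 - 2^-1)) * N).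
apply: (@le_trans _ _ (2 * expR (- (p0 X - p0 (x0 - 2^-1)) * N) *
    (2^-1 * (expR (2 * j.+1%:R * (x0 - 2^-1)) * expR (- (N * p0 (x0 - 2^-1))))))); last first.
  by rewrite ler_wpM2l// mulr_ge0.
have -> : 2 * expR (- (p0 X - p0 (x0 - 2^-1)) * N) *
    (2^-1 * (expR (2 * j.+1%:R * (x0 - 2^-1)) * expR (- (N * p0 (x0 - 2^-1))))) =
   expR (2 * j.+1%:R * (x0 - 2^-1)) * expR (- (N * p0 X)).
  have -> : - (p0 X - p0 (x0 - 2^-1)) * N = - (N * p0 X) + N * p0 (x0 - 2^-1) by ring.
  rewrite expRD expRN [expR (- (N * p0 (x0 - _)))]expRN; field.
  by rewrite !lt0r_neq0 ?expR_gt0.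
apply: (@le_trans _ _ (c ^+ j.+1 * expR (- (N * p0 X)))).
  have : 0 <= \int[mu]_(s in `]0, c]) radial N j s.
    apply: Rintegral_ge0 => s; rewrite /= in_itv/= => /andP[s0 _].
    by rewrite mulr_ge0 ?expR_ge0// exprn_ge0// ltW.
  move: b1; move: (\int[mu]_(s in `]0, c]) radial N j s) (c ^+ j.+1 * expR (- (N * p0 X))) => A A' *.
  lra.
rewrite ler_wpM2r ?expR_ge0// /c -expRM_natl ler_expR.
have j0 : 0 <= j.+1%:R :> R by [].
have -> : j.+1%:R * (2 * X) = 2 * j.+1%:R * X by ring.
by rewrite ler_wpM2l ?mulr_ge0//; lra.
Qed.

Lemma truncation :
  (fun N : nat => \sum_(j < N) ln (radial_norm N%:R j) - \sum_(j < N) lnZ p0 X 0 N%:R (2 * j.+1%:R / N%:R))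
    @ \oo --> (0 : R).
Proof.
pose c := p0 X - p0 (x0 - 2^-1).
have c0 : 0 < c by rewrite subr_gt0 p0_decr_lt.
have b (N : nat) : `|\sum_(j < N) ln (radial_norm N%:R j) - \sum_(j < N) lnZ p0 X 0 N%:R (2 * j.+1%:R / N%:R)|
   <= N%:R * (2 * expR (- (c * N%:R))).
  case: N => [|N]; first by rewrite !big_ord0 subrr normr0 mul0r.
  rewrite -sumrB (le_trans (ler_norm_sum _ _ _))//.
  have -> : N.+1%:R * (2 * expR (- (c * N.+1%:R))) = \sum_(j < N.+1) (2 * expR (- (c * N.+1%:R))).
    by rewrite sumr_const card_ord mulr_natl.
  apply: ler_sum => j _.
  have N0 : (0 : R) < N.+1%:R by [].
  have [t [-> t0 t1]] := radial_split j N0.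
  set l := lnZ _ _ _ _ _ in t1 *.
  have el := expR_gt0 l.
  have -> : expR l + t = expR l * (1 + t / expR l) by field; exact: lt0r_neq0.
  have tl : 0 <= t / expR l by rewrite divr_ge0// ltW.
  have p1' : 0 < 1 + t / expR l by lra.
  rewrite lnM ?posrE// expRK addrC addKr ger0_norm; last by rewrite ln_ge0// lerDl.
  rewrite (le_trans (le_ln1Dx _)) ?(lt_le_trans _ tl)//.
  by rewrite ler_pdivrMr// (le_trans t1)// mulNr.
have [K K0 hK] : exists2 K : R, 0 < K & forall x : R, 0 <= x -> x * (2 * expR (- (c * x))) <= K * expR (- (c / 2 * x)).
  exists (4 / c); first by rewrite divr_gt0.
  move=> x xge; have -> : - (c * x) = - (c / 2 * x) + - (c / 2 * x) by field.
  rewrite expRD !mulrA ler_wpM2r ?expR_ge0//.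
  have h1 : c / 2 * x <= expR (c / 2 * x) by rewrite (le_trans _ (expR_ge1Dx _))// lerDr.
  rewrite expRN ler_pdivrMr ?expR_gt0//.
  have := ler_wpM2l (ltW (divr_gt0 (ltr0Sn R 3) c0)) h1.
  by have -> : 4 / c * (c / 2 * x) = x * 2 by field; exact: lt0r_neq0.
apply: (@cvg_shift_squeeze _ _ (fun N => K * expR (- (c / 2 * N%:R)))).
  by rewrite -(mulr0 K); apply: cvgM; [exact: cvg_cst|apply: cvg_expRN_nat; rewrite divr_gt0].
by move=> N; rewrite subr0 (le_trans (b N))// hK.
Qed.

End profile.

(** * Collecting constants in the expansions *)

Section expansion_algebra.
Context {R : realType}.

(** Logarithms, integrals and universal constants are independent symbols, and the hypotheses list
    their relations. What remains is a rational identity, in which - al supplies the term 2 be left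
    over from (2 + g1) be. *)
Lemma crit_algebra (S e e4 N k lne lk lN Lam En Ent l2 lp p10 H eg sN ga sL Blk fi ra rb g1 g0 lP x0 L0 L1
    P3 F al be lsp lp2 P0 Px pa pb : R) :
  e4 = (e ^+ 2) ^+ 2 -> e ^+ 2 = (k * N)^-1 -> k != 0 -> N != 0 -> lne = - (2^-1 * (lk + lN)) ->
  Lam = k ^- 2 * (2 * En) -> Ent = k^-1 * ((l2 + lp + lk) * p10 - H) -> eg = sN * ga * sL ->
  Blk = 12^-1 * fi - 8^-1 * (ra - rb) -> ra = 2 + g1 -> rb = 2 + g0 ->
  lP = l2 + lp + lk - (2 * x0 + L0) -> lk = L1 - l2 -> 2^-1 * P3 = 2 + g1 ->
  F = 12^-1 * (2 * x0 + L0 - L1) - 16^-1 * (g1 - g0) + 24^-1 * (fi - 4 * (L1 - L0) + 4 * x0) ->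
  al = l2 - 2 * be -> lsp = 2^-1 * lp - l2 -> lp2 = lp - l2 -> P0 = k^-1 * pa -> Px = k^-1 * pb -> p10 = 2 ->
  S - (- (2 * e4)^-1 * Lam + lne / (2 * e ^+ 2) * (2 / k) + (4 * e ^+ 2)^-1 * Ent - eg
    - (2 * e ^+ 2)^-1 * (P0 - Px)) -
    (- x0 / 6 + 2^-1 * Blk + 2^-1 * P3 * be - 4^-1 * lP + 2^-1 * lsp) =
  S - (- N ^+ 2 * En - 2^-1 * N * lN - N * (2^-1 * (2^-1 * H - (pb - pa) - l2 * p10) - lp2 / 2)
    - sN * ga * sL + F - al + be * g1 + 2^-1 * l2).
Proof.
move=> -> -> kn Nn -> -> -> -> -> -> -> -> -> -> -> -> -> -> -> -> ->.
by field; apply/andP.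
Qed.

(** Here t stands for eta and D for the range 2 t / k of slopes beyond the wall, so D^(-1) = k / (2
    t) becomes L / (4 t) with L = 2 k. *)
Lemma out_algebra (S e e4 N k t lne lk lN Lam En Ent l2 lp p10 H eg eg' sN ga ga' sL Blk fi ra rb g1 g0 lP x0
    L0 L1 P3 F al al' be be' lp2 P0 Px pa pb D lD lt l2t l2pL L : R) :
  e4 = (e ^+ 2) ^+ 2 -> e ^+ 2 = (k * N)^-1 -> k != 0 -> N != 0 -> t != 0 -> lne = - (2^-1 * (lk + lN)) ->
  Lam = k ^- 2 * (2 * En) -> Ent = k^-1 * ((l2 + lp + lk) * p10 - H) ->
  eg = sN * ga * sL -> eg' = sN * ga' * sL ->
  Blk = 12^-1 * fi - 8^-1 * (ra - rb) -> ra = 2 + g1 -> rb = 2 + g0 ->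
  lP = l2 + lp + lk - (2 * x0 + L0) -> lk = L1 - l2 -> 2^-1 * P3 = 2 + g1 ->
  F = 12^-1 * (2 * x0 + L0 - L1) - 16^-1 * (g1 - g0) + 24^-1 * (fi - 4 * (L1 - L0) + 4 * x0) ->
  al = l2 - 2 * be -> al' = 2^-1 * lp - 2 * be' -> lp2 = lp - l2 -> P0 = k^-1 * pa -> Px = k^-1 * pb ->
  p10 = 2 * (1 - t) -> D = 2 * t / k -> lD = l2 + lt - lk -> l2t = l2 + lt -> l2pL = l2 + lp + L1 -> L = 2 * k ->
  S - (- (2 * e4)^-1 * Lam + lne / (2 * e ^+ 2) * (2 / k) + (4 * e ^+ 2)^-1 * Ent - eg
    - (2 * e ^+ 2)^-1 * (P0 - Px) - D * P0 / (2 * e4) - eg' - D / (2 * e ^+ 2) * (lD - lne - 1) + 2^-1 * lne) -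
    (- x0 / 6 + 2^-1 * Blk + 2^-1 * P3 * be - 4^-1 * lP + D^-1 + 2^-1 * P3 * be' - 2^-1 * lD) =
  S - (- N ^+ 2 * (En + t * pa) - (1 + t) / 2 * N * lN
    - N * (2^-1 * (2^-1 * H - (pb - pa) - l2 * p10) - (1 - t) * (lp2 / 2) + t * (l2t - 1))
    - sN * (ga + ga') * sL - 4^-1 * lN + F - (al + al') + (be + be') * g1 + L / (4 * t) - 2^-1 * lt + 4^-1 * l2pL).
Proof.
move=> -> -> kn Nn tn -> -> -> -> -> -> -> -> -> -> -> -> -> -> -> -> -> -> -> -> -> -> ->.
by field; apply/and3P.
Qed.

End expansion_algebra.

(** * The expansion in terms of the potential *)

Section expansion.
Context {R : realType} (q : R -> R) (r0 : R).
Hypothesis q_smooth : smooth_pos q.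
Hypothesis q_subharmonic : forall r, 0 < r -> 0 < laplQ q r.
Hypothesis r0_gt0 : 0 < r0.
Hypothesis r0_lt1 : r0 < 1.
Hypothesis q1r0 : derive1 q r0 = 0.
Notation mu := (@lebesgue_measure R).
Notation LT := (measurableTypeR R).
Let ex0 : expR (x0 r0) = r0. Proof. by rewrite lnK ?posrE. Qed.
Local Opaque x0 p0 p1 p2 p3 p4 p5.
Notation p0 := (p0 q).
Notation p1 := (p1 q).
Notation p2 := (p2 q).
Notation p3 := (p3 q).
Notation p4 := (p4 q).
Notation p5 := (p5 q).
Notation x0 := (x0 r0).
Notation Lq := (laplQ q).

Let d0 := dp0 q_smooth.
Let d1 := dp1 q_smooth.
Let d2 := dp2 q_smooth.
Let d3 := dp3 q_smooth.
Let d4 := dp4 q_smooth.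
Let c0 : continuous p0. Proof. by move=> x; exact: is_derive_cvg (d0 x). Qed.
Let c1 : continuous p1. Proof. by move=> x; exact: is_derive_cvg (d1 x). Qed.
Let c2 : continuous p2. Proof. by move=> x; exact: is_derive_cvg (d2 x). Qed.
Let c3 : continuous p3. Proof. by move=> x; exact: is_derive_cvg (d3 x). Qed.
Let c4 : continuous p4. Proof. by move=> x; exact: is_derive_cvg (d4 x). Qed.
Let g2 := p2_gt0 q_smooth q_subharmonic.
Let n2 x : p2 x != 0. Proof. exact: lt0r_neq0. Qed.
Let x0_lt0 : x0 < 0. Proof. exact: x00. Qed.
Let x0_le0 : x0 <= 0. Proof. exact: ltW. Qed.
Let p1_x0 : p1 x0 = 0. Proof. exact: p1x0. Qed.
Let mI : measurable (`[x0, 0]%classic : set LT). Proof. by []. Qed.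

Let icont (f : R -> R) : continuous f -> mu.-integrable `[x0, 0] (EFin \o f).
Proof.
by move=> cf; apply: continuous_compact_integrable; [exact: segment_compact|exact: continuous_subspaceT].
Qed.

Let IZ (f : R -> R) (k : R) : continuous f ->
  \int[mu]_(u in `[x0, 0]) (k * f u) = k * \int[mu]_(u in `[x0, 0]) f u.
Proof. by move=> cf; rewrite RintegralZl//; exact: icont. Qed.

Let ID (f g : R -> R) : continuous f -> continuous g ->
  \int[mu]_(u in `[x0, 0]) (f u + g u) = \int[mu]_(u in `[x0, 0]) f u + \int[mu]_(u in `[x0, 0]) g u.
Proof. by move=> cf cg; rewrite RintegralD//; exact: icont. Qed.

Let FTC (f F : R -> R) : (forall x : R, is_derive x 1 F (f x)) -> continuous f ->
  \int[mu]_(u in `[x0, 0]) f u = F 0 - F x0.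
Proof. by move=> dF cf; have [_ ->] := Rint_FTC x0_le0 (fun x _ => dF x) (fun x _ => @cf x). Qed.

Let cM (f g : R -> R) : continuous f -> continuous g -> continuous (fun x => f x * g x).
Proof. by move=> cf cg x; apply: cvgM; [exact: cf|exact: cg]. Qed.
Let cD (f g : R -> R) : continuous f -> continuous g -> continuous (fun x => f x + g x).
Proof. by move=> cf cg x; apply: cvgD; [exact: cf|exact: cg]. Qed.
Let cX (f : R -> R) : continuous f -> continuous (fun x => f x ^+ 2).
Proof. by move=> cf x; apply: cvgM; exact: cf. Qed.
Let cN (f : R -> R) : continuous f -> continuous (fun x => - f x).
Proof. by move=> cf x; apply: cvgN; exact: cf. Qed.
Let cC (k : R) : continuous (fun _ : R => k). Proof. by move=> x; exact: cvg_cst. Qed.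
Let cI : continuous (fun x : R => x). Proof. by move=> x; exact: cvg_id. Qed.
Let cV : continuous (fun x => (p2 x)^-1).
Proof. by move=> x; apply: cvgV; [exact: n2|exact: c2]. Qed.
Let cln : continuous (fun x => ln (p2 x)).
Proof.
move=> x; apply: (@continuous_comp _ _ _ p2 (@ln R)); first exact: c2.
by apply: continuous_ln; exact: g2.
Qed.

Definition energy : R := 2^-1 * \int[mu]_(x in `[x0, 0]) (p2 x * (p0 x - x * p1 x)).
Definition entropy : R := \int[mu]_(x in `[x0, 0]) (p2 x * ln (p2 x)).
(** The Fisher-type integral of ((ln p2)')^2, equal up to boundary terms to the integral in
    [F_Q]. *)
Definition fisher : R := \int[mu]_(x in `[x0, 0]) ((p3 x / p2 x) ^+ 2).

(** The derivatives of x p1^2 and p0 p1 both contain p1^2; eliminating it passes between the two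
    forms of the energy functional. Boundary terms at x0 vanish with p1. *)
Lemma energyE : energy = 4^-1 * \int[mu]_(x in `[x0, 0]) (p0 x * p2 x) + 4^-1 * p0 0 * p1 0.
Proof.
have dA (x : R) : is_derive x 1 (fun x => x * p1 x ^+ 2) (p1 x ^+ 2 + 2 * (p2 x * (x * p1 x))).
  have h := d1 x.
  have h1 : is_derive x 1 (fun x => p1 x * p1 x) (2 * (p1 x * p2 x)).
    by apply: (is_derive_eq (is_deriveM h h)); rewrite /GRing.scale/=; ring.
  have h2 := is_deriveM (is_derive_id x (1 : R)) h1.
  by apply: (is_derive_eq h2); rewrite /GRing.scale/= expr2; ring.
have dB (x : R) : is_derive x 1 (fun x => p0 x * p1 x) (p1 x ^+ 2 + p0 x * p2 x).
  by apply: (is_derive_eq (is_deriveM (d0 x) (d1 x))); rewrite /GRing.scale/= expr2; ring.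
have c11 : continuous (fun x => p1 x ^+ 2) by exact: cX.
have c02 := cM c0 c2; have c21 := cM c2 (cM cI c1).
have eA := FTC dA (cD c11 (cM (@cC 2) c21)).
have eB := FTC dB (cD c11 c02).
rewrite (ID c11 (cM (@cC 2) c21)) (IZ _ c21) p1_x0 in eA.
rewrite (ID c11 c02) p1_x0 in eB.
rewrite /energy.
have -> : \int[mu]_(x in `[x0, 0]) (p2 x * (p0 x - x * p1 x)) =
  \int[mu]_(x in `[x0, 0]) (p0 x * p2 x + - 1 * (p2 x * (x * p1 x))).
  by apply: eq_Rintegral => x _; ring.
rewrite (ID c02 (cM (@cC _) c21)) (IZ _ c21); move: eA eB.
move: (\int[mu]_(u in `[x0, 0]) (p1 u ^+ 2)) (\int[mu]_(u in `[x0, 0]) (p2 u * (u * p1 u))).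
move: (\int[mu]_(u in `[x0, 0]) (p0 u * p2 u)) (p0 0) (p1 0) (p0 x0) => a b c d e f; rewrite /=; lra.
Qed.

Lemma moment_p2 : \int[mu]_(x in `[x0, 0]) (x * p2 x) = p0 x0 - p0 0.
Proof.
have dA (x : R) : is_derive x 1 (fun x => x * p1 x - p0 x) (x * p2 x).
  have h2 := is_deriveB (is_deriveM (is_derive_id x (1 : R)) (d1 x)) (d0 x).
  by apply: (is_derive_eq h2); rewrite /GRing.scale/=; ring.
by rewrite (FTC dA (cM cI c2)) p1_x0; ring.
Qed.

Lemma mass_p2 : \int[mu]_(x in `[x0, 0]) p2 x = p1 0.
Proof. by rewrite (FTC d1 c2) p1_x0 subr0. Qed.

(** In logarithmic coordinates p3 / p2 - 2 is r times the logarithmic derivative of the Laplacian;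
    expanding the square leaves a cross term that is an exact derivative. *)
Lemma fisher_laplQ : fisher =
  \int[mu]_(r in `[r0, 1]) ((derive1 Lq r / Lq r) ^+ 2 * r) +
  4 * (ln (Lq 1) - ln (Lq r0)) - 4 * x0.
Proof.
pose g (x : R) := (p3 x / p2 x - 2) ^+ 2.
have cr : continuous (fun x => p3 x / p2 x) by exact: cM.
have cg : continuous g.
  by move=> x; apply: (@continuous_comp _ _ _ (fun x => p3 x / p2 x - 2) (fun z => z ^+ 2));
    [apply: cvgB; [exact: cr|exact: cvg_cst]|exact: exprn_continuous].
have [_] := Rint_exp ltr01 x0_le0 cg.
rewrite !mul1r expR0 ex0 => e.
have -> : \int[mu]_(r in `[r0, 1]) ((derive1 Lq r / Lq r) ^+ 2 * r) =
  \int[mu]_(s in `[r0, 1]) (g (ln s / 1) / (1 * s)).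
  apply: eq_Rintegral => s; rewrite inE/= in_itv/= => /andP[s1 _].
  have s0 : 0 < s by exact: lt_le_trans s1.
  have L0 := q_subharmonic s0.
  rewrite /g divr1 mul1r (p3E q_smooth) (p2E q_smooth) lnK ?posrE//; field.
  by rewrite !lt0r_neq0.
rewrite e.
have dl (x : R) : is_derive x 1 (fun x => ln (p2 x)) (p3 x / p2 x).
  have h1 := is_derive_lnr (g2 x); have h2 := d2 x.
  have h3 : is_derive x 1 (@ln R \o p2) ((p2 x)^-1 * p3 x) by exact: is_derive1_comp.
  by apply: (is_derive_eq h3); rewrite mulrC.
have el : \int[mu]_(x in `[x0, 0]) (p3 x / p2 x) = ln (Lq 1) - (2 * x0 + ln (Lq r0)).
  rewrite (FTC dl cr); congr (ln _ - _); first by rewrite (p2E q_smooth) expR0 expr1n mul1r.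
  rewrite (p2E q_smooth) ex0 (lnM _ (q_subharmonic r0_gt0)); last exact: exprn_gt0.
  by rewrite lnXn// mulr_natl.
have -> : fisher = \int[mu]_(x in `[x0, 0]) (g x + (4 * (p3 x / p2 x) + - 4)).
  by apply: eq_Rintegral => x _; rewrite /g; field.
rewrite (ID cg (cD (cM (@cC 4) cr) (@cC _))) (ID (cM (@cC 4) cr) (@cC _)) (IZ _ cr) el.
have -> : \int[mu]_(u in `[x0, 0]) - 4 = 4 * x0.
  by rewrite Rintegral_cst//= lebesgue_measure_itv/= lte_fin x0_lt0 -EFinB/=; ring.
have aux (a b c d : R) : a + (4 * (b - (2 * d + c)) + 4 * d) = a + 4 * (b - c) - 4 * d by ring.
exact: aux.
Qed.

Lemma ratio_p3 (r : R) : 0 < r -> p3 (ln r) / p2 (ln r) = 2 + r * (derive1 Lq r / Lq r).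
Proof.
move=> rp; have L0 := q_subharmonic rp.
by rewrite (p3E q_smooth) (p2E q_smooth) lnK ?posrE//; field; rewrite !lt0r_neq0.
Qed.

(** As (p3 / p2)' = p4 / p2 - (p3 / p2)^2, the bulk integrand is (5/24 - 1/8) (p3 / p2)^2 minus an
    eighth of an exact derivative. *)
Lemma bulkE : \int[mu]_(u in `[x0, 0]) (5 * p3 u ^+ 2 / (24 * p2 u ^+ 2) - p4 u / (8 * p2 u)) =
  12^-1 * fisher - 8^-1 * (p3 0 / p2 0 - p3 x0 / p2 x0).
Proof.
have cr : continuous (fun x => p3 x / p2 x) by exact: cM.
have crr : continuous (fun x => (p3 x / p2 x) ^+ 2) by exact: cX.
pose d x := p4 x / p2 x - (p3 x / p2 x) ^+ 2.
have cd : continuous d by apply: cD; [exact: cM|exact: cN].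
have dr (x : R) : is_derive x 1 (fun x => p3 x / p2 x) (d x).
  have nz := n2 x.
  have h4 := is_deriveM (d3 x) (is_deriveV nz (d2 x)).
  by apply: (is_derive_eq h4); rewrite /d /GRing.scale/=; field.
rewrite -(FTC dr cd) /fisher -(IZ _ crr) -mulNr -(IZ _ cd) -(ID (cM (@cC _) crr) (cM (@cC _) cd)).
apply: eq_Rintegral => x _; rewrite /d; have := n2 x.
by move: (p2 x) (p3 x) (p4 x) => a b c nz; field.
Qed.

Let kap := p2 0 / 2.
Let kap0 : 0 < kap. Proof. exact: divr_gt0. Qed.
Let kapn : kap != 0. Proof. exact: lt0r_neq0. Qed.
Let kapL : kap = Lq 1 / 2.
Proof. by rewrite /kap (p2E q_smooth) expR0 expr1n mul1r. Qed.
Let sc (f : R -> R) (x : R) := kap^-1 * f x.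
Let dsc (f g : R -> R) : (forall x : R, is_derive x 1 f (g x)) ->
  forall x : R, is_derive x 1 (sc f) (sc g x).
Proof. by move=> df x; exact: is_deriveZ. Qed.
Let c5 : continuous (sc p5).
Proof. by apply: (cM (@cC _)); exact: continuous_p5. Qed.
Let sc_gt0 (x : R) : 0 < sc p2 x. Proof. by rewrite mulr_gt0// invr_gt0. Qed.
Let sc20 : sc p2 0 = 2.
Proof. by rewrite /sc /kap; have := n2 0; move: (p2 0) => a an; field. Qed.
Let sc1x0 : sc p1 x0 = 0. Proof. by rewrite /sc p1_x0 mulr0. Qed.
Let Xx0 : x0 - 1 < x0. Proof. by rewrite gtrBl. Qed.

(** Starting at N = [shift] ensures kap N > 1, so e <= 1 at every index; the limit is unaffected. *)
Let shift := (Num.truncn kap^-1).+1.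
Let N_ (n : nat) : nat := (n + shift)%N.
Let e_ (n : nat) : R := (Num.sqrt (kap * (N_ n)%:R))^-1.
Let kN_gt1 n : 1 < kap * (N_ n)%:R.
Proof.
rewrite mulrC -ltr_pdivrMr// div1r (lt_le_trans (truncnS_gt _))// ler_nat.
exact: leq_addl.
Qed.
Let kN_gt0 n : 0 < kap * (N_ n)%:R. Proof. exact: lt_trans (kN_gt1 n). Qed.
Let N_gt0 n : 0 < (N_ n)%:R :> R. Proof. by rewrite ltr0n /N_ /shift addnS. Qed.
Let e_01 n : 0 < e_ n <= 1.
Proof.
rewrite invr_gt0 sqrtr_gt0 kN_gt0/= invf_le1 ?sqrtr_gt0//.
by rewrite -[leLHS]sqrtr1 ler_wsqrtr// ltW.
Qed.
Let e_2 n : e_ n ^+ 2 = (kap * (N_ n)%:R)^-1.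
Proof. by rewrite exprVn sqr_sqrtr// ltW. Qed.
Let e_cvg : e_ @ \oo --> (0 : R).
Proof.
apply/cvgr0Pnorm_lt => eps eps0; near=> n.
have [e0 _] := andP (e_01 n).
rewrite gtr0_norm// -(ltr_pXn2r (n := 2))// ?nnegrE ?(ltW e0) ?(ltW eps0)//.
rewrite e_2 invf_plt ?posrE ?exprn_gt0//.
apply: (@lt_le_trans _ _ (kap * n%:R)); last by rewrite (ler_wpM2l (ltW kap0))// ler_nat leq_addr.
rewrite mulrC -ltr_pdivrMr//; near: n; exact: nbhs_infty_gtr.
Unshelve. all: end_near. Qed.
Let Ne n : 2 * (N_ n)%:R * e_ n ^+ 2 = 2 / kap.
Proof.
rewrite e_2; have := lt0r_neq0 (N_gt0 n).
by move: ((N_ n)%:R : R) => m mn; field; rewrite mn kapn.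
Qed.

Let Psum (N : nat) := \sum_(j < N) lnZ p0 (x0 - 1) 0 N%:R (2 * j.+1%:R / N%:R).
Let GsumE n : \sum_(j < N_ n) lnZ (sc p0) (x0 - 1) 0 (e_ n ^- 2) (2 * j.+1%:R * e_ n ^+ 2) = Psum (N_ n).
Proof.
apply: eq_bigr => j _; rewrite e_2 /lnZ; congr ln; apply: eq_Rintegral => x _.
rewrite /gibbs /sc; congr expR; have := lt0r_neq0 (N_gt0 n).
move: ((N_ n)%:R : R) (p0 x) (j.+1%:R : R) => m a b mn; field.
by rewrite mn kapn.
Qed.

Let lne n : ln (e_ n) = - (2^-1 * (ln kap + ln (N_ n)%:R)).
Proof.
have h : 2 * ln (e_ n) = - (ln kap + ln (N_ n)%:R).
  have [e0 _] := andP (e_01 n).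
  by rewrite mulr_natl -lnXn// e_2 lnV ?posrE// (lnM kap0 (N_gt0 n)).
by rewrite -mulrN -h mulKf.
Qed.

Let einv n (a : R) : (e_ n)^-1 * (Num.sqrt 2 * a) = Num.sqrt (N_ n)%:R * a * Num.sqrt (Lq 1).
Proof.
have -> : Lq 1 = kap * 2 by rewrite kapL divfK.
rewrite invrK (sqrtrM _ (ltW kap0)) (sqrtrM _ (ltW kap0)).
by move: (Num.sqrt kap) (Num.sqrt 2) (Num.sqrt _) => *; ring.
Qed.

Let LamE : \int[mu]_(u in `[x0, 0]) (sc p2 u * (sc p0 u - u * sc p1 u)) = kap ^- 2 * (2 * energy).
Proof.
have c : continuous (fun x => p2 x * (p0 x - x * p1 x)).
  by apply: cM => //; apply: cD => //; apply: cN; exact: cM.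
rewrite /energy mulVKf// -(IZ _ c); apply: eq_Rintegral => x _.
by rewrite /sc -exprVn; move: (kap^-1) (p0 x) (p1 x) (p2 x) => *; ring.
Qed.

Let EntE : \int[mu]_(u in `[x0, 0]) (sc p2 u * ln (2 * pi / sc p2 u)) =
  kap^-1 * ((ln 2 + ln pi + ln kap) * p1 0 - entropy).
Proof.
rewrite -mass_p2 /entropy -(IZ _ c2).
have c := cM c2 cln.
rewrite -mulN1r -(IZ _ c) -(ID (cM (@cC _) c2) (cM (@cC _) c)) -(IZ _ (cD (cM (@cC _) c2) (cM (@cC _) c))).
apply: eq_Rintegral => x _.
have pp : 0 < pi :> R by exact: pi_gt0.
have -> : ln (2 * pi / sc p2 x) = ln 2 + ln pi + ln kap - ln (p2 x).
  have t2 : 0 < 2 :> R by [].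
  have vk : 0 < kap^-1 by rewrite invr_gt0.
  rewrite ln_div ?posrE ?mulr_gt0// (lnM t2 pp) /sc (lnM vk (g2 x)) lnV ?posrE//.
  by rewrite opprD opprK addrA.
by rewrite /sc; move: (kap^-1) (p2 x) (ln _) (ln _) (ln _) (ln _) => *; ring.
Qed.

Let BlkE : \int[mu]_(u in `[x0, 0]) (5 * sc p3 u ^+ 2 / (24 * sc p2 u ^+ 2) - sc p4 u / (8 * sc p2 u)) =
  12^-1 * fisher - 8^-1 * (p3 0 / p2 0 - p3 x0 / p2 x0).
Proof.
rewrite -bulkE; apply: eq_Rintegral => x _; rewrite /sc; have := n2 x; have := kapn.
by move: kap (p2 x) (p3 x) (p4 x) => k a b c kn an; field; rewrite kn an.
Qed.

Let r0x0 : p3 x0 / p2 x0 = 2 + r0 * (derive1 Lq r0 / Lq r0).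
Proof. by rewrite -ratio_p3// -ex0 expRK. Qed.

Let r00 : p3 0 / p2 0 = 2 + derive1 Lq 1 / Lq 1.
Proof.
rewrite (p3E q_smooth) (p2E q_smooth) expR0 expr1n !mul1r; have := lt0r_neq0 (q_subharmonic ltr01).
by move: (Lq 1) (derive1 Lq 1) => a b an; field.
Qed.

Let lnP2x0 : ln (2 * pi / sc p2 x0) = ln 2 + ln pi + ln kap - (2 * x0 + ln (Lq r0)).
Proof.
have pp : 0 < pi :> R by exact: pi_gt0.
have t2 : 0 < 2 :> R by [].
have vk : 0 < kap^-1 by rewrite invr_gt0.
have rr : 0 < r0 ^+ 2 by rewrite exprn_gt0.
rewrite ln_div ?posrE ?mulr_gt0// (lnM t2 pp) /sc (lnM vk (g2 _)) lnV ?posrE//.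
rewrite (p2E q_smooth) ex0 (lnM rr (q_subharmonic r0_gt0)) lnXn// mulr_natl.
by rewrite opprD opprK addrA.
Qed.

Let lnk : ln kap = ln (Lq 1) - ln 2.
Proof. by rewrite kapL ln_div ?posrE// q_subharmonic. Qed.

Let P30 : 2^-1 * sc p3 0 = 2 + derive1 Lq 1 / Lq 1.
Proof. by rewrite -r00 /sc /kap; have := n2 0; move: (p2 0) (p3 0) => a b an; field. Qed.

Let FE : F_Q q r0 = 12^-1 * (2 * x0 + ln (Lq r0) - ln (Lq 1))
  - 16^-1 * (derive1 Lq 1 / Lq 1 - r0 * (derive1 Lq r0 / Lq r0))
  + 24^-1 * (fisher - 4 * (ln (Lq 1) - ln (Lq r0)) + 4 * x0).
Proof.
have rr : 0 < r0 ^+ 2 by rewrite exprn_gt0.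
have L0 := q_subharmonic r0_gt0; have L1 := q_subharmonic ltr01.
have -> : fisher - 4 * (ln (Lq 1) - ln (Lq r0)) + 4 * x0 =
   \int[mu]_(r in `[r0, 1]) ((derive1 Lq r / Lq r) ^+ 2 * r).
  have aux (a b c : R) : a + b - c - b + c = a by ring.
  by rewrite fisher_laplQ; exact: aux.
have lx : ln r0 = x0 by rewrite -[RHS]expRK ex0.
by rewrite /F_Q (ln_div (mulr_gt0 rr L0) L1) (lnM rr L0) lnXn// lx mulr_natl.
Qed.

Let sqrt_pi : ln (Num.sqrt pi) = 2^-1 * ln pi :> R.
Proof.
have pp : 0 < pi :> R by exact: pi_gt0.
rewrite -[in RHS](sqr_sqrtr (ltW pp)) lnXn ?sqrtr_gt0//.
by move: (ln _) => l; rewrite mulr2n; field.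
Qed.

(** The entropy functional in the variable x: ln (Laplacian / 4) = ln p2 - 2 x - 2 ln 2, integrated
    against p2 / 2. *)
Definition log_energy : R := 2^-1 * entropy - (p0 x0 - p0 0) - ln 2 * p1 0.

Lemma expansion_crit : p1 0 = 2 ->
  (fun N : nat => Psum N -
    (- N%:R ^+ 2 * energy - 2^-1 * N%:R * ln N%:R
     - N%:R * (2^-1 * log_energy - ln (pi / 2) / 2)
     - Num.sqrt N%:R * gamma_in R * Num.sqrt (Lq 1)
     + F_Q q r0 - alpha_in R + beta_in R * (derive1 Lq 1 / Lq 1) + 2^-1 * ln 2)) @ \oo --> (0 : R).
Proof.
move=> p10; have EY : 2 / kap = sc p1 0 by rewrite /sc p10 mulrC.
have PY : sc p1 0 <= 2 / kap by rewrite EY.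
have h := sum_asym_crit (dsc d0) (dsc d1) (dsc d2) (dsc d3) (dsc d4) c5 sc_gt0 sc20 Xx0 x0_lt0 ltr01 sc1x0
  e_01 e_cvg Ne PY EY.
rewrite -(cvg_shiftn shift).
have pp : 0 < pi :> R by exact: pi_gt0.
have sp : 0 < Num.sqrt pi :> R by rewrite sqrtr_gt0.
have al : alpha_in R = ln 2 - 2 * beta_in R by exact: alpha_inE.
have hs : ln (Num.sqrt pi / 2) = 2^-1 * ln pi - ln 2 :> R by rewrite ln_div ?posrE// sqrt_pi.
have hp : ln (pi / 2) = ln pi - ln 2 :> R by rewrite ln_div ?posrE.
refine (rcvg_eq (rcvgB h (rcvgC _)) (fun n => _) (subrr _)).
have en4 : e_ n ^+ 4 = (e_ n ^+ 2) ^+ 2 by rewrite -exprM.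
rewrite GsumE.
refine (crit_algebra (Psum (N_ n)) (en4) (e_2 n) kapn (lt0r_neq0 (N_gt0 n)) (lne n) LamE EntE (einv n _)
  BlkE r00 r0x0 lnP2x0 lnk P30 FE al hs hp erefl erefl p10).
Qed.

Lemma expansion_out : p1 0 = 2 * (1 - eta q) -> 0 < eta q ->
  (fun N : nat => Psum N -
    (- N%:R ^+ 2 * (energy + eta q * p0 0) - (1 + eta q) / 2 * N%:R * ln N%:R
     - N%:R * (2^-1 * log_energy - (1 - eta q) * (ln (pi / 2) / 2) + eta q * (ln (2 * eta q) - 1))
     - Num.sqrt N%:R * (gamma_in R + gamma_out R) * Num.sqrt (Lq 1)
     - 4^-1 * ln N%:R
     + F_Q q r0 - (alpha_in R + alpha_out R)
     + (beta_in R + beta_out R) * (derive1 Lq 1 / Lq 1)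
     + Lq 1 / (4 * eta q) - 2^-1 * ln (eta q) + 4^-1 * ln (2 * pi * Lq 1))) @ \oo --> (0 : R).
Proof.
(* The range of slopes beyond the wall is 2 eta / kap: a positive eta puts the last node strictly
   beyond it. *)
move=> p10 eta0; have EY : 2 / kap - sc p1 0 = 2 * eta q / kap.
  by rewrite /sc p10; move: (eta q) => t; field; exact: kapn.
have PY : sc p1 0 < 2 / kap by rewrite -subr_gt0 EY divr_gt0// mulr_gt0.
have h := sum_asym_out (dsc d0) (dsc d1) (dsc d2) (dsc d3) (dsc d4) c5 sc_gt0 sc20 Xx0 x0_lt0 ltr01 sc1x0
  e_01 e_cvg Ne (ltW PY) PY.
rewrite -(cvg_shiftn shift).
have pp : 0 < pi :> R by exact: pi_gt0.
have t2 : 0 < 2 :> R by [].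
have sp : 0 < Num.sqrt pi :> R by rewrite sqrtr_gt0.
have L1 : 0 < Lq 1 by exact: q_subharmonic.
have pp2 : 0 < 2 * pi :> R by rewrite mulr_gt0.
have t2e : 0 < 2 * eta q by rewrite mulr_gt0.
have al : alpha_in R = ln 2 - 2 * beta_in R by exact: alpha_inE.
have al' : alpha_out R = 2^-1 * ln pi - 2 * beta_out R by rewrite alpha_outE sqrt_pi.
have hp : ln (pi / 2) = ln pi - ln 2 :> R by rewrite ln_div ?posrE.
have hY : ln (2 / kap - sc p1 0) = ln 2 + ln (eta q) - ln kap by rewrite EY (ln_div t2e kap0) (lnM t2 eta0).
have hL : ln (2 * pi * Lq 1) = ln 2 + ln pi + ln (Lq 1) by rewrite (lnM pp2 L1) (lnM t2 pp).
have hkL : Lq 1 = 2 * kap by rewrite kapL mulrC divfK.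
refine (rcvg_eq (rcvgB h (rcvgC _)) (fun n => _) (subrr _)).
have en4 : e_ n ^+ 4 = (e_ n ^+ 2) ^+ 2 by rewrite -exprM.
rewrite GsumE.
refine (out_algebra (Psum (N_ n)) (en4) (e_2 n) kapn (lt0r_neq0 (N_gt0 n)) (lt0r_neq0 eta0) (lne n) LamE EntE
  (einv n _) (einv n _) BlkE r00 r0x0 lnP2x0 lnk P30 FE al al' hp erefl erefl p10 EY hY (lnM t2 eta0) hL hkL).
Qed.

End expansion.

(** * Lebesgue measure on the plane *)

Section polar.
Context {R : realType}.
Notation mu := (@lebesgue_measure R).
Notation LT := (measurableTypeR R).
Notation mu2 := (lebesgue2 R).

(** Polar integration without an angle: the pushforward of planar measure under the squared modulus
    is pi times Lebesgue measure on the half-line. *)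
Definition sqmod (z : plane R) : LT := z.1 ^+ 2 + z.2 ^+ 2.

Lemma measurable_sqmod : measurable_fun setT sqmod.
Proof.
apply: measurable_funD; apply: measurable_funX; first exact: measurable_fst.
exact: measurable_snd.
Qed.

Lemma measurable_sqmod_preimage (A : set LT) : measurable A -> measurable (sqmod @^-1` A).
Proof. by move=> mA; rewrite -[X in measurable X]setTI; exact: measurable_sqmod. Qed.

Let disc (s : R) : set (plane R) := [set z | sqmod z <= s].

Let measurable_disc s : measurable (disc s).
Proof.
have -> : disc s = sqmod @^-1` `]-oo, s] by apply/seteqP; split => z; rewrite /= in_itv.
by apply: measurable_sqmod_preimage; exact: measurable_itv.
Qed.

Let disc_section (s : R) : mu2 (disc s) = (\int[mu]_x (2 * Num.sqrt (s - x ^+ 2))%:E)%E.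
Proof.
apply: eq_integral => x _ /=.
have -> : xsection (disc s) x = [set y | x ^+ 2 + y ^+ 2 <= s].
  by apply/seteqP; split => y; rewrite /xsection /= inE.
have [h|h] := leP 0 (s - x ^+ 2).
  have -> : [set y : LT | x ^+ 2 + y ^+ 2 <= s] = `[- Num.sqrt (s - x ^+ 2), Num.sqrt (s - x ^+ 2)]%classic.
    apply/seteqP; split => y; rewrite /= in_itv/= -ler_norml -sqrtr_sqr ler_sqrt// lerBrDl//.
  rewrite lebesgue_measure_itv/= lte_fin.
  have s0 := sqrtr_ge0 (s - x ^+ 2).
  case: ifPn => [_|]; first by rewrite -EFinB; congr EFin; rewrite opprK mulrDl mul1r.
  rewrite -leNgt => h1; have -> : Num.sqrt (s - x ^+ 2) = 0 by lra.
  by rewrite mulr0.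
rewrite ltr0_sqrtr// mulr0.
rewrite [X in mu X](_ : _ = set0) ?measure0//; apply/seteqP; split => y //= h'.
by have := sqr_ge0 y; lra.
Qed.

Let mf (s : R) : measurable_fun setT (fun x : LT => (2 * Num.sqrt (s - x ^+ 2))%:E).
Proof.
have c : continuous (fun x : R => 2 * Num.sqrt (s - x ^+ 2)).
  move=> x; apply: cvgM; first exact: cvg_cst.
  apply: (@continuous_comp _ _ _ (fun x : R => s - x ^+ 2) Num.sqrt); last exact: sqrt_continuous.
  by apply: cvgB; [exact: cvg_cst|exact: exprn_continuous].
have m : measurable_fun (setT : set LT) (fun x : R => 2 * Num.sqrt (s - x ^+ 2)) by exact: measurable_cont.
exact/measurable_EFinP.
Qed.

(** Sections of the disc are intervals of half-length sqrt (s - x^2); rescaling both the variable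
    and the length by sqrt s gives the factor s. *)
Let disc_scale (s : R) : 0 <= s -> mu2 (disc s) = (s%:E * mu2 (disc 1))%E.
Proof.
rewrite le_eqVlt => /predU1P[<-|s0].
  rewrite mul0e disc_section integral0_eq// => x _.
  by rewrite ler0_sqrtr ?mulr0// sub0r oppr_le0 sqr_ge0.
have r0 : 0 < Num.sqrt s by rewrite sqrtr_gt0.
have g0 (t x : R) : (0 <= (2 * Num.sqrt (t - x ^+ 2))%:E)%E by rewrite lee_fin mulr_ge0.
rewrite !disc_section (ge0_integral_affine 0 r0 measurableT (mf s) (fun x _ => g0 s x)).
rewrite preimage_setT /affine -[s in RHS](sqr_sqrtr (ltW s0)) expr2 EFinM -muleA; congr (_ * _)%E.
have e := @ge0_integralZl_EFin _ LT R mu setT measurableT (fun x => (2 * Num.sqrt (1 - x ^+ 2))%:E)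
  (fun x _ => g0 1 x) (mf 1) (Num.sqrt s) (ltW r0).
apply: (etrans _ e).
apply: eq_integral => x _; rewrite -EFinM; congr EFin.
rewrite add0r exprMn sqr_sqrtr ?ltW// -[X in X - _]mulr1 -mulrBr.
by rewrite (sqrtrM _ (ltW s0)) mulrCA.
Qed.

Let mu_cc (a : R) : 0 < a -> mu (`[- a, a]%classic : set LT) = (2 * a)%:E.
Proof.
move=> a0; rewrite lebesgue_measure_itv/= lte_fin ifT; last by lra.
by rewrite -EFinB; congr EFin; rewrite opprK mulrDl mul1r.
Qed.

Let square (a : R) : set (plane R) := (`[- a, a]%classic : set LT) `*` (`[- a, a]%classic : set LT).

Let measurable_square (a : R) : measurable (square a).
Proof. exact: measurableX. Qed.

Let mu2_square (a : R) : 0 < a -> mu2 (square a) = (2 * a * (2 * a))%:E.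
Proof.
move=> a0; have mI : measurable (`[- a, a]%classic : set LT) by [].
have h := @product_measure1E _ _ LT LT R mu mu _ _ mI mI.
by rewrite EFinM -mu_cc//; exact: h.
Qed.

Let disc1_lt : (mu2 (disc 1) < +oo)%E.
Proof.
have sub : disc 1 `<=` square 1.
  move=> [x y]; rewrite /disc /sqmod /square /= !in_itv/= => h.
  have hx := sqr_ge0 x; have hy := sqr_ge0 y.
  have sq (t : R) : t ^+ 2 <= 1 -> - 1 <= t <= 1.
    by move=> t1; rewrite -ler_norml -[leRHS]sqrtr1 -sqrtr_sqr ler_wsqrtr.
  by split; apply: sq; lra.
have := le_measure mu2 (mem_set (measurable_disc 1)) (mem_set (measurable_square 1)) sub.
have h1 : (mu2 (square 1) < +oo)%E by rewrite mu2_square// ltry.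
by move=> h; exact: le_lt_trans h h1.
Qed.

Let disc1_gt : (0 < mu2 (disc 1))%E.
Proof.
have sub : square 2^-1 `<=` disc 1.
  move=> [x y]; rewrite /disc /sqmod /square /= !in_itv/= => -[/andP[x1 x2] /andP[y1 y2]].
  by nra.
have := le_measure mu2 (mem_set (measurable_square 2^-1)) (mem_set (measurable_disc 1)) sub.
have h1 : (0 < mu2 (square 2^-1))%E by rewrite mu2_square// lte_fin !mulr_gt0.
by move=> h; exact: lt_le_trans h1 h.
Qed.

(** The area of the unit disc, known so far only to be positive and finite; [c_pi] evaluates it. *)
Let c := fine (mu2 (disc 1)).
Let cE : mu2 (disc 1) = c%:E.
Proof. by rewrite fineK// (ge0_fin_numE (measure_ge0 _ _)); exact: disc1_lt. Qed.
Let c0 : 0 < c. Proof. by rewrite -lte_fin -cE; exact: disc1_gt. Qed.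
Let ci0 : 0 <= c^-1. Proof. by rewrite invr_ge0; exact: ltW c0. Qed.

Let nu : {measure set LT -> \bar R} :=
  measure_function_pushforward__canonical__measure_function_Measure mu2 measurable_sqmod.
Let half : set LT := `]-oo, 0[%classic.
Let mhalf : measurable half. Proof. exact: measurable_itv. Qed.
(** Added to the pushforward, which does not charge the negative half-line, so that uniqueness of
    Lebesgue measure on the whole line applies. *)
Let neg : {measure set LT -> \bar R} := mrestr mu mhalf.

Let I (b : R) : set LT := `]-oo, b]%classic.
Let mI b : measurable (I b). Proof. exact: measurable_itv. Qed.
Let Oc (a b : R) : set LT := `]a, b]%classic.

Let nu_le (b : R) : nu (I b) = (Num.max b 0 * c)%:E.
Proof.
rewrite -[LHS]/(mu2 (sqmod @^-1` I b)).
have -> : sqmod @^-1` I b = disc b by apply/seteqP; split => z; rewrite /I /= in_itv.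
have [b0|b0] := leP 0 b; first by rewrite disc_scale// cE -EFinM.
rewrite mul0r (_ : disc b = set0) ?measure0//; apply/seteqP; split => -[x y] //.
rewrite /disc /sqmod/=; have := sqr_ge0 x; have := sqr_ge0 y; lra.
Qed.

Let nu_itv (a b : R) : a <= b -> nu (Oc a b) = ((Num.max b 0 - Num.max a 0) * c)%:E.
Proof.
move=> ab; have -> : Oc a b = I b `\` I a.
  apply/seteqP; split => x; rewrite /Oc /I /= !in_itv/=.
    by move=> /andP[h1 h2]; split => //; apply/negP; rewrite -ltNge.
  by move=> [-> /negP]; rewrite -ltNge => ->.
have lt : (nu (I b) < +oo)%E by rewrite nu_le ltry.
have e := @measureD _ LT R nu _ _ (mI b) (mI a) lt.
have e2 : I b `&` I a = I a.
  apply/seteqP; split => x; rewrite /I /= !in_itv/=; first by case.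
  by move=> h; split => //; exact: le_trans ab.
have e3 : (nu (I b) - nu (I a) = ((Num.max b 0 - Num.max a 0) * c)%:E)%E.
  by rewrite !nu_le -EFinB -mulrBl.
by apply: etrans e _; rewrite e2; exact: e3.
Qed.

Let neg_itv (a b : R) : a <= b -> neg (Oc a b) = (Num.min b 0 - Num.min a 0)%:E.
Proof.
move=> ab; rewrite -[LHS]/(mu (Oc a b `&` half)).
have mu_oc (x y : R) : x <= y -> mu (`]x, y]%classic : set LT) = (y - x)%:E.
  move=> xy; rewrite lebesgue_measure_itv/= lte_fin; case: ifPn => [_|]; first by rewrite -EFinB.
  by rewrite -leNgt => yx; rewrite (le_anti (introT andP (conj xy yx))) subrr.
have mu_oo (x y : R) : x <= y -> mu (`]x, y[%classic : set LT) = (y - x)%:E.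
  move=> xy; rewrite lebesgue_measure_itv/= lte_fin; case: ifPn => [_|]; first by rewrite -EFinB.
  by rewrite -leNgt => yx; rewrite (le_anti (introT andP (conj xy yx))) subrr.
have [b0|b0] := ltP b 0.
  rewrite (_ : _ `&` _ = `]a, b]%classic) ?mu_oc//; last first.
    apply/seteqP; split => x; rewrite /Oc /half /= !in_itv/=; first by case.
    by move=> /andP[-> h]; rewrite h; split => //; exact: le_lt_trans b0.
  by rewrite min_l// ltW// (le_lt_trans ab).
have [a0|a0] := ltP a 0.
  rewrite (_ : _ `&` _ = `]a, 0[%classic) ?(mu_oo _ _ (ltW a0))//.
  apply/seteqP; split => x; rewrite /Oc /half /= !in_itv/=; first by move=> [/andP[-> _] ->].
  by move=> /andP[-> h]; rewrite h/=; split => //; rewrite (le_trans (ltW h)).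
rewrite subrr (_ : _ `&` _ = set0) ?measure0//; apply/seteqP; split => x//.
rewrite /Oc /half /= !in_itv/= => -[/andP[ax _] x0].
by have := lt_trans (le_lt_trans a0 ax) x0; rewrite ltxx.
Qed.

Let H : set LT := `[0, +oo[%classic.
Let HE (x : R) : H x = (0 <= x) :> Prop.
Proof. by rewrite /H /= in_itv/= andbT. Qed.

Let polar_eq (A : set LT) : measurable A -> A `<=` H -> nu A = (c%:E * mu A)%E.
Proof.
move=> mA A0; pose m : {measure set LT -> \bar R} := measure_add (mscale (NngNum ci0) nu) neg.
have mE (B : set LT) : m B = ((c^-1)%:E * nu B + neg B)%E by exact: measure_addE.
have h : forall B : set LT, measurable B -> mu B = m B.
  apply: lebesgue_measure_unique => _ [[a b]] _ <-.
  have [ab|ba] := leP a b; last first.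
    rewrite /= (_ : `]a, b]%classic = set0) ?measure0//; apply/seteqP; split => x //=.
    by rewrite in_itv/= => /andP[h1 h2]; have := lt_trans (lt_le_trans h1 h2) ba; rewrite ltxx.
  apply: (@etrans _ _ ((c^-1)%:E * nu (Oc a b) + neg (Oc a b))%E); last by rewrite mE.
  rewrite nu_itv// neg_itv// -EFinM -EFinD.
  rewrite mulrCA mulVf ?lt0r_neq0// mulr1 addrACA -opprD.
  rewrite [Num.max b 0 + _]addrC [Num.max a 0 + _]addrC !addr_min_max !addr0.
  rewrite lebesgue_measure_itv/= lte_fin; case: ifPn => [_|]; first by rewrite -EFinB.
  by rewrite -leNgt => ba; rewrite (le_anti (introT andP (conj ab ba))) subrr.
rewrite (h _ mA) mE.
have -> : neg A = 0%E.
  rewrite -[LHS]/(mu (A `&` half)) (_ : _ `&` _ = set0) ?measure0//; apply/seteqP; split => x//.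
  move=> [/A0]; rewrite HE /half /= in_itv/= => x1 x2.
  by have := lt_le_trans x2 x1; rewrite ltxx.
by rewrite adde0 muleA -EFinM mulfV ?mul1e// lt0r_neq0.
Qed.

Let ge0_polar_c (A : set LT) (f : LT -> \bar R) : measurable A -> A `<=` H ->
  measurable_fun A f -> (forall x, A x -> 0 <= f x)%E ->
  (\int[mu2]_(z in sqmod @^-1` A) f (sqmod z) = c%:E * \int[mu]_(x in A) f x)%E.
Proof.
move=> mA A0 mfA f0.
rewrite -(ge0_integral_pushforward measurable_sqmod mu2 mA mfA); last by move=> x /[!inE]; exact: f0.
rewrite (eq_measure_integral (mscale (NngNum (ltW c0)) mu)); last 2 first.
- exact: measurable_sqmod.
- by move=> ? B mB BA; apply: polar_eq => // x /BA; exact: A0.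
by rewrite ge0_integral_mscale.
Qed.

Let mH : measurable H. Proof. exact: measurable_itv. Qed.

(** The integral of e^(-|z|^2) over the plane is c through the squared modulus, and (sqrt pi)^2 by
    Fubini. *)
Let c_pi : c = pi.
Proof.
pose g (x : R) : R := expR (- x).
have mg : measurable_fun (setT : set LT) g.
  have cg : continuous g.
    by move=> x; apply: (@continuous_comp _ _ _ (fun x : R => - x) expR);
      [apply: cvgN; exact: cvg_id|exact: continuous_expR].
  exact: measurable_cont.
have mgH : measurable_fun H (EFin \o g) by apply/measurable_EFinP; exact: measurable_funTS.
have gE (x : R) : (0 <= (EFin \o g) x)%E by rewrite lee_fin expR_ge0.
have h := @ge0_polar_c H (EFin \o g) mH (fun x => id) mgH (fun x _ => gE x).
have preT : sqmod @^-1` H = setT.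
  by apply/seteqP; split => -[x y] // _; rewrite /preimage /= HE addr_ge0 ?sqr_ge0.
have [i1 e1] := @intg_expR R 1 ltr01.
have i2 : mu.-integrable H (EFin \o g).
  by apply: (eq_intg mH _ i1) => x _; rewrite /g mul1r.
have eR : (\int[mu]_(x in H) (EFin \o g) x = 1%:E)%E.
  rewrite -[LHS]fineK; last exact: integrable_fin_num.
  congr EFin; rewrite -[RHS]invr1 -e1; apply: eq_Rintegral => x _ /=.
  by rewrite /g mul1r.
rewrite preT eR mule1 in h.
pose G (x : LT) : \bar R := (expR (- x ^+ 2))%:E.
have mG : measurable_fun setT G.
  apply/measurable_EFinP; have cG : continuous (fun x : R => expR (- x ^+ 2)).
    move=> x; apply: (@continuous_comp _ _ _ (fun x : R => - x ^+ 2) expR); last exact: continuous_expR.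
    by apply: cvgN; exact: exprn_continuous.
  by have := measurable_cont cG.
have G0 x : (0 <= G x)%E by rewrite lee_fin expR_ge0.
have iG : mu.-integrable setT (EFin \o (fun x : R => expR (- x ^+ 2))).
  by have i := @intg_gauss R 1 ltr01; apply: (eq_intg measurableT _ i) => x _; rewrite mul1r.
have IG : (\int[mu]_x G x = (Num.sqrt pi)%:E)%E.
  rewrite -[LHS]fineK; last exact: integrable_fin_num.
  have <- : \int[mu]_z expR (- (1 * z ^+ 2)) = Num.sqrt pi by rewrite gauss_total// divr1.
   congr EFin; apply: eq_Rintegral => x _ /=.
  by rewrite mul1r.
have mh : measurable_fun setT (fun z : plane R => (EFin \o g) (sqmod z)).
  apply: measurableT_comp; first by apply/measurable_EFinP.
  exact: measurable_sqmod.
have hF := fubini_tonelli1 (m1 := mu) (m2 := mu) _ mh (fun z => gE (sqmod z)).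
have e2 : (\int[mu2]_z (EFin \o g) (sqmod z) = pi%:E)%E.
  apply: (etrans hF).
  have e3 (x : LT) : fubini_F mu (fun z : plane R => (EFin \o g) (sqmod z)) x = ((Num.sqrt pi)%:E * G x)%E.
    rewrite /fubini_F muleC -IG -ge0_integralZl//; apply: eq_integral => y _.
    by rewrite /= /G /g /sqmod /= -EFinM -expRD opprD.
  transitivity (\int[mu]_x ((Num.sqrt pi)%:E * G x))%E; first by apply: eq_integral => x _; exact: e3.
  rewrite ge0_integralZl//= ?lee_fin// IG -EFinM; congr EFin.
  by rewrite -expr2 sqr_sqrtr// pi_ge0.
by move: h; rewrite e2 => -[].
Qed.

Lemma ge0_polar (A : set LT) (f : LT -> \bar R) : measurable A -> (forall x, A x -> 0 <= x) ->
  measurable_fun A f -> (forall x, A x -> 0 <= f x)%E ->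
  (\int[mu2]_(z in sqmod @^-1` A) f (sqmod z) = pi%:E * \int[mu]_(x in A) f x)%E.
Proof. by rewrite -c_pi => mA A0; apply: ge0_polar_c => // x /A0; rewrite HE. Qed.

Lemma polar (A : set LT) (f : R -> R) : measurable A -> (forall x, A x -> 0 <= x) ->
  mu.-integrable A (EFin \o f) ->
  mu2.-integrable (sqmod @^-1` A) (EFin \o (f \o sqmod)) /\
  \int[mu2]_(z in sqmod @^-1` A) f (sqmod z) = pi * \int[mu]_(x in A) f x.
Proof.
move=> mA A0 fi; have mf' := measurable_int mu fi.
have mA' := measurable_sqmod_preimage mA.
have fi' : mu2.-integrable (sqmod @^-1` A) (EFin \o (f \o sqmod)).
  apply/integrableP; split.
    apply/measurable_EFinP; apply: (measurable_comp mA _ (intg_mfun fi)).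
      by move=> _ [z /= Dz <-].
    by apply: measurable_funTS; exact: measurable_sqmod.
  have h := ge0_polar mA A0 (measurableT_comp (@abse_measurable R setT) mf') (fun x _ => abse_ge0 _).
  rewrite [X in (X < _)%E]h; have/integrableP[_ h2] := fi.
  by apply: lte_mul_pinfty => //; rewrite ?lee_fin ?pi_ge0.
split => //.
have E : (\int[mu2]_(z in sqmod @^-1` A) (f (sqmod z))%:E = pi%:E * \int[mu]_(x in A) (f x)%:E)%E.
  rewrite integralE [X in (_ * X)%E]integralE muleBr//; last first.
    rewrite fin_num_adde_defl// fin_numN; exact: integrable_neg_fin_num fi.
  have mfp : measurable_fun (A : set LT) (fun x => (EFin \o f)^\+ x)%E by exact: measurable_funepos.
  have mfn : measurable_fun (A : set LT) (fun x => (EFin \o f)^\- x)%E by exact: measurable_funeneg.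
  congr (_ - _)%E.
    apply: (etrans _ (ge0_polar mA A0 mfp (fun x _ => funepos_ge0 _ _))).
    by apply: eq_integral => z _; rewrite !funeposE.
  apply: (etrans _ (ge0_polar mA A0 mfn (fun x _ => funeneg_ge0 _ _))).
  by apply: eq_integral => z _; rewrite !funenegE.
by rewrite /Rintegral E fineM//; exact: integrable_fin_num.
Qed.

End polar.

(** * Invariance under one rotation *)

Section shear.
Context {R : realType}.
Notation mu := (@lebesgue_measure R).
Notation LT := (measurableTypeR R).
Notation mu2 := (lebesgue2 R).

(** A rotation is a product of three shears, and a shear preserves planar measure by Fubini and
    translation invariance on the line. *)
Definition shear1 (a : R) (z : plane R) : plane R := (z.1 + a * z.2, z.2).
Definition shear2 (a : R) (z : plane R) : plane R := (z.1, z.2 + a * z.1).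

Lemma measurable_shear1 a : measurable_fun setT (shear1 a).
Proof.
apply/measurable_fun_pair => /=; last exact: measurable_snd.
by apply: measurable_funD; [exact: measurable_fst|apply: measurable_funM => //; exact: measurable_snd].
Qed.

Lemma measurable_shear2 a : measurable_fun setT (shear2 a).
Proof.
apply/measurable_fun_pair => /=; first exact: measurable_fst.
by apply: measurable_funD; [exact: measurable_snd|apply: measurable_funM => //; exact: measurable_fst].
Qed.

Let translate (u : R) (f : LT -> \bar R) : measurable_fun setT f -> (forall x, 0 <= f x)%E ->
  (\int[mu]_x f ((x : R) + u)%R = \int[mu]_x f x)%E.
Proof.
move=> mf f0; rewrite (ge0_integral_affine u ltr01 measurableT mf (fun x _ => f0 x)) mul1e preimage_setT.
by apply: eq_integral => x _; rewrite /affine mul1r addrC.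
Qed.

Lemma ge0_integral_shear1 (a : R) (f : plane R -> \bar R) : measurable_fun setT f -> (forall z, 0 <= f z)%E ->
  (\int[mu2]_z f (shear1 a z) = \int[mu2]_z f z)%E.
Proof.
move=> mf f0.
have mfs : measurable_fun setT (f \o shear1 a) by apply: measurableT_comp => //; exact: measurable_shear1.
apply: (etrans (fubini_tonelli2 (m1 := mu) (m2 := mu) _ mfs (fun z => f0 _))).
apply: (etrans _ (esym (fubini_tonelli2 (m1 := mu) (m2 := mu) _ mf f0))).
apply: eq_integral => y _; rewrite /fubini_G.
apply: (translate (a * y) (f := fun x => f (x, y))) => //.
exact: measurableT_comp.
Qed.

Lemma ge0_integral_shear2 (a : R) (f : plane R -> \bar R) : measurable_fun setT f -> (forall z, 0 <= f z)%E ->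
  (\int[mu2]_z f (shear2 a z) = \int[mu2]_z f z)%E.
Proof.
move=> mf f0.
have mfs : measurable_fun setT (f \o shear2 a) by apply: measurableT_comp => //; exact: measurable_shear2.
apply: (etrans (fubini_tonelli1 (m1 := mu) (m2 := mu) _ mfs (fun z => f0 _))).
apply: (etrans _ (esym (fubini_tonelli1 (m1 := mu) (m2 := mu) _ mf f0))).
apply: eq_integral => x _; rewrite /fubini_F.
apply: (translate (a * x) (f := fun y => f (x, y))) => //.
exact: measurableT_comp.
Qed.

(* the rotation by the Pythagorean angle arctan (4/3), which is not a rational multiple of pi *)
Definition rot (z : plane R) : plane R := shear1 (- 2^-1) (shear2 (4 / 5) (shear1 (- 2^-1) z)).

Lemma rotE (z : plane R) : rot z = ((3 * z.1 - 4 * z.2) / 5, (4 * z.1 + 3 * z.2) / 5).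
Proof. by rewrite /rot /shear1 /shear2 /=; congr pair; field. Qed.

Lemma ge0_integral_rot (f : plane R -> \bar R) : measurable_fun setT f -> (forall z, 0 <= f z)%E ->
  (\int[mu2]_z f (rot z) = \int[mu2]_z f z)%E.
Proof.
move=> mf f0; rewrite /rot.
have m1 : measurable_fun setT (f \o shear1 (- 2^-1)) by apply: measurableT_comp => //; exact: measurable_shear1.
have m2 : measurable_fun setT (f \o shear1 (- 2^-1) \o shear2 (4 / 5)).
  by apply: measurableT_comp => //; exact: measurable_shear2.
rewrite (ge0_integral_shear1 (- 2^-1) m2 (fun z => f0 _)).
by rewrite (ge0_integral_shear2 (4 / 5) m1 (fun z => f0 _)) ge0_integral_shear1.
Qed.

Lemma Rintegral_rot (f : plane R -> R) : mu2.-integrable setT (EFin \o f) ->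
  \int[mu2]_z f (rot z) = \int[mu2]_z f z.
Proof.
move=> fi; have mf := measurable_int mu2 fi; congr fine.
rewrite integralE [RHS]integralE; congr (_ - _)%E.
  have m := measurable_funepos mf.
  apply: (etrans _ (ge0_integral_rot m (fun z => funepos_ge0 _ _))).
  by apply: eq_integral => z _; rewrite !funeposE.
have m := measurable_funeneg mf.
apply: (etrans _ (ge0_integral_rot m (fun z => funeneg_ge0 _ _))).
by apply: eq_integral => z _; rewrite !funenegE.
Qed.

End shear.

(** * Integrals of products over product measures *)

Section product_integral.
Context d1 d2 (T1 : measurableType d1) (T2 : measurableType d2) {R : realType}.
Variables (m1 : {sigma_finite_measure set T1 -> \bar R}) (m2 : {sigma_finite_measure set T2 -> \bar R}).

Lemma Rintegral_prod (f : T1 -> R) (g : T2 -> R) :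
  m1.-integrable setT (EFin \o f) -> m2.-integrable setT (EFin \o g) ->
  (sf_product m1 m2).-integrable setT (EFin \o (fun z => f z.1 * g z.2)) /\
  \int[sf_product m1 m2]_z (f z.1 * g z.2) = (\int[m1]_x f x) * (\int[m2]_y g y).
Proof.
move=> fi gi; have mf := intg_mfun fi; have mg := intg_mfun gi.
have mfg : measurable_fun setT (fun z : T1 * T2 => f z.1 * g z.2).
  by apply: measurable_funM; apply: measurableT_comp.
have fin := integrable_fin_num measurableT gi.
have i12 : (m1 \x m2)%E.-integrable setT (EFin \o (fun z : T1 * T2 => f z.1 * g z.2)).
  apply/integrable12ltyP; first exact/measurable_EFinP.
  have/integrableP[_ f1] := fi; have/integrableP[_ g1] := gi.
  have mag : measurable_fun setT (fun y => `|(EFin \o g) y|%E).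
    by apply: measurableT_comp => //; exact/measurable_EFinP.
  have maf : measurable_fun setT (fun y => `|(EFin \o f) y|%E).
    by apply: measurableT_comp => //; exact/measurable_EFinP.
  have e : (\int[m1]_x \int[m2]_y `|(EFin \o (fun z : T1 * T2 => (f z.1 * g z.2)%R)) (x, y)| =
     \int[m1]_x (`|(EFin \o f) x| * \int[m2]_y `|(EFin \o g) y|))%E.
    apply: eq_integral => x _; rewrite -ge0_integralZl//.
    by apply: eq_integral => y _; rewrite /= normrM EFinM.
  rewrite e ge0_integralZr//; last exact: integral_ge0.
  by apply: lte_mul_pinfty => //; [exact: integral_ge0|rewrite ge0_fin_numE//; exact: integral_ge0].
split; first exact: i12.
have e := integral12_prod_meas1 i12.
rewrite /Rintegral -[X in fine X]e.
have e2 : (\int[m1]_x fubini_F m2 (EFin \o (fun z : T1 * T2 => (f z.1 * g z.2)%R)) x =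
   \int[m1]_x ((EFin \o f) x * (\int[m2]_y g y)%:E))%E.
  apply: eq_integral => x _; rewrite /fubini_F /Rintegral fineK// -integralZl//.
rewrite e2 integralZr// fineM//; exact: integrable_fin_num.
Qed.

End product_integral.

(** * Complex-valued integrals *)

Section complex_integral.
Context d (T : measurableType d) {R : realType} (m : {measure set T -> \bar R}).
Implicit Types (f g : T -> R[i]).
Notation Re := complex.Re.
Notation Im := complex.Im.

Definition cintg f := m.-integrable setT (EFin \o (fun x => Re (f x))) /\
  m.-integrable setT (EFin \o (fun x => Im (f x))).

Definition cint f : R[i] := Complex (\int[m]_x Re (f x)) (\int[m]_x Im (f x)).

Lemma eq_cintg f g : f =1 g -> cintg f -> cintg g.
Proof. by move=> /funext ->. Qed.

Lemma eq_cint f g : f =1 g -> cint f = cint g.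
Proof. by move=> /funext ->. Qed.

Lemma cintgD f g : cintg f -> cintg g -> cintg (fun x => f x + g x).
Proof.
move=> [f1 f2] [g1 g2]; split.
  by apply: (eq_intg measurableT _ (intgD measurableT f1 g1)) => x _; case: (f x) (g x) => [? ?] [? ?].
by apply: (eq_intg measurableT _ (intgD measurableT f2 g2)) => x _; case: (f x) (g x) => [? ?] [? ?].
Qed.

Lemma cintD f g : cintg f -> cintg g -> cint (fun x => f x + g x) = cint f + cint g.
Proof.
move=> [f1 f2] [g1 g2]; rewrite /cint; congr Complex.
  rewrite -(RintegralD measurableT f1 g1); apply: eq_Rintegral => x _.
  by case: (f x) (g x) => [? ?] [? ?].
rewrite -(RintegralD measurableT f2 g2); apply: eq_Rintegral => x _.
by case: (f x) (g x) => [? ?] [? ?].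
Qed.

Lemma cintgZ (k : R[i]) f : cintg f -> cintg (fun x => k * f x).
Proof.
move=> [f1 f2]; split.
  apply: (eq_intg measurableT _ (intgB measurableT (intgZ (Re k) measurableT f1) (intgZ (Im k) measurableT f2))).
  by move=> x _; case: (k) (f x) => [? ?] [? ?].
apply: (eq_intg measurableT _ (intgD measurableT (intgZ (Re k) measurableT f2) (intgZ (Im k) measurableT f1))).
by move=> x _; case: (k) (f x) => [? ?] [? ?].
Qed.

Lemma cintZ (k : R[i]) f : cintg f -> cint (fun x => k * f x) = k * cint f.
Proof.
case: k => a b [f1 f2]; rewrite /cint [RHS]/GRing.mul/=.
have mT := @measurableT _ T.
have Z (k : R) (h : T -> R) : m.-integrable setT (EFin \o h) -> k * (\int[m]_x h x) = \int[m]_x (k * h x).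
  by move=> hi; rewrite RintegralZl.
congr Complex.
  rewrite (Z _ _ f1) (Z _ _ f2) -(RintegralB mT (intgZ a mT f1) (intgZ b mT f2)).
  by apply: eq_Rintegral => x _; case: (f x).
rewrite (Z _ _ f2) (Z _ _ f1) -(RintegralD mT (intgZ a mT f2) (intgZ b mT f1)).
by apply: eq_Rintegral => x _; case: (f x).
Qed.

Lemma cintg0 : cintg (fun=> 0).
Proof. by split; exact: integrable0. Qed.

Lemma cint_sum (I : Type) (r : seq I) (F : I -> T -> R[i]) : (forall i, cintg (F i)) ->
  cintg (fun x => \sum_(i <- r) F i x) /\ cint (fun x => \sum_(i <- r) F i x) = \sum_(i <- r) cint (F i).
Proof.
move=> hF; elim: r => [|i r [IH1 IH2]].
  split; first by apply: (eq_cintg _ cintg0) => x; rewrite big_nil.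
  rewrite big_nil (eq_cint (g := fun=> 0)); last by move=> x; rewrite big_nil.
  by rewrite /cint /= !Rintegral_cst// !mul0r.
split; first by apply: (eq_cintg _ (cintgD (hF i) IH1)) => x; rewrite big_cons.
rewrite big_cons -IH2 -cintD//; apply: eq_cint => x; by rewrite big_cons.
Qed.

End complex_integral.

Section complex_product.
Context d1 d2 (T1 : measurableType d1) (T2 : measurableType d2) {R : realType}.
Variables (m1 : {sigma_finite_measure set T1 -> \bar R}) (m2 : {sigma_finite_measure set T2 -> \bar R}).

Lemma cint_prod (f : T1 -> R[i]) (g : T2 -> R[i]) : cintg m1 f -> cintg m2 g ->
  cintg (sf_product m1 m2) (fun z => f z.1 * g z.2) /\
  cint (sf_product m1 m2) (fun z => f z.1 * g z.2) = cint m1 f * cint m2 g.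
Proof.
move=> [f1 f2] [g1 g2]; have mT := @measurableT _ (T1 * T2)%type.
have [i11 e11] := Rintegral_prod f1 g1; have [i12 e12] := Rintegral_prod f1 g2.
have [i21 e21] := Rintegral_prod f2 g1; have [i22 e22] := Rintegral_prod f2 g2.
split.
  split.
    by apply: (eq_intg mT _ (intgB mT i11 i22)) => -[x y] _ /=; case: (f x) (g y) => [? ?] [? ?].
  by apply: (eq_intg mT _ (intgD mT i12 i21)) => -[x y] _ /=; case: (f x) (g y) => [? ?] [? ?].
rewrite /cint [RHS]/GRing.mul/=; congr Complex.
  rewrite -e11 -e22 -(RintegralB mT i11 i22).
  by apply: eq_Rintegral => -[x y] _ /=; case: (f x) (g y) => [? ?] [? ?].
rewrite -e12 -e21 -(RintegralD mT i12 i21).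
by apply: eq_Rintegral => -[x y] _ /=; case: (f x) (g y) => [? ?] [? ?].
Qed.

End complex_product.

Section complex_tuple.
Context d (T : measurableType d) {R : realType} (m : {sigma_finite_measure set T -> \bar R}).

Lemma cint_tcons n (h : n.+1.-tuple T -> R[i]) :
  cintg (sf_product m (tuple_measure m n)) (h \o @tcons _ _ _) ->
  cintg (tuple_measure m n.+1) h /\
  cint (tuple_measure m n.+1) h = cint (sf_product m (tuple_measure m n)) (h \o @tcons _ _ _).
Proof.
move=> [i1 i2].
have mu := @measurable_tuncons _ T n.
have m1 : measurable_fun setT (fun t => complex.Re (h t)).
  have -> : (fun t => complex.Re (h t)) = (fun z => complex.Re ((h \o @tcons _ _ _) z)) \o @tuncons _ _ _.
    by apply/funext => t; rewrite /= tunconsK.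
  by apply: measurableT_comp => //; exact: intg_mfun i1.
have m2 : measurable_fun setT (fun t => complex.Im (h t)).
  have -> : (fun t => complex.Im (h t)) = (fun z => complex.Im ((h \o @tcons _ _ _) z)) \o @tuncons _ _ _.
    by apply/funext => t; rewrite /= tunconsK.
  by apply: measurableT_comp => //; exact: intg_mfun i2.
have mt := @measurable_tcons _ T n.
have me1 : measurable_fun setT (EFin \o (fun t => complex.Re (h t))) by exact/measurable_EFinP.
have me2 : measurable_fun setT (EFin \o (fun t => complex.Im (h t))) by exact/measurable_EFinP.
split.
  split; [have := integrable_pushforward mt me1 _ measurableT|have := integrable_pushforward mt me2 _ measurableT].
    by rewrite preimage_setT; apply; exact: i1.
  by rewrite preimage_setT; apply; exact: i2.
rewrite /cint; congr Complex; congr fine.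
  have := integral_pushforward mt me1 _ measurableT.
  by rewrite preimage_setT; apply; exact: i1.
have := integral_pushforward mt me2 _ measurableT.
by rewrite preimage_setT; apply; exact: i2.
Qed.

Lemma cint_tuple n (F : 'I_n -> T -> R[i]) : (forall i, cintg m (F i)) ->
  cintg (tuple_measure m n) (fun t => \prod_(i < n) F i (tnth t i)) /\
  cint (tuple_measure m n) (fun t => \prod_(i < n) F i (tnth t i)) = \prod_(i < n) cint m (F i).
Proof.
elim: n F => [|n IHn] F hF.
  have E (t : 0.-tuple T) : 1 = \prod_(i < 0) F i (tnth t i) by rewrite big_ord0.
  split.
    apply: (eq_cintg E); split; apply: finite_measure_integrable_cst; exact: measurableT.
  rewrite -(eq_cint _ E) big_ord0 /cint /= !Rintegral_cst// mul0r mul1r.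
  have -> : fine (tuple_measure m 0 setT) = 1.
    by rewrite -[X in fine X]/(\d_([tuple] : 0.-tuple T) setT) diracT.
  by [].
have [i2 e2] := IHn (fun i => F (lift ord0 i)) (fun i => hF (lift ord0 i)).
have [i3 e3] := cint_prod (hF ord0) i2.
have E (z : T * n.-tuple T) : F ord0 z.1 * \prod_(i < n) F (lift ord0 i) (tnth z.2 i) =
    ((fun t => \prod_(i < n.+1) F i (tnth t i)) \o @tcons _ _ _) z.
  by case: z => x t; rewrite /= big_ord_recl tnth0; congr (_ * _); apply: eq_bigr => i _; rewrite tnthS.
have [i4 e4] := cint_tcons (eq_cintg E i3).
by split => //; rewrite e4 -(eq_cint _ E) e3 e2 big_ord_recl.
Qed.

End complex_tuple.

(** * The partition function *)

Section complex_preliminaries.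
Context {R : realType}.
Implicit Types (w : R[i]).
Notation Re := complex.Re.
Notation Im := complex.Im.

Definition rc (x : R) : R[i] := Complex x 0.

Lemma rcM (x y : R) : rc (x * y) = rc x * rc y.
Proof. by rewrite /rc [RHS]/GRing.mul/= !mul0r !mulr0 subr0 addr0. Qed.

Lemma cmulE (a b c d : R) : Complex a b * Complex c d = Complex (a * c - b * d) (a * d + b * c).
Proof. by []. Qed.

Lemma rc1 : rc 1 = 1. Proof. by []. Qed.

Lemma rcX (x : R) n : rc (x ^+ n) = rc x ^+ n.
Proof. by elim: n => [|n IH]; rewrite ?expr0// !exprS rcM IH. Qed.

Lemma rc_prod (I : Type) (r : seq I) (P : pred I) (F : I -> R) :
  rc (\prod_(i <- r | P i) F i) = \prod_(i <- r | P i) rc (F i).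
Proof. exact: (big_morph rc rcM rc1). Qed.

Lemma modulus_sqr w : rc (modulus w ^+ 2) = w * conjc w.
Proof.
case: w => a b; rewrite /modulus /ComplexField.Normc.normc sqr_sqrtr ?addr_ge0 ?sqr_ge0//.
by rewrite [RHS]/GRing.mul/= /rc !expr2; congr Complex; ring.
Qed.

Lemma modulus_cplx (z : plane R) : modulus (cplx z) = Num.sqrt (sqmod z).
Proof. by []. Qed.

Lemma modulus_ge0 w : 0 <= modulus w. Proof. by case: w => a b; exact: sqrtr_ge0. Qed.

Lemma modulusM w1 w2 : modulus (w1 * w2) = modulus w1 * modulus w2.
Proof. exact: ComplexField.Normc.normcM. Qed.

Lemma modulusX w n : modulus (w ^+ n) = modulus w ^+ n.
Proof.
elim: n => [|n IH]; first by rewrite !expr0 [LHS]ComplexField.Normc.normc1.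
by rewrite !exprS modulusM IH.
Qed.

Lemma modulus_conj w : modulus (conjc w) = modulus w.
Proof. by case: w => a b; rewrite /modulus /= sqrrN. Qed.

Lemma modulus_rc (x : R) : modulus (rc x) = `|x|.
Proof. by rewrite /modulus /= expr0n addr0 sqrtr_sqr. Qed.

Lemma Re_le w : `|Re w| <= modulus w.
Proof. by case: w => a b; rewrite /modulus /= -sqrtr_sqr ler_wsqrtr// lerDl sqr_ge0. Qed.

Lemma Im_le w : `|Im w| <= modulus w.
Proof. by case: w => a b; rewrite /modulus /= -sqrtr_sqr ler_wsqrtr// lerDr sqr_ge0. Qed.

Definition omega : R[i] := Complex (3 / 5) (4 / 5).

Lemma cplx_rot (z : plane R) : cplx (rot z) = omega * cplx z.
Proof.
by case: z => x y; rewrite rotE /cplx /omega [RHS]/GRing.mul/=; congr Complex; field.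
Qed.

Lemma omega_conj : omega * conjc omega = 1.
Proof. by rewrite /omega [LHS]/GRing.mul/=; congr Complex; field. Qed.

Lemma sqmod_rot (z : plane R) : sqmod (rot z) = sqmod z.
Proof. by case: z => x y; rewrite rotE /sqmod /=; field. Qed.

(* modulo 5, every power of 3 + 4i is congruent to 3 + 4i *)
Lemma omega_powers (k : nat) : exists u v : int,
  omega ^+ k.+1 = rc (5 ^- k.+1) * Complex (5 * u%:~R + 3) (5 * v%:~R + 4).
Proof.
elim: k => [|k [u [v IH]]].
  by exists 0, 0; rewrite !expr1 /omega /rc [RHS]/GRing.mul/=; congr Complex; field.
exists (3 * u - 4 * v - 2), (4 * u + 3 * v + 4).
have eu : (3 * u - 4 * v - 2)%:~R = 3 * u%:~R - 4 * v%:~R - 2 :> R by rewrite !rmorphB !rmorphM.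
have ev : (4 * u + 3 * v + 4)%:~R = 4 * u%:~R + 3 * v%:~R + 4 :> R by rewrite !rmorphD !rmorphM.
rewrite exprS IH eu ev /omega /rc !cmulE !exprS.
have : (5 ^+ k : R) != 0 by rewrite expf_neq0.
by move: (5 ^+ k : R) (u%:~R : R) (v%:~R : R) => a b c an; congr Complex; field.
Qed.

Lemma omega_neq1 (k : nat) : (0 < k)%N -> omega ^+ k != 1.
Proof.
case: k => // k _; have [u [v ->]] := omega_powers k.
apply/eqP => /(congr1 (@complex.Im R)); rewrite /rc [_ * _]/GRing.mul/= mul0r addr0 => /eqP.
rewrite mulf_eq0 invr_eq0 expf_eq0/= (_ : (5 : R) == 0 = false)/=; last exact/negbTE.
have -> : 5 * v%:~R + 4 = (5 * v + 4)%:~R :> R by rewrite rmorphD rmorphM.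
rewrite intr_eq0 => /eqP; lia.
Qed.

(** Multiplying by the power |a - b| of [omega] leaves [omega] ^+ k * m = m for some k > 0, and
    [omega] is not a root of unity. *)
Lemma omega_moment (a b : nat) (m : R[i]) : a != b -> m = omega ^+ a * conjc omega ^+ b * m -> m = 0.
Proof.
move=> ab e; have [k k0 h] : exists2 k, (0 < k)%N & m * omega ^+ k = m.
  have op n : omega ^+ n * conjc omega ^+ n = 1 by rewrite -exprMn omega_conj expr1n.
  have [h|h|h] := ltngtP a b; last by rewrite h eqxx in ab.
    exists (b - a)%N; first by rewrite subn_gt0.
    have hb : conjc omega ^+ b = conjc omega ^+ a * conjc omega ^+ (b - a) by rewrite -exprD subnKC// ltnW.
    rewrite hb mulrA op mul1r in e.
    by rewrite {1}e mulrAC [_ ^+ _ * omega ^+ _]mulrC op mul1r.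
  exists (a - b)%N; first by rewrite subn_gt0.
  have hb : omega ^+ a = omega ^+ (a - b) * omega ^+ b by rewrite -exprD subnK// ltnW.
  by rewrite hb -(mulrA (omega ^+ _)) op mulr1 in e; rewrite mulrC -e.
apply/eqP; move/eqP: h; rewrite -subr_eq0 -[X in _ - X]mulr1 -mulrBr mulf_eq0.
by case/orP => //; rewrite subr_eq0 (negbTE (omega_neq1 k0)).
Qed.

End complex_preliminaries.

(** * Orthogonality of the monomials *)

Section moments.
Context {R : realType} (W : R -> R).
Notation mu := (@lebesgue_measure R).
Notation LT := (measurableTypeR R).
Notation mu2 := (lebesgue2 R).
Notation Re := complex.Re.
Notation Im := complex.Im.
Let U : set LT := `[0, 1]%classic.
Hypothesis iW : mu.-integrable U (EFin \o W).

Definition cutoff (s : R) : R := if 0 <= s <= 1 then W s else 0.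

Definition monomial (a b : nat) (z : plane R) : R[i] :=
  rc (cutoff (sqmod z)) * (cplx z ^+ a * conjc (cplx z) ^+ b).

Let mU : measurable U. Proof. exact: measurable_itv. Qed.
Let U_ge0 (x : LT) : U x -> 0 <= x. Proof. by rewrite /U /= in_itv/= => /andP[]. Qed.
Let cutoffE : cutoff = W \_ U.
Proof.
apply/funext => s; rewrite /cutoff /patch; case: ifPn => h; first by rewrite mem_set// /U /= in_itv/=.
by rewrite memNset// /U /= in_itv/=; exact/negP.
Qed.

Let i_cut (g : LT -> R) : mu.-integrable U (EFin \o (fun s => W s * g s)) ->
  mu2.-integrable setT (EFin \o (fun z => cutoff (sqmod z) * g (sqmod z))) /\
  \int[mu2]_z (cutoff (sqmod z) * g (sqmod z)) = pi * \int[mu]_(s in U) (W s * g s).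
Proof.
move=> i; have mP := measurable_sqmod_preimage mU.
have [i1 <-] := polar mU U_ge0 i.
have E (z : plane R) : cutoff (sqmod z) * g (sqmod z) =
    ((fun z => W (sqmod z) * g (sqmod z)) \_ (sqmod @^-1` U)) z.
  rewrite cutoffE /patch; case: ifPn => h; first by rewrite ifT// inE/=; move: h; rewrite inE.
  by rewrite mul0r ifF//; apply/negbTE; move: h; apply: contraNN; rewrite !inE.
split; last by rewrite [RHS]Rintegral_mkcond; apply: eq_Rintegral => z _; exact: E.
have h := (integrable_mkcond _ mP).1 i1; rewrite restrict_EFin in h.
by apply: (eq_intg measurableT _ h) => z _; rewrite E.
Qed.

Let cmeas (f : plane R -> R[i]) := measurable_fun setT (fun z => Re (f z)) /\
  measurable_fun setT (fun z => Im (f z)).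

Let cmeasM f g : cmeas f -> cmeas g -> cmeas (fun z => f z * g z).
Proof.
move=> [f1 f2] [g1 g2]; split.
  have -> : (fun z => Re (f z * g z)) = (fun z => Re (f z) * Re (g z) - Im (f z) * Im (g z)).
    by apply/funext => z; case: (f z) (g z) => [? ?] [? ?].
  by apply: measurable_funB; exact: measurable_funM.
have -> : (fun z => Im (f z * g z)) = (fun z => Re (f z) * Im (g z) + Im (f z) * Re (g z)).
  by apply/funext => z; case: (f z) (g z) => [? ?] [? ?].
by apply: measurable_funD; exact: measurable_funM.
Qed.

Let cmeasX f n : cmeas f -> cmeas (fun z => f z ^+ n).
Proof.
move=> h; elim: n => [|n IH]; first by split; exact: measurable_cst.
have [h1 h2] := cmeasM h IH.
by split; [apply: (eq_measurable_fun _ _ h1)|apply: (eq_measurable_fun _ _ h2)] => z _; rewrite exprS.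
Qed.

Let cmeas_cplx : cmeas (@cplx R).
Proof. by split; [exact: measurable_fst|exact: measurable_snd]. Qed.

Let cmeas_conj : cmeas (fun z => conjc (cplx z)).
Proof. by split; [exact: measurable_fst|apply: measurableT_comp => //; exact: measurable_snd]. Qed.

Let iW1 : mu.-integrable U (EFin \o (fun s => W s * 1)).
Proof. by apply: (eq_intg mU _ iW) => s _; rewrite mulr1. Qed.

Lemma cintg_monomial a b : cintg mu2 (monomial a b).
Proof.
have [i1 _] := i_cut iW1.
have m1 := intg_mfun i1.
have mc : cmeas (fun z => rc (cutoff (sqmod z))).
  by split; [apply: (eq_measurable_fun _ _ m1) => z _; rewrite /= mulr1|exact: measurable_cst].
have [mr mi] := cmeasM mc (cmeasM (cmeasX a cmeas_cplx) (cmeasX b cmeas_conj)).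
have i2 := integrable_norm i1.
have i3 : mu2.-integrable setT (EFin \o (fun z => `|cutoff (sqmod z)|)).
  by apply: (eq_intg measurableT _ i2) => z _; rewrite /= mulr1.
have b1 z : modulus (monomial a b z) <= `|cutoff (sqmod z)|.
  rewrite /monomial !modulusM !modulusX modulus_conj modulus_rc -exprD /cutoff.
  case: ifPn => [/andP[s0 s1]|_]; last by rewrite normr0 mul0r.
  rewrite ler_piMr// exprn_ile1 ?modulus_ge0// modulus_cplx -[leRHS]sqrtr1; exact: ler_wsqrtr.
split.
  by refine (intg_le measurableT mr i3 _) => z _; exact: le_trans (Re_le _) (b1 z).
by refine (intg_le measurableT mi i3 _) => z _; exact: le_trans (Im_le _) (b1 z).
Qed.

(** Rotation preserves the measure and the radial weight but multiplies the monomial by [omega] ^+ a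
    * conjc [omega] ^+ b, so a single rotation of infinite order replaces integration over the
    angle. *)
Lemma cint_monomial_neq a b : a != b -> cint mu2 (monomial a b) = 0.
Proof.
move=> ab; apply: (omega_moment ab).
have hm := cintg_monomial a b.
rewrite -(cintZ _ hm).
have E z : omega ^+ a * conjc omega ^+ b * monomial a b z = monomial a b (rot z).
  rewrite /monomial sqmod_rot cplx_rot rmorphM !exprMn/=.
  by rewrite mulrCA; congr (_ * _); rewrite mulrACA.
rewrite (eq_cint _ E) /cint; case: hm => h1 h2.
have e1 := @Rintegral_rot R (fun z => Re (monomial a b z)) h1.
have e2 := @Rintegral_rot R (fun z => Im (monomial a b z)) h2.
exact: (f_equal2 (@Complex R) (esym e1) (esym e2)).
Qed.

Lemma cint_monomial_eq a : mu.-integrable U (EFin \o (fun s => W s * s ^+ a)) ->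
  cint mu2 (monomial a a) = rc (pi * \int[mu]_(s in `[0, 1]) (W s * s ^+ a)).
Proof.
move=> i; have [_ <-] := i_cut i.
have E z : monomial a a z = rc (cutoff (sqmod z) * sqmod z ^+ a).
  rewrite /monomial -exprMn -modulus_sqr modulus_cplx sqr_sqrtr; last by rewrite addr_ge0 ?sqr_ge0.
  by rewrite rcM rcX.
rewrite (eq_cint _ E) /cint /rc; congr Complex.
by rewrite Rintegral_cst// mul0r.
Qed.

End moments.

(** * Expansion of the squared Vandermonde determinant *)

Section vandermonde.
Context {R : realType}.

Lemma vandermonde_perm (n : nat) (a : 'I_n -> R[i]) :
  \prod_(k < n) \prod_(j < n | (j < k)%N) (a k - a j) = \sum_(s : 'S_n) (-1) ^+ s * \prod_i a i ^+ s i.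
Proof.
(* The product over pairs is reordered by the smaller index, as in the Vandermonde determinant. *)
rewrite (exchange_big_dep xpredT)//=.
have := det_Vandermonde (\row_(i < n) a i); rewrite -det_tr /determinant => e.
transitivity (\prod_(i < n) \prod_(j < n | (i < j)%N) ((\row_(i < n) a i) 0 j - (\row_(i < n) a i) 0 i)).
  by apply: eq_bigr => i _; apply: eq_bigr => j _; rewrite !mxE.
by rewrite -e; apply: eq_bigr => s _; congr (_ * _); apply: eq_bigr => i _; rewrite !mxE.
Qed.

Lemma vandermonde_sqr (n : nat) (a : 'I_n -> R[i]) :
  rc (\prod_(k < n) \prod_(j < n | (j < k)%N) modulus (a k - a j) ^+ 2) =
  \sum_(s : 'S_n) \sum_(t : 'S_n) ((-1) ^+ s * (-1) ^+ t) * \prod_i (a i ^+ s i * conjc (a i) ^+ t i).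
Proof.
transitivity ((\prod_(k < n) \prod_(j < n | (j < k)%N) (a k - a j)) *
   \prod_(k < n) \prod_(j < n | (j < k)%N) (conjc (a k) - conjc (a j))).
  rewrite rc_prod -big_split; apply: eq_bigr => k _; rewrite rc_prod -big_split; apply: eq_bigr => j _.
  by rewrite modulus_sqr rmorphB.
rewrite !vandermonde_perm big_distrlr; apply: eq_bigr => s _; apply: eq_bigr => t _.
by rewrite /= mulrACA -big_split.
Qed.

(** If s and t differ somewhere the product contains an off-diagonal zero. The n! diagonal terms
    have sign 1 and are equal after reindexing by s. *)
Lemma sum_perm_diag (n : nat) (m : nat -> nat -> R[i]) : (forall a b, a != b -> m a b = 0) ->
  \sum_(s : 'S_n) \sum_(t : 'S_n) ((-1) ^+ s * (-1) ^+ t) * \prod_(i < n) m (s i) (t i) =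
  n`!%:R * \prod_(j < n) m j j.
Proof.
move=> m0.
transitivity (\sum_(s : 'S_n) \prod_(j < n) m j j); last first.
  rewrite sumr_const -[LHS]mulr_natl; congr (_%:R * _).
  by rewrite -card_Sn; apply: eq_card.
apply: eq_bigr => s _; rewrite (bigD1 s)//= [X in _ + X]big1 => [|t ts].
  rewrite addr0 -expr2 sqrr_sign mul1r [RHS](reindex_inj (@perm_inj _ s)).
  exact: eq_bigr.
have [i si] : exists i, s i != t i.
  apply/existsP; rewrite -negb_forall; apply: contraNN ts => /forallP h.
  by apply/eqP/permP => i; rewrite (eqP (h i)).
by rewrite (bigD1 i)//= m0 ?mul0r ?mulr0.
Qed.

End vandermonde.

Section partition_function.
Context {R : realType}.
Notation mu := (@lebesgue_measure R).
Notation LT := (measurableTypeR R).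
Notation mu2 := (lebesgue2 R).

Lemma Rintegral_vandermonde (W : R -> R) (n : nat) :
  (forall j : nat, mu.-integrable `[0, 1] (EFin \o (fun s => W s * s ^+ j))) ->
  \int[tuple_measure mu2 n]_z (\prod_(i < n) cutoff W (sqmod (tnth z i)) *
     \prod_(k < n) \prod_(j < n | (j < k)%N) modulus (cplx (tnth z k) - cplx (tnth z j)) ^+ 2) =
  n`!%:R * \prod_(j < n) (pi * \int[mu]_(s in `[0, 1]) (W s * s ^+ j)).
Proof.
move=> iW.
have mI : measurable (`[0, 1]%classic : set LT) by exact: measurable_itv.
have iW0 : mu.-integrable `[0, 1] (EFin \o W).
  by apply: (eq_intg mI _ (iW 0%N)) => s _; rewrite expr0 mulr1.
pose F (s t : 'S_n) (z : n.-tuple (plane R)) : R[i] :=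
  ((-1) ^+ s * (-1) ^+ t) * \prod_(i < n) monomial W (s i) (t i) (tnth z i).
have hF (s t : 'S_n) : cintg (tuple_measure mu2 n) (F s t) /\
    cint (tuple_measure mu2 n) (F s t) = ((-1) ^+ s * (-1) ^+ t) * \prod_(i < n) cint mu2 (monomial W (s i) (t i)).
  have [i1 e1] := @cint_tuple _ _ R mu2 n (fun i => monomial W (s i) (t i)) (fun i => cintg_monomial iW0 _ _).
  by split; [exact: cintgZ|rewrite cintZ// e1].
have hF2 (s : 'S_n) := cint_sum (index_enum _) (fun t => (hF s t).1).
have [i3 e3] := cint_sum (index_enum _) (fun s => (hF2 s).1).
have E (z : n.-tuple (plane R)) : \sum_(s : 'S_n) \sum_(t : 'S_n) F s t z =
    rc (\prod_(i < n) cutoff W (sqmod (tnth z i)) *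
     \prod_(k < n) \prod_(j < n | (j < k)%N) modulus (cplx (tnth z k) - cplx (tnth z j)) ^+ 2).
  rewrite rcM rc_prod vandermonde_sqr big_distrr; apply: eq_bigr => s _.
  rewrite big_distrr; apply: eq_bigr => t _ /=.
  by rewrite mulrCA -big_split.
have e4 := etrans (esym (eq_cint _ E)) e3.
have e5 : \sum_(s : 'S_n) cint (tuple_measure mu2 n) (fun z => \sum_(t : 'S_n) F s t z) =
    rc (n`!%:R * \prod_(j < n) (pi * \int[mu]_(s in `[0, 1]) (W s * s ^+ j))).
  rewrite rcM rc_prod.
  transitivity (n`!%:R * \prod_(j < n) cint mu2 (monomial W j j)).
    rewrite -(sum_perm_diag n (m := fun a b => cint mu2 (monomial W a b))); last exact: cint_monomial_neq.
    by apply: eq_bigr => s _; rewrite (hF2 s).2; apply: eq_bigr => t _; rewrite (hF s t).2.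
  congr (_ * _); last by apply: eq_bigr => j _; rewrite cint_monomial_eq.
  by rewrite /rc -[RHS]/(_%:C)%C rmorph_nat.
have := congr1 (@complex.Re R) (etrans e4 e5).
by [].
Qed.

(** The radial integrals exclude s = 0, a null point, while the planar computation uses the closed
    interval. *)
Lemma Zh_radial (q : R -> R) (N : nat) : (forall j, mu.-integrable `]0, 1] (EFin \o radial q N%:R j)) ->
  Zh q N = \prod_(j < N) (2 * pi * radial_norm q N%:R j).
Proof.
move=> ir; pose W (s : R) : R := expR (- (N%:R * q (Num.sqrt s))).
have rE j (s : R) : radial q N%:R j s = W s * s ^+ j by rewrite /radial mulrC.
have mO : measurable (`]0, 1]%classic : set LT) by [].
have iE j : mu.-integrable `]0, 1] (EFin \o (fun s => W s * s ^+ j)).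
  by apply: (eq_intg mO _ (ir j)) => s _; rewrite rE.
have iW j : mu.-integrable `[0, 1] (EFin \o (fun s => W s * s ^+ j)).
  have/integrableP[m1 f1] := iE j.
  have m2 : measurable_fun (`[0, 1]%classic : set LT) (EFin \o (fun s => W s * s ^+ j)).
    by apply/measurable_EFinP/measurable_fun_itv_obnd_cbndP/measurable_EFinP.
  apply/integrableP; split; first exact: m2.
  by rewrite -integral_itv_obnd_cbnd//; apply: measurableT_comp.
have h := Rintegral_vandermonde N iW.
rewrite /Zh Rintegral_mkcond.
transitivity ((N`!)%:R^-1 * (N`!%:R * \prod_(j < N) (pi * \int[mu]_(s in `[0, 1]) (W s * s ^+ j)))).
  rewrite -h; congr (_ * _); apply: eq_Rintegral => z _.
  rewrite /patch; case: ifPn => [|hz].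
    rewrite inE => hz; congr (_ * _).
    rewrite mulr_sumr -sumrN expR_sum; apply: eq_bigr => i _; rewrite modulus_cplx.
    have d : Num.sqrt (sqmod (tnth z i)) <= 1 := hz i.
    rewrite /cutoff ifT// addr_ge0 ?sqr_ge0//=.
    by rewrite -(@ler_sqrt _ _ 1) ?ler01// sqrtr1.
  have [i hi] : exists i, ~ @disk R (tnth z i).
    by apply/existsNP => h'; move: hz; rewrite notin_setE.
  rewrite (bigD1 i)//= /cutoff ifF ?mul0r//; apply/negbTE; move/negP: hi; apply: contraNN => /andP[_ s1].
  by rewrite modulus_cplx -[leRHS]sqrtr1 ler_wsqrtr.
rewrite mulrA mulVf ?mul1r; last by rewrite pnatr_eq0 -lt0n fact_gt0.
apply: eq_bigr => j _; rewrite /radial_norm.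
have -> : \int[mu]_(s in `]0, 1]) radial q N%:R j s = \int[mu]_(s in `[0, 1]) (W s * s ^+ j).
  by rewrite Rintegral_itv_obnd_cbnd//; apply: eq_Rintegral => s _; rewrite rE.
by field.
Qed.

End partition_function.

(** * Equilibrium functionals *)

Section equilibrium.
Context {R : realType} (q : R -> R) (r0 : R) (r1 : \bar R).
Hypothesis q_smooth : smooth_pos q.
Hypothesis q_subharmonic : forall r, 0 < r -> 0 < laplQ q r.
Hypothesis r0_gt0 : 0 < r0.
Hypothesis r0_lt1 : r0 < 1.
Hypothesis q1r0 : derive1 q r0 = 0.
Hypothesis r1_ge1 : (1 <= r1)%E.
Notation mu := (@lebesgue_measure R).
Notation LT := (measurableTypeR R).
Notation X0 := (x0 r0).

Let c0 : continuous (p0 q). Proof. by move=> x; exact: is_derive_cvg (dp0 q_smooth x). Qed.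
Let c2 : continuous (p2 q). Proof. by move=> x; exact: is_derive_cvg (dp2 q_smooth x). Qed.
Let ex0 : expR X0 = r0. Proof. by rewrite lnK ?posrE. Qed.
Let X00 : X0 <= 0. Proof. by rewrite ltW// x00. Qed.
Let g2 := p2_gt0 q_smooth q_subharmonic.
Let mI : measurable (`[X0, 0]%classic : set LT). Proof. by []. Qed.

(** Polar integration cancels 1 / pi. With s = e^(2 x), ds / 4 = s dx / 2, and s times the Laplacian
    is p2. *)
Lemma int_muQ_radial (f : plane R -> R) (g : R -> R) : continuous g ->
  (forall z, 0 < modulus (cplx z) -> f z = g (ln (modulus (cplx z)))) ->
  int_muQ q r0 r1 (droplet r0 r1 `&` @disk R) f = \int[mu]_(x in `[X0, 0]) (2^-1 * (g x * p2 q x)).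
Proof.
move=> cg fg; pose G (x : R) : R := 2^-1 * (g x * p2 q x).
have cG : continuous G.
  by move=> x; apply: cvgM; [exact: cvg_cst|apply: cvgM; [exact: cg|exact: c2]].
have [i e] := @Rint_exp R 2 G X0 0 (ltr0Sn _ 1) X00 cG.
have r20 : 0 < r0 ^+ 2 by rewrite exprn_gt0.
rewrite mulr0 expR0 -[2 * X0]mulrC expRM_natr ex0 in i e.
pose A : set LT := `[r0 ^+ 2, 1]%classic.
have mA : measurable A by exact: measurable_itv.
have A0 (x : LT) : A x -> 0 <= x.
  by rewrite /A /= in_itv/= => /andP[h _]; exact: ltW (lt_le_trans r20 h).
have [_ e2] := polar mA A0 i.
have -> : \int[mu]_(x in `[X0, 0]) (2^-1 * (g x * p2 q x)) =
   pi^-1 * \int[lebesgue2 R]_(z in sqmod @^-1` A) (G (ln (sqmod z) / 2) / (2 * sqmod z)).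
  by rewrite e2 mulKf ?gt_eqF ?pi_gt0// e.
rewrite /int_muQ; congr (_ * _).
(* As r1 >= 1, the outer boundary of the droplet imposes nothing inside the disk. *)
have -> : droplet r0 r1 `&` @disk R `&` droplet r0 r1 = sqmod @^-1` A.
  apply/seteqP; split => z; rewrite /droplet /disk /preimage /A /= in_itv/= -/(sqmod z).
    move=> [[[h1 _] h2] _]; rewrite -/(sqmod z) in h1 h2; apply/andP; split.
      have sz : 0 <= sqmod z by rewrite addr_ge0 ?sqr_ge0.
      by rewrite -(sqr_sqrtr sz) lerXn2r ?nnegrE// ltW.
    by rewrite -[leRHS]sqrtr1 ler_sqrt// in h2.
  move=> /andP[h1 h2].
  have h3 : r0 <= Num.sqrt (sqmod z) by rewrite -[leLHS]gtr0_norm// -sqrtr_sqr ler_wsqrtr.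
  have h4 : Num.sqrt (sqmod z) <= 1 by rewrite -[leRHS]sqrtr1 ler_wsqrtr.
  have h5 : ((Num.sqrt (sqmod z))%:E <= r1)%E by rewrite (le_trans _ r1_ge1)// lee_fin.
  by [].
apply: eq_Rintegral => z; rewrite inE /preimage /A /= in_itv/= -/(sqmod z) => /andP[h1 _].
have s0 : 0 < sqmod z by exact: lt_le_trans h1.
have t0 : 0 < Num.sqrt (sqmod z) by rewrite sqrtr_gt0.
have lE : ln (sqmod z) / 2 = ln (Num.sqrt (sqmod z)).
  have e3 := sqr_sqrtr (ltW s0); have e4 := lnXn 2 t0.
  by rewrite e3 in e4; rewrite e4 mulr2n; move: (ln _) => l; field.
rewrite fg ?modulus_cplx// lE /G (p2E q_smooth) lnK ?posrE// sqr_sqrtr ?(ltW s0)//.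
move: (g (ln (Num.sqrt (sqmod z)))) (laplQ q (Num.sqrt (sqmod z))) (sqmod z) (lt0r_neq0 s0) => a b s sn; field; exact: sn.
Qed.

Lemma p1_eta : p1 q 0 = 2 * (1 - eta q).
Proof. by rewrite p1E expR0 mul1r /eta; field. Qed.

Lemma I_muQE : I_muQ q r0 r1 = energy q r0.
Proof.
rewrite (energyE q_smooth r0_gt0 r0_lt1 q1r0) /I_muQ.
rewrite (int_muQ_radial c0); last by move=> z hz; rewrite p0E lnK ?posrE.
rewrite p1_eta p0E expR0.
have -> : \int[mu]_(x in `[X0, 0]) (2^-1 * (p0 q x * p2 q x)) = 2^-1 * \int[mu]_(x in `[X0, 0]) (p0 q x * p2 q x).
  rewrite RintegralZl//; apply: continuous_compact_integrable; first exact: segment_compact.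
  by apply: continuous_subspaceT => x; apply: cvgM; [exact: c0|exact: c2].
by move: (\int[mu]_(x in _) _) (q 1) (eta q) => *; field.
Qed.

Lemma E_muQE : E_muQ q r0 r1 = log_energy q r0.
Proof.
pose g (x : R) := ln (p2 q x) - 2 * x - 2 * ln 2.
have cl : continuous (fun x => ln (p2 q x)).
  move=> x; apply: (@continuous_comp _ _ _ (p2 q) (@ln R)); first exact: c2.
  by apply: continuous_ln; exact: g2.
have cg : continuous g.
  move=> x; apply: cvgB; last exact: cvg_cst.
  by apply: cvgB; [exact: cl|apply: cvgM; [exact: cvg_cst|exact: cvg_id]].
rewrite /E_muQ (int_muQ_radial cg); last first.
  move=> z hz; have L0 := q_subharmonic hz; have m2 : 0 < modulus (cplx z) ^+ 2 by rewrite exprn_gt0.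
  have q4 : 0 < 4^-1 :> R by [].
  rewrite /g (p2E q_smooth) lnK ?posrE// (lnM m2 L0) (lnM q4 L0) lnV ?posrE// lnXn//.
  have -> : ln 4 = 2 * ln 2 :> R by rewrite mulr_natl -lnXn// -natrX.
  by move: (ln _) (ln _) (ln _) => a b c; rewrite mulr_natl; ring.
have ic (h : R -> R) : continuous h -> mu.-integrable `[X0, 0] (EFin \o h).
  by move=> ch; apply: continuous_compact_integrable; [exact: segment_compact|exact: continuous_subspaceT].
have ce : continuous (fun x => p2 q x * ln (p2 q x)) by move=> x; apply: cvgM; [exact: c2|exact: cl].
have cx : continuous (fun x : R => x * p2 q x) by move=> x; apply: cvgM; [exact: cvg_id|exact: c2].
have iA := intgZ 2^-1 mI (ic _ ce); have iB := ic _ cx; have iC := intgZ (ln 2) mI (ic _ c2).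
have iAB := intgB mI iA iB.
rewrite /log_energy /entropy -(moment_p2 q_smooth r0_gt0 r0_lt1 q1r0) -(mass_p2 q_smooth r0_gt0 r0_lt1 q1r0).
transitivity (\int[mu]_(x in `[X0, 0]) (2^-1 * (p2 q x * ln (p2 q x)) - x * p2 q x - ln 2 * p2 q x)).
  by apply: eq_Rintegral => x _; rewrite /g; move: (p2 q x) (ln _) (ln _) => *; field.
rewrite (RintegralB mI iAB iC) (RintegralB mI iA iB).
by rewrite RintegralZl//; [rewrite RintegralZl//; exact: ic|exact: ic].
Qed.

Lemma eta_lt1 : eta q < 1.
Proof.
have := p1_incr q_smooth q_subharmonic (x00 r0_gt0 r0_lt1).
by rewrite (p1x0 r0_gt0 q1r0) p1_eta; lra.
Qed.

Lemma ln_Zh : (fun N : nat => ln (Zh q N / (2 * pi) ^+ N) -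
  \sum_(j < N) lnZ (p0 q) (X0 - 1) 0 N%:R (2 * j.+1%:R / N%:R)) @ \oo --> (0 : R).
Proof.
refine (rcvg_eq (truncation q_smooth q_subharmonic r0_gt0 r0_lt1 q1r0) _ erefl) => N.
congr (_ - _).
(* For N = 0 the radial weight need not be normalised, but both products are empty. *)
have rad j : 0 < radial_norm q N%:R j \/ N = 0%N.
  case: N => [|N]; first by right.
  left; have [t [-> t0 _]] := radial_split q_smooth q_subharmonic r0_gt0 r0_lt1 q1r0 j (ltr0Sn R N).
  by rewrite ltr_wpDr// expR_gt0.
rewrite (Zh_radial (fun j => intg_radial q_smooth q_subharmonic r0_gt0 q1r0 j (ler0n R N))).
rewrite big_split prodr_const card_ord /= mulrAC divff ?mul1r; last first.
  by rewrite expf_neq0// mulf_neq0// gt_eqF// pi_gt0.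
have [->|N0] := eqVneq N 0%N; first by rewrite !big_ord0 ln1.
have pos (j : nat) : 0 < radial_norm q N%:R j by have [//|e] := rad j; rewrite e eqxx in N0.
suff [-> //] : \sum_(j < N) ln (radial_norm q N%:R j) = ln (\prod_(j < N) radial_norm q N%:R j) /\
  0 < \prod_(j < N) radial_norm q N%:R j.
elim/big_rec2: _ => [|j y z _ [-> y0]]; first by rewrite ln1.
by rewrite (lnM (pos j) y0) mulr_gt0.
Qed.

Lemma outer_radius_gt1 : outer_radius q r1 -> (1 < r1)%E <-> 0 < eta q < 1.
Proof.
have p1e := p1_eta; have e1 := eta_lt1.
case: r1 r1_ge1 => [r| |] //= r1ge; last first.
  move=> h; split => // _; rewrite e1 andbT.
  by have := h 1 ltr01; rewrite mul1r /eta; lra.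
rewrite lee_fin in r1ge; rewrite lte_fin e1 andbT => -[r_gt0 hr _].
have pr : p1 q (ln r) = 2 by rewrite p1E lnK ?posrE.
split => [r_gt1|].
  have lr : 0 < ln r by rewrite ln_gt0.
  by have := p1_incr q_smooth q_subharmonic lr; rewrite pr p1e; lra.
move=> eta0; rewrite lt_neqAle r1ge andbT; apply/eqP => e; move: pr.
by rewrite -e ln1 p1e; lra.
Qed.

Lemma outer_radius_eq1 : outer_radius q r1 -> r1 = 1%E <-> eta q = 0.
Proof.
case: r1 r1_ge1 => [r| |] //= r1ge; last first.
  move=> h; split => // e; have := h 1 ltr01; rewrite mul1r.
  have -> : derive1 q 1 = 2 by move: e; rewrite /eta; lra.
  by rewrite ltxx.
move=> [r_gt0 hr hu]; split => [[e]|e].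
  by move: hr; rewrite e mul1r /eta; lra.
congr EFin; apply/esym; apply: hu => //.
by move: e; rewrite mul1r /eta; lra.
Qed.

End equilibrium.

Theorem theorem2p1 (R : realType) (q : R -> R) (r0 : R) (r1 : \bar R)
  (q_smooth : smooth_pos q)
  (q_subharmonic : forall r, 0 < r -> 0 < laplQ q r)
  (r0_inner : inner_radius q r0)
  (r1_outer : outer_radius q r1)
  (r0_gt0 : 0 < r0) (r0_lt1 : r0 < 1) (r1_ge1 : (1 <= r1)%E) :
  [/\ (1 < r1)%E <-> 0 < eta q < 1,
      r1 = 1%E <-> eta q = 0,
      (1 < r1)%E ->
      (fun N : nat => ln (Zh q N / (2 * pi) ^+ N) -
        (- N%:R ^+ 2 * (I_muQ q r0 r1 + eta q * q 1)
         - (1 + eta q) / 2 * N%:R * ln N%:R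
         - N%:R * (2^-1 * E_muQ q r0 r1 - (1 - eta q) * (ln (pi / 2) / 2)
                   + eta q * (ln (2 * eta q) - 1))
         - Num.sqrt N%:R * (gamma_in R + gamma_out R) * Num.sqrt (laplQ q 1)
         - 4^-1 * ln N%:R
         + F_Q q r0 - (alpha_in R + alpha_out R)
         + (beta_in R + beta_out R) * (derive1 (laplQ q) 1 / laplQ q 1)
         + laplQ q 1 / (4 * eta q) - 2^-1 * ln (eta q)
         + 4^-1 * ln (2 * pi * laplQ q 1))) @ \oo --> (0 : R)
    & r1 = 1%E ->
      (fun N : nat => ln (Zh q N / (2 * pi) ^+ N) -
        (- N%:R ^+ 2 * I_muQ q r0 r1
         - 2^-1 * N%:R * ln N%:R
         - N%:R * (2^-1 * E_muQ q r0 r1 - ln (pi / 2) / 2)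
         - Num.sqrt N%:R * gamma_in R * Num.sqrt (laplQ q 1)
         + F_Q q r0 - alpha_in R
         + beta_in R * (derive1 (laplQ q) 1 / laplQ q 1)
         + 2^-1 * ln 2)) @ \oo --> (0 : R)].
Proof.
have [_ q1r0 _] := r0_inner.
have h1 := outer_radius_gt1 q_smooth q_subharmonic r0_gt0 r0_lt1 q1r0 r1_ge1 r1_outer.
have h2 := outer_radius_eq1 r1_ge1 r1_outer.
have hZ := ln_Zh q_smooth q_subharmonic r0_gt0 r0_lt1 q1r0.
have hI := I_muQE q_smooth r0_gt0 r0_lt1 q1r0 r1_ge1.
have hE := E_muQE q_smooth q_subharmonic r0_gt0 r0_lt1 q1r0 r1_ge1.
split => // [/h1 /andP[eta0 _]|/h2 eta0].
  have T := expansion_out q_smooth q_subharmonic r0_gt0 r0_lt1 q1r0 (p1_eta q) eta0.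
  rewrite hI hE; refine (rcvg_eq (rcvgD hZ T) _ (addr0 _)) => N.
  by rewrite addrA subrK p0E expR0.
have p10 : p1 q 0 = 2 by rewrite p1_eta eta0 subr0 mulr1.
have T := expansion_crit q_smooth q_subharmonic r0_gt0 r0_lt1 q1r0 p10.
rewrite hI hE; refine (rcvg_eq (rcvgD hZ T) _ (addr0 _)) => N.
by rewrite addrA subrK.
Qed.
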